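(* Let $\{X(t)\}_{t\ge 0}$ be the stochastic replicator process with payoff matrix $A=(a_{ij})\in\mathbb{R}^{n\times n}$ and noise parameters $\sigma_1,\dots,\sigma_n$, and let $\tilde A=(\tilde a_{ij})=(a_{ij}-\tfrac12\sigma_i^2)_{i,j}$. Let $\boldsymbol\alpha\in\mathbb{R}^n$ and set $\gamma=\alpha_1+\cdots+\alpha_n$. The transition probability function of $\{X(t)\}$ has an invariant density (with respect to Lebesgue measure on $\operatorname{int}\Delta$) given by $$\prod_{i=1}^nx_i^{\alpha_i-1},\qquad(x_1,\dots,x_n)\in\operatorname{int}\Delta,$$ if and only if one of the following two conditions (a) and (b) holds. (a) $\gamma\neq-1$; $A$ satisfies, with this $\gamma$, $$a_{ij}+a_{ji}-a_{ii}-a_{jj}=\frac\gamma2(\sigma_i^2+\sigma_j^2)\qquad\text{for all }i\ne j;$$ $\{\tilde A\boldsymbol\alpha\}_1=\cdots=\{\tilde A\boldsymbol\alpha\}_n$; and if $\gamma=0$, then $\{\tilde A\boldsymbol\alpha\}_1=\sum_{i=1}^n\tilde a_{ii}\alpha_i-\frac12\sum_{i=1}^n\sigma_i^2\alpha_i^2$. (b) $\gamma=-1$ and for $k=1,\dots,n$, $$\frac{\sigma_k^2}2+\frac12\sum_{i=1}^n\sigma_i^2\alpha_i^2+\alpha_k\sigma_k^2-\tilde a_{kk}-\sum_{i=1}^n\alpha_i\tilde a_{ik}=0.$$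
   Context: Setting. $n\ge2$; $A=(a_{ij})\in\mathbb{R}^{n\times n}$ is an arbitrary payoff matrix; $\sigma_1,\dots,\sigma_n>0$; $W=(W_1,\dots,W_n)^T$ is a standard $n$-dimensional Brownian motion (independent components). $\Delta=\{\mathbf{y}\in[0,1]^n:y_1+\cdots+y_n=1\}$ and $\operatorname{int}\Delta=\{\mathbf{y}\in\Delta: y_i>0\ \forall i\}$. The stochastic replicator process $\{X(t)\}$ is a strong solution of the Itô equation $$dX(t)=\mathbf{b}(X(t))\,dt+C(X(t))\,dW(t),\qquad X(0)=\mathbf{x}_0\in\operatorname{int}\Delta,$$ with $\mathbf{b}(\mathbf{x})=[\operatorname{diag}(x_1,\dots,x_n)-\mathbf{x}\mathbf{x}^T][A-\operatorname{diag}(\sigma_1^2,\dots,\sigma_n^2)]\mathbf{x}$ and $C(\mathbf{x})=[\operatorname{diag}(x_1,\dots,x_n)-\mathbf{x}\mathbf{x}^T]\operatorname{diag}(\sigma_1,\dots,\sigma_n)$ for $\mathbf{x}\in\Delta$. Equivalently, $X_i=Z_i/(Z_1+\cdots+Z_n)$ where $dZ_i(t)=Z_i(t)[\{AX(t)\}_i\,dt+\sigma_i\,dW_i(t)]$, $Z_i(0)>0$. Almost surely $X(t)\in\operatorname{int}\Delta$ for all $t\ge0$, and $\{X(t)\}$ is a Markov process on $\operatorname{int}\Delta$; $P_{\mathbf{x}}$ denotes probability under $X(0)=\mathbf{x}$. $\{\mathbf{v}\}_i$ denotes the $i$th component of $\mathbf{v}$. Lebesgue measure on $\operatorname{int}\Delta$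 is $(n-1)$-dimensional Lebesgue measure (e.g. in the coordinates $x_1,\dots,x_{n-1}$). A nonnegative function $f$ on $\operatorname{int}\Delta$ (not necessarily integrable) is an invariant density if the measure $d\nu=f\,d\mathbf{x}$ is invariant: $\nu(B)=\int_{\operatorname{int}\Delta}P_{\mathbf{x}}\{X(t)\in B\}\,d\nu(\mathbf{x})$ for all $t\ge0$ and all Borel $B\subseteq\operatorname{int}\Delta$. *)

(* Defs.v *)
From HB Require Import structures.
From mathcomp Require Import all_boot all_order all_algebra.
From mathcomp Require Import all_classical all_reals all_analysis.
From mathcomp Require Import measurable_realfun.
Set Implicit Arguments.
Unset Strict Implicit.
Unset Printing Implicit Defensive.
Import Order.TTheory GRing.Theory Num.Theory.
Import numFieldNormedType.Exports.
Local Open Scope classical_set_scope.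
Local Open Scope ring_scope.

(* Points of R^n are n-tuples: [n.-tuple R] carries the product sigma-algebra
   of the Borel sigma-algebra of R, that is, the Borel sigma-algebra of R^n. *)

Section lebesgue_tuple.
Variable R : realType.

Section cons_step.
Variables (m : nat) (mu : {sigma_finite_measure set (m.-tuple R) -> \bar R}).

Definition tuple_of_pair (p : measurableTypeR R * m.-tuple R) :
  m.+1.-tuple R := [the m.+1.-tuple R of p.1 :: p.2].

Lemma measurable_tuple_of_pair : measurable_fun [set: _] tuple_of_pair.
Proof.
apply: measurable_cons; first exact: measurable_fst.
exact: measurable_snd.
Qed.

Definition lebesgue_cons : set (m.+1.-tuple R) -> \bar R :=
  pushforward (@lebesgue_measure R \x mu)%E tuple_of_pair.

HB.instance Definition _ := Measure.copy lebesgue_cons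
  (measure_function_pushforward__canonical__measure_function_Measure
     (@lebesgue_measure R \x mu)%E measurable_tuple_of_pair).

Let sigma_finite_lebesgue_cons : sigma_finite [set: _] lebesgue_cons.
Proof.
have /sigma_finiteP[F1 [F1T ndF1 F1oo]] := sigma_finiteT (@lebesgue_measure R).
have /sigma_finiteP[F2 [F2T ndF2 F2oo]] := sigma_finiteT mu.
pose g (x : m.+1.-tuple R) : measurableTypeR R * m.-tuple R :=
  (thead x, [tuple of behead x]).
have mg : measurable_fun [set: _] g.
  apply/measurable_fun_pair => /=.
    exact: measurable_tnth.
  exact: measurable_behead.
have gK p : g (tuple_of_pair p) = p.
  case: p => a t; rewrite /g /tuple_of_pair /=; congr pair.
  exact/val_inj.
exists (fun k => g @^-1` (F1 k `*` F2 k)).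
  apply/seteqP; split => // x _.
  have : [set: _] (g x).1 by [].
  rewrite F1T => -[k1 _ F1k].
  have : [set: _] (g x).2 by [].
  rewrite F2T => -[k2 _ F2k].
  exists (maxn k1 k2) => //; split.
    by move: F1k; exact/subsetPset/ndF1/leq_maxl.
  by move: F2k; exact/subsetPset/ndF2/leq_maxr.
move=> k; have [mF1 F1k] := F1oo k; have [mF2 F2k] := F2oo k; split.
  rewrite -[X in measurable X]setTI; apply: mg => //.
  exact: measurableX.
rewrite /lebesgue_cons /pushforward.
have -> : tuple_of_pair @^-1` (g @^-1` (F1 k `*` F2 k)) = F1 k `*` F2 k.
  by apply/funext => p; rewrite -[RHS](congr1 (F1 k `*` F2 k) (gK p)).
by rewrite product_measure1E// lte_mul_pinfty// ge0_fin_numE.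
Qed.

HB.instance Definition _ :=
  Measure_isSigmaFinite.Build _ _ _ lebesgue_cons sigma_finite_lebesgue_cons.
End cons_step.

Fixpoint lebesgue_tuple (m : nat) :
    {sigma_finite_measure set (m.-tuple R) -> \bar R} :=
  match m with
  | 0 => \d_([tuple] : 0.-tuple R)
  | m'.+1 => lebesgue_cons (lebesgue_tuple m')
  end.

Lemma lebesgue_tuple_box m (B : 'I_m -> set R) :
  (forall i, measurable (B i)) ->
  lebesgue_tuple m [set x | forall i, B i (tnth x i)] =
  (\prod_(i < m) lebesgue_measure (B i))%E.
Proof.
elim: m B => [|m IH] B mB.
  rewrite big_ord0 /= diracE.
  by rewrite mem_set// => -[].
rewrite big_ord_recl -(IH (fun i => B (lift ord0 i)))//=.
rewrite /lebesgue_cons /pushforward.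
have -> : tuple_of_pair (m:=m) @^-1` [set x | forall i, B i (tnth x i)] =
    B ord0 `*` [set x | forall i : 'I_m, B (lift ord0 i) (tnth x i)].
  apply/seteqP; split => [[a t] /= H|[a t] /= [Ha Ht] i].
    split; first exact: (H ord0).
    by move=> i; have := H (lift ord0 i); rewrite tnthS.
  by case: (unliftP ord0 i) => [j|] ->; rewrite ?tnthS.
rewrite product_measure1E//; first exact: mB.
have -> : [set x : m.-tuple R | forall i : 'I_m, B (lift ord0 i) (tnth x i)] =
    \bigcap_(i in [set: 'I_m]) ((@tnth m R ^~ i) @^-1` B (lift ord0 i)).
  by apply/seteqP; split => x /= H i; [move=> _|]; exact: H.
apply: fin_bigcap_measurable => // i _.
by rewrite -[X in measurable X]setTI; exact: measurable_tnth.
Qed.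

End lebesgue_tuple.

Section simplex.
Variables (R : realType) (n : nat).

Definition simplex : set (n.-tuple R) :=
  [set x | (forall i, 0 <= tnth x i <= 1) /\ \sum_(i < n) tnth x i = 1].

Definition int_simplex : set (n.-tuple R) :=
  [set x | simplex x /\ forall i, 0 < tnth x i].

(* The default value of [nth] supplies the last coordinate
   x_n = 1 - (x_1 + ... + x_(n-1)). *)
Definition simplex_chart (t : n.-1.-tuple R) : n.-tuple R :=
  [tuple nth (1 - \sum_(j < n.-1) tnth t j) t i | i < n].

Lemma measurable_simplex_chart : measurable_fun [set: _] simplex_chart.
Proof.
apply/measurable_fun_tnthP => i.
have [ilt|ige] := ltnP i n.-1.
  rewrite (_ : _ \o _ = fun t => tnth t (Ordinal ilt)).
    exact: measurable_tnth.
  by apply/funext => t /=; rewrite tnth_mktuple (tnth_nth (1 - \sum_(j < n.-1) tnth t j)).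
rewrite (_ : _ \o _ = fun t => 1 - \sum_(j < n.-1) tnth t j).
  apply: measurable_funB => //.
  by apply: measurable_sum => j; exact: measurable_tnth.
by apply/funext => t /=; rewrite tnth_mktuple nth_default// size_tuple.
Qed.

(* (n-1)-dimensional Lebesgue measure on the hyperplane x_1 + ... + x_n = 1,
   in the coordinates x_1, ..., x_(n-1); it is only used on subsets of
   [int_simplex]. *)
Definition simplex_lebesgue : set (n.-tuple R) -> \bar R :=
  pushforward (lebesgue_tuple R n.-1) simplex_chart.

HB.instance Definition _ := Measure.copy simplex_lebesgue
  (measure_function_pushforward__canonical__measure_function_Measure
     (lebesgue_tuple R n.-1) measurable_simplex_chart).

(* [p t x B] is the transition probability P_x {X(t) \in B}; with
   dnu = f dx, the right-hand side is the integral of [p t x B] against nu. *)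
Definition invariant_density
    (p : R -> n.-tuple R -> set (n.-tuple R) -> \bar R)
    (f : n.-tuple R -> R) : Prop :=
  [/\ measurable_fun int_simplex f,
      (forall x, int_simplex x -> 0 <= f x) &
      forall (t : R) (B : set (n.-tuple R)),
        0 <= t -> measurable B -> B `<=` int_simplex ->
        (\int[simplex_lebesgue]_(x in B) (f x)%:E =
         \int[simplex_lebesgue]_(x in int_simplex) (p t x B * (f x)%:E))%E].

End simplex.

Section brownian_motion.
Context d (T : measurableType d) (R : realType) (P : probability T R).

Definition mutually_independent (I : finType) (X : I -> T -> R) : Prop :=
  forall (J : {set I}) (B : I -> set R), (forall i, measurable (B i)) ->
    P (\bigcap_(i in [set` J]) (X i @^-1` B i)) =
    (\prod_(i in J) P (X i @^-1` B i))%E.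

(* [normal_prob m s] has standard deviation [s].  The independence clause ranges
   jointly over components and time steps: it says that the components have
   independent increments and are independent of each other. *)
Record standard_brownian_motion (n : nat) (W : 'I_n -> R -> T -> R) : Prop := {
  bm_measurable : forall i t, 0 <= t -> measurable_fun [set: T] (W i t) ;
  bm_start : forall i, {ae P, forall w, W i 0 w = 0} ;
  bm_continuous : forall i w, {within `[0, +oo[, continuous (W i ^~ w)} ;
  bm_gaussian : forall i s t (B : set R), 0 <= s -> s < t -> measurable B ->
    P ((fun w => W i t w - W i s w) @^-1` B) =
    normal_prob 0 (Num.sqrt (t - s)) B ;
  bm_independent : forall (u : nat -> R) (m : nat),
    0 <= u 0%N -> (forall k, u k < u k.+1) ->
    mutually_independent (fun (ik : 'I_n * 'I_m) w =>
      W ik.1 (u ik.2.+1) w - W ik.1 (u ik.2) w)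
}.

(* The filtration generated by W, augmented by the P-null events. *)
Definition brownian_filtration (n : nat) (W : 'I_n -> R -> T -> R) (t : R) :
    set (set T) :=
  <<s [set A | measurable A /\ P A = 0%E] `|`
      [set A | exists i s (B : set R),
         [/\ 0 <= s, s <= t, measurable B & A = W i s @^-1` B]] >>.

End brownian_motion.

Section ito_integral.
Context d (T : measurableType d) (R : realType) (P : probability T R).
Variable F : R -> set (set T).

(* A simple process sum_(k < m) e_k 1_[u_k, u_(k+1)[ . *)
Record simple_process := SimpleProcess {
  sp_size : nat ;
  sp_time : nat -> R ;
  sp_coef : nat -> T -> R
}.

Definition sp_fun (phi : simple_process) (s : R) (w : T) : R :=
  \sum_(k < sp_size phi)
    sp_coef phi k w * \1_(`[sp_time phi k, sp_time phi k.+1[) s.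

Definition sp_adapted (t : R) (phi : simple_process) : Prop :=
  [/\ 0 <= sp_time phi 0%N /\ sp_time phi (sp_size phi) <= t,
      forall k, (k < sp_size phi)%N -> sp_time phi k <= sp_time phi k.+1,
      forall k (B : set R), (k < sp_size phi)%N -> measurable B ->
        F (sp_time phi k) (sp_coef phi k @^-1` B) &
      exists M : R, forall k w, (k < sp_size phi)%N -> `|sp_coef phi k w| <= M].

Definition sp_integral (W : R -> T -> R) (phi : simple_process) (w : T) : R :=
  \sum_(k < sp_size phi)
    sp_coef phi k w * (W (sp_time phi k.+1) w - W (sp_time phi k) w).

(* [I] is (a version of) the Ito integral of H against dW over [0, t]: the limit
   in L^2(P) of the integrals of simple processes converging to H in
   L^2([0, t] x P). *)
Definition is_ito_integral (W H : R -> T -> R) (t : R) (I : T -> R) : Prop :=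
  measurable_fun [set: T] I /\
  exists phi : nat -> simple_process,
    [/\ forall N, sp_adapted t (phi N),
        (fun N => \int[P]_w \int[lebesgue_measure]_(s in `[0%R, t])
           ((H s w - sp_fun (phi N) s w) ^+ 2)%:E)%E @ \oo --> 0%E &
        (fun N => \int[P]_w
           ((I w - sp_integral W (phi N) w) ^+ 2)%:E)%E @ \oo --> 0%E].

End ito_integral.

Section stochastic_differential_equation.
Context d (T : measurableType d) (R : realType) (P : probability T R).
Variables (n : nat) (W : 'I_n -> R -> T -> R).
Variables (b : n.-tuple R -> 'cV[R]_n) (C : n.-tuple R -> 'M[R]_n).

(* Strong solution of dX = b(X) dt + C(X) dW, X(0) = x0, in the state space
   [simplex], with respect to the given Brownian motion W. *)
Record strong_solution (x0 : n.-tuple R) (X : R -> T -> n.-tuple R) : Prop := {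
  sol_adapted : forall t (B : set (n.-tuple R)), 0 <= t -> measurable B ->
    brownian_filtration P W t (X t @^-1` B) ;
  sol_continuous : forall i w,
    {within `[0, +oo[, continuous (fun t => tnth (X t w) i)} ;
  sol_state : forall t w, 0 <= t -> simplex (X t w) ;
  sol_start : {ae P, forall w, X 0 w = x0} ;
  sol_equation : forall t, 0 <= t ->
    exists2 I : 'I_n -> 'I_n -> T -> R,
      forall i j, is_ito_integral P (brownian_filtration P W)
                    (W j) (fun s w => C (X s w) i j) t (I i j) &
      {ae P, forall w, forall i,
         tnth (X t w) i =
         tnth (X 0 w) i
         + Rintegral lebesgue_measure `[0, t] (fun s => b (X s w) i ord0)
         + \sum_(j < n) I i j w}
}.

End stochastic_differential_equation.

Section stochastic_replicator.
Variables (R : realType) (n : nat) (A : 'M[R]_n) (sigma : 'rV[R]_n).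

Definition col_of_tuple (x : n.-tuple R) : 'cV[R]_n := \col_i tnth x i.

Definition replicator_mx (x : n.-tuple R) : 'M[R]_n :=
  diag_mx (col_of_tuple x)^T - col_of_tuple x *m (col_of_tuple x)^T.

Definition replicator_drift (x : n.-tuple R) : 'cV[R]_n :=
  replicator_mx x *m (A - diag_mx (\row_i (sigma 0 i ^+ 2))) *m col_of_tuple x.

Definition replicator_diffusion (x : n.-tuple R) : 'M[R]_n :=
  replicator_mx x *m diag_mx sigma.

(* X x is the process started at x, on one probability space and driven by one
   Brownian motion for all x. *)
Definition stochastic_replicator d (T : measurableType d)
    (P : probability T R) (W : 'I_n -> R -> T -> R)
    (X : n.-tuple R -> R -> T -> n.-tuple R) : Prop :=
  forall x, int_simplex x ->
    strong_solution P W replicator_drift replicator_diffusion x (X x).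

End stochastic_replicator.

Definition transition_probability d (T : measurableType d) (R : realType)
    (P : probability T R) (n : nat) (X : n.-tuple R -> R -> T -> n.-tuple R)
    (t : R) (x : n.-tuple R) (B : set (n.-tuple R)) : \bar R :=
  P (X x t @^-1` B).

Definition dirichlet_density (R : realType) (n : nat) (alpha : 'cV[R]_n)
    (x : n.-tuple R) : R :=
  \prod_(i < n) (tnth x i `^ (alpha i 0 - 1)).

Definition modified_payoff (R : realType) (n : nat) (A : 'M[R]_n)
    (sigma : 'rV[R]_n) : 'M[R]_n :=
  \matrix_(i, j) (A i j - sigma 0 i ^+ 2 / 2).

(* Main.v *)
(* In the coordinates y_i = ln (x_i / x_n) on int Delta the candidate density
   becomes F(y) = prod_i x_i^alpha_i with respect to dy, and the noise of the
   equation becomes additive. One splitting step of length h, consisting of a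
   shear y_j += h r_j(x) in each coordinate followed by a translation by the
   Brownian increments, turns the weight F into F (1 + h kappa) up to a relative
   error O(h^(3/2)), where kappa = (L^* F) / F is a quadratic polynomial in x.
   By the Ito isometry, the scheme approximates the solution with mean square
   error O(h) over a fixed time, and with mean error O(h^(3/2)) over one step.

   If kappa = 0 on int Delta, then iterating the step along dyadic grids shows,
   by dominated convergence against test functions that vanish near the
   boundary, that F dy is invariant. Conversely, if F dy is invariant, then one
   step of length h -> 0 gives int F kappa phi dy = 0 for smooth phi vanishing
   near the boundary, and phi = kappa chi with cut-offs chi forces kappa = 0.
   Homogenising kappa by sum_i x_i = 1 makes it a quadratic form that vanishes on
   an open cone, and its coefficients are zero exactly under (a) or (b). *)

From HB Require Import structures.
From mathcomp Require Import all_boot all_order all_algebra.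
From mathcomp Require Import all_classical all_reals all_analysis.
From mathcomp Require Import measurable_realfun.
From mathcomp Require Import ring lra.
Require Import Defs.
Set Implicit Arguments.
Unset Strict Implicit.
Unset Printing Implicit Defensive.
Import Order.TTheory GRing.Theory Num.Theory.
Import numFieldNormedType.Exports.
Local Open Scope classical_set_scope.
Local Open Scope ring_scope.

(** Three obstacles shape the proof. The measure F dy may be infinite, so a bounded error per unit
    of mass says nothing about integrals: the scheme is compared with its adjoint up to a factor
    exp(C h^(3/2)) per step, and t / h steps cost a factor exp(C t h^(1/2)). The equation is known
    only through Ito integrals that are L^2 limits of simple processes; second-order calculus is
    therefore carried out on the scheme, whose step is an explicit function of the Brownian
    increment, and the solution enters only through moment bounds over a short interval. Finally,
    the process is given separately for each starting point, and joint measurability in the starting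
    point and the event comes from the limit of the scheme. The drift is applied by shears because a
    shear moves one coordinate: its Jacobian is a derivative in one variable, and substitution
    reduces to increasing functions on the line. In the converse, the error of one step has to
    remain o(h) after integration against the infinite measure; this is obtained by interpolating
    between the uniform bound O(h^(3/2)) and exponential tails. *)

Notation borel := (measurable_fun setT) (only parsing).

(** * Softmax averages *)

Section taylor.
Variable R : realType.
Implicit Types f g : R -> R.

Lemma le_increment_01 f f1 (M : R) :
 (forall s : R, is_derive s 1 f (f1 s)) ->
 (forall s, 0 <= s <= 1 -> `|f1 s| <= M) ->
 forall s, 0 <= s <= 1 -> `|f s - f 0| <= M.
Proof.
move=> df fM s /andP[s0 s1].
have [->|sn0] := eqVneq s 0.
 rewrite subrr normr0; apply: le_trans (fM 0 _) => //; rewrite ?lexx ?ler01//.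
have {sn0} s0' : 0 < s by rewrite lt_neqAle eq_sym sn0.
have [c|c] := @MVT _ f f1 0 s s0' (fun x _ => df x).
 apply: derivable_within_continuous => x _.
 by apply: ex_derive.
rewrite in_itv/= => /andP[c0 cs] ->.
rewrite subr0 normrM (ger0_norm s0) -[leRHS]mulr1 ler_pM//.
by apply: fM; rewrite ltW//= (le_trans (ltW cs)).
Qed.

(** The mean value bound is applied to [f s - s * f1 0], whose derivative is controlled by the same
    bound for [f1]. The factorials in the remainders are given up, here and in the third-order
    version. *)
Lemma taylor2_01 f f1 f2 (M : R) :
 (forall s : R, is_derive s 1 f (f1 s)) ->
 (forall s : R, is_derive s 1 f1 (f2 s)) ->
 (forall s, 0 <= s <= 1 -> `|f2 s| <= M) ->
 forall s, 0 <= s <= 1 -> `|f s - f 0 - s * f1 0| <= M.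
Proof.
move=> df df1 fM s s01.
have := @le_increment_01 (fun s => f s - s * f1 0) (fun s => f1 s - f1 0) M _ _ s s01.
rewrite mul0r subr0 addrAC; apply.
 by move=> u; apply: is_deriveB; apply: is_derive_eq; rewrite scaler0 add0r /GRing.scale/= mulr1.
by move=> u u01; exact: (le_increment_01 df1 fM).
Qed.

Lemma taylor3_01 f f1 f2 f3 (M : R) :
 (forall s : R, is_derive s 1 f (f1 s)) ->
 (forall s : R, is_derive s 1 f1 (f2 s)) ->
 (forall s : R, is_derive s 1 f2 (f3 s)) ->
 (forall s, 0 <= s <= 1 -> `|f3 s| <= M) ->
 `|f 1 - f 0 - f1 0 - f2 0 / 2| <= M.
Proof.
move=> df df1 df2 fM.
have := @le_increment_01 (fun s => f s - s * f1 0 - s ^+ 2 * (f2 0 / 2))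
 (fun s => f1 s - f1 0 - s * f2 0) M _ _ 1 _.
rewrite !mul0r expr0n/= !subr0 expr1n !mul1r mul0r subr0 => H.
have -> : f 1 - f 0 - f1 0 - f2 0 / 2 = f 1 - f1 0 - f2 0 / 2 - f 0 by ring.
apply: H; rewrite ?lexx ?ler01//.
 by move=> u; apply: is_derive_eq; rewrite /GRing.scale/=; field.
by move=> u u01; exact: (taylor2_01 df1 df2 fM).
Qed.

End taylor.

Section tilting.
Variables (R : realType) (n : nat).
Implicit Types (p d : 'I_n -> R).

(** Exponential tilting: if [p] is the softmax of a vector y, then [tilt p d 1] is the softmax of y
    + d. Letting [s] run from 0 to 1 turns expansions of the softmax in d into one-variable Taylor
    formulas, whose coefficients are moments of d under the tilted weights and are bounded through
    [|d i| <= D]. *)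
Definition tilt_norm p d (s : R) : R := \sum_j p j * expR (s * d j).
Definition tilt p d (s : R) (i : 'I_n) : R := p i * expR (s * d i) / tilt_norm p d s.
Definition tilt_moment p d (k : nat) (s : R) : R := \sum_j tilt p d s j * d j ^+ k.

Variables (p d : 'I_n -> R) (D : R).
Hypotheses (p_ge0 : forall i, 0 <= p i) (p_sum1 : \sum_i p i = 1).
Hypothesis d_le : forall i, `|d i| <= D.

Let Z := tilt_norm p d.
Let t := tilt p d.
Let M := tilt_moment p d.

Lemma tilt_norm_gt0 s : 0 < Z s.
Proof.
rewrite lt_neqAle; apply/andP; split; last first.
 by apply: sumr_ge0 => j _; rewrite mulr_ge0// expR_ge0.
apply/eqP => /esym/eqP; rewrite psumr_eq0; last first.
 by move=> j _; rewrite mulr_ge0// expR_ge0.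
move=> /allP p0; suff : \sum_i p i = 0 by rewrite p_sum1 => /eqP; rewrite oner_eq0.
apply: big1 => i _; have /= := p0 i; rewrite mem_index_enum => /(_ isT).
by rewrite mulf_eq0 (gt_eqF (expR_gt0 _)) orbF => /eqP.
Qed.

Lemma tilt_ge0 s i : 0 <= t s i.
Proof. by rewrite /t /tilt divr_ge0 ?mulr_ge0 ?expR_ge0// ltW// tilt_norm_gt0. Qed.

Lemma tilt_sum1 s : \sum_i t s i = 1.
Proof. by rewrite -mulr_suml divff// gt_eqF// tilt_norm_gt0. Qed.

Lemma tilt_le1 s i : t s i <= 1.
Proof.
rewrite -(tilt_sum1 s) (bigD1 i)//= lerDl sumr_ge0// => j _; exact: tilt_ge0.
Qed.

Lemma tilt0 i : t 0 i = p i.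
Proof.
rewrite /t /tilt /tilt_norm mul0r expR0 mulr1.
under eq_bigr do rewrite mul0r expR0 mulr1.
by rewrite p_sum1 divr1.
Qed.

Lemma tilt_norm0 : Z 0 = 1.
Proof.
by rewrite /Z /tilt_norm; under eq_bigr do rewrite mul0r expR0 mulr1.
Qed.

Lemma tilt_moment_le k s : `|M k s| <= D ^+ k.
Proof.
rewrite (le_trans (ler_norm_sum _ _ _))//.
have -> : D ^+ k = \sum_j t s j * D ^+ k by rewrite -mulr_suml tilt_sum1 mul1r.
apply: ler_sum => j _; rewrite normrM (ger0_norm (tilt_ge0 _ _)).
by rewrite ler_wpM2l ?tilt_ge0// normrX lerXn2r// nnegrE (le_trans _ (d_le j)).
Qed.

Lemma is_derive_tilt_norm (s : R) : is_derive s 1 Z (Z s * M 1 s).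
Proof.
rewrite {1}(_ : Z = \sum_(j < n) (fun s : R => p j * expR (s * d j))); last first.
 by apply/funext => u; rewrite fct_sumE.
have dj (j : 'I_n) : is_derive s 1 (fun s : R => p j * expR (s * d j))
  (Z s * (t s j * d j)).
 have -> : (fun s : R => p j * expR (s * d j)) =
  (fun s : R => p j *: (expR \o (fun s => s * d j)) s) by [].
 apply: is_derive_eq.
 have := lt0r_neq0 (tilt_norm_gt0 s).
 by rewrite /GRing.scale/= /t /tilt -/(Z s) => Z0; field.
apply: is_derive_eq.
rewrite /M /tilt_moment mulr_sumr; apply: eq_bigr => j _.
by rewrite expr1.
Qed.

Lemma is_derive_tilt (s : R) i : is_derive s 1 (t ^~ i) (t s i * (d i - M 1 s)).
Proof.
have dZ := is_derive_tilt_norm s.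
have Z0 : Z s != 0 by rewrite gt_eqF// tilt_norm_gt0.
have -> : t ^~ i =
  (fun s : R => (p i *: (expR \o (fun s => s * d i)) s) * (Z s)^-1) by [].
apply: is_derive_eq.
by rewrite /GRing.scale/= /t /tilt -/(Z s); field.
Qed.

Lemma is_derive_tilt_moment k (s : R) :
 is_derive s 1 (M k) (M k.+1 s - M k s * M 1 s).
Proof.
have dt := is_derive_tilt.
rewrite {1}/M /tilt_moment.
have -> : (fun s : R => \sum_(j < n) tilt p d s j * d j ^+ k) =
 \sum_(j < n) (fun s : R => d j ^+ k *: t s j).
 apply/funext => u; rewrite fct_sumE; apply: eq_bigr => j _.
 by rewrite /GRing.scale/= mulrC.
apply: is_derive_eq.
rewrite /M /tilt_moment [in RHS]mulr_suml -sumrB; apply: eq_bigr => j _.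
rewrite /GRing.scale/= exprS -/(t s j) -/(M 1 s); ring.
Qed.

Let V s := M 2 s - M 1 s ^+ 2.

Lemma tilt_expand1 i : `|t 1 i - p i| <= 2 * D.
Proof.
rewrite -[p i]tilt0.
apply: (le_increment_01 (is_derive_tilt ^~ i)); rewrite ?lexx ?ler01// => s _.
rewrite normrM (ger0_norm (tilt_ge0 _ _)).
have M1 := tilt_moment_le 1 s; rewrite expr1 in M1.
have : `|d i - M 1 s| <= 2 * D.
 by have := ler_normB (d i) (M 1 s); have := d_le i; lra.
by have := tilt_le1 s i; have := tilt_ge0 s i; have := normr_ge0 (d i - M 1 s); nra.
Qed.

Lemma is_derive_tilt1 (s : R) i :
 is_derive s 1 (fun s => t s i * (d i - M 1 s))
  (t s i * ((d i - M 1 s) ^+ 2 - V s)).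
Proof.
have dt := is_derive_tilt s; have dM := is_derive_tilt_moment.
apply: is_derive_eq; rewrite /GRing.scale/= /V; ring.
Qed.

(** The derivative of the variance is the third cumulant M3 - 3 M1 M2 + 2 M1^3, grouped so that each
    term has an immediate bound. *)
Lemma is_derive_tilt_var (s : R) : is_derive s 1 V
 (M 3 s - M 2 s * M 1 s - 2 * M 1 s * V s).
Proof.
have dM := is_derive_tilt_moment.
apply: is_derive_eq; rewrite /GRing.scale/= /V; ring.
Qed.

Lemma is_derive_tilt2 (s : R) i :
 is_derive s 1 (fun s => t s i * ((d i - M 1 s) ^+ 2 - V s))
  (t s i * ((d i - M 1 s) ^+ 3 - 3 * (d i - M 1 s) * V s
    - (M 3 s - M 2 s * M 1 s - 2 * M 1 s * V s))).
Proof.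
have dt := is_derive_tilt s; have dM := is_derive_tilt_moment.
apply: is_derive_eq; rewrite /GRing.scale/= /V; ring.
Qed.

Let D_ge0 (i : 'I_n) : 0 <= D. Proof. exact: le_trans (d_le i). Qed.

Let normM (a b A B : R) : `|a| <= A -> `|b| <= B -> `|a * b| <= A * B.
Proof. by move=> aA bB; rewrite normrM ler_pM. Qed.

Let M_le s : [/\ `|M 1 s| <= D, `|M 2 s| <= D ^+ 2, `|M 3 s| <= D ^+ 3 &
 `|V s| <= 2 * D ^+ 2].
Proof.
have M1 := tilt_moment_le 1 s; have M2 := tilt_moment_le 2 s.
have M3 := tilt_moment_le 3 s; rewrite expr1 in M1.
split=> //; rewrite /V (le_trans (ler_normB _ _))//.
by have := normM M1 M1; rewrite -!expr2; lra.
Qed.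

Let d3_le s : `|M 3 s - M 2 s * M 1 s - 2 * M 1 s * V s| <= 6 * D ^+ 3.
Proof.
have [M1 M2 M3 MV] := M_le s.
have := normM M2 M1; have := normM M1 MV; move: M3.
move=> ? ? ?.
have -> : M 3 s - M 2 s * M 1 s - 2 * M 1 s * V s =
  M 3 s - M 2 s * M 1 s - 2 * (M 1 s * V s) by ring.
have := ler_normB (M 3 s - M 2 s * M 1 s) (2 * (M 1 s * V s)).
have := ler_normB (M 3 s) (M 2 s * M 1 s).
rewrite (normrM 2) (ger0_norm (_ : 0 <= 2))//.
have -> : D ^+ 3 = D ^+ 2 * D by ring.
lra.
Qed.

(** The third derivative of a tilted weight is the weight times a polynomial in the centred
    direction. In 26 = 8 + 12 + 6 the summands bound the cube, three times the product with the
    variance, and the third cumulant. *)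
Lemma tilt_expand3 i :
 `|t 1 i - p i - p i * (d i - M 1 0)
  - p i * ((d i - M 1 0) ^+ 2 - (M 2 0 - M 1 0 ^+ 2)) / 2| <= 26 * D ^+ 3.
Proof.
rewrite -[p i]tilt0.
apply: (taylor3_01 (is_derive_tilt ^~ i) (is_derive_tilt1 ^~ i) (is_derive_tilt2 ^~ i)).
move=> s _.
have [M1 M2 M3 MV] := M_le s; have d3 := d3_le s.
rewrite normrM (ger0_norm (tilt_ge0 _ _)).
have dM : `|d i - M 1 s| <= 2 * D.
 by have := ler_normB (d i) (M 1 s); have := d_le i; lra.
have ule := normM (normM dM dM) dM; have vle := normM dM MV.
have -> : (d i - M 1 s) ^+ 3 = (d i - M 1 s) * (d i - M 1 s) * (d i - M 1 s) by ring.
set u := (X in `|X| <= _) in ule; set v := (X in `|X| <= _) in vle.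
set w := (X in `|X| <= _) in d3; rewrite -(mulrA 3) -/v -/u -/w.
have : `|u - 3 * v - w| <= 26 * D ^+ 3.
 have := ler_normB (u - 3 * v) w; have := ler_normB u (3 * v).
 rewrite (normrM 3) (ger0_norm (_ : 0 <= 3))// => h1 h2; lra.
by have := tilt_le1 s i; have := tilt_ge0 s i; have := normr_ge0 (u - 3 * v - w); nra.
Qed.

Variables (a : 'I_n -> R) (g c : R).
Hypothesis c_ge : \sum_i `|a i| + `|g| <= c.

Let l := \sum_i a i * d i.

(** The factor by which the weight F changes when the log-coordinates are shifted by s d: up to the
    choice of exponents, ln F is the linear form with coefficients [a] minus [g] times the logarithm
    of the exponential sum, [g] being the sum of the exponents, and [ln (tilt_norm p d s)] is the
    increment of that logarithm. *)
Definition tilt_ratio p d a g (s : R) : R :=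
 expR (s * (\sum_i a i * d i) - g * ln (tilt_norm p d s)).

Let r := tilt_ratio p d a g.

Let D0 : 0 <= D.
Proof.
case: n p d p_sum1 d_le => [|n'] p' d' p'1 d'D; last exact: le_trans (d'D ord0).
by move: p'1; rewrite big_ord0 => /esym/eqP; rewrite oner_eq0.
Qed.

Let c_ge0 : 0 <= c.
Proof. by rewrite (le_trans _ c_ge)// addr_ge0// sumr_ge0. Qed.

Let e (s : R) := l - g * M 1 s.

Let e_le s : `|e s| <= c * D.
Proof.
have [M1 _ _ _] := M_le s.
rewrite /e (le_trans (ler_normB _ _))// normrM.
rewrite (@le_trans _ _ ((\sum_i `|a i| + `|g|) * D))//; last by rewrite ler_wpM2r.
rewrite mulrDl lerD// ?ler_wpM2l// /l (le_trans (ler_norm_sum _ _ _))// mulr_suml.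
by apply: ler_sum => j _; rewrite normrM ler_wpM2l.
Qed.

Let lnr (s : R) := s * l - g * ln (Z s).

Let is_derive_lnr (s : R) : is_derive s 1 lnr (e s).
Proof.
have dZ := is_derive_tilt_norm s.
have dln : is_derive s 1 (@ln R \o Z) ((Z s)^-1 *: (Z s * M 1 s)).
 apply: is_derive1_comp.
 exact/is_derive1_ln/tilt_norm_gt0.
have Z0 := lt0r_neq0 (tilt_norm_gt0 s).
have -> : lnr = (fun s => s * l - g *: (@ln R \o Z) s) by [].
apply: is_derive_eq; rewrite /GRing.scale/= /e; field.
exact: Z0.
Qed.

Lemma is_derive_tilt_ratio (s : R) : is_derive s 1 r (r s * e s).
Proof.
have d1 := is_derive_lnr s.
have -> : r = @expR R \o lnr by [].
by apply: is_derive_eq; rewrite /GRing.scale/= mulrC.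
Qed.

Let is_derive_e (s : R) : is_derive s 1 e (- (g * V s)).
Proof.
have dM := is_derive_tilt_moment.
have -> : e = (fun s => l - g *: M 1 s) by [].
by apply: is_derive_eq; rewrite /GRing.scale/= /V; ring.
Qed.

Lemma is_derive_tilt_ratio1 (s : R) : is_derive s 1 (fun s => r s * e s)
 (r s * (e s ^+ 2 - g * V s)).
Proof.
have de := is_derive_e; have dr := is_derive_tilt_ratio; have dV := is_derive_tilt_var.
by apply: is_derive_eq; rewrite /GRing.scale/=; ring.
Qed.

Lemma is_derive_tilt_ratio2 (s : R) :
 is_derive s 1 (fun s => r s * (e s ^+ 2 - g * V s))
 (r s * (e s ^+ 3 - 3 * g * e s * V s
  - g * (M 3 s - M 2 s * M 1 s - 2 * M 1 s * V s))).
Proof.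
have de := is_derive_e; have dr := is_derive_tilt_ratio; have dV := is_derive_tilt_var.
by apply: is_derive_eq; rewrite /GRing.scale/=; ring.
Qed.

Lemma tilt_ratio_gt0 s : 0 < r s. Proof. exact: expR_gt0. Qed.

Lemma tilt_ratio0 : r 0 = 1.
Proof. by rewrite /r /tilt_ratio -/(Z 0) tilt_norm0 ln1 mul0r mulr0 subr0 expR0. Qed.

Lemma tilt_ratio_le s : 0 <= s <= 1 -> r s <= expR (c * D).
Proof.
move=> s01; rewrite ler_expR.
have := le_increment_01 is_derive_lnr (fun s _ => e_le s) s01.
have -> : lnr 0 = 0 by rewrite /lnr tilt_norm0 ln1 mul0r mulr0 subr0.
by rewrite subr0 => /ler_normlP[_].
Qed.

Let gV s : `|g * V s| <= 2 * c * D ^+ 2.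
Proof.
have [M1 M2 M3 MV] := M_le s.
have -> : 2 * c * D ^+ 2 = c * (2 * D ^+ 2) by ring.
by apply: normM => //; rewrite (le_trans _ c_ge)// lerDr sumr_ge0.
Qed.

Lemma tilt_ratio_expand2 :
 `|r 1 - 1 - e 0| <= (c ^+ 2 + 2 * c) * D ^+ 2 * expR (c * D).
Proof.
have := @taylor2_01 _ _ _ _ ((c ^+ 2 + 2 * c) * D ^+ 2 * expR (c * D))
 is_derive_tilt_ratio is_derive_tilt_ratio1 _ 1.
rewrite !tilt_ratio0 !mul1r; apply; rewrite ?lexx ?ler01// => s s01.
rewrite mulrC; apply: normM; last by rewrite gtr0_norm ?tilt_ratio_gt0// tilt_ratio_le.
rewrite (le_trans (ler_normB _ _))//.
have := normM (e_le s) (e_le s); have := gV s; rewrite -expr2 => h1 h2.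
by rewrite mulrDl -exprMn lerD.
Qed.

(** The logarithmic slope [e] is at most c D, [g * V] at most 2 c D^2 and the third cumulant at most
    6 D^3; this gives c^3, 3 c (2 c) and 6 c. *)
Lemma tilt_ratio_expand3 :
 `|r 1 - 1 - e 0 - (e 0 ^+ 2 - g * V 0) / 2| <=
  (c ^+ 3 + 6 * c ^+ 2 + 6 * c) * D ^+ 3 * expR (c * D).
Proof.
have := @taylor3_01 _ _ _ _ _ ((c ^+ 3 + 6 * c ^+ 2 + 6 * c) * D ^+ 3 * expR (c * D))
 is_derive_tilt_ratio is_derive_tilt_ratio1 is_derive_tilt_ratio2.
rewrite !tilt_ratio0 !mul1r; apply=> s s01.
rewrite mulrC; apply: normM; last by rewrite gtr0_norm ?tilt_ratio_gt0// tilt_ratio_le.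
have gc : `|g| <= c by rewrite (le_trans _ c_ge)// lerDr sumr_ge0.
have h1 := normM (normM (e_le s) (e_le s)) (e_le s).
have h2 := normM (e_le s) (gV s).
have h3 := normM gc (d3_le s).
have -> : e s ^+ 3 - 3 * g * e s * V s
  - g * (M 3 s - M 2 s * M 1 s - 2 * M 1 s * V s) =
  e s * e s * e s - 3 * (e s * (g * V s))
  - g * (M 3 s - M 2 s * M 1 s - 2 * M 1 s * V s) by ring.
rewrite (le_trans (ler_normB _ _))//.
rewrite (_ : _ * D ^+ 3 = c * D * (c * D) * (c * D) + 3 * (c * D * (2 * c * D ^+ 2))
  + c * (6 * D ^+ 3)); last by ring.
rewrite lerD// (le_trans (ler_normB _ _))// lerD// normrM ger0_norm//.
by rewrite ler_wpM2l.
Qed.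

Lemma tilt_moment0 k : M k 0 = \sum_i p i * d i ^+ k.
Proof. by apply: eq_bigr => i _; rewrite -/(t 0 i) tilt0. Qed.

End tilting.

(** * Integration in log-coordinates *)

Section weighted_measure.
Import HBNNSimple.
Local Open Scope ereal_scope.
Context d (T : measurableType d) (R : realType).
Variables (mu : {measure set T -> \bar R}) (w : T -> R).
Hypotheses (w_ge0 : forall x, (0 <= w x)%R) (mw : borel w).

(** The two proofs are arguments of the definition, so that the measure structure can be inferred
    from the term itself. *)
Definition weighted (w_ge0 : forall x, (0 <= w x)%R)
  (mw : borel w) (A : set T) : \bar R :=
 \int[mu]_(x in A) (w x)%:E.

Let weighted0 : weighted w_ge0 mw set0 = 0.
Proof. exact: integral_set0. Qed.

Let weighted_ge0 A : 0 <= weighted w_ge0 mw A.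
Proof. by apply: integral_ge0 => x _; rewrite lee_fin. Qed.

Let weighted_sigma_additive : semi_sigma_additive (weighted w_ge0 mw).
Proof.
move=> F mF tF mUF; rewrite /weighted ge0_integral_bigcup//.
- by apply: is_cvg_ereal_nneg_natsum_cond => n _ _; exact: weighted_ge0.
- exact/measurable_EFinP/measurable_funTS.
- by move=> x _; rewrite lee_fin.
Qed.

HB.instance Definition _ := isMeasure.Build _ _ _ (weighted w_ge0 mw)
 weighted0 weighted_ge0 weighted_sigma_additive.

Lemma integral_weighted (f : T -> \bar R) :
 (forall x, 0 <= f x) -> borel f ->
 \int[weighted w_ge0 mw]_x f x = \int[mu]_x (f x * (w x)%:E).
Proof.
move=> f0 mf.
pose f_ := nnsfun_approx measurableT mf.
have cvgf x : EFin \o f_ ^~ x @ \oo --> f x.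
 by apply: cvg_nnsfun_approx.
have -> : \int[weighted w_ge0 mw]_x f x =
  limn (fun n => \int[weighted w_ge0 mw]_x (f_ n x)%:E).
 rewrite -monotone_convergence//.
 - by apply: eq_integral => x _; apply/esym/cvg_lim => //; exact: cvgf.
 - by move=> n; exact/measurable_EFinP.
 - by move=> n x _; rewrite lee_fin.
 - by move=> x _ a b ab; rewrite lee_fin; exact/lefP/nd_nnsfun_approx.
have -> : \int[mu]_x (f x * (w x)%:E) = limn (fun n => \int[mu]_x ((f_ n x)%:E * (w x)%:E)).
 rewrite -monotone_convergence//.
 - apply: eq_integral => x _; apply/esym/cvg_lim => //.
  by apply: cvgeZr => //; exact: cvgf.
 - by move=> n; apply: emeasurable_funM; exact/measurable_EFinP.
 - by move=> n x _; rewrite -EFinM lee_fin mulr_ge0.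
 - move=> x _ a b ab; apply: lee_wpmul2r; first by rewrite lee_fin.
  by rewrite lee_fin; exact/lefP/nd_nnsfun_approx.
congr (limn _); apply/funext => n.
transitivity (\sum_(k \in range (f_ n))
  \int[weighted w_ge0 mw]_x (k * \1_(f_ n @^-1` [set k]) x)%:E).
 under eq_integral do rewrite fimfunE -fsumEFin//.
 rewrite ge0_integral_fsum//.
 - by move=> y; exact/measurable_EFinP/measurable_funM.
 - by move=> y x _; rewrite nnfun_muleindic_ge0.
transitivity (\sum_(k \in range (f_ n))
  \int[mu]_x ((k * \1_(f_ n @^-1` [set k]) x)%:E * (w x)%:E)); last first.
 rewrite -ge0_integral_fsum//.
 - apply: eq_integral => x _; rewrite [in RHS]fimfunE -fsumEFin//.
  rewrite ge0_mule_fsuml// => r.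
  by rewrite nnfun_muleindic_ge0.
 - move=> r; apply: emeasurable_funM; apply/measurable_EFinP => //.
  exact: measurable_funM.
 - by move=> r x _; apply: mule_ge0; rewrite ?nnfun_muleindic_ge0// lee_fin.
apply: eq_fsbigr => r _.
rewrite integralZl_indic_nnsfun// integral_indic// setIT /=.
rewrite /weighted integral_mkcond.
under [RHS]eq_integral do rewrite EFinM -muleA.
have [r0|r0] := leP 0%R r.
 rewrite ge0_integralZl//.
 - congr (_ * _); apply: eq_integral => x _.
  rewrite /patch indicE; case: ifPn => xr; first by rewrite mul1e.
  by rewrite mul0e.
 - apply: emeasurable_funM; exact/measurable_EFinP.
 - by move=> x _; rewrite -EFinM lee_fin mulr_ge0.
have e0 : f_ n @^-1` [set r] = set0 by rewrite preimage_nnfun0.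
rewrite e0; under [RHS]eq_integral do rewrite indic0 mul0e mule0.
by rewrite integral0 patch_set0 integral0 mule0.
Qed.

End weighted_measure.

(** * Change of variables along one coordinate *)

Section increasing_substitution.
Variable R : realType.
Notation lam := (@lebesgue_measure R).
Variables (g g' : R -> R).
Hypothesis dg : forall x : R, is_derive x 1 g (g' x).
Hypothesis g'_gt0 : forall x, 0 < g' x.
Hypothesis cg' : continuous g'.

Let cg : continuous g.
Proof.
by move=> x; apply/differentiable_continuous/derivable1_diffP/(@ex_derive _ _ _ _ _ _ _ (dg x)).
Qed.

Let g_incr x y : (g x < g y) = (x < y).
Proof.
have incr a b : a < b -> g a < g b.
 move=> ab; rewrite -subr_gt0.
 have [c _ ->] := @MVT _ g g' a b ab (fun x _ => dg x)
  (derivable_within_continuous (fun x _ => @ex_derive _ _ _ _ _ _ _ (dg x))).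
 by rewrite mulr_gt0// subr_gt0.
have [xy|xy|->] := ltgtP x y; first exact: incr.
 by apply/negbTE; rewrite -leNgt; exact/ltW/incr.
by rewrite ltxx.
Qed.

Let g_leE x y : (g x <= g y) = (x <= y).
Proof. by rewrite !leNgt g_incr. Qed.

Let range_interval : is_interval (range g).
Proof.
move=> _ _ [x _ <-] [y _ <-] z /andP[xz zy].
have xy : x <= y by rewrite -g_leE (le_trans xz).
have [||c _ <-] := @IVT R g x y z xy; last by exists c.
 exact: continuous_subspaceT.
by rewrite (min_idPl _) ?(max_idPr _) ?g_leE// xz zy.
Qed.

Let rI u v z : g u <= z <= g v -> range g z.
Proof. by apply: range_interval; [exists u|exists v]. Qed.

Lemma measurable_range_increasing : measurable (range g).
Proof. exact: is_interval_measurable. Qed.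

Let mg : measurable_fun [set: measurableTypeR R] (g : measurableTypeR R -> measurableTypeR R).
Proof. exact: continuous_measurable_fun. Qed.

Let mg' : measurable_fun [set: measurableTypeR R] g'.
Proof. exact: continuous_measurable_fun. Qed.

Let g'_ge0 x : 0 <= g' x. Proof. exact/ltW. Qed.

(** The image under [g] of the measure with density [g']. It will be identified with [m2], Lebesgue
    measure restricted to the range of [g]. The range is the whole line for the shears but a bounded
    interval for the logistic map of the chart. *)
Let m1 : {measure set (measurableTypeR R) -> \bar R} :=
 measure_function_pushforward__canonical__measure_function_Measure
  (weighted lam g'_ge0 mg') mg.
Let indic_ge0 (x : R) : 0 <= (\1_(range g) x : R). Proof. by []. Qed.
Let m_indic : measurable_fun [set: measurableTypeR R] (\1_(range g) : R -> R).
Proof. by apply: measurable_indic; exact: measurable_range_increasing. Qed.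
Let m2 : {measure set (measurableTypeR R) -> \bar R} :=
 weighted lam indic_ge0 m_indic.
Let m2E A : measurable A -> m2 A = lam (A `&` range g).
Proof.
move=> mA; have mr := measurable_range_increasing.
transitivity (\int[lam]_(x in A) (\1_(range g) x)%:E)%E; first by [].
by rewrite integral_indic// setIC.
Qed.

Let m1_oc u v : m1 `]g u, g v]%classic = m2 `]g u, g v]%classic.
Proof.
have -> : m1 `]g u, g v]%classic = (\int[lam]_(x in `]u, v]) (g' x)%:E)%E.
 rewrite [LHS](_ : _ = (\int[lam]_(x in g @^-1` `]g u, g v]%classic) (g' x)%:E)%E)//.
 congr (integral _ _ _).
 by apply/seteqP; split => x /=; rewrite !in_itv/= g_incr g_leE.
have -> : m2 `]g u, g v]%classic = lam `]g u, g v]%classic.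
 rewrite m2E//; congr (lam _); apply/setIidPl => z.
 rewrite /= in_itv/= => /andP[uz zv].
 by apply: (@rI u v); rewrite (ltW uz).
have [uv|vu] := ltP u v; last first.
 rewrite !set_itv_ge ?bnd_simp -?leNgt//; first by rewrite integral_set0 measure0.
 by rewrite g_leE.
rewrite integral_itv_obnd_cbnd; last exact/measurable_EFinP/measurable_funTS.
rewrite (@continuous_FTC2 _ _ g) ?lebesgue_measure_itv/= ?lte_fin ?g_incr ?uv ?EFinB//.
- exact: continuous_subspaceT.
- split=> [x _|  |].
 + exact: ex_derive.
 + by apply: cvg_at_right_filter; exact: cg.
 + by apply: cvg_at_left_filter; exact: cg.
- by move=> x _; rewrite derive1E derive_val.
Qed.

(** The end points [a] and [b] need not be values of [g]. The intervals [J k] have end points in the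
    range and exhaust it, and both measures vanish off the range; so the intervals between values of
    [g] decide the general case in the limit. *)
Let m12_oc a b : m1 `]a, b]%classic = m2 `]a, b]%classic.
Proof.
pose J (k : nat) : set R := `]g (- k%:R), g k%:R]%classic.
have mIJ k : measurable (`]a, b]%classic `&` J k : set (measurableTypeR R)).
 by apply: measurableI; exact: measurable_itv.
have ndJ : nondecreasing_seq (fun k => `]a, b]%classic `&` J k).
 move=> k l kl; apply/subsetPset; apply: setIS.
 apply: subset_itv; rewrite bnd_simp g_leE ?lerN2 ler_nat//.
have JU : \bigcup_k J k = range g.
 apply/seteqP; split => z.
  move=> [k _]; rewrite /J /= in_itv/= => /andP[kz zk].
  by apply: (@rI (- k%:R) k%:R); rewrite (ltW kz).
 move=> [x _ <-]; exists (Num.truncn `|x|).+1 => //.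
 rewrite /J /= in_itv/= g_incr g_leE.
 have := truncnS_gt `|x|; rewrite ltr_norml => /andP[h1 h2].
 by rewrite h1 ltW.
have limJ (m : {measure set (measurableTypeR R) -> \bar R}) :
 m (~` range g) = 0%E ->
 (fun k => m (`]a, b]%classic `&` J k)) @ \oo --> m `]a, b]%classic.
 move=> mr; have -> : m `]a, b]%classic = m (\bigcup_k (`]a, b]%classic `&` J k)).
  rewrite -setI_bigcupr JU.
  have mC : measurable (~` range g : set (measurableTypeR R)).
   by apply: measurableC; exact: measurable_range_increasing.
  rewrite [in LHS](_ : `]a, b]%classic =
   (`]a, b]%classic `&` range g) `|` (`]a, b]%classic `&` ~` range g)); last first.
   by rewrite -setIUr setUv setIT.
  rewrite measureU//=.
  - rewrite (_ : m (_ `&` ~` _) = 0%E) ?adde0//.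
   apply/eqP; rewrite eq_le measure_ge0 andbT -mr le_measure ?inE//.
   exact: measurableI.
  - apply: measurableI => //; exact: measurable_range_increasing.
  - exact: measurableI.
  - by rewrite setIACA setICr setI0.
 apply: nondecreasing_cvg_mu => //.
 exact: bigcupT_measurable.
have m1r : m1 (~` range g) = 0%E.
 rewrite /m1 /= /pushforward /weighted.
 rewrite (_ : g @^-1` _ = set0) ?integral_set0//.
 by apply/seteqP; split => // x /=; apply; exists x.
have m2r : m2 (~` range g) = 0%E.
 by rewrite m2E ?setICl ?measure0//; apply: measurableC; exact: measurable_range_increasing.
have e k : m1 (`]a, b]%classic `&` J k) = m2 (`]a, b]%classic `&` J k).
 have -> : `]a, b]%classic `&` J k = `]Num.max a (g (- k%:R)), Num.min b (g k%:R)]%classic.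
  apply/seteqP; split => z; rewrite /J /= !in_itv/= gt_max le_min.
   by move=> [/andP[-> ->] /andP[-> ->]].
  by move=> /andP[/andP[-> ->] /andP[-> ->]].
 set a' := Num.max _ _; set b' := Num.min _ _.
 have [ab|ba] := ltP a' b'; last by rewrite set_itv_ge ?bnd_simp -?leNgt// !measure0.
 have a'1 : g (- k%:R) <= a' by rewrite le_max lexx orbT.
 have b'2 : b' <= g k%:R by rewrite ge_min lexx orbT.
 have [|u _ ug] := @rI (- k%:R) k%:R a'; first by rewrite a'1 (le_trans (ltW ab)).
 have [|v _ vg] := @rI (- k%:R) k%:R b'; first by rewrite b'2 (le_trans _ (ltW ab)).
 by rewrite -ug -vg m1_oc.
rewrite -(cvg_lim _ (limJ m1 m1r))// -(cvg_lim _ (limJ m2 m2r))//.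
by congr (limn _); apply/funext => k; exact: e.
Qed.

Lemma increasing_substitution (H : R -> \bar R) :
 (forall x, (0 <= H x)%E) -> borel H ->
 (\int[lam]_(z in range g) H z = \int[lam]_y (H (g y) * (g' y)%:E))%E.
Proof.
move=> H0 mH.
have m12 : forall A, measurable A -> m1 A = m2 A.
 apply: (@measure_unique _ R (measurableTypeR R) (@ocitv R)
  (fun k : nat => `]- k%:R, k%:R]%classic)) => //.
 - exact: ocitvI.
 - by move=> k; exact: is_ocitv.
 - apply/seteqP; split => // x _; exists (Num.truncn `|x|).+1 => //=.
  have := truncnS_gt `|x|; rewrite ltr_norml in_itv/= => /andP[h1 h2].
  by rewrite h1 ltW.
 - by move=> _ [[a b] _ <-]; exact: m12_oc.
 - move=> k; rewrite m12_oc m2E//.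
  apply: (@le_lt_trans _ _ (lam `]- k%:R, k%:R]%classic)).
   apply: le_measure; last exact: subIsetl.
    rewrite inE; apply: measurableI; first exact: measurable_itv.
    exact: measurable_range_increasing.
   by rewrite inE; exact: measurable_itv.
  by rewrite lebesgue_measure_itv/=; case: ifPn => // _; rewrite ltry.
transitivity (\int[m2]_z H z)%E.
 rewrite integral_weighted// [LHS]integral_mkcond.
 apply: eq_integral => x _; rewrite /patch indicE.
 by case: ifP => _; rewrite ?mule1 ?mule0.
transitivity (\int[m1]_z H z)%E.
 by apply: eq_measure_integral => A mA _; rewrite m12.
rewrite [LHS](_ : _ = \int[pushforward (weighted lam g'_ge0 mg') (g : measurableTypeR R -> measurableTypeR R)]_z H z)%E; last by [].
rewrite ge0_integral_pushforward// preimage_setT integral_weighted//.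
- by move=> x; exact: H0.
- exact: measurableT_comp.
Qed.

End increasing_substitution.

Section lebesgue_tuple_integral.
Variable R : realType.
Notation lam := (@lebesgue_measure R).
Notation leb m := (lebesgue_tuple R m).

Lemma integral_lebesgue_tuple0 (f : 0.-tuple R -> \bar R) :
 measurable_fun [set: 0.-tuple R] f -> (\int[leb 0]_x f x = f [tuple])%E.
Proof.
move=> mf.
rewrite [LHS](_ : _ = \int[\d_([tuple] : 0.-tuple R)]_x f x)%E//.
by rewrite integral_dirac// diracE mem_set// mul1e.
Qed.

Variable m : nat.

Lemma measurable_comp_tuple_of_pair (f : m.+1.-tuple R -> \bar R) :
 borel f ->
 measurable_fun [set: measurableTypeR R * m.-tuple R] (f \o @tuple_of_pair R m).
Proof. by move=> mf; apply: measurableT_comp => //; exact: measurable_tuple_of_pair. Qed.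

Lemma integral_lebesgue_tuple_prod (f : m.+1.-tuple R -> \bar R) :
 (forall x, (0 <= f x)%E) -> borel f ->
 (\int[leb m.+1]_x f x = \int[lam \x leb m]_p f (tuple_of_pair p))%E.
Proof.
move=> f0 mf.
rewrite [LHS](_ : _ = \int[pushforward (lam \x leb m) (@tuple_of_pair R m)]_x f x)%E//.
rewrite ge0_integral_pushforward//.
exact: measurable_tuple_of_pair.
Qed.

Lemma integral_lebesgue_tupleS (f : m.+1.-tuple R -> \bar R) :
 (forall x, (0 <= f x)%E) -> borel f ->
 (\int[leb m.+1]_x f x = \int[lam]_a \int[leb m]_t f (tuple_of_pair (a, t)))%E.
Proof.
move=> f0 mf; rewrite integral_lebesgue_tuple_prod//.
exact: (fubini_tonelli1 _ (measurable_comp_tuple_of_pair mf) (fun p => f0 _)).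
Qed.

Lemma integral_lebesgue_tupleS_swap (f : m.+1.-tuple R -> \bar R) :
 (forall x, (0 <= f x)%E) -> borel f ->
 (\int[leb m.+1]_x f x = \int[leb m]_t \int[lam]_a f (tuple_of_pair (a, t)))%E.
Proof.
move=> f0 mf; rewrite integral_lebesgue_tupleS//.
exact: (fubini_tonelli _ (measurable_comp_tuple_of_pair mf) (fun p => f0 _)).
Qed.

Lemma measurable_tuple_of_pair1 (a : R) :
 measurable_fun [set: m.-tuple R] (fun t => tuple_of_pair (a, t)).
Proof.
apply: (measurableT_comp (@measurable_tuple_of_pair R m)).
exact: measurable_pair1.
Qed.

Lemma measurable_tuple_of_pair2 (t : m.-tuple R) :
 measurable_fun [set: measurableTypeR R] (fun a : R => tuple_of_pair (a, t)).
Proof.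
apply: (measurableT_comp (@measurable_tuple_of_pair R m)).
exact: measurable_pair2.
Qed.

Lemma tnth_tuple_of_pair0 (a : R) (t : m.-tuple R) :
 tnth (tuple_of_pair (a, t)) ord0 = a.
Proof. by []. Qed.

Lemma tnth_tuple_of_pairS (a : R) (t : m.-tuple R) j :
 tnth (tuple_of_pair (a, t)) (lift ord0 j) = tnth t j.
Proof. by rewrite /tuple_of_pair tnthS. Qed.

End lebesgue_tuple_integral.

Section tuple_update.
Variable R : realType.
Notation lam := (@lebesgue_measure R).
Notation leb m := (lebesgue_tuple R m).

Definition tuple_update m (y : m.-tuple R) (i : 'I_m) (r : R) : m.-tuple R :=
 [tuple if j == i then r else tnth y j | j < m].

Lemma tnth_tuple_update m (y : m.-tuple R) i r j :
 tnth (tuple_update y i r) j = if j == i then r else tnth y j.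
Proof. by rewrite tnth_mktuple. Qed.

Lemma tuple_updateK m (y : m.-tuple R) i r s :
 tuple_update (tuple_update y i r) i s = tuple_update y i s.
Proof. by apply: eq_from_tnth => j; rewrite !tnth_tuple_update; case: eqP. Qed.

Lemma tuple_update0 m (a r : R) (t : m.-tuple R) :
 tuple_update (tuple_of_pair (a, t)) ord0 r = tuple_of_pair (r, t).
Proof.
apply: eq_from_tnth => j; rewrite tnth_tuple_update.
case: (unliftP ord0 j) => [k|] ->; last by rewrite eqxx.
by rewrite eq_sym (negbTE (neq_lift _ _)) !tnth_tuple_of_pairS.
Qed.

Lemma tuple_updateS m (a r : R) (t : m.-tuple R) i :
 tuple_update (tuple_of_pair (a, t)) (lift ord0 i) r =
 tuple_of_pair (a, tuple_update t i r).
Proof.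
apply: eq_from_tnth => j; rewrite tnth_tuple_update.
case: (unliftP ord0 j) => [k|] ->.
 by rewrite (inj_eq (@lift_inj _ _)) !tnth_tuple_of_pairS tnth_tuple_update.
by rewrite (negbTE (neq_lift _ _)).
Qed.

Lemma measurable_tuple_update d (T : measurableType d) m (i : 'I_m)
  (y : T -> m.-tuple R) (r : T -> R) :
 borel y -> borel r ->
 borel (fun x => tuple_update (y x) i (r x)).
Proof.
move=> my mr; apply/measurable_fun_tnthP => j.
have [->|ji] := eqVneq j i.
 by rewrite (_ : _ \o _ = r)//; apply/funext => x /=; rewrite tnth_tuple_update eqxx.
rewrite (_ : _ \o _ = fun x => tnth (y x) j).
 by apply: (measurableT_comp (measurable_tnth j)).
by apply/funext => x /=; rewrite tnth_tuple_update (negbTE ji).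
Qed.

(** Only coordinate [i] moves, so that [J], the derivative of [theta] along this coordinate, is the
    whole Jacobian. The induction on [m] strips the coordinates before [i] by Tonelli; once [i] is
    the first one, the order of integration is exchanged and the substitution is made on the line
    with all other coordinates fixed. *)
Lemma shear_substitution m (i : 'I_m) (theta J : m.-tuple R -> R) (H : m.-tuple R -> \bar R) :
 borel theta ->
 borel J ->
 (forall y (r : R), is_derive r 1 (fun r => theta (tuple_update y i r))
           (J (tuple_update y i r))) ->
 (forall y, continuous (fun r => J (tuple_update y i r))) ->
 (forall y, 0 < J y) ->
 (forall y, range (fun r => theta (tuple_update y i r)) = [set: R]) ->
 (forall x, (0 <= H x)%E) -> borel H ->
 (\int[leb m]_y H y =
  \int[leb m]_y (H (tuple_update y i (theta y)) * (J y)%:E))%E.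
Proof.
elim: m i theta J H => [[]//|m IH] i theta J H mth mJ dth cJ J0 rth H0 mH.
have mR : borel
  (fun y => H (tuple_update y i (theta y)) * (J y)%:E)%E.
 apply: emeasurable_funM; last exact/measurable_EFinP.
 by apply: measurableT_comp => //; exact: measurable_tuple_update.
have R0 y : (0 <= H (tuple_update y i (theta y)) * (J y)%:E)%E.
 by apply: mule_ge0 => //; rewrite lee_fin ltW.
case: (unliftP ord0 i) mth mJ dth cJ rth mR R0 => [j|] -> mth mJ dth cJ rth mR R0.
 rewrite !integral_lebesgue_tupleS//; apply: eq_integral => a _.
 have dth' y (r : R) : is_derive r 1 (fun r => theta (tuple_of_pair (a, tuple_update y j r)))
   (J (tuple_of_pair (a, tuple_update y j r))).
  have := dth (tuple_of_pair (a, y)) r; rewrite tuple_updateS.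
  rewrite (_ : (fun r => theta (tuple_update (tuple_of_pair _) _ _)) =
   fun r => theta (tuple_of_pair (a, tuple_update y j r)))//.
  by apply/funext => s; rewrite tuple_updateS.
 etransitivity.
  apply: (IH j (fun t => theta (tuple_of_pair (a, t)))
   (fun t => J (tuple_of_pair (a, t))) (fun t => H (tuple_of_pair (a, t)))).
  - by apply: measurableT_comp => //; exact: measurable_tuple_of_pair1.
  - by apply: measurableT_comp => //; exact: measurable_tuple_of_pair1.
  - move=> y; have := cJ (tuple_of_pair (a, y)).
   rewrite (_ : (fun r => J (tuple_update (tuple_of_pair _) _ _)) =
    fun r => J (tuple_of_pair (a, tuple_update y j r)))//.
   by apply/funext => s; rewrite tuple_updateS.
  - by move=> y; exact: J0.
  - move=> y; rewrite -[RHS](rth (tuple_of_pair (a, y))); congr (_ @` _).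
   by apply/funext => s; rewrite tuple_updateS.
  - by move=> x; exact: H0.
  - by apply: measurableT_comp => //; exact: measurable_tuple_of_pair1.
 by apply: eq_integral => t _; rewrite tuple_updateS.
rewrite !integral_lebesgue_tupleS_swap//; apply: eq_integral => t _.
pose g r := theta (tuple_of_pair (r, t)).
pose g' r := J (tuple_of_pair (r, t)).
have gE a : g = (fun r => theta (tuple_update (tuple_of_pair (a, t)) ord0 r)).
 by apply/funext => r; rewrite tuple_update0.
have g'E a : g' = (fun r => J (tuple_update (tuple_of_pair (a, t)) ord0 r)).
 by apply/funext => r; rewrite tuple_update0.
have dg (r : R) : is_derive r 1 g (g' r).
 rewrite {1}(gE 0) (_ : g' r = J (tuple_update (tuple_of_pair (0, t)) ord0 r))//.
 by rewrite tuple_update0.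
have := @increasing_substitution R g g' dg _ _ (fun a => H (tuple_of_pair (a, t))).
rewrite {1}(gE 0) rth => sub.
rewrite {}sub.
- by apply: eq_integral => r _; rewrite tuple_update0.
- by move=> r; exact: J0.
- by rewrite (g'E 0); exact: cJ.
- by move=> x; exact: H0.
- by apply: measurableT_comp => //; exact: measurable_tuple_of_pair2.
Qed.

End tuple_update.

Section measurability.
Context d (T : measurableType d) (R : realType).

Lemma measurable_fun_invr (f : T -> R) : borel f ->
 (forall x, 0 < f x) -> borel (fun x => (f x)^-1).
Proof.
move=> mf f0; rewrite (_ : (fun x => _) = (fun x => expR (- ln (f x)))).
 apply: measurableT_comp => //; apply: measurableT_comp => //.
 by apply: measurableT_comp => //; exact: measurable_ln.
by apply/funext => x; rewrite expRN lnK// posrE.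
Qed.

Lemma measurable_fun_tuple n (f : 'I_n -> T -> R) :
 (forall i, borel (f i)) ->
 borel (fun x => [tuple f i x | i < n]).
Proof.
move=> mf; apply/measurable_fun_tnthP => i.
by rewrite (_ : _ \o _ = f i)//; apply/funext => x /=; rewrite tnth_mktuple.
Qed.

Lemma measurable_fun_tnth n (y : T -> n.-tuple R) i :
 borel y -> borel (fun x => tnth (y x) i).
Proof. by move=> my; apply: (measurableT_comp (measurable_tnth i)). Qed.

Lemma measurable_fun_bigsum n (f : 'I_n -> T -> R) :
 (forall i, borel (f i)) ->
 borel (fun x => \sum_(i < n) f i x).
Proof. by move=> mf; apply: measurable_sum. Qed.

Lemma measurable_fun_bigprod n (f : 'I_n -> T -> R) :
 (forall i, borel (f i)) ->
 borel (fun x => \prod_(i < n) f i x).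
Proof. by move=> mf; apply: measurable_prod. Qed.

End measurability.

(** * The logarithmic chart of the simplex and its Jacobian *)

Section chart.
Variable R : realType.
Notation lam := (@lebesgue_measure R).
Notation leb m := (lebesgue_tuple R m).

Definition open_corner m (c : R) : set (m.-tuple R) :=
 [set t | (forall i, 0 < tnth t i) /\ \sum_(i < m) tnth t i < c].

(** The summand 1 is the exponential of the last log-coordinate, which is 0. *)
Definition exp_norm m (y : m.-tuple R) : R := 1 + \sum_(i < m) expR (tnth y i).

(** The size [c] is variable for the sake of the induction on [m]: once the first coordinate equals
    a, the others range over the corner of size c - a. *)
Definition corner_chart m (c : R) (y : m.-tuple R) : m.-tuple R :=
 [tuple c * expR (tnth y i) / exp_norm y | i < m].

(** The Jacobian determinant of [corner_chart c]. It is never computed as a determinant: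
    [corner_jac_cons] is the chain rule that builds it one coordinate at a time. *)
Definition corner_jac m (c : R) (y : m.-tuple R) : R :=
 c ^+ m * (\prod_(i < m) expR (tnth y i)) / exp_norm y ^+ m.+1.

Lemma exp_norm_gt0 m (y : m.-tuple R) : 0 < exp_norm y.
Proof. by rewrite ltr_pwDl// sumr_ge0// => i _; rewrite expR_ge0. Qed.

Lemma measurable_exp_norm m : borel (@exp_norm m).
Proof.
apply: measurable_funD => //; apply: measurable_fun_bigsum => i.
by apply: measurableT_comp => //; exact: measurable_tnth.
Qed.

Lemma measurable_open_corner m (c : R) : measurable (@open_corner m c).
Proof.
have -> : @open_corner m c =
  \bigcap_(i in [set: 'I_m]) ((fun t => tnth t i) @^-1` `]0, +oo[%classic)
  `&` ((fun t => \sum_(i < m) tnth t i) @^-1` `]-oo, c[%classic).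
 apply/seteqP; split=> t; rewrite /open_corner /=.
  move=> [h1 h2]; split; last by rewrite in_itv.
  by move=> i _; rewrite /= in_itv/= h1.
 move=> [h1 h2]; split; last by move: h2; rewrite in_itv.
 by move=> i; have := h1 i I; rewrite /= in_itv/= andbT.
apply: measurableI.
 apply: fin_bigcap_measurable => // i _.
 rewrite -[X in measurable X]setTI; apply: measurable_tnth => //.
rewrite -[X in measurable X]setTI.
by apply: (measurable_fun_bigsum (fun i => @measurable_tnth _ _ m i)).
Qed.

(** With the later log-coordinates fixed, the first coordinate is a logistic function of its own
    log-coordinate [v], and what remains is the chart of the smaller corner at the same [y]. *)
Lemma corner_chart_cons m (c v : R) (y : m.-tuple R) :
 let a := c * (expR v / (expR v + exp_norm y)) in
 tuple_of_pair (a, corner_chart (c - a) y) = corner_chart c (tuple_of_pair (v, y)).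
Proof.
move=> a; have K0 := exp_norm_gt0 y.
have DE : exp_norm (tuple_of_pair (v, y)) = expR v + exp_norm y.
 rewrite /exp_norm big_ord_recl tnth_tuple_of_pair0 addrCA; congr (_ + (_ + _)).
 by apply: eq_bigr => i _; rewrite tnth_tuple_of_pairS.
have D0 : 0 < expR v + exp_norm y by rewrite addr_gt0// expR_gt0.
apply: eq_from_tnth => i; case: (unliftP ord0 i) => [j|] ->.
 rewrite tnth_tuple_of_pairS !tnth_mktuple tnth_tuple_of_pairS DE /a; field.
 by rewrite !gt_eqF.
by rewrite tnth_tuple_of_pair0 tnth_mktuple tnth_tuple_of_pair0 DE /a mulrA.
Qed.

Lemma corner_jac_cons m (c v : R) (y : m.-tuple R) :
 let a := c * (expR v / (expR v + exp_norm y)) in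
 corner_jac (c - a) y * (c * (expR v * exp_norm y / (expR v + exp_norm y) ^+ 2)) =
 corner_jac c (tuple_of_pair (v, y)).
Proof.
move=> a; have K0 := exp_norm_gt0 y.
have DE : exp_norm (tuple_of_pair (v, y)) = expR v + exp_norm y.
 rewrite /exp_norm big_ord_recl tnth_tuple_of_pair0 addrCA; congr (_ + (_ + _)).
 by apply: eq_bigr => i _; rewrite tnth_tuple_of_pairS.
have D0 : 0 < expR v + exp_norm y by rewrite addr_gt0// expR_gt0.
rewrite /corner_jac DE big_ord_recl tnth_tuple_of_pair0.
under [in RHS]eq_bigr do rewrite tnth_tuple_of_pairS.
have -> : c - a = c * exp_norm y / (expR v + exp_norm y).
 by rewrite /a; field; rewrite gt_eqF.
rewrite !exprMn exprVn !exprS; field.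
by rewrite ?expf_neq0 ?gt_eqF.
Qed.

Let logit (c K : R) (v : R) : R := c * (expR v / (expR v + K)).
Let logit' (c K : R) (v : R) : R := c * (expR v * K / (expR v + K) ^+ 2).

Let is_derive_logit (c K : R) (v : R) : 0 < K ->
 is_derive v 1 (logit c K) (logit' c K v).
Proof.
move=> K0; have D0 : expR v + K != 0 by rewrite gt_eqF// addr_gt0// expR_gt0.
have -> : logit c K = (fun v : R => c *: (expR v * (expR v + K)^-1)) by [].
apply: is_derive_eq; rewrite /GRing.scale/= /logit'; field.
exact: D0.
Qed.

Let continuous_logit' (c K : R) : 0 < K -> continuous (logit' c K).
Proof.
move=> K0 v.
have D0 (u : R) : expR u + K != 0 by rewrite gt_eqF// addr_gt0// expR_gt0.
have d (u : R) : derivable (fun v => c * (expR v * K) * (expR v + K)^-1 ^+ 2) u 1.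
 exact: ex_derive.
have -> : logit' c K = (fun v => c * (expR v * K) * (expR v + K)^-1 ^+ 2).
 by apply/funext => u; rewrite /logit' exprVn !mulrA.
exact/differentiable_continuous/derivable1_diffP/d.
Qed.

Let range_logit (c K : R) : 0 < c -> 0 < K -> range (logit c K) = `]0, c[%classic.
Proof.
move=> c0 K0; apply/seteqP; split => [_ [v _ <-]|a].
 have e0 := expR_gt0 v; have D0 : 0 < expR v + K by rewrite addr_gt0.
 rewrite /= in_itv/= /logit mulr_gt0 ?divr_gt0//=.
 by rewrite -[ltRHS]mulr1 ltr_pM2l// ltr_pdivrMr// mul1r ltrDl.
rewrite /= in_itv/= => /andP[a0 ac].
have ca : 0 < c - a by rewrite subr_gt0.
exists (ln (K * a / (c - a))) => //; rewrite /logit lnK; last first.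
 by rewrite posrE divr_gt0// mulr_gt0.
field; rewrite (gt_eqF ca)/=.
have -> : K * a + K * (c - a) = K * c by ring.
by rewrite mulf_neq0 ?gt_eqF.
Qed.

Lemma measurable_corner_chart2 m :
 measurable_fun [set: measurableTypeR R * m.-tuple R]
  (fun p => corner_chart p.1 p.2).
Proof.
apply: measurable_fun_tuple => i.
apply: measurable_funM.
 apply: measurable_funM; first exact: measurable_fst.
 apply: measurableT_comp => //; apply: measurable_fun_tnth; exact: measurable_snd.
apply: measurable_fun_invr.
 by apply: measurableT_comp => //; first exact: measurable_exp_norm.
by move=> x; exact: exp_norm_gt0.
Qed.

Lemma measurable_corner_jac2 m :
 measurable_fun [set: measurableTypeR R * m.-tuple R]
  (fun p => corner_jac p.1 p.2).
Proof.
apply: measurable_funM.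
 apply: measurable_funM; first by apply: measurable_funX; exact: measurable_fst.
 apply: measurable_fun_bigprod => i.
 apply: measurableT_comp => //; apply: measurable_fun_tnth; exact: measurable_snd.
apply: measurable_fun_invr.
 by apply: measurable_funX; apply: measurableT_comp => //; first exact: measurable_exp_norm.
by move=> x; rewrite exprn_gt0// exp_norm_gt0.
Qed.

Lemma corner_jac_ge0 m (c : R) (y : m.-tuple R) : 0 <= c -> 0 <= corner_jac c y.
Proof.
move=> c0; rewrite /corner_jac divr_ge0 ?mulr_ge0 ?exprn_ge0//.
 by apply: prodr_ge0 => i _; rewrite expR_ge0.
by rewrite ltW// exp_norm_gt0.
Qed.

Lemma open_corner_cons m (c a : R) (t : m.-tuple R) :
 open_corner c (tuple_of_pair (a, t)) = (0 < a /\ open_corner (c - a) t).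
Proof.
rewrite /open_corner /= big_ord_recl tnth_tuple_of_pair0.
rewrite (_ : \sum_(i < m) tnth (tuple_of_pair _) _ = \sum_(i < m) tnth t i); last first.
 by apply: eq_bigr => i _; rewrite tnth_tuple_of_pairS.
apply/propext; split=> [[h1 h2]|[h1 [h2 h3]]].
 split; first by have := h1 ord0.
 by split; [move=> i; have := h1 (lift ord0 i); rewrite tnth_tuple_of_pairS|rewrite ltrBrDl].
split; last by rewrite -ltrBrDl.
by move=> i; case: (unliftP ord0 i) => [j|] ->; rewrite ?tnth_tuple_of_pairS.
Qed.

Lemma open_corner_le0 m (c : R) (t : m.-tuple R) : c <= 0 -> ~ open_corner c t.
Proof.
move=> c0 [h1]; apply/negP; rewrite -leNgt (le_trans c0)// sumr_ge0// => i _.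
exact/ltW.
Qed.

Lemma measurable_corner_chart m (c : R) :
 borel (@corner_chart m c).
Proof.
apply: (measurableT_comp (f := fun p => corner_chart p.1 p.2) (g := pair c)).
 exact: measurable_corner_chart2.
exact: measurable_pair1.
Qed.

Lemma measurable_corner_jac m (c : R) :
 borel (@corner_jac m c).
Proof.
apply: (measurableT_comp (f := fun p => corner_jac p.1 p.2) (g := pair c)).
 exact: measurable_corner_jac2.
exact: measurable_pair1.
Qed.

(** For a fixed first coordinate a, the induction hypothesis parametrises the corner of size c - a
    by log-coordinates [y]. The two integrals are then exchanged, and for fixed [y] the coordinate a
    is replaced by a logistic function whose range is the interval from 0 to [c]. *)
Lemma integral_open_corner m (c : R) (G : m.-tuple R -> \bar R) : 0 < c ->
 (forall x, (0 <= G x)%E) -> borel G ->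
 (\int[leb m]_(t in open_corner c) G t =
  \int[leb m]_y (G (corner_chart c y) * (corner_jac c y)%:E))%E.
Proof.
elim: m c G => [|m IH] c G c0 G0 mG.
 rewrite integral_mkcond !integral_lebesgue_tuple0.
 - rewrite patchE mem_set; last by split=> [[]//|]; rewrite big_ord0.
  rewrite /corner_jac big_ord0 expr0 /exp_norm big_ord0 addr0 expr1 divr1 !mulr1.
  by rewrite mule1; congr G; apply: eq_from_tnth => -[].
 - by apply/(measurable_restrictT _ _).1 => //;
   [exact: measurable_open_corner|exact: measurable_funTS].
 - apply: emeasurable_funM; last by apply/measurable_EFinP; exact: measurable_corner_jac.
  by apply: measurableT_comp => //; exact: measurable_corner_chart.
rewrite [LHS]integral_mkcond [LHS]integral_lebesgue_tupleS; last 2 first.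
- by move=> x; rewrite patchE; case: ifP.
- by apply/(measurable_restrictT _ _).1 => //;
  [exact: measurable_open_corner|exact: measurable_funTS].
(* The absolute value keeps [K] nonnegative where c - a is negative, a region that the indicator
   removes; Tonelli asks for nonnegativity everywhere. *)
pose K (p : measurableTypeR R * m.-tuple R) : \bar R :=
 (G (tuple_of_pair (p.1, corner_chart (c - p.1) p.2)) * (`|corner_jac (c - p.1) p.2|)%:E
  * (\1_(`]0, c[%classic : set R) p.1)%:E)%E.
have K0 p : (0 <= K p)%E.
 by rewrite /K !mule_ge0// lee_fin.
have mcp : measurable_fun [set: measurableTypeR R * m.-tuple R] (fun p => (c - p.1 : measurableTypeR R, p.2)).
 apply/measurable_fun_pair => /=; last exact: measurable_snd.
 by apply: measurable_funB => //; exact: measurable_fst.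
have mK : measurable_fun [set: measurableTypeR R * m.-tuple R] K.
 apply: emeasurable_funM.
  apply: emeasurable_funM.
   apply: measurableT_comp => //.
   apply: (measurableT_comp (@measurable_tuple_of_pair R m)).
   apply/measurable_fun_pair => /=; first exact: measurable_fst.
   exact: (measurableT_comp (@measurable_corner_chart2 m) mcp).
  apply/measurable_EFinP; apply: measurableT_comp => //.
  exact: (measurableT_comp (@measurable_corner_jac2 m) mcp).
 apply/measurable_EFinP; apply: measurableT_comp; last exact: measurable_fst.
 exact: measurable_indic.
transitivity (\int[lam]_a \int[leb m]_y K (a, y))%E.
 apply: eq_integral => a _.
 have [a0|a0] := leP a 0.
  rewrite !integral0_eq// => t _.
   by rewrite /K /= indicE memNset ?mule0//= in_itv/= => /andP[]; rewrite ltNge a0.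
  by rewrite patchE memNset// open_corner_cons => -[]; rewrite ltNge a0.
 have [ac|ac] := leP c a.
  rewrite !integral0_eq// => t _.
   by rewrite /K /= indicE memNset ?mule0//= in_itv/= => /andP[_]; rewrite ltNge ac.
  rewrite patchE memNset// open_corner_cons => -[_].
  by apply: open_corner_le0; rewrite subr_le0.
 have ca : 0 < c - a by rewrite subr_gt0.
 transitivity (\int[leb m]_(t in open_corner (c - a)) G (tuple_of_pair (a, t)))%E.
  rewrite [RHS]integral_mkcond; apply: eq_integral => t _.
  rewrite !patchE; congr (if _ then _ else _).
  by apply/asbool_equiv_eq; rewrite open_corner_cons; split => [[]|].
 rewrite IH//; last by apply: measurableT_comp => //; exact: measurable_tuple_of_pair1.
 apply: eq_integral => t _; rewrite /K /= indicE mem_set ?mule1//=; last first.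
  by rewrite in_itv/= a0 ac.
 by rewrite ger0_norm// corner_jac_ge0// ltW.
rewrite (fubini_tonelli K)// [RHS]integral_lebesgue_tupleS_swap; last 2 first.
- by move=> y; rewrite mule_ge0// lee_fin corner_jac_ge0// ltW.
- apply: emeasurable_funM; last by apply/measurable_EFinP; exact: measurable_corner_jac.
 by apply: measurableT_comp => //; exact: measurable_corner_chart.
apply: eq_integral => y _.
have E0 := exp_norm_gt0 y.
transitivity (\int[lam]_(a in range (logit c (exp_norm y)))
  (G (tuple_of_pair (a, corner_chart (c - a) y)) * (`|corner_jac (c - a) y|)%:E))%E.
 rewrite range_logit// [RHS]integral_mkcond; apply: eq_integral => a _.
 rewrite /K /= indicE patchE; case: (_ \in _); by rewrite ?mule1 ?mule0.
rewrite (@increasing_substitution R (logit c (exp_norm y)) (logit' c (exp_norm y))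
 (fun v => is_derive_logit c v E0) _ _
 (fun a => G (tuple_of_pair (a, corner_chart (c - a) y)) * (`|corner_jac (c - a) y|)%:E)%E).
- apply: eq_integral => v _; rewrite -corner_chart_cons -corner_jac_cons.
 rewrite -muleA -EFinM ger0_norm// corner_jac_ge0//.
 have : range (logit c (exp_norm y)) (logit c (exp_norm y) v) by exists v.
 by rewrite range_logit//= in_itv/= subr_ge0 => /andP[_ /ltW].
- move=> v; have e0 := expR_gt0 v.
 by apply: mulr_gt0 => //; apply: divr_gt0; [exact: mulr_gt0|exact/exprn_gt0/addr_gt0].
- exact: continuous_logit'.
- by move=> x; rewrite mule_ge0.
have mcy : measurable_fun [set: measurableTypeR R] (fun a => (c - a : measurableTypeR R, y)).
 apply/measurable_fun_pair => //=.
 exact: measurable_funB.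
apply: emeasurable_funM.
 apply: measurableT_comp => //.
 apply: (measurableT_comp (@measurable_tuple_of_pair R m)).
 apply/measurable_fun_pair => //=.
 exact: (measurableT_comp (@measurable_corner_chart2 m) mcy).
apply/measurable_EFinP; apply: measurableT_comp => //.
exact: (measurableT_comp (@measurable_corner_jac2 m) mcy).
Qed.

End chart.

Section softmax.
Variable R : realType.
Notation lam := (@lebesgue_measure R).
Notation leb m := (lebesgue_tuple R m).

Lemma ord_max_ind m (Q : 'I_m.+1 -> Prop) :
 (forall j : 'I_m, Q (widen_ord (leqnSn m) j)) -> Q ord_max -> forall i, Q i.
Proof.
move=> Qw Qm i; have [im|im] := ltnP i m; last first.
 by rewrite (_ : i = ord_max)//; apply/val_inj/eqP; rewrite eqn_leq im -ltnS ltn_ord.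
by rewrite (_ : i = widen_ord (leqnSn m) (Ordinal im))//; exact/val_inj.
Qed.

(** The i-th log-coordinate is ln (x_i / x_n); the default value 0 of [nth] is the one with i =
    n. *)
Definition logcoord m (y : m.-tuple R) (i : 'I_m.+1) : R := nth 0 y i.

Lemma logcoord_max m (y : m.-tuple R) : logcoord y ord_max = 0.
Proof. by rewrite /logcoord nth_default// size_tuple. Qed.

Lemma logcoord_widen m (y : m.-tuple R) j :
 logcoord y (widen_ord (leqnSn m) j) = tnth y j.
Proof. by rewrite /logcoord (tnth_nth 0). Qed.

Lemma exp_normE m (y : m.-tuple R) : exp_norm y = \sum_(j < m.+1) expR (logcoord y j).
Proof.
rewrite big_ord_recr/= logcoord_max expR0 addrC /exp_norm; congr (_ + _).
by apply: eq_bigr => j _; rewrite logcoord_widen.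
Qed.

Definition softmax m (y : m.-tuple R) : m.+1.-tuple R :=
 [tuple expR (logcoord y i) / exp_norm y | i < m.+1].

Lemma tnth_softmax m (y : m.-tuple R) i :
 tnth (softmax y) i = expR (logcoord y i) / exp_norm y.
Proof. by rewrite tnth_mktuple. Qed.

Lemma softmax_gt0 m (y : m.-tuple R) i : 0 < tnth (softmax y) i.
Proof. by rewrite tnth_softmax divr_gt0 ?expR_gt0 ?exp_norm_gt0. Qed.

Lemma softmax_sum1 m (y : m.-tuple R) : \sum_(i < m.+1) tnth (softmax y) i = 1.
Proof.
under eq_bigr do rewrite tnth_softmax.
by rewrite -mulr_suml -exp_normE divff// gt_eqF// exp_norm_gt0.
Qed.

Lemma int_simplexP n (x : n.-tuple R) :
 int_simplex x <-> (forall i, 0 < tnth x i) /\ \sum_(i < n) tnth x i = 1.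
Proof.
split=> [[[_ x1] x0]//|[x0 x1]]; split => //; split => // i.
rewrite ltW//= -x1 (bigD1 i)//= lerDl sumr_ge0// => j _; exact/ltW.
Qed.

Lemma int_simplex_softmax m (y : m.-tuple R) : int_simplex (softmax y).
Proof. by apply/int_simplexP; split; [exact: softmax_gt0|exact: softmax_sum1]. Qed.

Lemma measurable_int_simplex n : measurable (@int_simplex R n).
Proof.
have -> : @int_simplex R n =
  \bigcap_(i in [set: 'I_n]) ((fun t => tnth t i) @^-1` `]0, +oo[%classic)
  `&` ((fun t => \sum_(i < n) tnth t i) @^-1` [set 1]).
 apply/seteqP; split=> t.
  move=> /int_simplexP[h1 h2]; split => // i _; by rewrite /= in_itv/= h1.
 move=> [h1 h2]; apply/int_simplexP; split => // i.
 by have := h1 i I; rewrite /= in_itv/= andbT.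
apply: measurableI.
 apply: fin_bigcap_measurable => // i _.
 rewrite -[X in measurable X]setTI; exact: measurable_tnth.
rewrite -[X in measurable X]setTI.
by apply: (measurable_fun_bigsum (fun i => @measurable_tnth _ _ n i)).
Qed.

Lemma measurable_logcoord m i : measurable_fun [set: m.-tuple R] (fun y => logcoord y i).
Proof.
elim/ord_max_ind: i => [j|].
 rewrite (_ : (fun y => _) = (fun y => tnth y j)); first exact: measurable_tnth.
 by apply/funext => y; rewrite logcoord_widen.
by rewrite (_ : (fun y => _) = cst 0)//; apply/funext => y; rewrite logcoord_max.
Qed.

Lemma measurable_softmax m : borel (@softmax m).
Proof.
apply: measurable_fun_tuple => i; apply: measurable_funM.
 by apply: measurableT_comp => //; exact: measurable_logcoord.
apply: measurable_fun_invr; first exact: measurable_exp_norm.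
by move=> x; exact: exp_norm_gt0.
Qed.

Lemma simplex_chart_corner m (y : m.-tuple R) :
 @simplex_chart R m.+1 (corner_chart 1 y) = softmax y.
Proof.
have K0 := exp_norm_gt0 y.
apply: eq_from_tnth; elim/ord_max_ind => [j|]; rewrite tnth_mktuple tnth_softmax.
 rewrite logcoord_widen -[LHS](tnth_nth _ (corner_chart 1 y) j) tnth_mktuple.
 by rewrite mul1r.
rewrite nth_default ?size_tuple// logcoord_max expR0.
under eq_bigr do rewrite tnth_mktuple mul1r.
rewrite -mulr_suml; apply: (mulIf (lt0r_neq0 K0)).
rewrite mulrBl !divfK ?gt_eqF// mul1r {1}/exp_norm; ring.
Qed.

(** Thus dx becomes the product of the x_i times dy, which is why the exponents alpha_i - 1 of the
    density turn into alpha_i in log-coordinates. *)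
Lemma corner_jac1 m (y : m.-tuple R) :
 corner_jac 1 y = \prod_(i < m.+1) tnth (softmax y) i.
Proof.
under eq_bigr do rewrite tnth_softmax.
rewrite big_split/= prodr_const card_ord exprVn /corner_jac expr1n mul1r.
rewrite big_ord_recr/= logcoord_max expR0 mulr1; congr (_ * _).
by apply: eq_bigr => j _; rewrite logcoord_widen.
Qed.

Lemma int_simplex_chart m (t : m.-tuple R) :
 int_simplex (@simplex_chart R m.+1 t) <-> open_corner 1 t.
Proof.
have cj (j : 'I_m) : tnth (@simplex_chart R m.+1 t) (widen_ord (leqnSn m) j) = tnth t j.
 by rewrite tnth_mktuple -[LHS](tnth_nth _ t j).
have cm : tnth (@simplex_chart R m.+1 t) ord_max = 1 - \sum_(j < m) tnth t j.
 by rewrite tnth_mktuple nth_default// size_tuple.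
rewrite int_simplexP big_ord_recr cm /=; split.
 move=> [h _]; split; first by move=> j; rewrite -cj.
 by have := h ord_max; rewrite cm subr_gt0.
move=> [h1 h2]; split.
 by elim/ord_max_ind => [j|]; rewrite ?cj ?cm// subr_gt0.
by under eq_bigr do rewrite cj; rewrite addrC subrK.
Qed.

Lemma integral_int_simplex m (g : m.+1.-tuple R -> \bar R) :
 (forall x, int_simplex x -> (0 <= g x)%E) -> measurable_fun (@int_simplex R m.+1) g ->
 (\int[@simplex_lebesgue R m.+1]_(x in @int_simplex R m.+1) g x =
  \int[leb m]_y (g (softmax y) * (\prod_(i < m.+1) tnth (softmax y) i)%:E))%E.
Proof.
move=> g0 mg; have mS := @measurable_int_simplex m.+1.
pose g' := g \_ (@int_simplex R m.+1).
have mg' : borel g'.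
 by apply/(measurable_restrictT _ _).1.
have g'0 x : (0 <= g' x)%E.
 by rewrite /g' patchE; case: ifPn => // /set_mem; exact: g0.
have mc := @measurable_simplex_chart R m.+1.
rewrite integral_mkcond -/g'.
rewrite [LHS](_ : _ = \int[pushforward (leb m) (@simplex_chart R m.+1)]_x g' x)%E//.
rewrite ge0_integral_pushforward// preimage_setT.
transitivity (\int[leb m]_(t in open_corner 1) g' (@simplex_chart R m.+1 t))%E.
 rewrite [RHS]integral_mkcond; apply: eq_integral => t _.
 rewrite /= patchE; case: ifPn => // tc; rewrite /g' patchE ifN//.
 apply: contra tc => /set_mem /int_simplex_chart tc; exact: mem_set.
rewrite (integral_open_corner (G := g' \o @simplex_chart R m.+1))//; last first.
- exact: measurableT_comp.
- by move=> x; exact: g'0.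
apply: eq_integral => y _.
rewrite /= simplex_chart_corner corner_jac1 /g' patchE mem_set//.
exact: int_simplex_softmax.
Qed.

End softmax.

Section exponential_weight.
Variable R : realType.
Notation lam := (@lebesgue_measure R).
Notation leb m := (lebesgue_tuple R m).

(** The dominating function of the limits below: with rate 1 it is integrable, and with a large rate
    it beats the at most exponential growth of F. *)
Definition exp_weight m (l : R) (y : m.-tuple R) : R :=
 expR (- (l * \sum_(i < m) `|tnth y i|)).

Lemma measurable_exp_weight m l : measurable_fun [set: m.-tuple R] (exp_weight l).
Proof.
apply: measurableT_comp => //; apply: measurableT_comp => //.
apply: measurable_funM => //; apply: measurable_fun_bigsum => i.
by apply: measurableT_comp => //; exact: measurable_tnth.
Qed.

Lemma integral_exp_abs : (\int[lam]_x (expR (- `|x|))%:E < +oo)%E.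
Proof.
have cf : continuous (fun x : R => expR (- `|x|)).
 move=> x; apply: (@continuous_comp _ _ _ (fun x : R => - `|x|) expR); last exact: continuous_expR.
 by apply: continuousN; exact: norm_continuous.
rewrite (@ge0_symfun_integralT R (fun x => expR (- `|x|)) (fun x => expR_ge0 _) cf); last first.
 by move=> x /=; rewrite normrN.
apply: lte_mul_pinfty => //.
apply: (@le_lt_trans _ _ 1%:E); last exact: ltry.
rewrite -(integral_exponential_pdf (ltr01 : 0 < 1 :> R)) integral_mkcond.
apply: ge0_le_integral => //.
- by move=> x _; rewrite patchE; case: ifP => // _; rewrite lee_fin expR_ge0.
- apply/(measurable_restrictT _ _).1.
  by rewrite -set_itvcy; exact: measurable_itv.
 apply/measurable_EFinP; apply: measurable_funTS.
 exact: continuous_measurable_fun.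
- apply/measurable_EFinP; exact: measurable_exponential_pdf.
move=> x _; rewrite patchE; case: ifPn => [/set_mem/= x0|_].
 by rewrite exponential_pdfE// lee_fin ger0_norm// mul1r mulN1r.
by rewrite lee_fin exponential_pdf_ge0.
Qed.

Lemma integral_exp_weight m : (\int[leb m]_y (exp_weight 1 y)%:E < +oo)%E.
Proof.
elim: m => [|m IH].
 rewrite integral_lebesgue_tuple0 ?ltry//.
 by apply/measurable_EFinP; exact: measurable_exp_weight.
rewrite integral_lebesgue_tupleS; last 2 first.
- by move=> x; rewrite lee_fin expR_ge0.
- by apply/measurable_EFinP; exact: measurable_exp_weight.
under eq_integral => a _.
 under eq_integral => t _.
  rewrite (_ : exp_weight 1 (tuple_of_pair (a, t)) = expR (- `|a|) * exp_weight 1 t); last first.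
   rewrite /exp_weight big_ord_recl tnth_tuple_of_pair0 !mul1r opprD expRD.
   by under eq_bigr do rewrite tnth_tuple_of_pairS.
  rewrite EFinM.
  over.
 rewrite ge0_integralZl_EFin ?expR_ge0//; last 2 first.
 - by move=> x _; rewrite lee_fin expR_ge0.
 - by apply/measurable_EFinP; exact: measurable_exp_weight.
 over.
have I0 : (0 <= \int[leb m]_x (exp_weight 1 x)%:E)%E.
 by apply: integral_ge0 => x _; rewrite lee_fin expR_ge0.
rewrite ge0_integralZr//; last first.
 apply/measurable_EFinP; apply: measurableT_comp => //.
 by apply: measurableT_comp => //; exact: measurableT_comp.
apply: lte_mul_pinfty => //.
- by apply: integral_ge0 => x _; rewrite lee_fin expR_ge0.
- rewrite ge0_fin_numE ?integral_exp_abs//.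
 by apply: integral_ge0 => x _; rewrite lee_fin expR_ge0.
Qed.

End exponential_weight.

(** * Means and independence *)

Section expectation.
Context d (T : measurableType d) (R : realType) (P : probability T R).
Implicit Types f g : T -> R.

Definition L1 f := P.-integrable [set: T] (EFin \o f).
Definition mean f : R := fine (\int[P]_w (f w)%:E).

Lemma meanE f : L1 f -> (\int[P]_w (f w)%:E = (mean f)%:E)%E.
Proof. by move=> fi; rewrite /mean fineK//; exact: integrable_fin_num. Qed.

Lemma measurable_L1 f : L1 f -> borel f.
Proof. by move=> /measurable_int /measurable_EFinP. Qed.

Lemma L1_ge0 f : borel f -> (forall w, 0 <= f w) ->
 (\int[P]_w (f w)%:E < +oo)%E -> L1 f.
Proof.
move=> mf f0 fi; apply/integrableP; split; first exact/measurable_EFinP.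
by under eq_integral do rewrite /= ger0_norm//.
Qed.

Lemma L1_le f g : borel f ->
 (forall w, `|f w| <= g w) -> L1 g -> L1 f.
Proof.
move=> mf fg gi; apply: (le_integrable _ _ _ gi) => //.
 exact/measurable_EFinP.
by move=> w _ /=; rewrite lee_fin (le_trans (fg w))// ler_norm.
Qed.

Lemma L1_cst c : L1 (fun=> c).
Proof. exact: finite_measure_integrable_cst. Qed.

Lemma L1D f g : L1 f -> L1 g ->
 L1 (fun w => f w + g w).
Proof. by move=> fi gi; exact: (integrableD measurableT fi gi). Qed.

Lemma L1Z c f : L1 f -> L1 (fun w => c * f w).
Proof. by move=> fi; exact: (integrableZl measurableT c fi). Qed.

Lemma L1N f : L1 f -> L1 (fun w => - f w).
Proof.
by move=> fi; have := L1Z (-1) fi; under eq_fun do rewrite mulN1r.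
Qed.

Lemma L1B f g : L1 f -> L1 g ->
 L1 (fun w => f w - g w).
Proof. by move=> fi gi; exact: (integrableB measurableT fi gi). Qed.

Lemma L1_norm f : L1 f -> L1 (fun w => `|f w|).
Proof. by move=> fi; exact: integrable_norm. Qed.

Lemma L1_sum I (s : seq I) (f : I -> T -> R) :
 (forall i, L1 (f i)) -> L1 (fun w => \sum_(i <- s) f i w).
Proof.
move=> fi; elim: s => [|i s IH].
 by under eq_fun do rewrite big_nil; exact: L1_cst.
by under eq_fun do rewrite big_cons; exact: L1D.
Qed.

Lemma mean_cst c : mean (fun=> c) = c.
Proof.
have := @integral_cst _ _ _ P setT measurableT c%:E.
by rewrite /mean => ->; rewrite [X in (_ * X)%E](_ : _ = 1%E) ?mule1//; exact: probability_setT.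
Qed.

Lemma meanD f g : L1 f -> L1 g ->
 mean (fun w => f w + g w) = mean f + mean g.
Proof.
move=> fi gi; rewrite /mean.
under eq_integral do rewrite EFinD.
rewrite integralD// fineD//; exact: integrable_fin_num.
Qed.

Lemma meanZ c f : L1 f -> mean (fun w => c * f w) = c * mean f.
Proof.
move=> fi; rewrite /mean; under eq_integral do rewrite EFinM.
rewrite integralZl// fineM//; exact: integrable_fin_num.
Qed.

Lemma meanN f : L1 f -> mean (fun w => - f w) = - mean f.
Proof.
move=> fi; rewrite -mulN1r -meanZ//; congr mean; apply/funext => w.
by rewrite mulN1r.
Qed.

Lemma meanB f g : L1 f -> L1 g ->
 mean (fun w => f w - g w) = mean f - mean g.
Proof. by move=> fi gi; rewrite meanD ?meanN//; exact: L1N. Qed.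

Lemma mean_sum I (s : seq I) (f : I -> T -> R) :
 (forall i, L1 (f i)) ->
 mean (fun w => \sum_(i <- s) f i w) = \sum_(i <- s) mean (f i).
Proof.
move=> fi; elim: s => [|i s IH].
 by under eq_fun do rewrite big_nil; rewrite mean_cst big_nil.
under eq_fun do rewrite big_cons.
by rewrite meanD// ?IH ?big_cons//; exact: L1_sum.
Qed.

Lemma le_mean f g : L1 f -> L1 g ->
 (forall w, f w <= g w) -> mean f <= mean g.
Proof.
move=> fi gi fg; rewrite -lee_fin -!meanE//.
by apply: le_integral => // w _; rewrite lee_fin.
Qed.

Lemma mean_ge0 f : (forall w, 0 <= f w) -> 0 <= mean f.
Proof. by move=> f0; apply: fine_ge0; apply: integral_ge0 => w _; rewrite lee_fin. Qed.

Lemma norm_mean_le f g : L1 f -> L1 g ->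
 (forall w, `|f w| <= g w) -> `|mean f| <= mean g.
Proof.
move=> fi gi fg; rewrite ler_norml -meanN//; apply/andP; split; apply: le_mean => //.
- exact: L1N.
- by move=> w; have := fg w; rewrite ler_norml => /andP[].
- by move=> w; have := fg w; rewrite ler_norml => /andP[].
Qed.

Lemma eq_mean_ae f g : borel f -> borel g ->
 {ae P, forall w, f w = g w} -> mean f = mean g.
Proof.
move=> mf mg fg; congr fine; apply: ae_eq_integral => //;
 [exact/measurable_EFinP|exact/measurable_EFinP|].
by move: fg; apply: filterS => w /= -> _.
Qed.

Lemma mean_le_integral f (c : R) : borel f -> (forall w, 0 <= f w) ->
 (\int[P]_w (f w)%:E <= c%:E)%E -> L1 f /\ mean f <= c.
Proof.
move=> mf f0 fc; have fi : L1 f.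
 by apply: L1_ge0 => //; rewrite (le_lt_trans fc)// ltry.
by split => //; rewrite -lee_fin -meanE.
Qed.

Definition L2 f :=
 borel f /\ L1 (fun w => f w ^+ 2).

Lemma L2_le f g : borel f ->
 (forall w, `|f w| <= `|g w|) -> L2 g -> L2 f.
Proof.
move=> mf fg [mg gi]; split => //; apply: (L1_le _ _ gi).
 exact: measurable_funX.
by move=> w; rewrite normrX -(real_normK (num_real (g w))) lerXn2r.
Qed.

Lemma L2_cst c : L2 (fun=> c).
Proof. by split => //; exact: L1_cst. Qed.

Lemma L2Z c f : L2 f -> L2 (fun w => c * f w).
Proof.
move=> [mf fi]; split; first exact: measurable_funM.
by under eq_fun do rewrite exprMn; exact: L1Z.
Qed.

Lemma L2D f g : L2 f -> L2 g ->
 L2 (fun w => f w + g w).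
Proof.
move=> [mf fi] [mg gi]; split; first exact: measurable_funD.
apply: (@L1_le _ (fun w => 2 * f w ^+ 2 + 2 * g w ^+ 2)).
- by apply: measurable_funX; exact: measurable_funD.
- move=> w; rewrite ger0_norm ?sqr_ge0//.
 by have := sqr_ge0 (f w - g w); rewrite !expr2; lra.
- by apply: L1D; exact: L1Z.
Qed.

Lemma L2N f : L2 f -> L2 (fun w => - f w).
Proof.
move=> [mf fi]; split; first exact: measurable_funN.
by under eq_fun do rewrite sqrrN.
Qed.

Lemma L2B f g : L2 f -> L2 g ->
 L2 (fun w => f w - g w).
Proof. by move=> fi gi; apply: L2D => //; exact: L2N. Qed.

Lemma L2_sum I (s : seq I) (f : I -> T -> R) :
 (forall i, L2 (f i)) -> L2 (fun w => \sum_(i <- s) f i w).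
Proof.
move=> fi; elim: s => [|i s IH].
 by under eq_fun do rewrite big_nil; exact: L2_cst.
by under eq_fun do rewrite big_cons; exact: L2D.
Qed.

Lemma L2_mull (b f : T -> R) (M : R) : borel b ->
 (forall w, `|b w| <= M) -> L2 f -> L2 (fun w => b w * f w).
Proof.
move=> mb bM fi; apply: (L2_le _ _ (L2Z M fi)).
 by apply: measurable_funM => //; case: fi.
move=> w; rewrite !normrM ler_wpM2r// (le_trans (bM w))// ler_norm.
by [].
Qed.

Lemma L2_bounded (b : T -> R) (M : R) : borel b ->
 (forall w, `|b w| <= M) -> L2 b.
Proof.
move=> mb bM; apply: (L2_le _ _ (L2_cst M)) => // w.
by rewrite (le_trans (bM w))// ler_norm.
Qed.

Lemma L1M f g : L2 f -> L2 g ->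
 L1 (fun w => f w * g w).
Proof.
move=> [mf fi] [mg gi].
apply: (@L1_le _ (fun w => f w ^+ 2 + g w ^+ 2)).
- exact: measurable_funM.
- move=> w; rewrite ler_norml; apply/andP; split.
  by have := sqr_ge0 (f w + g w); have := sqr_ge0 (f w); have := sqr_ge0 (g w); rewrite !expr2; lra.
 by have := sqr_ge0 (f w - g w); have := sqr_ge0 (f w); have := sqr_ge0 (g w); rewrite !expr2; lra.
- exact: L1D.
Qed.

Lemma sq_L1 f : L2 f -> L1 f.
Proof.
move=> fi; have := L1M fi (L2_cst 1).
by under eq_fun do rewrite mulr1.
Qed.

Lemma mean_sqD_le f g : L2 f -> L2 g ->
 mean (fun w => (f w + g w) ^+ 2) <=
  2 * mean (fun w => f w ^+ 2) + 2 * mean (fun w => g w ^+ 2).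
Proof.
move=> fi gi; rewrite -!meanZ ?(fi.2) ?(gi.2)//.
rewrite -meanD; [|exact: L1Z fi.2|exact: L1Z gi.2].
apply: le_mean.
- exact: (L2D fi gi).2.
- by apply: L1D; apply: L1Z; [exact: fi.2|exact: gi.2].
- by move=> w; have := sqr_ge0 (f w - g w); rewrite !expr2; lra.
Qed.

Lemma mean_sqZ c f : L2 f ->
 mean (fun w => (c * f w) ^+ 2) = c ^+ 2 * mean (fun w => f w ^+ 2).
Proof. by move=> fi; under eq_fun do rewrite exprMn; rewrite meanZ//; case: fi. Qed.

(** The Cauchy-Schwarz inequality for finite sums, read off from the nonnegativity of the double sum
    of (f_i - f_j)^2. *)
Lemma mean_sq_sum_le n (f : 'I_n -> T -> R) (c : R) :
 (forall i, L2 (f i)) ->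
 (forall i, mean (fun w => f i w ^+ 2) <= c) ->
 mean (fun w => (\sum_(i < n) f i w) ^+ 2) <= n%:R ^+ 2 * c.
Proof.
move=> fi fc.
have e : n%:R ^+ 2 * c >= n%:R * \sum_(i < n) mean (fun w => f i w ^+ 2).
 rewrite expr2 -mulrA ler_wpM2l//.
 rewrite (_ : n%:R * c = \sum_(i < n) c); first exact: ler_sum.
 by rewrite sumr_const card_ord mulr_natl.
apply: le_trans e; rewrite -mean_sum; last by move=> i; case: (fi i).
rewrite -meanZ; last by apply: L1_sum => i; case: (fi i).
apply: le_mean.
- exact: (L2_sum (index_enum _) fi).2.
- by apply: L1Z; apply: L1_sum => i; case: (fi i).
move=> w; rewrite expr2.
have : 0 <= \sum_(i < n) \sum_(j < n) (f i w - f j w) ^+ 2.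
 by apply: sumr_ge0 => i _; apply: sumr_ge0 => j _; exact: sqr_ge0.
rewrite (_ : \sum_(i < n) _ = 2 * (n%:R * \sum_(i < n) f i w ^+ 2)
  - 2 * ((\sum_(i < n) f i w) * \sum_(i < n) f i w)); first by lra.
transitivity (\sum_(i < n) (n%:R * f i w ^+ 2 + (\sum_(j < n) f j w ^+ 2)
   - 2 * f i w * \sum_(j < n) f j w)).
 apply: eq_bigr => i _; rewrite mulr_sumr.
 rewrite -[X in X * _](_ : \sum_(j < n) 1 = n%:R); last first.
  by rewrite sumr_const card_ord.
 rewrite mulr_suml -big_split/= -sumrB; apply: eq_bigr => j _; ring.
rewrite sumrB big_split/= -mulr_sumr sumr_const card_ord -mulr_natl -mulr_suml.
rewrite -mulr_sumr; ring.
Qed.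

End expectation.

(** * Independence: from generating events to means of products *)

Section independence.
Context d (T : measurableType d) (R : realType) (P : probability T R).

Let complement_rule (x y u v : \bar R) : x \is a fin_num -> y \is a fin_num ->
 u \is a fin_num -> v \is a fin_num ->
 (y = u + v -> v = x * y -> u = (1 - x) * y)%E.
Proof.
move: x y u v => [x| |] [y| |] [u| |] [v| |] //= _ _ _ _.
rewrite -EFinD => -[yE]; rewrite -EFinM => -[vE].
by rewrite -EFinB -EFinM mulrBl mul1r -vE yE addrK.
Qed.

Definition product_rule (G H : set T) : Prop := P (G `&` H) = (P G * P H)%E.

Lemma product_rule_dynkin (F : set (set T)) (H : set T) :
 setI_closed F -> F `<=` measurable -> measurable H ->
 (forall G, F G -> product_rule G H) ->
 forall G, <<s F >> G -> product_rule G H.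
Proof.
move=> FI Fm mH FH G FG.
suff /(_ G) : <<s F >> `<=` [set A | measurable A /\ product_rule A H].
 by move=> /(_ FG) [].
rewrite -setI_closed_g_dynkin_g_sigma_algebra//.
apply: smallest_sub; last by move=> A FA; split; [exact: Fm|exact: FH].
have fin A : measurable A -> P A \is a fin_num by move=> mA; exact: fin_num_measure.
split.
- by split => //; rewrite /product_rule setTI probability_setT mul1e.
- move=> A [mA AH]; split; first exact: measurableC.
 have := measureDI P mH mA; rewrite setDE !(setIC H) => PH.
 have PA : P (~` A) = (1 - P A)%E by exact: probability_setC.
 rewrite /product_rule PA; apply: complement_rule PH AH; apply: fin => //;
  apply: measurableI => //; exact: measurableC.
- move=> A tA AH; split.
  by apply: bigcupT_measurable => i; exact: (AH i).1.
 rewrite /product_rule setI_bigcupl measure_bigcup//=; last 2 first.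
 + by move=> i _; apply: measurableI => //; exact: (AH i).1.
 + by apply: trivIset_setIr.
 rewrite measure_bigcup//=; last by move=> i _; exact: (AH i).1.
 under eq_eseriesr do rewrite (AH _).2.
 under eq_eseriesr do rewrite muleC.
 by rewrite -(fineK (fin _ mH)) nneseriesZl// muleC.
Qed.

Section joint_law.
Context d1 (E1 : measurableType d1) d2 (E2 : measurableType d2).
Variables (Y : T -> E1) (V : T -> E2).
Hypotheses (mY : borel Y) (mV : borel V).
Hypothesis YV : forall A B, measurable A -> measurable B ->
 product_rule (Y @^-1` A) (V @^-1` B).

Let phi1 (w : T) : E1 * E2 := (Y w, V w).
Let phi2 (p : T * T) : E1 * E2 := (Y p.1, V p.2).

Let mphi1 : borel phi1.
Proof. exact/measurable_fun_pair. Qed.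

Let mphi2 : measurable_fun [set: T * T] phi2.
Proof.
apply/measurable_fun_pair => /=.
- by apply: measurableT_comp => //; exact: measurable_fst.
- by apply: measurableT_comp => //; exact: measurable_snd.
Qed.

Let m1 : {measure set (E1 * E2) -> \bar R} :=
 measure_function_pushforward__canonical__measure_function_Measure P mphi1.
Let m2 : {measure set (E1 * E2) -> \bar R} :=
 measure_function_pushforward__canonical__measure_function_Measure (P \x P)%E mphi2.

Let m12 A : measurable A -> m1 A = m2 A.
Proof.
apply: (@measure_unique _ R (E1 * E2)%type
 [set A1 `*` A2 | A1 in measurable & A2 in measurable] (fun=> setT)).
- exact: measurable_prod_measurableType.
- move=> _ _ [A1 mA1 [A2 mA2 <-]] [B1 mB1 [B2 mB2 <-]].
 exists (A1 `&` B1); first exact: measurableI.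
 exists (A2 `&` B2); first exact: measurableI.
 by rewrite setXI.
- by move=> _; exists setT => //; exists setT => //; rewrite setXTT.
- by rewrite bigcup_const//; exists 0%N.
- move=> _ [A1 mA1 [A2 mA2 <-]].
 transitivity (P (Y @^-1` A1 `&` V @^-1` A2)); first by [].
 rewrite YV//.
 transitivity ((P \x P)%E ((Y @^-1` A1) `*` (V @^-1` A2))); last by [].
 rewrite product_measure1E//.
 + by rewrite -[X in measurable X]setTI; exact: mY.
 + by rewrite -[X in measurable X]setTI; exact: mV.
- move=> _; rewrite (_ : m1 setT = P setT)//.
 by rewrite [X in (X < _)%E](_ : _ = 1%E) ?ltry//; exact: probability_setT.
Qed.

(** The pair of [Y] and [V] has under [P] the same law as the pair of copies taken at two separate
    points under the product of [P] with itself, because the two laws agree on rectangles. Tonelli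
    is then applied to the product. *)
Lemma independent_tonelli (Psi : E1 * E2 -> \bar R) :
 (forall z, (0 <= Psi z)%E) -> measurable_fun [set: E1 * E2] Psi ->
 (\int[P]_w Psi (Y w, V w) = \int[P]_w \int[P]_v Psi (Y w, V v))%E.
Proof.
move=> P0 mP.
transitivity (\int[m1]_z Psi z)%E.
 rewrite [RHS](_ : _ = \int[pushforward P phi1]_z Psi z)%E; last by [].
 by rewrite ge0_integral_pushforward.
transitivity (\int[m2]_z Psi z)%E.
 by apply: eq_measure_integral => A mA _; exact: m12.
rewrite [LHS](_ : _ = \int[pushforward (P \x P)%E phi2]_z Psi z)%E; last by [].
rewrite ge0_integral_pushforward// preimage_setT.
rewrite (fubini_tonelli1 (Psi \o phi2))//.
- exact: measurableT_comp.
- by move=> x; exact: P0.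
Qed.

End joint_law.

Section independent_mean.
Variables (Y V : T -> R).
Hypotheses (iY : L1 P Y) (iV : L1 P V).
Hypothesis YV : forall A B : set R, measurable A -> measurable B ->
 product_rule (Y @^-1` A) (V @^-1` B).

Let mY := measurable_L1 iY.
Let mV := measurable_L1 iV.

Let ge0_mean (a b : R -> R) : borel a -> borel b ->
 (forall x, 0 <= a x) -> (forall x, 0 <= b x) ->
 L1 P (a \o Y) -> L1 P (b \o V) ->
 L1 P (fun w => a (Y w) * b (V w)) /\
 mean P (fun w => a (Y w) * b (V w)) = mean P (a \o Y) * mean P (b \o V).
Proof.
move=> ma mb a0 b0 ia ib.
have ab0 w : 0 <= a (Y w) * b (V w) by rewrite mulr_ge0.
have E : (\int[P]_w (a (Y w) * b (V w))%:E = (mean P (a \o Y) * mean P (b \o V))%:E)%E.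
 rewrite (independent_tonelli mY mV YV (Psi := fun z => (a z.1 * b z.2)%:E)).
 - under eq_integral => w _.
   under eq_integral do rewrite EFinM /=.
   rewrite ge0_integralZl_EFin//; last 2 first.
   + by move=> x _; rewrite lee_fin.
   + by apply/measurable_EFinP; exact: measurableT_comp.
   rewrite [X in (_ * X)%E](meanE ib).
   over.
  under eq_integral do rewrite -EFinM mulrC.
  transitivity ((mean P (fun x => mean P (b \o V) * a (Y x)))%:E).
   exact: (meanE (L1Z _ ia)).
  by rewrite (meanZ _ ia) mulrC.
 - by move=> z; rewrite lee_fin mulr_ge0.
 - apply/measurable_EFinP; apply: measurable_funM.
   by apply: measurableT_comp => //; exact: measurable_fst.
  by apply: measurableT_comp => //; exact: measurable_snd.
split; last by rewrite /mean E.
apply: L1_ge0 => //; last by rewrite E ltry.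
by apply: measurable_funM; exact: measurableT_comp.
Qed.

(** The decomposition x = (|x| + x) - |x| reduces signed variables to nonnegative Borel functions of
    them, to which [independent_tonelli] applies; the product becomes a combination of four
    nonnegative products. *)
Lemma independent_mean : L1 P (fun w => Y w * V w) /\
 mean P (fun w => Y w * V w) = mean P Y * mean P V.
Proof.
pose b (x : R) : R := `|x| + x.
pose n (x : R) : R := `|x|.
have b0 x : 0 <= b x by have := ler_norm (- x); rewrite normrN /b; lra.
have n0 x : 0 <= n x by exact: normr_ge0.
have mn : borel n by exact: measurableT_comp.
have mb : borel b by exact: measurable_funD.
have inY : L1 P (n \o Y) by exact: L1_norm.
have inV : L1 P (n \o V) by exact: L1_norm.
have ibY : L1 P (b \o Y) by exact: L1D.
have ibV : L1 P (b \o V) by exact: L1D.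
have [i1 e1] := ge0_mean mb mb b0 b0 ibY ibV.
have [i2 e2] := ge0_mean mn mb n0 b0 inY ibV.
have [i3 e3] := ge0_mean mb mn b0 n0 ibY inV.
have [i4 e4] := ge0_mean mn mn n0 n0 inY inV.
have -> : (fun w => Y w * V w) = (fun w => (b (Y w) * b (V w) - n (Y w) * b (V w))
  - (b (Y w) * n (V w) - n (Y w) * n (V w))).
 by apply/funext => w; rewrite /b /n; ring.
have iD1 := L1B i1 i2; have iD2 := L1B i3 i4.
split; first exact: L1B.
rewrite meanB// (meanB i1 i2) (meanB i3 i4) e1 e2 e3 e4.
have eY : mean P (b \o Y) = mean P (n \o Y) + mean P Y by rewrite -meanD.
have eV : mean P (b \o V) = mean P (n \o V) + mean P V by rewrite -meanD.
by rewrite eY eV; ring.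
Qed.

End independent_mean.

Lemma product_rule_tuple n (V : T -> n.-tuple R) (G : set T) : measurable G ->
 borel V ->
 (forall B : 'I_n -> set R, (forall i, measurable (B i)) ->
  product_rule G (V @^-1` [set x | forall i, B i (tnth x i)])) ->
 forall M, measurable M -> product_rule G (V @^-1` M).
Proof.
move=> mG mV rect M mM.
pose D : set (set (n.-tuple R)) :=
 [set S | exists2 B : 'I_n -> set R, (forall i, measurable (B i)) &
  S = [set x | forall i, B i (tnth x i)]].
have mrect (B : 'I_n -> set R) : (forall i, measurable (B i)) ->
  measurable ([set x : n.-tuple R | forall i, B i (tnth x i)]).
 move=> mB; rewrite (_ : mkset _ = \bigcap_(i in [set: 'I_n]) ((@tnth n R ^~ i) @^-1` B i)).
  apply: fin_bigcap_measurable => // i _.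
  by rewrite -[X in measurable X]setTI; exact: measurable_tnth.
 by apply/seteqP; split => x /= h i; [move=> _|]; exact: h.
have genD : @measurable _ (n.-tuple R) = <<s D >>.
 apply/seteqP; split; last first.
  by apply: smallest_sub; [exact: sigma_algebra_measurable|move=> _ [B mB ->]; exact: mrect].
 apply: smallest_sub; first exact: smallest_sigma_algebra.
 move=> S; rewrite -bigcup_seq => -[i _ [B mB <-]]; apply: sub_sigma_algebra.
 exists (fun j => if j == i then B else setT); first by move=> j; case: ifP.
 apply/seteqP; split => x /=.
  by move=> [_ xB] j; case: eqP => [->|].
 by move=> h; split => //; have := h i; rewrite eqxx.
have mVM S : measurable S -> measurable (V @^-1` S).
 by move=> mS; rewrite -[X in measurable X]setTI; exact: mV.
have fin A : measurable A -> P A \is a fin_num by move=> mA; exact: fin_num_measure.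
apply: (@dynkin_induction _ (n.-tuple R) D (fun S => product_rule G (V @^-1` S))) => //.
- move=> _ _ [A mA ->] [B mB ->]; exists (fun i => A i `&` B i).
  by move=> i; exact: measurableI.
 apply/seteqP; split => x /=; first by move=> [h1 h2] i; split.
 by move=> h; split => i; case: (h i).
- by rewrite /product_rule preimage_setT setIT probability_setT mule1.
- by move=> _ [B mB ->]; exact: rect.
- move=> S mS GS; rewrite /product_rule preimage_setC.
 have mVS := mVM _ mS.
 have := measureDI P mG mVS; rewrite setDE => PG.
 have PA : P (~` (V @^-1` S)) = (1 - P (V @^-1` S))%E.
  exact: probability_setC.
 rewrite /product_rule muleC in GS.
 transitivity (P (~` (V @^-1` S)) * P G)%E; last by rewrite muleC.
 rewrite PA; apply: complement_rule PG GS; apply: fin => //;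
  apply: measurableI => //; exact: measurableC.
- move=> F mF tF GF; rewrite /product_rule preimage_bigcup setI_bigcupr.
 have tVF : trivIset [set: nat] (fun i => V @^-1` F i).
  by move=> i j _ _ [x [Fi Fj]]; apply: tF => //; exists (V x).
 rewrite measure_bigcup//=; last 2 first.
 + by move=> i _; apply: measurableI => //; exact: mVM.
 + exact: trivIset_setIl.
 rewrite measure_bigcup//=; last by move=> i _; exact: mVM.
 under eq_eseriesr do rewrite GF.
 by rewrite -(fineK (fin _ mG)) nneseriesZl.
- by rewrite -genD.
Qed.

End independence.

(** * Moments of a centred Gaussian variable *)

Section gaussian.
Context d (T : measurableType d) (R : realType) (P : probability T R).
Variables (X : T -> R) (s : R).
Hypotheses (mX : borel X) (s_gt0 : 0 < s).
Hypothesis X_law : forall B : set R, measurable B -> P (X @^-1` B) = normal_prob 0 s B.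

Let lam := @lebesgue_measure R.

Lemma gaussian_integral (f : R -> \bar R) : (forall x, (0 <= f x)%E) ->
 borel f ->
 (\int[P]_w f (X w) = \int[lam]_x (f x * (normal_pdf 0 s x)%:E))%E.
Proof.
move=> f0 mf.
pose n0 := fun x => @normal_pdf_ge0 R 0 s x.
have mn : measurable_fun [set: measurableTypeR R] (normal_pdf 0 s) := @measurable_normal_pdf R 0 s.
rewrite -(integral_weighted lam n0 mn f0 mf).
transitivity (\int[pushforward P (X : T -> measurableTypeR R)]_x f x)%E.
 by rewrite ge0_integral_pushforward.
apply: eq_measure_integral => A mA _.
exact: X_law.
Qed.

Lemma gaussian_mgf (l : R) :
 (\int[P]_w (expR (l * X w))%:E = (expR (l ^+ 2 * s ^+ 2 / 2))%:E)%E.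
Proof.
rewrite (gaussian_integral (f := fun x => (expR (l * x))%:E)); last 2 first.
- by move=> x; rewrite lee_fin expR_ge0.
- by apply/measurable_EFinP; apply: measurableT_comp => //; exact: measurable_funM.
have s0 : s != 0 by rewrite gt_eqF.
transitivity (\int[lam]_x ((expR (l ^+ 2 * s ^+ 2 / 2))%:E *
  (normal_pdf (l * s ^+ 2) s x)%:E))%E.
 apply: eq_integral => x _; rewrite -!EFinM !normal_pdfE//; congr EFin.
 rewrite mulrCA [RHS]mulrCA; congr (_ * _).
 rewrite /normal_fun -!expRD; congr expR.
 by field; rewrite s0.
rewrite ge0_integralZl_EFin ?expR_ge0//.
- by rewrite integral_normal_pdf// mule1.
- by move=> x _; rewrite lee_fin normal_pdf_ge0.
- by apply/measurable_EFinP; exact: measurable_normal_pdf.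
Qed.

Let mexp (l : R) : borel (fun w => expR (l * X w)).
Proof. by apply: measurableT_comp => //; exact: measurable_funM. Qed.

Lemma gaussian_mgf_mean (l : R) : L1 P (fun w => expR (l * X w)) /\
 mean P (fun w => expR (l * X w)) = expR (l ^+ 2 * s ^+ 2 / 2).
Proof.
split; last by rewrite /mean gaussian_mgf.
by apply: L1_ge0 => //; rewrite gaussian_mgf ltry.
Qed.

Lemma gaussian_exp_abs (l : R) : L1 P (fun w => expR (l * `|X w|)) /\
 mean P (fun w => expR (l * `|X w|)) <= 2 * expR (l ^+ 2 * s ^+ 2 / 2).
Proof.
have [i1 e1] := gaussian_mgf_mean l; have [i2 e2] := gaussian_mgf_mean (- l).
have mf : borel (fun w => expR (l * `|X w|)).
 apply: measurableT_comp => //; apply: measurable_funM => //.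
 exact: measurableT_comp.
have le w : expR (l * `|X w|) <= expR (l * X w) + expR (- l * X w).
 have [x0|x0] := ger0P (X w); first by rewrite lerDl expR_ge0.
 by rewrite mulrN mulNr lerDr expR_ge0.
have i : L1 P (fun w => expR (l * `|X w|)).
 apply: (L1_le mf _ (L1D i1 i2)) => w.
 by rewrite ger0_norm ?expR_ge0.
split => //; have := le_mean i (L1D i1 i2) le.
by rewrite meanD// e1 e2 sqrrN; lra.
Qed.

Lemma expR_ge_pow k (y : R) : 0 <= y -> y ^+ k <= k`!%:R * expR y.
Proof.
move=> y0; case: k => [|k]; first by rewrite expr0 fact0 mul1r; have := expR_ge1Dx y; lra.
have := expR_ge1Dxn k y0; rewrite [y ^+ _ / _]mulrC => h.
by rewrite -ler_pdivrMl//; lra.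
Qed.

(** From y^k <= k! exp(y) at y = |X| / s the moment is bounded by the exponential moment of |X| at
    the rate 1 / s + c, whose exponent (1 + c s)^2 / 2 is at most (1 + c)^2 / 2 when s <= 1. *)
Definition gaussian_const (k : nat) (c : R) : R :=
 k`!%:R * (2 * expR ((1 + c) ^+ 2 / 2)).

Lemma gaussian_abs_moment k (c : R) : 0 <= c -> s <= 1 ->
 L1 P (fun w => `|X w| ^+ k * expR (c * `|X w|)) /\
 mean P (fun w => `|X w| ^+ k * expR (c * `|X w|)) <= gaussian_const k c * s ^+ k.
Proof.
move=> c0 s1.
have [i e] := gaussian_exp_abs (s^-1 + c).
have mf : borel (fun w => `|X w| ^+ k * expR (c * `|X w|)).
 have mn : borel (fun w => `|X w|) by exact: measurableT_comp.
 apply: measurable_funM; first exact: measurable_funX.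
 by apply: measurableT_comp => //; exact: measurable_funM.
have le w : `|X w| ^+ k * expR (c * `|X w|) <=
  (k`!%:R * s ^+ k) * expR ((s^-1 + c) * `|X w|).
 have y0 : 0 <= `|X w| / s by rewrite divr_ge0// ltW.
 have := expR_ge_pow k y0.
 rewrite expr_div_n ler_pdivrMr ?exprn_gt0// => h.
 rewrite mulrDl expRD (mulrC s^-1) mulrA ler_wpM2r ?expR_ge0//.
 by rewrite (le_trans h)// mulrAC.
have i' := L1Z (k`!%:R * s ^+ k) i.
have ii : L1 P (fun w => `|X w| ^+ k * expR (c * `|X w|)).
 apply: (L1_le mf _ i') => w.
 by rewrite ger0_norm ?mulr_ge0 ?exprn_ge0 ?expR_ge0.
split => //; have := le_mean ii i' le; rewrite meanZ// => h; apply: (le_trans h).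
rewrite /gaussian_const mulrAC; apply: ler_wpM2r; first by rewrite exprn_ge0// ltW.
apply: ler_wpM2l => //; apply: (le_trans e); apply: ler_wpM2l => //.
rewrite ler_expR ler_pM2r// -exprMn mulrDl mulVf ?gt_eqF//.
have s0 := ltW s_gt0; have cs0 : 0 <= c * s by exact: mulr_ge0.
rewrite lerXn2r ?nnegrE ?addr_ge0//.
by rewrite lerD2l ler_piMr.
Qed.

Let expR_taylor3 (a : R) : `|expR a - 1 - a - a ^+ 2 / 2| <= `|a| ^+ 3 * expR `|a|.
Proof.
have d0 (u : R) : is_derive u 1 (fun s : R => expR (a * s)) (a * expR (a * u)).
 rewrite (_ : (fun s : R => expR (a * s)) = expR \o (fun s => a * s))//.
 by apply: is_derive_eq; rewrite /GRing.scale/=; ring.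
have d1 (u : R) : is_derive u 1 (fun s : R => a * expR (a * s)) (a ^+ 2 * expR (a * u)).
 rewrite (_ : (fun s : R => _) = (fun s => a *: (fun s : R => expR (a * s)) s))//.
 by apply: is_derive_eq; rewrite /GRing.scale/=; ring.
have d2 (u : R) : is_derive u 1 (fun s : R => a ^+ 2 * expR (a * s)) (a ^+ 3 * expR (a * u)).
 rewrite (_ : (fun s : R => _) = (fun s => a ^+ 2 *: (fun s : R => expR (a * s)) s))//.
 by apply: is_derive_eq; rewrite /GRing.scale/=; ring.
have := taylor3_01 (M := `|a| ^+ 3 * expR `|a|) d0 d1 d2.
rewrite mulr1 mulr0 expR0 !mulr1; apply => u /andP[u0 u1].
rewrite normrM normrX ler_wpM2l ?exprn_ge0// ger0_norm ?expR_ge0// ler_expR.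
apply: (le_trans (ler_norm _)); rewrite normrM (ger0_norm u0).
exact: ler_piMr.
Qed.

Lemma gaussian_sq : L2 P X.
Proof.
split => //; have [i _] := gaussian_exp_abs 1.
apply: (L1_le _ _ (L1Z 2 i)); first exact: measurable_funX.
move=> w; rewrite normrX; have := @expR_ge_pow 2 `|X w| (normr_ge0 _).
by rewrite mul1r.
Qed.

(** The mean of exp(l X) is expanded twice to second order, through the Taylor formula in X and
    through its exact value. The difference of the two quadratic polynomials in [l] is of third
    order. *)
Let gaussian_quad : exists2 K : R, 0 <= K & forall l, `|l| <= 1 ->
 `|l * mean P X + l ^+ 2 * (mean P (fun w => X w ^+ 2) - s ^+ 2) / 2| <= K * `|l| ^+ 3.
Proof.
have [i3 e3] := gaussian_exp_abs 2.
pose E := mean P (fun w => expR (2 * `|X w|)).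
have E0 : 0 <= E by apply: mean_ge0 => w; exact: expR_ge0.
pose K2 := (s ^+ 2 / 2) ^+ 2 * expR (s ^+ 2 / 2) * 2.
exists (6 * E + K2 * 2).
 have K2_ge0 : 0 <= K2 by rewrite /K2 mulr_ge0// mulr_ge0 ?sqr_ge0 ?expR_ge0.
 by lra.
move=> l l1.
have [im em] := gaussian_mgf_mean l.
have iX := sq_L1 gaussian_sq; have iX2 := gaussian_sq.2.
have := norm_mean_le (P := P) (f := fun w => expR (l * X w) - (1 + (l * X w + l ^+ 2 / 2 * X w ^+ 2)))
 (g := fun w => (6 * `|l| ^+ 3) * expR (2 * `|X w|)).
rewrite meanB//; last first.
 by apply: L1D; [exact: L1_cst|apply: L1D; exact: L1Z].
rewrite meanD; [|exact: L1_cst|by apply: L1D; exact: L1Z].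
rewrite meanD; [|exact: L1Z|exact: L1Z].
rewrite !meanZ// mean_cst em => H.
have {}H : `|expR (l ^+ 2 * s ^+ 2 / 2) -
  (1 + (l * mean P X + l ^+ 2 / 2 * mean P (fun w => X w ^+ 2)))| <= 6 * `|l| ^+ 3 * E.
 apply: H.
 - apply: L1B => //.
  by apply: L1D; [exact: L1_cst|apply: L1D; exact: L1Z].
 - exact: L1Z.
 move=> w; have := expR_taylor3 (l * X w).
 rewrite (_ : expR _ - 1 - _ - _ = expR (l * X w) - (1 + (l * X w + l ^+ 2 / 2 * X w ^+ 2))); last first.
  by rewrite exprMn; ring.
 move=> h; apply: (le_trans h); rewrite normrM exprMn.
 have -> : 2 * `|X w| = `|X w| + `|X w| by ring.
 have h6 := @expR_ge_pow 3 `|X w| (normr_ge0 _).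
 have he : expR (`|l| * `|X w|) <= expR `|X w| by rewrite ler_expR ler_piMl.
 have := ler_pM (exprn_ge0 3 (normr_ge0 (X w))) (expR_ge0 _) h6 he.
 rewrite expRD; move: (exprn_ge0 3 (normr_ge0 l)).
 move: (`|l| ^+ 3) (`|X w| ^+ 3) (expR _) (expR _) => x y u v x0 yuv.
 rewrite (_ : 6 * x * (u * u) = x * (3`!%:R * u * u)); last first.
  by rewrite (_ : 3`! = 6%N)//; ring.
 by rewrite -[x * y * v]mulrA; exact: ler_wpM2l.
have H2 : `|expR (l ^+ 2 * s ^+ 2 / 2) - 1 - l ^+ 2 * s ^+ 2 / 2| <= K2 * 2 * `|l| ^+ 3.
 set b := l ^+ 2 * s ^+ 2 / 2.
 have l2 : l ^+ 2 <= 1 by rewrite -(real_normK (num_real l)) expr_le1.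
 have b0 : 0 <= b by rewrite /b; apply: divr_ge0 => //; apply: mulr_ge0; exact: sqr_ge0.
 have bs : b <= s ^+ 2 / 2 by rewrite /b ler_pM2r// ler_piMl ?sqr_ge0.
 have d0 (u : R) : is_derive u 1 (fun s : R => expR (b * s)) (b * expR (b * u)).
  rewrite (_ : (fun s : R => expR (b * s)) = expR \o (fun s => b * s))//.
  by apply: is_derive_eq; rewrite /GRing.scale/=; ring.
 have d1 (u : R) : is_derive u 1 (fun s : R => b * expR (b * s)) (b ^+ 2 * expR (b * u)).
  rewrite (_ : (fun s : R => _) = (fun s => b *: (fun s : R => expR (b * s)) s))//.
  by apply: is_derive_eq; rewrite /GRing.scale/=; ring.
 have := @taylor2_01 _ _ _ _ (b ^+ 2 * expR b) d0 d1 _ 1.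
 rewrite mulr1 mulr0 expR0 mulr1 mul1r => h.
 apply: (le_trans (h _ _)).
 - move=> u /andP[u0 u1]; rewrite normrM ger0_norm ?sqr_ge0// ler_wpM2l ?sqr_ge0//.
  by rewrite ger0_norm ?expR_ge0// ler_expR ler_piMr.
 - by rewrite lexx ler01.
 have l4 : b ^+ 2 <= (s ^+ 2 / 2) ^+ 2 * `|l| ^+ 3.
  rewrite /b -(real_normK (num_real l)) -mulrA exprMn mulrC ler_wpM2l ?sqr_ge0//.
  rewrite -exprM (_ : (2 * 2 = 3 + 1)%N)// exprD expr1 ler_piMr ?exprn_ge0//.
 have eb : expR b <= expR (s ^+ 2 / 2) by rewrite ler_expR.
 apply: (@le_trans _ _ ((s ^+ 2 / 2) ^+ 2 * `|l| ^+ 3 * expR (s ^+ 2 / 2))).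
  by rewrite ler_pM ?sqr_ge0 ?expR_ge0.
 rewrite /K2; have : 0 <= (s ^+ 2 / 2) ^+ 2 * `|l| ^+ 3 * expR (s ^+ 2 / 2).
  by apply: mulr_ge0 (expR_ge0 _); apply: mulr_ge0; [exact: sqr_ge0|exact: exprn_ge0].
 by lra.
move: H H2; rewrite !ler_norml => /andP[h1 h2] /andP[h3 h4]; apply/andP; split; lra.
Qed.

(** A quadratic polynomial in [l] without constant term that is of third order at 0 vanishes: the
    bounds at l and at -l are added to isolate the variance and subtracted to isolate the mean. *)
Lemma gaussian_mean_var : mean P X = 0 /\ mean P (fun w => X w ^+ 2) = s ^+ 2.
Proof.
have [K K0 H] := gaussian_quad.
set m := mean P X in H *; set v := mean P _ - s ^+ 2 in H.
have h l : 0 < l -> l <= 1 -> `|m| <= K * l ^+ 2 /\ `|v| <= 2 * K * l.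
 move=> l0 l1; have l3 : 0 < l ^+ 3 by rewrite exprn_gt0.
 have := H l; have := H (- l); rewrite normrN sqrrN (gtr0_norm l0) => /(_ l1) + /(_ l1).
 rewrite !ler_norml => /andP[h1 h2] /andP[h3 h4].
 have e1 : l * (K * l ^+ 2) = K * l ^+ 3 by ring.
 have e2 : l * (l * (2 * K * l)) = 2 * (K * l ^+ 3) by ring.
 have e3 : l * (l * v) = l ^+ 2 * v by ring.
 split; apply/andP; split; rewrite -(ler_pM2l l0) ?mulrN.
 - by rewrite e1; lra.
 - by rewrite e1; lra.
 - by rewrite -(ler_pM2l l0) mulrN e2 e3; lra.
 - by rewrite -(ler_pM2l l0) e2 e3; lra.
have small (a : R) : (forall l, 0 < l -> l <= 1 -> `|a| <= 2 * K * l) -> a = 0.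
 move=> ha; apply/eqP; rewrite -normr_eq0 eq_le normr_ge0 andbT leNgt; apply/negP => a0.
 have K1 : 0 < 2 * K + `|a| by rewrite ltr_wpDl ?mulr_ge0.
 pose l := `|a| / (2 * (2 * K + `|a|)).
 have l0 : 0 < l by rewrite divr_gt0// mulr_gt0.
 have l1 : l <= 1 by rewrite ler_pdivrMr ?mulr_gt0// mul1r; have := mulr_ge0 (ler0n R 2) K0; lra.
 have := ha l l0 l1; rewrite /l mulrA ler_pdivlMr ?mulr_gt0// => ha'.
 have := mulr_gt0 a0 K1; have := mulr_gt0 a0 a0; have := mulr_ge0 (ltW a0) K0; lra.
split.
 apply: small => l l0 l1; apply: (le_trans (h l l0 l1).1).
 rewrite expr2 -mulrA; have : K * (l * l) <= K * l by rewrite ler_wpM2l// ler_piMl// ltW.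
 by have := mulr_ge0 K0 (ltW l0); lra.
by apply/eqP; rewrite -subr_eq0; apply/eqP/small => l l0 l1; exact: (h l l0 l1).2.
Qed.

End gaussian.

Section continuity_sequence.
Variable R : realType.

Lemma within_continuous_seq (f : R -> R) (x_ : nat -> R) (x : R) :
 {within `[0, +oo[, continuous f} -> (forall k, 0 <= x_ k) -> 0 <= x ->
 x_ @ \oo --> x -> f (x_ k) @[k --> \oo] --> f x.
Proof.
move=> /subspace_continuousP cf x_0 x0 xx.
have xI : `[0, +oo[%classic x by rewrite /= in_itv/= x0.
apply: (@cvg_comp _ _ _ x_ f _ (within `[0, +oo[%classic (nbhs x))); last exact: cf.
move=> A wA; have [N _ H] := xx _ wA; exists N => // k Nk; apply: H => //.
by rewrite /= in_itv/= x_0.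
Qed.

End continuity_sequence.

Section ae_probability.
Context d (T : measurableType d) (R : realType) (P : probability T R).

Lemma eq_probability_ae (A B : set T) : measurable A -> measurable B ->
 {ae P, forall w, A w <-> B w} -> P A = P B.
Proof.
move=> mA mB AB.
have e (C : set T) : measurable C -> P C = (\int[P]_x (\1_C x)%:E)%E.
 by move=> mC; rewrite integral_indic// setIT.
rewrite (e A mA) (e B mB); apply: ae_eq_integral => //.
- by apply/measurable_EFinP; exact: measurable_indic.
- by apply/measurable_EFinP; exact: measurable_indic.
apply: filterS AB => w AB _ /=; congr ((nat_of_bool _)%:R%:E).
by apply/idP/idP => /set_mem wA; apply/mem_set/AB.
Qed.

End ae_probability.

(** * Brownian increments *)

Section brownian.
Context d (T : measurableType d) (R : realType) (P : probability T R).
Variables (n : nat) (W : 'I_n -> R -> T -> R).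
Hypothesis hW : standard_brownian_motion P W.

Definition filtration_generator (t : R) : set (set T) :=
 [set A | measurable A /\ P A = 0%E] `|`
 [set A | exists i s (B : set R),
   [/\ 0 <= s, s <= t, measurable B & A = W i s @^-1` B]].

Let F := brownian_filtration P W.

Lemma measurable_brownian_preimage i t (B : set R) : 0 <= t -> measurable B ->
 measurable (W i t @^-1` B).
Proof.
move=> t0 mB; rewrite -[X in measurable X]setTI.
exact: (bm_measurable hW i t0).
Qed.

Lemma filtration_generator_measurable t : filtration_generator t `<=` measurable.
Proof.
move=> A [[]//|[i [s [B [s0 _ mB ->]]]]]; exact: measurable_brownian_preimage.
Qed.

Lemma filtration_measurable t : F t `<=` measurable.
Proof.
apply: smallest_sub; first exact: sigma_algebra_measurable.
exact: filtration_generator_measurable.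
Qed.

Lemma filtration_le s t : s <= t -> F s `<=` F t.
Proof.
move=> st; apply: sub_sigma_algebra2 => A [Anull|[i [r [B [r0 rs mB AE]]]]]; [by left|right].
by exists i, r, B; split => //; exact: le_trans st.
Qed.

Lemma filtration_brownian i s t (B : set R) : 0 <= s -> s <= t -> measurable B ->
 F t (W i s @^-1` B).
Proof. by move=> s0 st mB; apply: sub_sigma_algebra; right; exists i, s, B. Qed.

Definition increment (u v : R) (w : T) : n.-tuple R := [tuple W i v w - W i u w | i < n].

Lemma measurable_increment u v : 0 <= u -> 0 <= v -> borel (increment u v).
Proof.
move=> u0 v0; apply: measurable_fun_tuple => i.
by apply: measurable_funB; exact: (bm_measurable hW).
Qed.

Section past.
Variables (u v : R) (N : nat).
Hypotheses (u0 : 0 < u) (uv : u < v) (N0 : (0 < N)%N).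

(** The times 0 to [N] are the uniform grid of the interval from 0 to u, and time N + 1 is v. The
    unit steps afterwards only continue the sequence, since [bm_independent] speaks of infinite
    increasing sequences. *)
Let tau (k : nat) : R :=
 if (k <= N)%N then u * k%:R / N%:R else v + (k - N.+1)%:R.

Let NR : 0 < N%:R :> R. Proof. by rewrite ltr0n. Qed.

Let tauN : tau N = u. Proof. by rewrite /tau leqnn mulfK// gt_eqF. Qed.

Let tau_incr k : tau k < tau k.+1.
Proof.
rewrite /tau; case: (ltngtP k N) => [kN|Nk|->].
- by rewrite ltr_pM2r ?invr_gt0// ltr_pM2l// ltr_nat.
- by rewrite ltrD2l ltr_nat subSS subnS ltn_predL subn_gt0.
- by rewrite subnn addr0 mulfK// gt_eqF.
Qed.

Let tau_ge0 k : 0 <= tau k.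
Proof.
rewrite /tau; case: ifP => _; first by rewrite divr_ge0// mulr_ge0// ltW.
by rewrite addr_ge0// ltW// (lt_trans u0).
Qed.

Let inc (ik : 'I_n * 'I_N.+1) (w : T) : R := W ik.1 (tau ik.2.+1) w - W ik.1 (tau ik.2) w.

Let minc ik : borel (inc ik).
Proof. by apply: measurable_funB; exact: (bm_measurable hW). Qed.

(** Boxes in the initial values and in the increments before [u]; the inequality with [ord_max]
    leaves out the last increment, the one from [u] to [v]. The initial values are part of the data
    because W(0) = 0 holds only almost surely. *)
Let Pi : set (set T) := [set G | exists (A : 'I_n -> set R) (B : 'I_n * 'I_N.+1 -> set R),
 [/\ forall i, measurable (A i), forall ik, measurable (B ik) &
  G = [set w | (forall i, A i (W i 0 w)) /\
    (forall ik, ik.2 != ord_max -> B ik (inc ik w))]]].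

Let mA0 (A : 'I_n -> set R) : (forall i, measurable (A i)) ->
 measurable [set w | forall i, A i (W i 0 w)].
Proof.
move=> mA; rewrite (_ : mkset _ = \bigcap_(i in [set: 'I_n]) (W i 0 @^-1` A i)).
 apply: fin_bigcap_measurable => // i _; exact: measurable_brownian_preimage.
by apply/seteqP; split => w /= h i; [move=> _|]; exact: h.
Qed.

Let minc_set (B : 'I_n * 'I_N.+1 -> set R) (Q : pred ('I_n * 'I_N.+1)) :
 (forall ik, measurable (B ik)) ->
 measurable [set w | forall ik, Q ik -> B ik (inc ik w)].
Proof.
move=> mB; rewrite (_ : mkset _ = \bigcap_(ik in [set ik | Q ik]) (inc ik @^-1` B ik)).
 apply: fin_bigcap_measurable => [|ik _]; first exact: finite_finset.
 by rewrite -[X in measurable X]setTI; exact: minc.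
by apply/seteqP; split => w /= h ik; exact: h.
Qed.

Let Pi_measurable : Pi `<=` measurable.
Proof.
move=> _ [A [B [mA mB ->]]]; apply: measurableI; first exact: mA0.
exact: (minc_set (fun ik => ik.2 != ord_max)).
Qed.

Let PiI : setI_closed Pi.
Proof.
move=> _ _ [A [B [mA mB ->]]] [A' [B' [mA' mB' ->]]].
exists (fun i => A i `&` A' i), (fun ik => B ik `&` B' ik); split.
- by move=> i; exact: measurableI.
- by move=> i; exact: measurableI.
apply/seteqP; split=> w /=.
 by move=> [[h1 h2] [h3 h4]]; split=> [i|ik ikN]; split => //; [exact: h2|exact: h4].
move=> [h1 h2]; split; split=> [i|ik ikN].
- by case: (h1 i).
- by case: (h2 ik ikN).
- by case: (h1 i).
- by case: (h2 ik ikN).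
Qed.

Let prod_inc (B : 'I_n * 'I_N.+1 -> set R) (Q : pred ('I_n * 'I_N.+1)) :
 (forall ik, measurable (B ik)) ->
 P [set w | forall ik, Q ik -> B ik (inc ik w)] = (\prod_(ik | Q ik) P (inc ik @^-1` B ik))%E.
Proof.
move=> mB; have := @bm_independent _ _ _ _ _ _ hW tau N.+1 (tau_ge0 0) tau_incr.
move=> /(_ [set ik | Q ik]%SET B mB) => H.
rewrite (_ : (\prod_(ik | Q ik) _ = \prod_(ik in [set ik | Q ik]%SET) P (inc ik @^-1` B ik))%E); last first.
 by apply: eq_bigl => ik; rewrite inE.
rewrite -[RHS]H; congr (P _); apply/seteqP; split => w /= h ik.
 by move=> /=; rewrite inE => Qik; exact: h.
by move=> Qik; apply: h => /=; rewrite inE.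
Qed.

Let Pi_rule G (C : 'I_n -> set R) : Pi G -> (forall i, measurable (C i)) ->
 product_rule P G (increment u v @^-1` [set x | forall i, C i (tnth x i)]).
Proof.
move=> [A [B [mA mB ->]]] mC.
set H := _ @^-1` _.
pose E := [set w | forall ik : 'I_n * 'I_N.+1, ik.2 != ord_max -> B ik (inc ik w)].
have mE : measurable E := minc_set (fun ik => ik.2 != ord_max) mB.
pose B' (ik : 'I_n * 'I_N.+1) := if ik.2 == ord_max then C ik.1 else B ik.
have mB' ik : measurable (B' ik) by rewrite /B'; case: ifP.
have HE : H = [set w | forall ik : 'I_n * 'I_N.+1, ik.2 == ord_max -> B' ik (inc ik w)].
 have lst i w : inc (i, ord_max) w = W i v w - W i u w.
  by rewrite /inc /= tauN /tau ltnn subnn addr0.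
 apply/seteqP; split => w /=.
  move=> h [i k] /= /eqP ->; rewrite /B' /= eqxx lst.
  by have := h i; rewrite tnth_mktuple.
 move=> h i; rewrite tnth_mktuple -lst.
 by have := h (i, ord_max); rewrite /B' /= eqxx => /(_ isT).
have EE : E = [set w | forall ik : 'I_n * 'I_N.+1, ik.2 != ord_max -> B' ik (inc ik w)].
 by apply/seteqP; split => w /= h ik ikN; have := h ik ikN; rewrite /B' (negbTE ikN).
have mH : measurable H by rewrite HE; exact: (minc_set (fun ik => ik.2 == ord_max)).
have EH : product_rule P E H.
 rewrite /product_rule.
 have -> : E `&` H = [set w | forall ik : 'I_n * 'I_N.+1, xpredT ik -> B' ik (inc ik w)].
  rewrite EE HE; apply/seteqP; split => w /=.
   move=> [h1 h2] ik _; have [e|e] := boolP (ik.2 == ord_max); first exact: h2.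
   exact: h1.
  by move=> h; split => ik _; exact: h.
 rewrite EE HE !prod_inc// (bigID (fun ik : 'I_n * 'I_N.+1 => ik.2 != ord_max))/=.
 by congr (_ * _)%E; apply: eq_bigl => ik; rewrite negbK.
have mG : measurable [set w | (forall i, A i (W i 0 w)) /\
  (forall ik : 'I_n * 'I_N.+1, ik.2 != ord_max -> B ik (inc ik w))].
 by apply: measurableI => //; exact: mA0.
have ae0 : {ae P, forall w, forall i, W i 0 w = 0}.
 by apply: filter_forall => i; exact: (bm_start hW).
rewrite /product_rule.
(* Since W(0) = 0 almost surely, the constraint on the initial values either holds almost surely and
   may be dropped, or makes the event null; independence of the increments alone says nothing about
   W(0). *)
have [A0|/existsNP[i Ai]] := pselect (forall i, A i 0).
 have -> : P [set w | (forall i, A i (W i 0 w)) /\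
   (forall ik : 'I_n * 'I_N.+1, ik.2 != ord_max -> B ik (inc ik w))] = P E.
  apply: eq_probability_ae => //.
  by apply: filterS ae0 => w w0 /=; split=> [[]//|h]; split => // j; rewrite w0.
 rewrite -EH; apply: eq_probability_ae; [exact: measurableI|exact: measurableI|].
 by apply: filterS ae0 => w w0 /=; split=> [[[]//]|[h1 h2]]; split => //; split => // j; rewrite w0.
rewrite (@eq_probability_ae _ _ _ P _ set0)//.
- rewrite measure0 (@eq_probability_ae _ _ _ P _ set0)//.
  by rewrite measure0 mul0e.
 apply: filterS ae0 => w w0 /=; split => // -[h _].
 by apply: Ai; rewrite -(w0 i).
- exact: measurableI.
apply: filterS ae0 => w w0 /=; split => // -[[h _] _].
by apply: Ai; rewrite -(w0 i).
Qed.

Definition grid_generator : set (set T) :=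
 [set A | exists i k (B : set R), [/\ (k <= N)%N, measurable B & A = W i (u * k%:R / N%:R) @^-1` B]].

(** The value on the grid is the initial value plus the increments up to that time. *)
Let grid_measurable_Pi i k : (k <= N)%N ->
 measurable_fun [set: g_sigma_algebraType Pi] (W i (u * k%:R / N%:R)).
Proof.
elim: k => [_|k IH kN].
 rewrite mulr0 mul0r => _ B mB; rewrite setTI; apply: sub_sigma_algebra.
 exists (fun j => if j == i then B else setT), (fun=> setT); split => //.
  by move=> j; case: ifP.
 apply/seteqP; split => w /=.
  by move=> Bw; split => // j; case: eqP => [->|].
 by move=> [h _]; have := h i; rewrite eqxx.
have kk : tau k.+1 = u * k.+1%:R / N%:R by rewrite /tau kN.
have kk' : tau k = u * k%:R / N%:R by rewrite /tau (ltnW kN).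
have kN' : (k < N.+1)%N by rewrite ltnS ltnW.
pose ik : 'I_n * 'I_N.+1 := (i, Ordinal kN').
rewrite (_ : W i _ = (fun w => W i (u * k%:R / N%:R) w + inc ik w)); last first.
 by apply/funext => w; rewrite /inc /= kk kk' addrC subrK.
apply: measurable_funD; first by apply: IH; exact: ltnW.
move=> _ B mB; rewrite setTI; apply: sub_sigma_algebra.
exists (fun=> setT), (fun jk => if jk == ik then B else setT); split => //.
 by move=> j; case: ifP.
apply/seteqP; split => w /=.
 by move=> Bw; split => // j _; case: eqP => [->|].
move=> [_ h]; have := h ik; rewrite eqxx; apply.
by rewrite /ik /= -val_eqE /= neq_ltn kN.
Qed.

Lemma grid_rule G M : <<s grid_generator >> G -> measurable M ->
 product_rule P G (increment u v @^-1` M).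
Proof.
move=> gG mM.
have v0 : 0 < v by exact: lt_trans uv.
have mH : measurable (increment u v @^-1` M).
 by rewrite -[X in measurable X]setTI; apply: measurable_increment => //; exact: ltW.
have GPi : <<s Pi >> G.
 apply: (smallest_sub _ _ gG); first exact: smallest_sigma_algebra.
 move=> _ [i [k [B [kN mB ->]]]].
 by have := grid_measurable_Pi i kN measurableT mB; rewrite setTI.
apply: (product_rule_dynkin PiI Pi_measurable mH _ GPi) => G' PiG'.
apply: product_rule_tuple => //.
- exact: Pi_measurable.
- by apply: measurable_increment => //; exact: ltW.
- by move=> B mB; exact: Pi_rule.
Qed.

End past.

Lemma grid_generator_double u (K : nat) :
 grid_generator u (2 ^ K) `<=` grid_generator u (2 ^ K.+1).
Proof.
move=> _ [i [k [B [kK mB ->]]]]; exists i, (2 * k)%N, B; split => //.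
 by rewrite expnS leq_mul2l kK.
suff -> : u * (2 * k)%:R / (2 ^ K.+1)%:R = u * k%:R / (2 ^ K)%:R by [].
by rewrite expnS !natrM; field.
Qed.

Lemma grid_generator_le u (K L : nat) : (K <= L)%N ->
 grid_generator u (2 ^ K) `<=` grid_generator u (2 ^ L).
Proof.
move=> /subnK <-; elim: (L - K)%N => [//|j IH].
by apply: (subset_trans IH); rewrite addSn; exact: grid_generator_double.
Qed.

Lemma grid_generator_measurable u N : 0 <= u -> grid_generator u N `<=` measurable.
Proof.
move=> u0 _ [i [k [B [kK mB ->]]]]; apply: measurable_brownian_preimage => //.
by rewrite divr_ge0// mulr_ge0.
Qed.

Let null : set (set T) := [set A | measurable A /\ P A = 0%E].

(** Null events together with the events that depend on [W] on one dyadic grid. Dyadic grids are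
    nested, so two such events live on a common finer grid and the family is closed under
    intersection, as Dynkin's theorem requires. *)
Let trace u : set (set T) := null `|` \bigcup_K <<s grid_generator u (2 ^ K) >>.

Let trace_measurable u : 0 <= u -> trace u `<=` measurable.
Proof.
move=> u0 A [[]//|[K _]]; apply: smallest_sub; first exact: sigma_algebra_measurable.
exact: grid_generator_measurable.
Qed.

Let traceI u : 0 <= u -> setI_closed (trace u).
Proof.
move=> u0 A B tA tB; have mA := trace_measurable u0 tA; have mB := trace_measurable u0 tB.
case: tA => [[_ A0]|[K _ AK]].
 left; split; first exact: measurableI.
 by apply/eqP; rewrite eq_le measure_ge0 andbT -A0 le_measure ?inE//; exact: measurableI.
case: tB => [[_ B0]|[L _ BL]].
 left; split; first exact: measurableI.
 by apply/eqP; rewrite eq_le measure_ge0 andbT -B0 le_measure ?inE//; exact: measurableI.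
right; exists (maxn K L) => //.
have AM := sub_sigma_algebra2 (grid_generator_le (leq_maxl K L)) AK.
have BM := sub_sigma_algebra2 (grid_generator_le (leq_maxr K L)) BL.
rewrite -(setCK (A `&` B)) setCI.
rewrite -setTD; apply: sigma_algebraCD; rewrite -bigcup2E.
apply: sigma_algebra_bigcup => -[|[|k]] /=; rewrite -?setTD.
- exact: sigma_algebraCD.
- exact: sigma_algebraCD.
- exact: sigma_algebra0.
Qed.

(** The dyadic points [sK K], the largest multiples of u / 2^K not exceeding s, increase the
    precision with K and converge to s from below; W(s) is the limit of measurable variables by
    continuity of the paths. *)
Let generator_trace u : 0 < u -> filtration_generator u `<=` <<s trace u >>.
Proof.
move=> u0 A [An|[i [s [B [s0 su mB ->]]]]].
 by apply: sub_sigma_algebra; left.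
pose k (K : nat) := Num.truncn (s / u * (2 ^ K)%:R).
pose sK (K : nat) : R := u * (k K)%:R / (2 ^ K)%:R.
have x0 K : 0 <= s / u * (2 ^ K)%:R by rewrite mulr_ge0 ?divr_ge0// ltW.
have kle K : (k K <= 2 ^ K)%N.
 rewrite -(ler_nat R); apply: (@le_trans _ _ (s / u * (2 ^ K)%:R)).
  by rewrite truncn_le ?x0.
 by rewrite ler_piMl ?ler_pdivrMr ?mul1r// ltW.
have sK0 K : 0 <= sK K by rewrite /sK divr_ge0// mulr_ge0// ltW.
have sKs : sK @ \oo --> s.
 apply/cvgrPdist_le => e e0; near=> K.
 have h1 : sK K <= s.
  rewrite /sK ler_pdivrMr// -ler_pdivlMl// mulrA [_^-1 * _]mulrC.
  by rewrite truncn_le ?x0.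
 have h2 : s - sK K <= u / (2 ^ K)%:R.
  have := truncnS_gt (s / u * (2 ^ K)%:R); rewrite -/(k K) => hk.
  rewrite lerBlDl /sK -mulrDl ler_pdivlMr// -[X in _ + X]mulr1 -mulrDr.
  rewrite -ler_pdivrMl// mulrA [_^-1 * _]mulrC -natr1 in hk *.
  exact: ltW.
 rewrite ger0_norm ?subr_ge0//; apply: (le_trans h2).
 rewrite ler_pdivrMr// -ler_pdivrMl//.
 apply: (@le_trans _ _ K%:R); last by rewrite ler_nat ltnW// ltn_expl.
 near: K; exact: nbhs_infty_ger.
 Unshelve. all: end_near.
have mK K : measurable_fun [set: g_sigma_algebraType (trace u)] (W i (sK K)).
 move=> _ C mC; rewrite setTI; apply: sub_sigma_algebra; right; exists K => //.
 by apply: sub_sigma_algebra; exists i, (k K), C.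
have ms : measurable_fun [set: g_sigma_algebraType (trace u)] (W i s).
 apply: (@measurable_fun_cvg _ (g_sigma_algebraType (trace u)) R setT (fun K => W i (sK K)) (W i s)) => // w _.
 have h := @within_continuous_seq _ (W i ^~ w) sK s (@bm_continuous _ _ _ _ _ _ hW i w) sK0 s0 sKs.
 exact: h.
by have := ms measurableT _ mB; rewrite setTI.
Qed.

(* Dynkin's theorem gives independence of the values of W on dyadic grids of
   [0, u]; these generate [F u], up to null events, by continuity of paths. *)
Lemma increment_independent u v G M : 0 <= u -> u < v -> F u G -> measurable M ->
 product_rule P G (increment u v @^-1` M).
Proof.
rewrite le_eqVlt => /orP[/eqP <-|u0] uv FG mM.
 have mH : measurable (increment 0 v @^-1` M).
  by rewrite -[X in measurable X]setTI; apply: measurable_increment => //; exact: ltW.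
 (* For u = 0 there is no grid to refine. All generators of the filtration at time 0 then have
    probability 0 or 1, and such events are independent of everything. *)
 pose Z : set (set T) := [set A | measurable A /\ (P A = 0%E \/ P A = 1%E)].
 have rule A H : Z A -> measurable H -> product_rule P A H.
  move=> [mA A01] {}mH; rewrite /product_rule.
  have [A0|A1] := A01; rewrite ?A0 ?A1 ?mul0e ?mul1e.
   apply/eqP; rewrite eq_le measure_ge0 andbT -A0 le_measure ?inE//.
   exact: measurableI.
  apply: eq_probability_ae => //; first exact: measurableI.
  have A1' : P (~` A) = 0%E by rewrite probability_setC// A1 subee.
  have : {ae P, forall w, A w}.
   exists (~` A); split => //; exact: measurableC.
  by apply: filterS => w Aw; split => [[]|].
 have ZI : setI_closed Z.
  move=> A B ZA ZB; split; first by apply: measurableI; [exact: ZA.1|exact: ZB.1].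
  rewrite (rule A B ZA ZB.1).
  by case: ZA.2 => ->; case: ZB.2 => ->; rewrite ?mul0e ?mul1e; [left|left|left|right].
 apply: (product_rule_dynkin ZI _ mH _ (G := G)) => //.
 - by move=> A [].
 - by move=> A ZA; exact: rule.
 apply: (smallest_sub _ _ FG); first exact: smallest_sigma_algebra.
 move=> A [[mA A0]|[i [s [B [s0 s0' mB ->]]]]].
  by apply: sub_sigma_algebra; split => //; left.
 have {s0 s0'} -> : s = 0 by apply/eqP; rewrite eq_le s0 s0'.
 apply: sub_sigma_algebra.
 have mWB : measurable (W i 0 @^-1` B) by exact: measurable_brownian_preimage.
 split=> //; have [B0|B0] := pselect (B 0); [right|left].
  rewrite -[RHS](probability_setT P); apply: eq_probability_ae => //.
  by have := bm_start hW i; apply: filterS => w w0 /=; rewrite w0.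
 rewrite -[RHS](measure0 P); apply: eq_probability_ae => //.
 by have := bm_start hW i; apply: filterS => w w0 /=; rewrite w0.
have v0 : 0 < v by exact: lt_trans uv.
have mH : measurable (increment u v @^-1` M).
 by rewrite -[X in measurable X]setTI; apply: measurable_increment => //; exact: ltW.
apply: (product_rule_dynkin (traceI (ltW u0)) (trace_measurable (ltW u0)) mH _ (G := G)).
 move=> A [[mA A0]|[K _ AK]].
  rewrite /product_rule A0 mul0e.
  apply/eqP; rewrite eq_le measure_ge0 andbT -A0 le_measure ?inE//.
  exact: measurableI.
 by apply: (@grid_rule u v (2 ^ K)) => //; rewrite expn_gt0.
apply: (smallest_sub _ _ FG); first exact: smallest_sigma_algebra.
exact: generator_trace.
Qed.

End brownian.

Section brownian_moments.
Context d (T : measurableType d) (R : realType) (P : probability T R).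
Variables (n : nat) (W : 'I_n -> R -> T -> R).
Hypothesis hW : standard_brownian_motion P W.

Let F := brownian_filtration P W.

Definition past (u : R) d' (E : measurableType d') (Z : T -> E) : Prop :=
 forall B, measurable B -> F u (Z @^-1` B).

Lemma pastE u d' (E : measurableType d') (Z : T -> E) :
 past u Z <-> measurable_fun [set: g_sigma_algebraType (filtration_generator P W u)] Z.
Proof.
split=> [h _ B mB|h B mB]; first by rewrite setTI; exact: h.
by have := h measurableT B mB; rewrite setTI.
Qed.

Lemma past_measurable u d' (E : measurableType d') (Z : T -> E) : past u Z ->
 borel Z.
Proof. by move=> h _ B mB; rewrite setTI; apply: (filtration_measurable hW); exact: h. Qed.

Lemma past_le u v d' (E : measurableType d') (Z : T -> E) : u <= v -> past u Z -> past v Z.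
Proof. by move=> uv h B mB; apply: (filtration_le uv); exact: h. Qed.

Lemma past_comp u d1 (E1 : measurableType d1) d2 (E2 : measurableType d2)
  (g : E1 -> E2) (Z : T -> E1) :
 measurable_fun [set: E1] g -> past u Z -> past u (g \o Z).
Proof. by move=> mg /pastE mZ; apply/pastE; exact: (measurableT_comp mg mZ). Qed.

Lemma pastM u (Y Z : T -> R) : past u Y -> past u Z -> past u (fun w => Y w * Z w).
Proof. by move=> /pastE mY /pastE mZ; apply/pastE; exact: measurable_funM. Qed.

Lemma pastB u (Y Z : T -> R) : past u Y -> past u Z -> past u (fun w => Y w - Z w).
Proof. by move=> /pastE mY /pastE mZ; apply/pastE; exact: measurable_funB. Qed.

Lemma past_cst u (c : R) : past u (fun=> c).
Proof. by apply/pastE; exact: measurable_cst. Qed.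

Lemma past_brownian i u v : 0 <= u -> u <= v -> past v (W i u).
Proof. by move=> u0 uv B mB; exact: filtration_brownian. Qed.

Lemma past_tuple u k (Z : T -> k.-tuple R) :
 (forall i, past u (fun w => tnth (Z w) i)) -> past u Z.
Proof.
move=> h; apply/pastE; apply/measurable_fun_tnthP => i.
by have /pastE := h i.
Qed.

Definition winc i u v (w : T) : R := W i v w - W i u w.

Lemma measurable_winc i u v : 0 <= u -> 0 <= v -> borel (winc i u v).
Proof. by move=> u0 v0; apply: measurable_funB; exact: (bm_measurable hW). Qed.

Lemma past_winc i u v s : 0 <= u -> u <= v -> v <= s -> past s (winc i u v).
Proof.
move=> u0 uv vs; apply: pastB; apply: past_brownian => //; first exact: le_trans uv.
exact: le_trans vs.
Qed.

Lemma winc_mean i u v : 0 <= u -> u <= v ->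
 [/\ L2 P (winc i u v), mean P (winc i u v) = 0 &
   mean P (fun w => winc i u v w ^+ 2) = v - u].
Proof.
move=> u0; rewrite le_eqVlt => /orP[/eqP <-|uv].
 rewrite (_ : winc i u u = fun=> 0); last by apply/funext => w; rewrite /winc subrr.
 rewrite !mean_cst expr0n subrr; split => //; exact: L2_cst.
have v0 : 0 <= v by rewrite ltW// (le_lt_trans u0).
have s0 : 0 < Num.sqrt (v - u) by rewrite sqrtr_gt0 subr_gt0.
have law B : measurable B -> P (winc i u v @^-1` B) = normal_prob 0 (Num.sqrt (v - u)) B.
 exact: (bm_gaussian hW).
have mw := measurable_winc i u0 v0.
have [m1 m2] := gaussian_mean_var mw s0 law.
split => //; first exact: (gaussian_sq mw s0 law).
by rewrite m2 sqr_sqrtr// subr_ge0 ltW.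
Qed.

Lemma winc_independent i j u v (A B : set R) : 0 <= u -> u < v -> i != j ->
 measurable A -> measurable B ->
 product_rule P (winc i u v @^-1` A) (winc j u v @^-1` B).
Proof.
move=> u0 uv ij mA mB.
pose t (k : nat) : R := u + k%:R * (v - u).
have t0 : 0 <= t 0%N by rewrite /t mul0r addr0.
have tS k : t k < t k.+1.
 by rewrite /t ltrD2l ltr_pM2r ?subr_gt0// ltr_nat.
have := @bm_independent _ _ _ _ _ _ hW t 1%N t0 tS.
pose o : 'I_1 := ord0.
pose C (ik : 'I_n * 'I_1) : set R := if ik.1 == i then A else B.
move=> /(_ [set (i, o); (j, o)]%SET C) H.
rewrite /product_rule.
have t0E : t 0%N = u by rewrite /t mul0r addr0.
have t1E : t 1%N = v by rewrite /t mul1r addrC subrK.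
rewrite big_setU1/= ?big_set1 in H; last first.
 by rewrite inE xpair_eqE eqxx andbT.
have ji : (j == i) = false by rewrite eq_sym (negbTE ij).
rewrite /C /= eqxx ji t0E t1E in H.
rewrite -[RHS]H; last by move=> ik; case: ifP.
congr (P _); apply/seteqP; split => w /=.
 by move=> [h1 h2] [i' k']; rewrite /= !inE => /orP[|] /eqP[-> ->]; rewrite ?eqxx ?ji /= ?t0E ?t1E.
move=> h; split.
 by have := h (i, o); rewrite /= !inE !eqxx /= t0E t1E; exact.
by have := h (j, o); rewrite /= !inE !eqxx orbT /= ji t0E t1E; exact.
Qed.

Lemma winc_cross i j u v : 0 <= u -> u <= v ->
 mean P (fun w => winc i u v w * winc j u v w) = (v - u) * (i == j)%:R.
Proof.
move=> u0 uv; have [<-|ij] := eqVneq i j.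
 by rewrite mulr1; have [_ _] := winc_mean i u0 uv.
rewrite mulr0; move: uv; rewrite le_eqVlt => /orP[/eqP <-|uv].
 rewrite (_ : (fun w => _) = fun=> 0) ?mean_cst//.
 by apply/funext => w; rewrite /winc subrr mul0r.
have [i1 m1 _] := winc_mean i u0 (ltW uv).
have [i2 m2 _] := winc_mean j u0 (ltW uv).
have [] := @independent_mean _ _ _ P (winc i u v) (winc j u v).
- exact: sq_L1.
- exact: sq_L1.
- by move=> A B mA mB; exact: winc_independent.
by move=> _ ->; rewrite m1 mul0r.
Qed.

Lemma increment_mean u v (Z : T -> R) (g : n.-tuple R -> R) : 0 <= u -> u < v ->
 past u Z -> L1 P Z -> borel g ->
 L1 P (g \o increment W u v) ->
 L1 P (fun w => Z w * g (increment W u v w)) /\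
 mean P (fun w => Z w * g (increment W u v w)) = mean P Z * mean P (g \o increment W u v).
Proof.
move=> u0 uv pZ iZ mg ig.
apply: (independent_mean iZ ig) => A B mA mB.
rewrite comp_preimage; apply: (increment_independent hW) => //; first exact: pZ.
by rewrite -[X in measurable X]setTI; exact: mg.
Qed.

Lemma past_winc_mean i u v (Z : T -> R) : 0 <= u -> u <= v -> past u Z -> L1 P Z ->
 [/\ L1 P (fun w => Z w * winc i u v w),
   mean P (fun w => Z w * winc i u v w) = 0 ,
   L1 P (fun w => Z w * winc i u v w ^+ 2) &
   mean P (fun w => Z w * winc i u v w ^+ 2) = mean P Z * (v - u)].
Proof.
move=> u0; rewrite le_eqVlt => /orP[/eqP <-|uv] pZ iZ.
 have -> : winc i u u = fun=> 0 by apply/funext => w; rewrite /winc subrr.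
 rewrite subrr expr0n/=; under eq_fun do rewrite mulr0; rewrite mulr0 mean_cst.
 by split => //; exact: L1_cst.
have [iw m1 m2] := winc_mean i u0 (ltW uv).
have e1 : (fun x : n.-tuple R => tnth x i) \o increment W u v = winc i u v.
 by apply/funext => w; rewrite /= tnth_mktuple.
have e2 : (fun x : n.-tuple R => tnth x i ^+ 2) \o increment W u v =
  (fun w => winc i u v w ^+ 2).
 by apply/funext => w; rewrite /= tnth_mktuple.
have i1 : L1 P ((fun x : n.-tuple R => tnth x i) \o increment W u v).
 by rewrite e1; exact: sq_L1.
have i2 : L1 P ((fun x : n.-tuple R => tnth x i ^+ 2) \o increment W u v).
 by rewrite e2; exact: iw.2.
have [a1 a2] := @increment_mean u v Z (fun x => tnth x i) u0 uv pZ iZ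
 (measurable_tnth i) i1.
have [b1 b2] := @increment_mean u v Z (fun x => tnth x i ^+ 2) u0 uv pZ iZ
 (measurable_funX 2 (measurable_tnth i)) i2.
move: a1 a2 b1 b2; rewrite e1 e2 m1 m2 mulr0.
have -> : winc i u v = (fun w => tnth (increment W u v w) i).
 by apply/funext => w; rewrite tnth_mktuple.
by [].
Qed.

End brownian_moments.

(** * Ito integrals *)

Section time_integral.
Context d (T : measurableType d) (R : realType) (P : probability T R).

Definition tint (A : set R) (f : R -> T -> R) : \bar R :=
 (\int[P]_w \int[lebesgue_measure]_(s in A) (f s w)%:E)%E.

Definition bimeasurable (f : R -> T -> R) : Prop :=
 measurable_fun [set: measurableTypeR R * T] (fun p => f p.1 p.2).

Lemma joint_slice f w : bimeasurable f -> measurable_fun [set: measurableTypeR R] (f ^~ w).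
Proof.
move=> mf; have h : measurable_fun setT (fun s : measurableTypeR R => (s, w)).
 exact/measurable_fun_pair.
exact: (measurableT_comp mf h).
Qed.

Lemma tint_restrict A B f : measurable A -> A `<=` B ->
 tint A f = tint B (fun s w => f s w * \1_A s).
Proof.
move=> mA AB; rewrite /tint; apply: eq_integral => w _.
rewrite -{1}(setIidr AB) integral_mkcondr; apply: eq_integral => s _.
rewrite patchE indicE; case: ifP => _; rewrite ?mulr1 ?mulr0//.
Qed.

Let joint_indic A : measurable A -> bimeasurable (fun s _ => \1_A s).
Proof.
move=> mA; by apply: (measurableT_comp (f := (\1_A : measurableTypeR R -> R))).
Qed.

Lemma joint_restrict A f : measurable A -> bimeasurable f ->
 bimeasurable (fun s w => f s w * \1_A s).
Proof. by move=> mA mf; apply: measurable_funM => //; exact: joint_indic. Qed.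

Section nonneg.
Variables (A : set R) (f : R -> T -> R).
Hypotheses (mA : measurable A) (mf : bimeasurable f) (f0 : forall s w, 0 <= f s w).

Let g (p : measurableTypeR R * T) : \bar R := (f p.1 p.2 * \1_A p.1)%:E.

Let mg : measurable_fun [set: measurableTypeR R * T] g.
Proof. by apply/measurable_EFinP; exact: joint_restrict. Qed.

Let g0 p : (0 <= g p)%E.
Proof. by rewrite lee_fin mulr_ge0. Qed.

Let innerE w : (\int[lebesgue_measure]_(s in A) (f s w)%:E = \int[lebesgue_measure]_s g (s, w))%E.
Proof.
rewrite integral_mkcond; apply: eq_integral => s _.
by rewrite patchE /g /= indicE; case: ifP => _; rewrite ?mulr1 ?mulr0.
Qed.

Lemma measurable_tint_inner :
 borel (fun w => \int[lebesgue_measure]_(s in A) (f s w)%:E)%E.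
Proof.
rewrite (_ : (fun w => _) = fubini_G (@lebesgue_measure R) g); last exact/funext.
exact: (measurable_fun_fubini_tonelli_G _ mg g0).
Qed.

Lemma tint_swap : tint A f = (\int[lebesgue_measure]_(s in A) \int[P]_w (f s w)%:E)%E.
Proof.
rewrite /tint; under eq_integral do rewrite innerE.
rewrite -(fubini_tonelli _ mg g0) [RHS]integral_mkcond.
apply: eq_integral => s _; rewrite patchE; case: ifPn => sA.
 by apply: eq_integral => w _; rewrite /g /= indicE sA mulr1.
by apply: integral0_eq => w _; rewrite /g /= indicE (negbTE sA) mulr0.
Qed.

End nonneg.

Lemma tint_ge0 A f : (forall s w, 0 <= f s w) -> (0 <= tint A f)%E.
Proof. by move=> f0; apply: integral_ge0 => w _; apply: integral_ge0 => s _; rewrite lee_fin. Qed.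

Lemma tint_le A f g : measurable A -> bimeasurable f -> bimeasurable g ->
 (forall s w, 0 <= f s w) -> (forall s w, A s -> f s w <= g s w) -> (forall s w, 0 <= g s w) ->
 (tint A f <= tint A g)%E.
Proof.
move=> mA mf mg f0 fg g0; apply: ge0_le_integral => //.
- by move=> w _; apply: integral_ge0 => s _; rewrite lee_fin.
- exact: measurable_tint_inner.
- exact: measurable_tint_inner.
move=> w _; apply: ge0_le_integral => //.
- by move=> s _; rewrite lee_fin.
- by apply: measurable_funTS; apply/measurable_EFinP; exact: joint_slice.
- by apply: measurable_funTS; apply/measurable_EFinP; exact: joint_slice.
by move=> s As; rewrite lee_fin fg.
Qed.

Lemma tintD A f g : measurable A -> bimeasurable f -> bimeasurable g ->
 (forall s w, 0 <= f s w) -> (forall s w, 0 <= g s w) ->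
 tint A (fun s w => f s w + g s w) = (tint A f + tint A g)%E.
Proof.
move=> mA mf mg f0 g0; rewrite /tint -ge0_integralD//.
- apply: eq_integral => w _; rewrite -ge0_integralD//.
 + by move=> s _; rewrite lee_fin.
 + by apply: measurable_funTS; apply/measurable_EFinP; exact: joint_slice.
 + by move=> s _; rewrite lee_fin.
 + by apply: measurable_funTS; apply/measurable_EFinP; exact: joint_slice.
- by move=> w _; apply: integral_ge0 => s _; rewrite lee_fin.
- exact: measurable_tint_inner.
- by move=> w _; apply: integral_ge0 => s _; rewrite lee_fin.
- exact: measurable_tint_inner.
Qed.

Lemma tintZ A f (c : R) : measurable A -> bimeasurable f -> 0 <= c ->
 (forall s w, 0 <= f s w) ->
 tint A (fun s w => c * f s w) = (c%:E * tint A f)%E.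
Proof.
move=> mA mf c0 f0; rewrite /tint -ge0_integralZl//.
- apply: eq_integral => w _; rewrite -ge0_integralZl//.
 + by apply: measurable_funTS; apply/measurable_EFinP; exact: joint_slice.
 + by move=> s _; rewrite lee_fin.
- exact: measurable_tint_inner.
- by move=> w _; apply: integral_ge0 => s _; rewrite lee_fin.
Qed.

End time_integral.

Section blocks.
Context d (T : measurableType d) (R : realType) (P : probability T R).
Variables (n : nat) (W : 'I_n -> R -> T -> R).
Hypothesis hW : standard_brownian_motion P W.
Variable i : 'I_n.

(* [(s, t, Z)] encodes the integrand Z 1_[s, t[. *)
Definition block := (R * R * (T -> R))%type.

(** The coefficient must be known at the left end only if the block has positive length. Cutting at
    a time u may collapse a later block to an empty one placed at u, while its coefficient is not
    known at u. *)
Definition block_wf (t : R) (p : block) : Prop :=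
 [/\ 0 <= p.1.1 <= p.1.2, p.1.2 <= t, borel p.2,
   (exists M : R, forall w, `|p.2 w| <= M) & (p.1.1 < p.1.2 -> past P W p.1.1 p.2)].

Definition bint (p : block) (w : T) : R := p.2 w * winc W i p.1.1 p.1.2 w.
Definition bfun (p : block) (s : R) (w : T) : R := p.2 w * \1_(`[p.1.1, p.1.2[) s.
Definition overlap (p q : block) : R :=
 Num.max 0 (Num.min p.1.2 q.1.2 - Num.max p.1.1 q.1.1).

Lemma sq_bint t p : block_wf t p -> L2 P (bint p).
Proof.
move=> [/andP[p0 pp] _ mp [M pM] _]; have [iw _ _] := winc_mean hW i p0 pp.
exact: (L2_mull mp pM iw).
Qed.

Let bint0 a e w : bint (a, a, e) w = 0.
Proof. by rewrite /bint /winc /= subrr mulr0. Qed.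

(** The blocks meet on the interval from a' to c, the smaller of the two right ends. After splitting
    both increments at a' and c, every product with a later increment against earlier factors has
    mean 0, and the product of the two increments after c vanishes because one of them is 0. Only
    the square of the common increment remains, with mean c - a'. *)
Let cross_le p q t : block_wf t p -> block_wf t q -> p.1.1 <= q.1.1 ->
 mean P (fun w => bint p w * bint q w) = mean P (fun w => p.2 w * q.2 w) * overlap p q.
Proof.
move: p q => [[a b] e] [[a' b'] e'] wp wq /= aa'.
have := wp => -[/= /andP[a0 ab] bt me [M eM] pe]; have := wq => -[/= /andP[a'0 ab'] bt' me' [M' eM'] pe'].
have ovE : overlap (a, b, e) (a', b', e') = Num.max 0 (Num.min b b' - a').
 by rewrite /overlap /= (max_idPr aa').
rewrite ovE.
have [e1|lt'] := eqVneq a' b'.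
 rewrite -e1; under eq_fun do rewrite bint0 mulr0.
 rewrite mean_cst (max_idPl _) ?mulr0// subr_le0 ge_min lexx orbT//.
have {lt'} ab'lt : a' < b' by rewrite lt_neqAle lt'.
have {}pe' := pe' ab'lt.
have [e1|lt'] := eqVneq a b.
 rewrite -e1; under eq_fun do rewrite bint0 mul0r.
 by rewrite mean_cst (max_idPl _) ?mulr0// subr_le0 ge_min aa'.
have {lt'} ablt : a < b by rewrite lt_neqAle lt'.
have {}pe := pe ablt.
have pa'e : past P W a' e by exact: past_le aa' pe.
have [ba'|a'b] := leP b a'.
 rewrite (max_idPl _) ?mulr0; last by rewrite subr_le0 ge_min ba'.
 pose Z w := e w * winc W i a b w * e' w.
 have pZ : past P W a' Z.
  by apply: pastM => //; apply: pastM => //; exact: past_winc.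
 have iZ : L1 P Z.
  apply: L1M; first exact: (sq_bint wp).
  exact: (L2_bounded P me' eM').
 have [_ m0 _ _] := past_winc_mean hW i a'0 ab' pZ iZ.
 by rewrite -[RHS]m0; congr mean; apply/funext => w; rewrite /bint /Z /=; ring.
set c := Num.min b b'.
have a'c : a' <= c by rewrite le_min (ltW a'b) ab'.
have c0 : 0 <= c by exact: le_trans a'c.
rewrite (max_idPr _); last by rewrite subr_ge0.
have cb : c <= b by rewrite ge_min lexx.
have cb' : c <= b' by rewrite ge_min lexx orbT.
pose G w := e w * e' w.
have pG : past P W a' G by exact: pastM.
have GM w : `|G w| <= M * M'.
 by rewrite normrM ler_pM.
have mG : borel G by exact: measurable_funM.
have iG := L2_bounded P mG GM.
have [iw1 _ _] := winc_mean hW i a0 aa'.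
have [iw2 _ _] := winc_mean hW i a'0 a'c.
pose Z1 w := G w * winc W i a a' w.
have pw1 : past P W a' (winc W i a a') by exact: past_winc.
have pw2 : past P W c (winc W i a' c) by exact: past_winc.
have [j1 m1 _ _] := past_winc_mean hW i a'0 ab' (Z := Z1)
 (pastM pG pw1) (L1M iG iw1).
have [_ _ j2 m2] := past_winc_mean hW i a'0 a'c pG (sq_L1 iG).
pose Z3 w := G w * winc W i a' c w.
have p3 := pastM (past_le a'c pG) pw2.
have [j3 m3 _ _] := past_winc_mean hW i c0 cb' (Z := Z3) p3 (L1M iG iw2).
have [j4 m4 _ _] := past_winc_mean hW i c0 cb (Z := Z3) p3 (L1M iG iw2).
have -> : (fun w => bint (a, b, e) w * bint (a', b', e') w) = (fun w =>
  Z1 w * winc W i a' b' w + G w * winc W i a' c w ^+ 2 +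
  Z3 w * winc W i c b' w + Z3 w * winc W i c b w).
 apply/funext => w; rewrite /bint /Z1 /Z3 /G /winc /=.
 have : (W i b w - W i c w) * (W i b' w - W i c w) = 0.
  by rewrite /c; case: (leP b b') => _; rewrite subrr ?mul0r ?mulr0.
 move=> h; apply/eqP; rewrite -subr_eq0; apply/eqP.
 transitivity (e w * e' w * ((W i b w - W i c w) * (W i b' w - W i c w))); first by ring.
 by rewrite h mulr0.
rewrite !meanD//; try by repeat apply: L1D.
by rewrite m1 m2 m3 m4 add0r !addr0.
Qed.

Lemma bint_cross p q t : block_wf t p -> block_wf t q ->
 mean P (fun w => bint p w * bint q w) = mean P (fun w => p.2 w * q.2 w) * overlap p q.
Proof.
move=> wp wq; have [pq|/ltW qp] := leP p.1.1 q.1.1; first exact: cross_le wp wq pq.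
under eq_fun do rewrite mulrC.
rewrite (cross_le wq wp qp); congr (_ * _).
 by congr mean; apply/funext => w; rewrite mulrC.
by rewrite /overlap minC [Num.max q.1.1 _]maxC.
Qed.

Lemma overlap_integral t p q : block_wf t p -> block_wf t q ->
 (\int[lebesgue_measure]_(s in `[0%R, t]) (\1_(`[p.1.1, p.1.2[) s * \1_(`[q.1.1, q.1.2[) s)%:E =
  (overlap p q)%:E)%E.
Proof.
move: p q => [[a b] e] [[a' b'] e'] [/= /andP[a0 ab] bt _ _ _] [/= /andP[a'0 ab'] bt' _ _ _].
pose J := `[Num.max a a', Num.min b b'[%classic : set R.
transitivity (\int[lebesgue_measure]_(s in `[0%R, t]) (\1_J s)%:E)%E.
 apply: eq_integral => s _; congr EFin; rewrite !indicE /J -natrM mulnb.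
 congr ((nat_of_bool _)%:R); apply/idP/idP.
  move=> /andP[/set_mem + /set_mem]; rewrite /= !in_itv/= => /andP[h1 h2] /andP[h3 h4].
  by apply/mem_set; rewrite /= in_itv/= ge_max lt_min h1 h2 h3 h4.
 move/set_mem; rewrite /= in_itv/= ge_max lt_min => /andP[/andP[h1 h2] /andP[h3 h4]].
 by apply/andP; split; apply/mem_set; rewrite /= in_itv/= ?h1 ?h2 ?h3 ?h4.
rewrite integral_indic//; last exact: measurable_itv.
rewrite setIidl; last first.
 move=> s; rewrite /J /= !in_itv/= ge_max lt_min => /andP[/andP[h1 h2] /andP[h3 h4]].
 by rewrite (le_trans a0 h1)/= (le_trans (ltW h3) bt).
rewrite /J /overlap /= lebesgue_measure_itv/= lte_fin.
case: ltP => h; congr EFin; first by rewrite [RHS](max_idPr _)// subr_ge0 ltW.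
by rewrite [RHS](max_idPl _)// subr_le0.
Qed.

Section families.
Variables (t : R) (I : finType) (L : I -> block).
Hypothesis wfL : forall k, block_wf t (L k).

Definition bint_sum (w : T) : R := \sum_(k : I) bint (L k) w.
Definition bfun_sum (s : R) (w : T) : R := \sum_(k : I) bfun (L k) s w.

Lemma sq_bint_sum : L2 P bint_sum.
Proof. by apply: L2_sum => k; exact: sq_bint (wfL k). Qed.

Let coef_bounded k : L2 P (L k).2.
Proof. by have [_ _ mk [M hM] _] := wfL k; exact: L2_bounded hM. Qed.

Lemma mean_bint_sum_sq : mean P (fun w => bint_sum w ^+ 2) =
 \sum_(j : I) \sum_(k : I) mean P (fun w => (L j).2 w * (L k).2 w) * overlap (L j) (L k).
Proof.
under eq_fun do rewrite expr2 /bint_sum big_distrlr /=.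
rewrite mean_sum => [|j]; last first.
 by apply: L1_sum => k; apply: L1M; [exact: sq_bint (wfL j)|exact: sq_bint (wfL k)].
apply: eq_bigr => j _; rewrite mean_sum => [|k].
 by apply: eq_bigr => k _; exact: bint_cross (wfL j) (wfL k).
by apply: L1M; [exact: sq_bint (wfL j)|exact: sq_bint (wfL k)].
Qed.

(** The Ito isometry for families of blocks that may overlap. Differences of simple processes on
    unrelated partitions are covered without passing to a common refinement. *)
Lemma bint_isometry : tint P `[0, t] (fun s w => bfun_sum s w ^+ 2) =
 (mean P (fun w => bint_sum w ^+ 2))%:E.
Proof.
pose S w := \sum_(j : I) \sum_(k : I) ((L j).2 w * (L k).2 w) * overlap (L j) (L k).
have iS j k : L1 P (fun w => (L j).2 w * (L k).2 w * overlap (L j) (L k)).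
 under eq_fun do rewrite mulrC.
 by apply: L1Z; apply: L1M.
transitivity (\int[P]_w (S w)%:E)%E; last first.
 rewrite mean_bint_sum_sq meanE; last by apply: L1_sum => j; exact: L1_sum.
 congr EFin; rewrite mean_sum => [|j]; last exact: L1_sum.
 apply: eq_bigr => j _; rewrite mean_sum//; apply: eq_bigr => k _.
 rewrite [RHS]mulrC -meanZ; last exact: L1M.
 by congr mean; apply/funext => w; rewrite mulrC.
rewrite /tint; apply: eq_integral => w _.
pose g (j k : I) (s : R) : R :=
 \1_(`[(L j).1.1, (L j).1.2[) s * \1_(`[(L k).1.1, (L k).1.2[) s.
have ig j k : (@lebesgue_measure R).-integrable `[0, t] (EFin \o g j k).
 have mg : measurable_fun `[0, t] (g j k).
  by apply: measurable_funM; exact: measurable_indic.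
 apply: (@le_integrable _ _ _ _ _ _ _ (EFin \o cst 1)) => //.
 - exact/measurable_EFinP.
 - move=> s _ /=; rewrite lee_fin /g normr1 !indicE -natrM mulnb.
  by case: (_ && _); rewrite ?normr0 ?normr1.
 - apply/integrableP; split; first exact/measurable_EFinP.
  under eq_integral do rewrite /= normr1.
  rewrite integral_cst//= mul1e lebesgue_measure_itv/=.
  by case: ifP => _; rewrite ?ltry// -EFinB ltry.
transitivity (\int[lebesgue_measure]_(s in `[0%R, t])
  \sum_(j : I) \sum_(k : I) ((L j).2 w * (L k).2 w)%:E * (g j k s)%:E)%E.
 apply: eq_integral => s _; rewrite expr2 /bfun_sum big_distrlr /= -sumEFin.
 apply: eq_bigr => j _; rewrite -sumEFin; apply: eq_bigr => k _.
 by rewrite -EFinM; congr EFin; rewrite /bfun /g; ring.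
have igZ j k c : (@lebesgue_measure R).-integrable `[0, t] (fun s => (c%:E * (g j k s)%:E)%E).
 exact: (integrableZl _ c (ig j k)).
rewrite integral_sum//; last by move=> j; exact: integrable_sum.
rewrite /S -sumEFin; apply: eq_bigr => j _.
rewrite integral_sum// -sumEFin; apply: eq_bigr => k _.
rewrite integralZl//; last exact: ig.
by rewrite [RHS]EFinM; congr (_ * _)%E; exact: overlap_integral.
Qed.

End families.

Lemma bint_sumU (I J : finType) (L : I -> block) (M : J -> block) w :
 bint_sum (fun k : I + J => match k with inl a => L a | inr b => M b end) w =
 bint_sum L w + bint_sum M w.
Proof. by rewrite /bint_sum big_sumType. Qed.

Lemma bfun_sumU (I J : finType) (L : I -> block) (M : J -> block) s w :
 bfun_sum (fun k : I + J => match k with inl a => L a | inr b => M b end) s w =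
 bfun_sum L s w + bfun_sum M s w.
Proof. by rewrite /bfun_sum big_sumType. Qed.

Definition cut_lo (u : R) (p : block) : block := (Num.min p.1.1 u, Num.min p.1.2 u, p.2).
Definition cut_hi (u : R) (p : block) : block := (Num.max p.1.1 u, Num.max p.1.2 u, p.2).
Definition bopp (p : block) : block := (p.1, fun w => - p.2 w).

Lemma cut_lo_wf t u p : 0 <= u -> block_wf t p -> block_wf t (cut_lo u p).
Proof.
move: p => [[a b] e] u0 [/= /andP[a0 ab] bt me Me pe]; split => //=.
- by rewrite le_min a0 u0 /= le_min !ge_min ab lexx orbT.
- by rewrite ge_min bt.
- move=> h; have au : a < u.
  rewrite ltNge; apply/negP => ua; move: h.
  by rewrite (min_idPr ua) (min_idPr (le_trans ua ab)) ltxx.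
 rewrite (min_idPl (ltW au)); apply: pe.
 by move: h; rewrite (min_idPl (ltW au)) lt_min => /andP[].
Qed.

Lemma cut_hi_wf t u p : u <= t -> block_wf t p -> block_wf t (cut_hi u p).
Proof.
move: p => [[a b] e] ut [/= /andP[a0 ab] bt me Me pe]; split => //=.
- by rewrite le_max a0 /= ge_max !le_max ab lexx orbT.
- by rewrite ge_max bt.
- move=> h; have aM : a <= Num.max a u by rewrite le_max lexx.
 apply: (past_le aM); apply: pe; rewrite ltNge; apply/negP => ba.
 have e1 : a = b by apply/eqP; rewrite eq_le ab ba.
 by move: h; rewrite e1 ltxx.
Qed.

Lemma bopp_wf t p : block_wf t p -> block_wf t (bopp p).
Proof.
move: p => [[a b] e] [/= ab bt me [M Me] pe]; split => //=.
- exact: measurable_funN.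
- by exists M => w; rewrite normrN.
- move=> lt_ab; have p0 : past P W a (fun=> 0 : R) by exact: past_cst.
 by have := pastB p0 (pe lt_ab); under eq_fun do rewrite sub0r.
Qed.

Lemma bint_cut u p w : bint p w = bint (cut_lo u p) w + bint (cut_hi u p) w.
Proof.
rewrite /bint /winc /=; case: (leP p.1.1 u) => _; case: (leP p.1.2 u) => _; ring.
Qed.

Lemma bint_opp p w : bint (bopp p) w = - bint p w.
Proof. by rewrite /bint /= mulNr. Qed.

Lemma bfun_cut_lo (u : R) (p : block) (s : R) w : p.1.1 <= p.1.2 -> bfun (cut_lo u p) s w = bfun p s w * (s < u)%R%:R.
Proof.
move: p => [[a b] e] /= ab; rewrite /bfun /= -mulrA; congr (_ * _).
rewrite !indicE -natrM mulnb; congr ((nat_of_bool _)%:R); apply/idP/idP.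
 move=> /set_mem; rewrite /= in_itv/= lt_min ge_min => /andP[h1 /andP[h2 h3]].
 rewrite h3 andbT; apply/mem_set; rewrite /= in_itv/= h2 andbT.
 by move: h1 => /orP[//|]; rewrite leNgt h3.
move=> /andP[/set_mem + h3]; rewrite /= in_itv/= => /andP[h1 h2].
by apply/mem_set; rewrite /= in_itv/= lt_min ge_min h1 h2 h3.
Qed.

Lemma bfun_cut_hi (u : R) (p : block) (s : R) w : p.1.1 <= p.1.2 -> bfun (cut_hi u p) s w = bfun p s w * (u <= s)%R%:R.
Proof.
move: p => [[a b] e] /= ab; rewrite /bfun /= -mulrA; congr (_ * _).
rewrite !indicE -natrM mulnb; congr ((nat_of_bool _)%:R); apply/idP/idP.
 move=> /set_mem; rewrite /= in_itv/= lt_max ge_max => /andP[/andP[h1 h2] h3].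
 rewrite h2 andbT; apply/mem_set; rewrite /= in_itv/= h1 /=.
 by move: h3 => /orP[//|]; rewrite ltNge h2.
move=> /andP[/set_mem + h3]; rewrite /= in_itv/= => /andP[h1 h2].
by apply/mem_set; rewrite /= in_itv/= lt_max ge_max h1 h2 h3.
Qed.

Lemma bfun_opp p s w : bfun (bopp p) s w = - bfun p s w.
Proof. by rewrite /bfun /= mulNr. Qed.

(** The martingale property for one block that starts after [u]: the factor [z] joins the
    coefficient, which is still known when the block begins. *)
Lemma bint_past_mean0 t u p (z : T -> R) (M : R) : block_wf t p -> u <= p.1.1 ->
 past P W u z -> (forall w, `|z w| <= M) ->
 mean P (fun w => z w * bint p w) = 0.
Proof.
move=> wp up pz zM; have := wp => -[/andP[p0 pp] _ mp [M' pM'] pe].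
have mz := past_measurable hW pz.
have iz : L2 P (fun w => z w * p.2 w).
 exact: (L2_mull mz zM (L2_bounded P mp pM')).
under eq_fun do rewrite /bint mulrA.
have [e|ne] := eqVneq p.1.1 p.1.2.
 rewrite (_ : (fun w => _) = fun=> 0) ?mean_cst//.
 by apply/funext => w; rewrite /winc e subrr mulr0.
have lt : p.1.1 < p.1.2 by rewrite lt_neqAle ne.
have [] := past_winc_mean hW i p0 pp (Z := fun w => z w * p.2 w) _ (sq_L1 iz) => //.
by apply: pastM; [exact: past_le up pz|exact: pe].
Qed.

Definition sp_block (phi : simple_process T R) (k : 'I_(sp_size phi)) : block :=
 (sp_time phi k, sp_time phi k.+1, sp_coef phi k).

Lemma sp_adapted_time t phi k : sp_adapted (brownian_filtration P W) t phi ->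
 (k <= sp_size phi)%N -> 0 <= sp_time phi k <= t.
Proof.
move=> [[p0 pt] pm _ _] kN; apply/andP; split.
 elim: k kN => [//|k IH kN]; apply: (le_trans (IH (ltnW kN))); exact: pm.
apply: le_trans pt; rewrite -{1}(subnKC kN).
have : (k + (sp_size phi - k) <= sp_size phi)%N by rewrite subnKC.
elim: (sp_size phi - k)%N => [|j IH]; rewrite ?addn0// addnS => jN.
by apply: (le_trans (IH (ltnW jN))); exact: pm.
Qed.

Lemma sp_block_wf t phi k : sp_adapted (brownian_filtration P W) t phi ->
 block_wf t (@sp_block phi k).
Proof.
move=> h; have /andP[h1 h2] := sp_adapted_time h (ltnW (ltn_ord k)).
have /andP[h3 h4] := sp_adapted_time h (ltn_ord k).
have [_ pm pF [M hM]] := h.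
have pk : past P W (sp_time phi k) (sp_coef phi k) by move=> B mB; exact: pF.
split => //=; first by rewrite h1 pm.
- exact: (past_measurable hW pk).
- by exists M => w; exact: hM.
Qed.

Lemma bint_sum_sp phi w : bint_sum (@sp_block phi) w = sp_integral (W i) phi w.
Proof. by []. Qed.

Lemma bfun_sum_sp phi s w : bfun_sum (@sp_block phi) s w = sp_fun phi s w.
Proof. by []. Qed.

End blocks.

(** * Ito integrals over a short interval *)

Section ito_increments.
Context d (T : measurableType d) (R : realType) (P : probability T R).
Variables (n : nat) (W : 'I_n -> R -> T -> R).
Hypothesis hW : standard_brownian_motion P W.
Variable i : 'I_n.

Let F := brownian_filtration P W.

Lemma cvge0_small2 (a b : nat -> \bar R) (e : R) : 0 < e ->
 a @ \oo --> 0%E -> b @ \oo --> 0%E ->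
 (forall k, 0 <= a k)%E -> (forall k, 0 <= b k)%E ->
 exists k, (a k <= e%:E)%E /\ (b k <= e%:E)%E.
Proof.
move=> e0 /fine_cvgP[[N1 _ fa] /cvgrPdist_le /(_ e e0)[N2 _ ha]].
move=> /fine_cvgP[[N3 _ fb] /cvgrPdist_le /(_ e e0)[N4 _ hb]] a0 b0.
pose N := maxn (maxn N1 N2) (maxn N3 N4).
have [h1 h2] : (maxn N1 N2 <= N)%N /\ (maxn N3 N4 <= N)%N by rewrite leq_maxl leq_maxr.
move: h1 h2; rewrite !geq_max => /andP[n1 n2] /andP[n3 n4].
exists N; rewrite -(fineK (fa _ n1)) -(fineK (fb _ n3)) !lee_fin.
have := ha _ n2; have := hb _ n4; rewrite !sub0r !normrN => h3 h4.
by split; [apply: le_trans h4|apply: le_trans h3]; exact: ler_norm.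
Qed.

Lemma mean_le_eps (x c : R) : (forall e, 0 < e -> x <= c + e) -> x <= c.
Proof. by move=> h; apply/ler_addgt0Pr => e e0; exact: h. Qed.

Lemma bfun_joint p : borel p.2 -> bimeasurable (@bfun _ T R p).
Proof.
move=> mp; have m1 : bimeasurable (fun (s : R) w => p.2 w).
 by apply: measurableT_comp => //; exact: measurable_snd.
exact: (joint_restrict (measurable_itv _) m1).
Qed.

Lemma sp_joint t phi : sp_adapted F t phi -> bimeasurable (sp_fun phi).
Proof.
move=> h; apply: measurable_sum => k.
have [_ _ mk _ _] := sp_block_wf hW k h.
exact: (bfun_joint (p := sp_block k)).
Qed.

Lemma sp_fun_out t phi s w : sp_adapted F t phi -> t <= s -> sp_fun phi s w = 0.
Proof.
move=> h ts; rewrite /sp_fun big1// => k _.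
have /andP[_ kt] := sp_adapted_time h (ltn_ord k).
rewrite indicE memNset ?mulr0//= in_itv/= => /andP[_].
by rewrite ltNge (le_trans kt ts).
Qed.

Lemma bfun_sum_lo u t phi s w : sp_adapted F t phi ->
 bfun_sum (fun k => cut_lo u (@sp_block _ _ _ phi k)) s w = sp_fun phi s w * (s < u)%R%:R.
Proof.
move=> h; rewrite /bfun_sum -bfun_sum_sp mulr_suml; apply: eq_bigr => k _.
have [/andP[_ h1] _ _ _ _] := sp_block_wf hW k h.
exact: bfun_cut_lo.
Qed.

Lemma bfun_sum_hi u t phi s w : sp_adapted F t phi ->
 bfun_sum (fun k => cut_hi u (@sp_block _ _ _ phi k)) s w = sp_fun phi s w * (u <= s)%R%:R.
Proof.
move=> h; rewrite /bfun_sum -bfun_sum_sp mulr_suml; apply: eq_bigr => k _.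
have [/andP[_ h1] _ _ _ _] := sp_block_wf hW k h.
exact: bfun_cut_hi.
Qed.

Section increment.
Variables (H : R -> T -> R) (u v : R) (Iu Iv eta : T -> R) (M c : R).
Hypotheses (u0 : 0 <= u) (uv : u < v).
Hypothesis mH : bimeasurable (fun s w => H (Num.max 0 s) w).
Hypotheses (hu : is_ito_integral P F (W i) H u Iu) (hv : is_ito_integral P F (W i) H v Iv).
Hypotheses (peta : past P W u eta) (etaM : forall w, `|eta w| <= M).
Hypothesis Hc : (tint P `[u, v] (fun s w => (H s w - eta w) ^+ 2)%R <= c%:E)%E.

(** Nothing is known of the integrand at negative times; freezing it there gives a function that is
    jointly measurable on the whole line and agrees with it where it is integrated. *)
Let H' s w := H (Num.max 0 s) w.

Let tint_H' A g : A `<=` `[0, +oo[ ->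
 tint P A (fun s w => (H s w - g s w) ^+ 2) = tint P A (fun s w => (H' s w - g s w) ^+ 2).
Proof.
move=> A0; apply: eq_integral => w _; apply: eq_integral => s /set_mem As.
by have := A0 _ As; rewrite /= in_itv/= andbT => s0; rewrite /H' (max_idPr s0).
Qed.

Let meta : borel eta := past_measurable hW peta.

Let joint_sq (f g : R -> T -> R) : bimeasurable f -> bimeasurable g ->
 bimeasurable (fun s w => (f s w - g s w) ^+ 2).
Proof. by move=> mf mg; apply: measurable_funX; exact: measurable_funB. Qed.

Let D w := Iv w - Iu w - eta w * winc W i u v w.

Let approx (e : R) : 0 < e -> exists X Y : T -> R,
 [/\ L2 P X /\ L2 P Y, (forall w, D w = X w + Y w),
   mean P (fun w => X w ^+ 2) <= e, mean P (fun w => Y w ^+ 2) <= e + 2 * c &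
   forall (z : T -> R) (K : R), past P W u z -> (forall w, `|z w| <= K) ->
    mean P (fun w => z w * Y w) = 0].
Proof.
move=> e0.
(* The mean square of [X] comes out as at most 16 times [dl]. *)
pose dl := e / 32; have dl0 : 0 < dl by rewrite divr_gt0.
have [mIu [phu [adu cu1 cu2]]] := hu; have [mIv [phv [adv cv1 cv2]]] := hv.
have sqI (g : T -> R) : (0 <= \int[P]_w ((g w) ^+ 2)%:E)%E.
 by apply: integral_ge0 => w _; rewrite lee_fin sqr_ge0.
have sqT A (g h : R -> T -> R) : (0 <= tint P A (fun s w => (g s w - h s w) ^+ 2)%R)%E.
 by apply: tint_ge0 => s w; exact: sqr_ge0.
have [ku [hu1 hu2]] : exists k, (tint P `[0%R, u] (fun s w => (H s w - sp_fun (phu k) s w) ^+ 2)%R <= dl%:E)%E /\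
  (\int[P]_w ((Iu w - sp_integral (W i) (phu k) w) ^+ 2)%:E <= dl%:E)%E.
 by apply: cvge0_small2 => //; exact: cu1.
have [kv [hv1 hv2]] : exists k, (tint P `[0%R, v] (fun s w => (H s w - sp_fun (phv k) s w) ^+ 2)%R <= dl%:E)%E /\
  (\int[P]_w ((Iv w - sp_integral (W i) (phv k) w) ^+ 2)%:E <= dl%:E)%E.
 by apply: cvge0_small2 => //; exact: cv1.
set fu := phu ku in hu1 hu2; set fv := phv kv in hv1 hv2.
have {}adu : sp_adapted F u fu by exact: adu.
have {}adv : sp_adapted F v fv by exact: adv.
have sub0 (x y : R) : 0 <= x -> `[x, y] `<=` `[0, +oo[.
 by move=> x0 s /=; rewrite !in_itv/= andbT => /andP[xs _]; exact: le_trans xs.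
rewrite tint_H' in hu1; last exact: sub0.
rewrite tint_H' in hv1; last exact: sub0.
have hc := Hc; rewrite (tint_H' (fun=> eta)) in hc; last exact: sub0.
have ju := sp_joint adu; have jv := sp_joint adv.
have jeta : bimeasurable (fun (s : R) w => eta w).
 by apply: measurableT_comp => //; exact: measurable_snd.
have wfu k : block_wf P W v (@sp_block _ _ _ fu k).
 have [h1 h2 h3 h4 h5] := sp_block_wf hW k adu.
 by split => //; exact: (le_trans h2 (ltW uv)).
pose lo (k : 'I_(sp_size fv) + 'I_(sp_size fu)) : block T R :=
 match k with inl a => cut_lo u (@sp_block _ _ _ fv a) | inr b => bopp (@sp_block _ _ _ fu b) end.
pose hi (k : 'I_(sp_size fv) + unit) : block T R :=
 match k with inl a => cut_hi u (@sp_block _ _ _ fv a) | inr b => (u, v, fun w => - eta w) end.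
have wlo k : block_wf P W v (lo k).
 case: k => k; first by apply: cut_lo_wf => //; exact: sp_block_wf.
 exact: bopp_wf.
have whi k : block_wf P W v (hi k).
 case: k => k; first by apply: cut_hi_wf => //; [exact: ltW|exact: sp_block_wf].
 apply: (@bopp_wf _ _ _ _ _ _ v (u, v, eta)); split => //=; first by rewrite u0 ltW.
 by exists M.
have jL (I : finType) (L : I -> block T R) : (forall k, block_wf P W v (L k)) ->
  bimeasurable (fun s w => bfun_sum L s w ^+ 2).
 move=> wL; apply: measurable_funX; apply: measurable_sum => k.
 by have [_ _ mk _ _] := wL k; exact: bfun_joint.
have flo s w : bfun_sum lo s w = sp_fun fv s w * (s < u)%R%:R - sp_fun fu s w.
 rewrite /lo bfun_sumU (bfun_sum_lo _ _ _ adv); congr (_ + _).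
 by rewrite -bfun_sum_sp /bfun_sum -sumrN; apply: eq_bigr => k _; rewrite bfun_opp.
have fhi s w : bfun_sum hi s w = sp_fun fv s w * (u <= s)%R%:R - eta w * \1_(`[u, v[) s.
 rewrite /hi bfun_sumU (bfun_sum_hi _ _ _ adv); congr (_ + _).
 by rewrite /bfun_sum big_const card_unit /= addr0 /bfun /= mulNr.
pose A w := Iv w - sp_integral (W i) fv w.
pose B w := Iu w - sp_integral (W i) fu w.
have mfv : borel (sp_integral (W i) fv).
 by have [] := sq_bint_sum hW i (fun k => sp_block_wf hW k adv).
have mfu : borel (sp_integral (W i) fu).
 by have [] := sq_bint_sum hW i (fun k => sp_block_wf hW k adu).
have mA : borel A by exact: measurable_funB.
have mB : borel B by exact: measurable_funB.
have [iA eA] := mean_le_integral (measurable_funX 2 mA) (fun w => sqr_ge0 (A w)) hv2.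
have [iB eB] := mean_le_integral (measurable_funX 2 mB) (fun w => sqr_ge0 (B w)) hu2.
have sA : L2 P A by [].
have sB : L2 P B by [].
have slo := sq_bint_sum hW i wlo; have shi := sq_bint_sum hW i whi.
have sqB (x y z : R) : (x - y) ^+ 2 <= 2 * (z - x) ^+ 2 + 2 * (z - y) ^+ 2.
 have -> : x - y = (z - y) - (z - x) by ring.
 have := sqr_ge0 ((z - y) + (z - x)); nra.
have elo : mean P (fun w => bint_sum W i lo w ^+ 2) <= 4 * dl.
 rewrite -lee_fin -(bint_isometry hW i wlo).
 pose f1 s w := 2 * (H' s w - sp_fun fv s w) ^+ 2.
 pose f2 s w := 2 * ((H' s w - sp_fun fu s w) ^+ 2 * \1_(`[0, u]) s).
 have j1 : bimeasurable f1 by apply: measurable_funM => //; exact: joint_sq.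
 have j2' : bimeasurable (fun s w => (H' s w - sp_fun fu s w) ^+ 2 * \1_(`[0, u]) s).
  by apply: joint_restrict => //; exact: joint_sq.
 have j2 : bimeasurable f2 by exact: measurable_funM.
 have f10 s w : 0 <= f1 s w by rewrite mulr_ge0// sqr_ge0.
 have f20 s w : 0 <= f2 s w by rewrite mulr_ge0// mulr_ge0// sqr_ge0.
 apply: (@le_trans _ _ (tint P `[0, v] (fun s w => f1 s w + f2 s w)%R)).
  apply: tint_le => //; first exact: jL.
  - exact: measurable_funD.
  - by move=> s w; exact: sqr_ge0.
  - move=> s w; rewrite /= in_itv/= => /andP[s0 _]; rewrite flo /f1 /f2.
   case: ltP => su.
    by rewrite mulr1 indicE mem_set ?mulr1 ?sqB//= in_itv/= s0 ltW.
   rewrite (sp_fun_out _ adu su) mulr0 subrr expr0n/=; apply: addr_ge0.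
    by rewrite mulr_ge0// sqr_ge0.
   by rewrite mulr_ge0// mulr_ge0// sqr_ge0.
  - by move=> s w; exact: addr_ge0.
 rewrite tintD// tintZ//; [|exact: joint_sq|by move=> s w; exact: sqr_ge0].
 rewrite tintZ//; last by move=> s w; rewrite mulr_ge0// sqr_ge0.
 rewrite -tint_restrict//; last first.
  by move=> s /=; rewrite !in_itv/= => /andP[-> su] /=; rewrite (le_trans su)// ltW.
 apply: (@le_trans _ _ (2%:E * dl%:E + 2%:E * dl%:E)%E).
  by apply: leeD; apply: lee_wpmul2l => //.
 by rewrite -!EFinM -EFinD lee_fin; lra.
have ehi : mean P (fun w => bint_sum W i hi w ^+ 2) <= 2 * dl + 2 * c.
 rewrite -lee_fin -(bint_isometry hW i whi).
 pose f1 s w := 2 * (H' s w - sp_fun fv s w) ^+ 2.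
 pose f2 s w := 2 * ((H' s w - eta w) ^+ 2 * \1_(`[u, v]) s).
 have j1 : bimeasurable f1 by apply: measurable_funM => //; exact: joint_sq.
 have j2' : bimeasurable (fun s w => (H' s w - eta w) ^+ 2 * \1_(`[u, v]) s).
  by apply: joint_restrict => //; exact: joint_sq.
 have j2 : bimeasurable f2 by exact: measurable_funM.
 have f10 s w : 0 <= f1 s w by rewrite mulr_ge0// sqr_ge0.
 have f20 s w : 0 <= f2 s w by rewrite mulr_ge0// mulr_ge0// sqr_ge0.
 apply: (@le_trans _ _ (tint P `[0, v] (fun s w => f1 s w + f2 s w)%R)).
  apply: tint_le => //; first exact: jL.
  - exact: measurable_funD.
  - by move=> s w; exact: sqr_ge0.
  - move=> s w; rewrite /= in_itv/= => /andP[s0 sv]; rewrite fhi /f1 /f2.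
   case: (leP u s) => us; last first.
    rewrite mulr0 [\1_(`[u, v[) s]indicE memNset; last first.
     by rewrite /= in_itv/= leNgt us.
    by rewrite mulr0 subrr expr0n/=; apply: addr_ge0; [exact: f10|exact: f20].
   rewrite mulr1 [\1_(`[u, v]) s]indicE mem_set; last by rewrite /= in_itv/= us.
   rewrite mulr1; have [sv'|vs] := ltP s v.
    by rewrite indicE mem_set ?mulr1 ?sqB//= in_itv/= us.
   rewrite (sp_fun_out _ adv vs) indicE memNset; last first.
    by rewrite /= in_itv/= us ltNge vs.
   by rewrite mulr0 subrr expr0n/=; apply: addr_ge0; rewrite mulr_ge0// sqr_ge0.
  - by move=> s w; exact: addr_ge0.
 rewrite tintD// tintZ//; [|exact: joint_sq|by move=> s w; exact: sqr_ge0].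
 rewrite tintZ//; last by move=> s w; rewrite mulr_ge0// sqr_ge0.
 rewrite -tint_restrict//; last first.
  by move=> s /=; rewrite !in_itv/= => /andP[us ->]; rewrite (le_trans u0).
 apply: (@le_trans _ _ (2%:E * dl%:E + 2%:E * c%:E)%E).
  by apply: leeD; apply: lee_wpmul2l => //.
 by rewrite -!EFinM -EFinD lee_fin.
exists (fun w => (A w - B w) + bint_sum W i lo w), (bint_sum W i hi); split.
- by split => //; apply: L2D => //; exact: L2B.
- move=> w; rewrite /D /A /B /lo /hi !bint_sumU.
 have -> : sp_integral (W i) fv w = \sum_k bint W i (cut_lo u (@sp_block _ _ _ fv k)) w +
   \sum_k bint W i (cut_hi u (@sp_block _ _ _ fv k)) w.
  by rewrite -big_split /= -bint_sum_sp; apply: eq_bigr => k _; exact: bint_cut.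
 have -> : sp_integral (W i) fu w = - \sum_k bint W i (bopp (@sp_block _ _ _ fu k)) w.
  by rewrite -sumrN -bint_sum_sp; apply: eq_bigr => k _; rewrite bint_opp opprK.
 rewrite /bint_sum [\sum_(k : unit) _]big_const card_unit /= addr0 /bint /=.
 by ring.
- apply: (le_trans (mean_sqD_le (L2B sA sB) slo)).
 have := mean_sqD_le sA (L2N sB).
 have -> : mean P (fun w => (- B w) ^+ 2) = mean P (fun w => B w ^+ 2).
  by congr mean; apply/funext => w; rewrite sqrrN.
 have := eA; have := eB; rewrite -/A -/B /dl in elo *; lra.
- by apply: (le_trans ehi); rewrite /dl; lra.
move=> z K pz zK; have mz := past_measurable hW pz.
under eq_fun do rewrite /bint_sum mulr_sumr.
rewrite mean_sum => [|k]; last first.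
 by apply: sq_L1; apply: (L2_mull mz zK); exact: sq_bint (whi k).
apply: big1 => k _; apply: (bint_past_mean0 hW i (whi k) _ pz zK).
by case: k => [k|k] //=; rewrite le_max lexx orbT.
Qed.

(** Both conclusions are limits of [approx]. The constant 4 is the product of two factors 2 from (a
    + b)^2 <= 2 a^2 + 2 b^2, one inside [approx] and one for the sum of [X] and [Y]. *)
Lemma ito_increment :
 [/\ L2 P D, mean P (fun w => D w ^+ 2) <= 4 * c &
   forall (z : T -> R) (K : R), past P W u z -> (forall w, `|z w| <= K) ->
    mean P (fun w => z w * D w) = 0].
Proof.
have [X [Y [[sX sY] DE _ _ _]]] := approx ltr01.
have sD : L2 P D.
 by rewrite (_ : D = fun w => X w + Y w); [exact: L2D|exact/funext].
split => //.
 apply: mean_le_eps => e e0.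
 have [|X' [Y' [[sX' sY'] DE' eX eY _]]] := @approx (e / 4); first by rewrite divr_gt0.
 have -> : mean P (fun w => D w ^+ 2) = mean P (fun w => (X' w + Y' w) ^+ 2).
  by congr mean; apply/funext => w; rewrite DE'.
 apply: (le_trans (mean_sqD_le sX' sY')); lra.
move=> z K pz zK; have mz := past_measurable hW pz.
apply/eqP; rewrite -normr_le0; apply: mean_le_eps => e e0; rewrite add0r.
(* Young's inequality K |X| <= a K^2 / 2 + X^2 / (2 a): with this [a] and a mean square of [X] of at
   most a e, each of the two terms is at most e / 2. *)
pose a := e / (K ^+ 2 + 1).
have k1 : 0 < K ^+ 2 + 1 by have := sqr_ge0 K; lra.
have a0 : 0 < a by rewrite divr_gt0.
have [|X' [Y' [[sX' sY'] DE' eX _ zY]]] := @approx (a * e); first by rewrite mulr_gt0.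
have iz (f : T -> R) : L2 P f -> L1 P (fun w => z w * f w).
 by move=> sf; apply: sq_L1; exact: (L2_mull mz zK).
have -> : mean P (fun w => z w * D w) = mean P (fun w => z w * X' w).
 under eq_fun do rewrite DE' mulrDr.
 by rewrite meanD ?iz// (zY z K)// addr0.
have iQ : L1 P (fun w => a / 2 * K ^+ 2 + (2 * a)^-1 * X' w ^+ 2).
 by apply: L1D; [exact: L1_cst|apply: L1Z; case: sX'].
apply: (le_trans (norm_mean_le (iz _ sX') iQ _)).
 move=> w; rewrite normrM.
 apply: (@le_trans _ _ (K * `|X' w|)); first by rewrite ler_wpM2r.
 rewrite -(real_normK (num_real (X' w))).
 have h := sqr_ge0 (a * K - `|X' w|).
 rewrite -subr_ge0.
 have -> : a / 2 * K ^+ 2 + (2 * a)^-1 * `|X' w| ^+ 2 - K * `|X' w| =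
   (2 * a)^-1 * (a * K - `|X' w|) ^+ 2 by field; rewrite gt_eqF.
 by rewrite mulr_ge0// invr_ge0 mulr_ge0// ltW.
rewrite meanD; [|exact: L1_cst|by apply: L1Z; case: sX'].
rewrite mean_cst meanZ; last by case: sX'.
apply: (@le_trans _ _ (a / 2 * K ^+ 2 + (2 * a)^-1 * (a * e))).
 by rewrite lerD2l ler_wpM2l// invr_ge0 mulr_ge0// ltW.
have -> : (2 * a)^-1 * (a * e) = e / 2 by field; rewrite gt_eqF.
have : a * K ^+ 2 <= e.
 by rewrite /a mulrAC ler_pdivrMr// ler_pM2l// lerDl.
by lra.
Qed.

End increment.
End ito_increments.

Section joint_measurability.
Context d (T : measurableType d) (R : realType).

Let grid (N : nat) (s : R) : nat := Num.truncn (Num.max 0 s * N.+1%:R).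

Let grid_cvg (s : R) : (fun N => (grid N s)%:R / N.+1%:R : R) @ \oo --> Num.max 0 s.
Proof.
have s0 : 0 <= Num.max 0 s by rewrite le_max lexx.
apply/cvgrPdist_le => e e0; near=> N.
have N0 : 0 < N.+1%:R :> R by rewrite ltr0n.
have := truncn_itv (mulr_ge0 s0 (ltW N0)); rewrite -/(grid N s) => /andP[h1 h2].
have h3 : (grid N s)%:R / N.+1%:R <= Num.max 0 s by rewrite ler_pdivrMr.
rewrite ger0_norm ?subr_ge0// lerBlDr.
have h4 : Num.max 0 s <= N.+1%:R^-1 + (grid N s)%:R / N.+1%:R.
 rewrite -[X in X + _]mul1r -mulrDl ler_pdivlMr// -(natrD _ 1%N) add1n; exact: ltW.
apply: (le_trans h4); rewrite lerD2r -[e]invrK lef_pV2 ?posrE ?invr_gt0//.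
apply: (@le_trans _ _ N%:R); last by rewrite ler_nat.
near: N; exact: nbhs_infty_ger.
Unshelve. all: end_near. Qed.

(** The process is the pointwise limit of its values at the grid points to the left, and these
    approximations are measurable because they are constant in time between grid points. *)
Lemma joint_continuous (Z : R -> T -> R) :
 (forall s, 0 <= s -> borel (Z s)) ->
 (forall w, {within `[0, +oo[, continuous (Z ^~ w)}) ->
 bimeasurable (fun s w => Z (Num.max 0 s) w).
Proof.
move=> mZ cZ.
apply: (@measurable_fun_cvg _ (measurableTypeR R * T)%type R setT
 (fun N p => Z ((grid N p.1)%:R / N.+1%:R) p.2)); last first.
 move=> -[s w] _ /=; apply: (within_continuous_seq (cZ w)) => //.
 by rewrite le_max lexx.
move=> N _ B mB; rewrite setTI.
have mg : measurable_fun [set: measurableTypeR R] (fun s : measurableTypeR R => Num.max 0 s * N.+1%:R).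
 by apply: measurable_funM => //; exact: measurable_maxr.
rewrite (_ : _ @^-1` _ = \bigcup_k
  ((fun s : measurableTypeR R => Num.max 0 s * N.+1%:R) @^-1` `[k%:R, k.+1%:R[ `*`
   (Z (k%:R / N.+1%:R) @^-1` B))); last first.
 apply/seteqP; split => [[s w] /= ZB|[s w] [k _ [/= h ZB]]].
  exists (grid N s) => //; split => //=; rewrite in_itv/=; apply: truncn_itv.
  by rewrite mulr_ge0// le_max lexx.
 have -> : grid N s = k by apply: truncn_def; move: h; rewrite in_itv.
 exact: ZB.
apply: bigcup_measurable => k _; apply: measurableX.
 by rewrite -[X in measurable X]setTI; apply: mg.
by rewrite -[X in measurable X]setTI; apply: mZ => //; rewrite divr_ge0.
Qed.

End joint_measurability.

Section jensen.
Variable R : realType.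

Lemma lebesgue_itv_oc (u v : R) : u < v -> (@lebesgue_measure R) `]u, v]%classic = (v - u)%:E.
Proof. by move=> uv; rewrite lebesgue_measure_itv/= lte_fin uv -EFinB. Qed.

Lemma integrable_cst_oc (u v c : R) : u < v ->
 (@lebesgue_measure R).-integrable `]u, v] (EFin \o cst c).
Proof.
move=> uv; apply/integrableP; split; first exact/measurable_EFinP.
under eq_integral do rewrite /=.
by rewrite integral_cst//= [X in (_ * X)%E](lebesgue_itv_oc uv) -EFinM ltry.
Qed.

Lemma bounded_integrable_oc (u v : R) (g : R -> R) (L : R) : u < v ->
 measurable_fun [set: measurableTypeR R] g ->
 (forall s, `]u, v]%classic s -> `|g s| <= L) ->
 (@lebesgue_measure R).-integrable `]u, v] (EFin \o g).
Proof.
move=> uv mg gL; apply: (le_integrable _ _ _ (integrable_cst_oc L uv)).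
- exact: measurable_itv.
- by apply/measurable_EFinP; exact: measurable_funTS.
- by move=> s Ds; rewrite /= lee_fin (le_trans (gL s Ds))// ler_norm.
Qed.

(** Expanding the integral of the square of [f] minus its average, which is nonnegative, gives the
    inequality. *)
Lemma Rintegral_sq_le (u v : R) (f : R -> R) (K : R) : u < v ->
 measurable_fun [set: measurableTypeR R] f ->
 (forall s, `]u, v]%classic s -> `|f s| <= K) ->
 (((\int[lebesgue_measure]_(s in `]u, v]) f s) ^+ 2)%:E <=
  (v - u)%:E * \int[lebesgue_measure]_(s in `]u, v]) (f s ^+ 2)%:E)%E.
Proof.
move=> uv mf fK; set h := v - u; have h0 : 0 < h by rewrite subr_gt0.
have mD : measurable (`]u, v] : set (measurableTypeR R)) by exact: measurable_itv.
have lD := lebesgue_itv_oc uv; rewrite -/h in lD.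
have ic c := integrable_cst_oc c uv.
have i1 := bounded_integrable_oc uv mf fK.
have i2 : (@lebesgue_measure R).-integrable `]u, v] (EFin \o (fun s => f s ^+ 2)).
 apply: (@bounded_integrable_oc _ _ _ (K ^+ 2)) => //; first exact: measurable_funX.
 by move=> s Ds; rewrite normrX lerXn2r ?nnegrE ?fK// (le_trans _ (fK s Ds)).
set m := \int[lebesgue_measure]_(s in `]u, v]) f s.
set q := (\int[lebesgue_measure]_(s in `]u, v]) (f s ^+ 2)%:E)%E.
have qE : q = (\int[lebesgue_measure]_(s in `]u, v]) (f s ^+ 2))%:E.
 by rewrite /Rintegral fineK//; exact: (integrable_fin_num mD i2).
rewrite qE -EFinM lee_fin.
have : 0 <= \int[lebesgue_measure]_(s in `]u, v]) ((f s - m / h) ^+ 2).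
 by apply: Rintegral_ge0 => s _; exact: sqr_ge0.
have -> : (fun s => (f s - m / h) ^+ 2) =
  (fun s => f s ^+ 2 + ((- 2 * (m / h)) * f s + (m / h) ^+ 2)).
 by apply/funext => s; ring.
have i3 : (@lebesgue_measure R).-integrable `]u, v] (EFin \o (fun s => (- 2 * (m / h)) * f s)).
 exact: (integrableZl mD _ i1).
rewrite (RintegralD mD i2 (integrableD mD i3 (ic _))) (RintegralD mD i3 (ic _)) (RintegralZl _ mD i1).
have cE c : \int[lebesgue_measure]_(s in `]u, v]) (cst c s) = c * h.
 have e := @integral_cst _ _ _ (@lebesgue_measure R) _ mD c%:E.
 rewrite [X in (_ * X)%E]lD -EFinM in e.
 by rewrite /Rintegral; transitivity (fine (c * h)%:E) => //; congr fine; exact: e.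
rewrite (cE ((m / h) ^+ 2)) -/m; set Q := \int[_]_(s in _) _.
have -> : - 2 * (m / h) * m + (m / h) ^+ 2 * h = - (m ^+ 2 / h) by field; rewrite gt_eqF.
by rewrite subr_ge0 ler_pdivrMr// mulrC.
Qed.

End jensen.

(** * Increments of a strong solution *)

Section solution_increment.
Context d (T : measurableType d) (R : realType) (P : probability T R).
Variables (n : nat) (W : 'I_n -> R -> T -> R).
Hypothesis hW : standard_brownian_motion P W.
Variables (b : n.-tuple R -> 'cV[R]_n) (C : n.-tuple R -> 'M[R]_n) (K : R).
Hypothesis mb : forall k, borel (fun x => b x k ord0).
Hypothesis mC : forall k j, borel (fun x => C x k j).

Definition sqdist (x y : n.-tuple R) : R := \sum_(k < n) (tnth x k - tnth y k) ^+ 2.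

Hypothesis K0 : 0 <= K.
Hypothesis bK : forall k x, @simplex R n x -> `|b x k ord0| <= K.
Hypothesis CK : forall k j x, @simplex R n x -> `|C x k j| <= K.
Hypothesis bL : forall k x y, @simplex R n x -> @simplex R n y ->
 (b x k ord0 - b y k ord0) ^+ 2 <= K * sqdist x y.
Hypothesis CL : forall k j x y, @simplex R n x -> @simplex R n y ->
 (C x k j - C y k j) ^+ 2 <= K * sqdist x y.
Variables (x0 : n.-tuple R) (X : R -> T -> n.-tuple R).
Hypothesis hX : strong_solution P W b C x0 X.

Lemma solution_past s : 0 <= s -> past P W s (X s).
Proof. by move=> s0 B mB; exact: (sol_adapted hX). Qed.

Lemma measurable_solution s : 0 <= s -> borel (X s).
Proof. by move=> s0; exact: (past_measurable hW (solution_past s0)). Qed.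

Lemma joint_solution (f : n.-tuple R -> R) : borel f ->
 bimeasurable (fun s w => f (X (Num.max 0 s) w)).
Proof.
move=> mf; have mX : measurable_fun [set: measurableTypeR R * T]
  (fun p => X (Num.max 0 p.1) p.2).
 apply/measurable_fun_tnthP => k.
 apply: (@joint_continuous _ T R (fun s w => tnth (X s w) k)).
  by move=> s s0; apply: measurableT_comp (measurable_tnth k) (measurable_solution s0).
 by move=> w; exact: (@sol_continuous _ _ _ _ _ _ _ _ _ _ hX k w).
exact: (measurableT_comp mf mX).
Qed.

Let simX s w : 0 <= s -> simplex (X s w) := @sol_state _ _ _ _ _ _ _ _ _ _ hX s w.

Definition drift_part (k : 'I_n) (u v : R) (w : T) : R :=
 \int[lebesgue_measure]_(s in `]u, v]) b (X s w) k ord0.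

Lemma drift_partE k u v w : 0 <= u -> u < v ->
 \int[lebesgue_measure]_(s in `[0, v]) b (X s w) k ord0 =
 \int[lebesgue_measure]_(s in `[0, u]) b (X s w) k ord0 + drift_part k u v w.
Proof.
move=> u0 uv; have E : `[0, v]%classic = `[0, u]%classic `|` `]u, v]%classic :> set R.
 apply/seteqP; split => s /=; rewrite !in_itv/=.
  by move=> /andP[h1 h2]; case: (leP s u) => h; [left; rewrite h1|right; rewrite h2].
 move=> [/andP[h1 h2]|/andP[h1 h2]]; first by rewrite h1 (le_trans h2)// ltW.
 by rewrite h2 andbT (le_trans u0)// ltW.
rewrite E Rintegral_setU//.
- rewrite -E; apply/integrableP.
 have mf : measurable_fun `[0, v]%classic (fun s : measurableTypeR R => b (X s w) k ord0).
  apply: (@eq_measurable_fun _ _ _ _ _ (fun s : measurableTypeR R => b (X (Num.max 0 s) w) k ord0)).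
   by move=> s /set_mem; rewrite /= in_itv/= => /andP[s0 _]; rewrite (max_idPr s0).
  by apply: measurable_funTS; exact: (joint_slice w (joint_solution (mb k))).
 split; first exact/measurable_EFinP.
 apply: (@le_lt_trans _ _ (\int[lebesgue_measure]_(s in `[0%R, v]) (cst K%:E s))%E).
  apply: ge0_le_integral => //.
  + by apply: measurableT_comp => //; exact/measurable_EFinP.
  + move=> s; rewrite /= in_itv/= => /andP[s0 _]; rewrite lee_fin.
   by apply: bK; exact: simX.
 rewrite integral_cst//= lebesgue_measure_itv/= lte_fin (le_lt_trans u0 uv) -EFinB -EFinM.
 exact: ltry.
- apply/eqP/seteqP; split => // s /= []; rewrite !in_itv/= => /andP[_ h1] /andP[h2 _].
 by move: h2; rewrite ltNge h1.
Qed.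

Lemma tint_le_mean (u v c : R) (f : R -> T -> R) : u < v -> 0 <= c -> bimeasurable f ->
 (forall s w, 0 <= f s w) ->
 (forall s, u <= s -> s <= v -> (\int[P]_w (f s w)%:E <= c%:E)%E) ->
 (tint P `[u, v] f <= (c * (v - u))%:E)%E.
Proof.
move=> uv c0 mf f0 fc; rewrite (tint_swap P (measurable_itv _) mf f0).
apply: (@le_trans _ _ (\int[lebesgue_measure]_(s in `[u, v]) (cst c%:E s))%E).
 apply: ge0_le_integral => //.
 - by move=> s _; apply: integral_ge0 => w _; rewrite lee_fin.
 - apply: measurable_funTS.
  have mg : measurable_fun [set: measurableTypeR R * T] (fun p => (f p.1 p.2)%:E).
   exact/measurable_EFinP.
  rewrite (_ : (fun s => _) = fubini_F P (fun p : measurableTypeR R * T => (f p.1 p.2)%:E))//.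
  by apply: measurable_fun_fubini_tonelli_F => // p; rewrite lee_fin.
 - by move=> s; rewrite /= in_itv/= => /andP[h1 h2]; exact: fc.
by rewrite integral_cst//= lebesgue_measure_itv/= lte_fin uv -EFinB.
Qed.

Lemma tint_max A (f : n.-tuple R -> T -> R) : A `<=` `[0, +oo[ ->
 tint P A (fun s w => f (X s w) w) = tint P A (fun s w => f (X (Num.max 0 s) w) w).
Proof.
move=> A0; apply: eq_integral => w _; apply: eq_integral => s /set_mem As.
by have := A0 _ As; rewrite /= in_itv/= andbT => s0; rewrite (max_idPr s0).
Qed.

Lemma drift_bound (u v c L : R) (f : R -> T -> R) (Q : T -> R) : u < v ->
 borel Q -> bimeasurable f ->
 (forall s w, `]u, v]%classic s -> `|f s w| <= L) ->
 {ae P, forall w, Q w = \int[lebesgue_measure]_(s in `]u, v]) f s w} ->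
 (tint P `]u, v] (fun s w => f s w ^+ 2)%R <= c%:E)%E ->
 L2 P Q /\ mean P (fun w => Q w ^+ 2) <= (v - u) * c.
Proof.
move=> uv mQ mf fL Qf fc.
have mf2 : bimeasurable (fun s w => f s w ^+ 2) by exact: measurable_funX.
have f20 s w : 0 <= f s w ^+ 2 by exact: sqr_ge0.
have mi := measurable_tint_inner (A := `]u, v]) (measurable_itv _) mf2 f20.
have h0 : 0 <= v - u by rewrite subr_ge0 ltW.
have [] := @mean_le_integral _ _ _ P (fun w => Q w ^+ 2) ((v - u) * c) (measurable_funX 2 mQ).
- by move=> w; exact: sqr_ge0.
- apply: (@le_trans _ _ (\int[P]_w ((v - u)%:E * \int[lebesgue_measure]_(s in `]u, v]) (f s w ^+ 2)%:E))%E).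
  apply: ae_ge0_le_integral => //.
  + by move=> w _; rewrite lee_fin sqr_ge0.
  + by apply/measurable_EFinP; exact: measurable_funX.
  + by move=> w _; apply: mule_ge0 => //; apply: integral_ge0 => s _; rewrite lee_fin.
  + exact: measurable_funeM.
  + apply: filterS Qf => w -> _.
   by apply: (@Rintegral_sq_le _ u v (f ^~ w) L) => //; [exact: joint_slice|move=> s; exact: fL].
 rewrite ge0_integralZl//; last first.
  by move=> w _; apply: integral_ge0 => s _; rewrite lee_fin.
 by rewrite EFinM lee_wpmul2l.
by move=> i m; split.
Qed.

Lemma solution_difference u v : 0 <= u -> u < v ->
 exists Iu Iv : 'I_n -> 'I_n -> T -> R,
 [/\ forall k j, is_ito_integral P (brownian_filtration P W) (W j)
    (fun s w => C (X s w) k j) u (Iu k j),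
   forall k j, is_ito_integral P (brownian_filtration P W) (W j)
    (fun s w => C (X s w) k j) v (Iv k j) &
   {ae P, forall w, forall k, tnth (X v w) k - tnth (X u w) k -
     \sum_(j < n) (Iv k j w - Iu k j w) = drift_part k u v w}].
Proof.
move=> u0 uv; have v0 : 0 <= v by rewrite (le_trans u0)// ltW.
have [Iu hu eu] := sol_equation hX u0; have [Iv hv ev] := sol_equation hX v0.
exists Iu, Iv; split => //.
apply: filterS2 eu ev => w hu' hv' k.
by rewrite hu' hv' (drift_partE _ _ u0 uv) sumrB; ring.
Qed.

Let joint_C k j : bimeasurable (fun s w => C (X (Num.max 0 s) w) k j).
Proof. exact: (joint_solution (mC k j)). Qed.

Let mX1 s k : 0 <= s -> borel (fun w => tnth (X s w) k).
Proof. by move=> s0; apply: measurableT_comp (measurable_tnth k) (measurable_solution s0). Qed.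

Let tint_oc (u v : R) (f : R -> T -> R) : bimeasurable f -> (forall s w, 0 <= f s w) ->
 (tint P `]u, v] f <= tint P `[u, v] f)%E.
Proof.
move=> mf f0; rewrite (@tint_restrict _ _ _ _ `]u, v] `[u, v])//; last first.
 by move=> s; rewrite /= !in_itv/= => /andP[h ->]; rewrite ltW.
apply: tint_le => //.
- exact: joint_restrict.
- by move=> s w; rewrite mulr_ge0.
- by move=> s w _; rewrite ler_piMr// indicE; case: (_ \in _).
Qed.

Let max0_ge0 (s : R) : 0 <= Num.max 0 s.
Proof. by rewrite le_max lexx. Qed.

(** 2 K^2 comes from the drift and 8 n^2 K^2 from the n stochastic integrals, each of which is
    bounded by [ito_increment] with frozen integrand 0. *)
Definition increment_const : R := 2 * K ^+ 2 + 8 * n%:R ^+ 2 * K ^+ 2.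

Lemma increment_const_ge0 : 0 <= increment_const.
Proof. by rewrite addr_ge0 ?mulr_ge0 ?sqr_ge0. Qed.

Lemma solution_sq_increment k u v : 0 <= u -> u < v -> v - u <= 1 ->
 mean P (fun w => (tnth (X v w) k - tnth (X u w) k) ^+ 2) <= increment_const * (v - u).
Proof.
move=> u0 uv h1; have v0 : 0 <= v by rewrite (le_trans u0)// ltW.
have h0 : 0 < v - u by rewrite subr_gt0.
have [Iu [Iv [hu hv e]]] := solution_difference u0 uv.
have sub0 : `[u, v] `<=` `[0, +oo[.
 by move=> s /=; rewrite !in_itv/= andbT => /andP[us _]; exact: le_trans us.
have K20 : 0 <= K ^+ 2 by exact: sqr_ge0.
have hD j : L2 P (fun w => Iv k j w - Iu k j w) /\
  mean P (fun w => (Iv k j w - Iu k j w) ^+ 2) <= 4 * (K ^+ 2 * (v - u)).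
 have hc : (tint P `[u, v] (fun s w => (C (X s w) k j - (fun=> 0) w) ^+ 2)%R <= (K ^+ 2 * (v - u))%:E)%E.
  rewrite (tint_max (fun x w => (C x k j - 0) ^+ 2))//; apply: tint_le_mean => //.
  - by apply: measurable_funX; apply: measurable_funB => //; exact: joint_C.
  - by move=> s w; exact: sqr_ge0.
  move=> s us sv; apply: (@le_trans _ _ (\int[P]_w (cst (K ^+ 2)%:E w))%E).
   apply: ge0_le_integral => //.
   + by move=> w _; rewrite lee_fin sqr_ge0.
   + apply/measurable_EFinP; apply: measurable_funX; apply: measurable_funB => //.
    by apply: measurableT_comp (mC k j) (measurable_solution _).
   + move=> w _; rewrite lee_fin subr0 -real_normK ?num_real//.
    by rewrite lerXn2r ?nnegrE// CK//; exact: simX.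
  by rewrite integral_cst// [X in (_ * X)%E](_ : _ = 1%E) ?mule1//; exact: probability_setT.
 have p0 : past P W u (fun=> 0 : R) by exact: past_cst.
 have n0 (w : T) : `|0 : R| <= 0 by rewrite normr0.
 have [sD eD _] := @ito_increment _ _ _ _ _ _ hW j (fun s w => C (X s w) k j) u v (Iu k j) (Iv k j)
  (fun=> 0) 0 _ u0 uv (joint_C k j) (hu k j) (hv k j) p0 n0 hc.
 move: sD eD; under eq_fun do rewrite mul0r subr0.
 by under [X in mean P X]eq_fun do rewrite mul0r subr0.
pose Q w := tnth (X v w) k - tnth (X u w) k - \sum_(j < n) (Iv k j w - Iu k j w).
have sS : L2 P (fun w => \sum_(j < n) (Iv k j w - Iu k j w)).
 by apply: L2_sum => j; exact: (hD j).1.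
have mQ : borel Q.
 by apply: measurable_funB; [apply: measurable_funB; exact: mX1|case: sS].
have jb := joint_solution (mb k).
have [|||sQ eQ] := @drift_bound u v (K ^+ 2 * (v - u)) K (fun s w => b (X (Num.max 0 s) w) k ord0) Q uv mQ jb.
- by move=> s w _; apply: bK; exact: simX.
- apply: filterS e => w h; rewrite /Q h /drift_part.
 apply: eq_Rintegral => s /set_mem; rewrite /= in_itv/= => /andP[us _].
 by rewrite (max_idPr _)// (le_trans u0)// ltW.
- apply: (le_trans (tint_oc _ _ _ _)).
 + exact: measurable_funX.
 + by move=> s w; exact: sqr_ge0.
 apply: tint_le_mean => //; first exact: measurable_funX.
  by move=> s w; exact: sqr_ge0.
 move=> s us sv; apply: (@le_trans _ _ (\int[P]_w (cst (K ^+ 2)%:E w))%E).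
  apply: ge0_le_integral => //.
  + by move=> w _; rewrite lee_fin sqr_ge0.
  + apply/measurable_EFinP; apply: measurable_funX.
   by apply: measurableT_comp (mb k) (measurable_solution _).
  + move=> w _; rewrite lee_fin -real_normK ?num_real//.
   by rewrite lerXn2r ?nnegrE// bK//; exact: simX.
 by rewrite integral_cst// [X in (_ * X)%E](_ : _ = 1%E) ?mule1//; exact: probability_setT.
have -> : (fun w => (tnth (X v w) k - tnth (X u w) k) ^+ 2) =
  (fun w => (Q w + \sum_(j < n) (Iv k j w - Iu k j w)) ^+ 2).
 by apply/funext => w; rewrite /Q subrK.
apply: (le_trans (mean_sqD_le sQ sS)).
have := mean_sq_sum_le (fun j => (hD j).1) (fun j => (hD j).2) => eS.
have : (v - u) * (K ^+ 2 * (v - u)) <= K ^+ 2 * (v - u).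
 by rewrite ler_piMl// mulr_ge0// ltW.
rewrite /increment_const; have := eQ; lra.
Qed.

Let simplex_bound x k : @simplex R n x -> `|tnth x k| <= 1.
Proof. by move=> [h _]; have /andP[h0 h1] := h k; rewrite ger0_norm. Qed.

Lemma sq_solution s k : 0 <= s -> L2 P (fun w => tnth (X s w) k).
Proof.
by move=> s0; apply: (L2_bounded P (M := 1)) => [|w]; [exact: mX1|apply/simplex_bound/simX].
Qed.

Lemma mean_sqdist u v : 0 <= u -> u <= v -> v - u <= 1 ->
 L1 P (fun w => sqdist (X v w) (X u w)) /\
 mean P (fun w => sqdist (X v w) (X u w)) <= n%:R * increment_const * (v - u).
Proof.
move=> u0 uv h1; have v0 : 0 <= v by exact: le_trans uv.
have i k : L1 P (fun w => (tnth (X v w) k - tnth (X u w) k) ^+ 2).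
 by have [] := L2B (sq_solution k v0) (sq_solution k u0).
split; first exact: L1_sum.
rewrite mean_sum//; apply: (@le_trans _ _ (\sum_(k < n) increment_const * (v - u))).
 apply: ler_sum => k _; move: uv; rewrite le_eqVlt => /orP[/eqP <-|uv].
  rewrite subrr mulr0 (_ : (fun w => _) = fun=> 0) ?mean_cst//.
  by apply/funext => w; rewrite subrr expr0n.
 exact: solution_sq_increment.
by rewrite sumr_const card_ord -mulrA [leRHS]mulr_natl.
Qed.

Let lip_integral (g : n.-tuple R -> R) u v s :
 borel g ->
 (forall x y, @simplex R n x -> @simplex R n y -> (g x - g y) ^+ 2 <= K * sqdist x y) ->
 0 <= u -> u < v -> v - u <= 1 -> u <= s -> s <= v ->
 (\int[P]_w ((g (X (Num.max 0 s) w) - g (X u w)) ^+ 2)%:E <=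
   (K * (n%:R * increment_const * (v - u)))%:E)%E.
Proof.
move=> mg gL u0 uv h1 us sv.
have s0 : 0 <= s by exact: le_trans us.
have [i m] := mean_sqdist u0 us (le_trans (lerB sv (lexx u)) h1).
rewrite (max_idPr s0).
apply: (@le_trans _ _ (\int[P]_w (K * sqdist (X s w) (X u w))%:E)%E).
 apply: ge0_le_integral => //.
 - by move=> w _; rewrite lee_fin sqr_ge0.
 - apply/measurable_EFinP; apply: measurable_funX; apply: measurable_funB.
   by apply: measurableT_comp mg (measurable_solution _).
  by apply: measurableT_comp mg (measurable_solution _).
 - by apply/measurable_EFinP; exact: measurable_L1 (L1Z K i).
 - by move=> w _; rewrite lee_fin; apply: gL; exact: simX.
rewrite (meanE (L1Z K i)) lee_fin meanZ// ler_wpM2l//; apply: (le_trans m).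
by rewrite ler_wpM2l ?mulr_ge0 ?increment_const_ge0// lerB.
Qed.

(** The last factor bounds the mean square variation of a coefficient along the path, by the
    Lipschitz property and [mean_sqdist]; 4 n^2 comes from the n stochastic integrals and 1 from the
    drift. *)
Definition step_const : R := (4 * n%:R ^+ 2 + 1) * (K * (n%:R * increment_const)).

Lemma step_const_ge0 : 0 <= step_const.
Proof.
by rewrite /step_const mulr_ge0 ?addr_ge0 ?mulr_ge0 ?increment_const_ge0//.
Qed.

(** The remainder of the Euler step is split in two because its parts accumulate differently. [D],
    from the stochastic integrals, is of order h in mean square, too large to be summed naively over
    1 / h steps, but it is orthogonal to the past. [r], from the drift, has no such orthogonality
    but is of order h^(3/2). *)
Lemma solution_step u v : 0 <= u -> u < v -> v - u <= 1 ->
 exists D r : 'I_n -> T -> R, forall k,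
 [/\ (L2 P (D k) /\ L2 P (r k)),
   (forall w, tnth (X v w) k = tnth (X u w) k + (v - u) * b (X u w) k ord0 +
     \sum_(j < n) C (X u w) k j * winc W j u v w + D k w + r k w),
   mean P (fun w => D k w ^+ 2) <= step_const * (v - u) ^+ 2,
   mean P (fun w => r k w ^+ 2) <= step_const * (v - u) ^+ 3 &
   forall (z : T -> R) (L : R), past P W u z -> (forall w, `|z w| <= L) ->
    mean P (fun w => z w * D k w) = 0].
Proof.
move=> u0 uv h1; have v0 : 0 <= v by rewrite (le_trans u0)// ltW.
have h0 : 0 < v - u by rewrite subr_gt0.
have [Iu [Iv [hu hv e]]] := solution_difference u0 uv.
have sub0 : `[u, v] `<=` `[0, +oo[.
 by move=> s /=; rewrite !in_itv/= andbT => /andP[us _]; exact: le_trans us.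
pose c := K * (n%:R * increment_const * (v - u)).
have c0 : 0 <= c by rewrite mulr_ge0// mulr_ge0 ?mulr_ge0 ?increment_const_ge0// ltW.
pose eta k j w := C (X u w) k j.
have peta k j : past P W u (eta k j).
 by apply: (past_comp (mC k j)); exact: solution_past.
have etaK k j w : `|eta k j w| <= K by apply: CK; exact: simX.
have joint_cst (g : T -> R) : borel g -> bimeasurable (fun (s : R) w => g w).
 by move=> mg; apply: measurableT_comp => //; exact: measurable_snd.
have jbu k : bimeasurable (fun (s : R) w => b (X u w) k ord0).
 apply: (joint_cst (fun w => b (X u w) k ord0)).
 exact: measurableT_comp (mb k) (measurable_solution u0).
have hc k j : (tint P `[u, v] (fun s w => (C (X s w) k j - eta k j w) ^+ 2)%R <= (c * (v - u))%:E)%E.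
 rewrite (tint_max (fun x w => (C x k j - eta k j w) ^+ 2))//; apply: tint_le_mean => //.
 - apply: measurable_funX; apply: measurable_funB; first exact: joint_C.
  by apply: joint_cst; exact: (past_measurable hW (peta k j)).
 - by move=> s w; exact: sqr_ge0.
 by move=> s us sv; apply: (lip_integral (g := fun x => C x k j)) => // x y; exact: CL.
pose Dj k j w := Iv k j w - Iu k j w - eta k j w * winc W j u v w.
have hD k j := @ito_increment _ _ _ _ _ _ hW j (fun s w => C (X s w) k j) u v (Iu k j) (Iv k j)
 (eta k j) K _ u0 uv (joint_C k j) (hu k j) (hv k j) (peta k j) (etaK k j) (hc k j).
pose D k w := \sum_(j < n) Dj k j w.
have sDj k j : L2 P (Dj k j) by have [] := hD k j.
have sD k : L2 P (D k) by exact: L2_sum.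
have sW k j : L2 P (fun w => eta k j w * winc W j u v w).
 have [iw _ _] := winc_mean hW j u0 (ltW uv).
 exact: (L2_mull (past_measurable hW (peta k j)) (etaK k j) iw).
have sb k : L2 P (fun w => b (X u w) k ord0).
 apply: (L2_bounded P (M := K)) => [|w]; last by apply: bK; exact: simX.
 by apply: measurableT_comp (mb k) (measurable_solution u0).
pose r k w := tnth (X v w) k - tnth (X u w) k - (v - u) * b (X u w) k ord0 -
 \sum_(j < n) eta k j w * winc W j u v w - D k w.
have sr k : L2 P (r k).
 apply: L2B => //; apply: L2B; last exact: L2_sum.
 apply: L2B; last exact: L2Z.
 by apply: L2B; exact: sq_solution.
exists D, r => k; split.
- by split.
- by move=> w; rewrite /r; ring.
- have := mean_sq_sum_le (sDj k) (c := 4 * (c * (v - u))).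
 move=> /(_ (fun j => let: And3 _ h _ := hD k j in h)) h.
 apply: (le_trans h); rewrite /c /step_const.
 have q0 : 0 <= K * (n%:R * increment_const) * (v - u) ^+ 2.
  by rewrite mulr_ge0 ?sqr_ge0// mulr_ge0// mulr_ge0 ?increment_const_ge0.
 by rewrite -subr_ge0; apply: le_trans q0 _; rewrite le_eqVlt; apply/orP; left; apply/eqP; ring.
- pose f s w := b (X (Num.max 0 s) w) k ord0 - b (X u w) k ord0.
 have jf : bimeasurable f.
  apply: measurable_funB; first exact: (joint_solution (mb k)).
  exact: jbu.
 have [|||_ er] := @drift_bound u v (c * (v - u)) (K + K) f (r k) uv (sr k).1 jf.
 + move=> s w _; rewrite /f; apply: (le_trans (ler_normB _ _)); apply: lerD; apply: bK; exact: simX.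
 + apply: filterS e => w h.
  have -> : r k w = drift_part k u v w - (v - u) * b (X u w) k ord0.
   by rewrite -h /r /D /Dj !sumrB; ring.
  have bi (g : R -> T -> R) : bimeasurable g -> (forall s w, `|g s w| <= K) ->
    (@lebesgue_measure R).-integrable `]u, v] (EFin \o (g ^~ w)).
   move=> jg gK; apply: (@bounded_integrable_oc _ _ _ _ K) => //; exact: joint_slice.
  rewrite /f RintegralB//; last first.
  * apply: (bi (fun s w => b (X u w) k ord0)) => [|s w']; last by apply: bK; exact: simX.
   exact: jbu.
  * apply: (bi (fun s w => b (X (Num.max 0 s) w) k ord0)) => [|s w']; last by apply: bK; exact: simX.
   exact: (joint_solution (mb k)).
  congr (_ - _).
   apply: eq_Rintegral => s /set_mem; rewrite /= in_itv/= => /andP[us _].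
   by rewrite (max_idPr _)// (le_trans u0)// ltW.
  have mD : measurable (`]u, v]%classic : set (measurableTypeR R)) by exact: measurable_itv.
  have e1 := @integral_cst _ _ _ (@lebesgue_measure R) _ mD (b (X u w) k ord0)%:E.
  rewrite [X in (_ * X)%E](lebesgue_itv_oc uv) -EFinM in e1.
  by rewrite mulrC /Rintegral; transitivity (fine (b (X u w) k ord0 * (v - u))%:E) => //; congr fine.
 + have jf2 : bimeasurable (fun s w => f s w ^+ 2) by exact: measurable_funX.
  have f20 s w : 0 <= f s w ^+ 2 by exact: sqr_ge0.
  apply: (le_trans (tint_oc u v jf2 f20)); apply: tint_le_mean => //.
  by move=> s us sv; apply: (lip_integral (g := fun x => b x k ord0)) => // x y; exact: bL.
 apply: (le_trans er); rewrite /c /step_const.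
 have q0 : 0 <= 4 * n%:R ^+ 2 * (K * (n%:R * increment_const) * (v - u) ^+ 3).
  by rewrite !mulr_ge0 ?increment_const_ge0 ?exprn_ge0// ltW.
 by rewrite -subr_ge0; apply: le_trans q0 _; rewrite le_eqVlt; apply/orP; left; apply/eqP; ring.
- move=> z L pz zL; have mz := past_measurable hW pz.
 under eq_fun do rewrite /D mulr_sumr.
 rewrite mean_sum => [|j]; last first.
  by apply: sq_L1; exact: (L2_mull mz zL).
 by apply: big1 => j _; have [_ _ h] := hD k j; exact: h zL.
Qed.

End solution_increment.

(** * The splitting scheme and the weight F *)

Section simplex_lipschitz.
Variables (R : realType) (n : nat).
Implicit Types f g : n.-tuple R -> R.

Definition simplex_lip g (K : R) : Prop :=
 [/\ 0 <= K, (forall x, @simplex R n x -> `|g x| <= K) &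
   forall x y e, @simplex R n x -> @simplex R n y ->
    (forall k, `|tnth x k - tnth y k| <= e) -> `|g x - g y| <= K * e].

Definition nice g := borel g /\ exists K, simplex_lip g K.

Lemma simplex_lipW g K L : K <= L -> simplex_lip g K -> simplex_lip g L.
Proof.
move=> KL [K0 gK gL]; split; first exact: le_trans KL.
 by move=> x sx; exact: le_trans (gK x sx) KL.
move=> x y e sx sy xy; apply: (le_trans (gL x y e sx sy xy)).
have [e0|e0] := leP 0 e; first by rewrite ler_wpM2r.
have h : forall k : 'I_n, False by move=> k; have := xy k; rewrite leNgt (lt_le_trans e0).
have [_ /(congr1 (fun x : R => x))] := sx.
by rewrite big1 => [/eqP|k _]; [rewrite eq_sym oner_eq0|case: (h k)].
Qed.

Lemma nice_cst c : nice (fun=> c).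
Proof.
split => //; exists `|c|; split => // x y e sx sy xy; rewrite subrr normr0.
have [e0|e0] := leP 0 e; first by rewrite mulr_ge0.
have h : forall k : 'I_n, False by move=> k; have := xy k; rewrite leNgt (lt_le_trans e0).
have [_ /(congr1 (fun x : R => x))] := sx.
by rewrite big1 => [/eqP|k _]; [rewrite eq_sym oner_eq0|case: (h k)].
Qed.

Lemma nice_coord k : nice (fun x => tnth x k).
Proof.
split; first exact: measurable_tnth.
exists 1; split => //.
- by move=> x [h _]; have /andP[h0 h1] := h k; rewrite ger0_norm.
- by move=> x y e _ _ h; rewrite mul1r.
Qed.

Lemma niceD f g : nice f -> nice g -> nice (fun x => f x + g x).
Proof.
move=> [mf [K [K0 fK fL]]] [mg [L [L0 gK gL]]]; split; first exact: measurable_funD.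
exists (K + L); split; first exact: addr_ge0.
- by move=> x sx; apply: (le_trans (ler_normD _ _)); rewrite lerD ?fK ?gK.
- move=> x y e sx sy xy; rewrite opprD addrACA mulrDl.
 by apply: (le_trans (ler_normD _ _)); rewrite lerD ?fL ?gL.
Qed.

Lemma niceM f g : nice f -> nice g -> nice (fun x => f x * g x).
Proof.
move=> [mf [K hf]] [mg [L hg]]; split; first exact: measurable_funM.
have [K0 fK fL] := hf; have [L0 gK gL] := hg.
exists (2 * (K * L) + K * L); apply: (@simplex_lipW _ (2 * (K * L))).
 by rewrite lerDl mulr_ge0.
have KL0 : 0 <= K * L by exact: mulr_ge0.
split; first by rewrite mulr_ge0.
- move=> x sx; rewrite normrM; apply: (@le_trans _ _ (K * L)); last by lra.
 by apply: ler_pM; rewrite ?fK ?gK.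
- move=> x y e sx sy xy.
 have -> : f x * g x - f y * g y = f x * (g x - g y) + (f x - f y) * g y by ring.
 apply: (le_trans (ler_normD _ _)); rewrite !normrM.
 have -> : 2 * (K * L) * e = K * (L * e) + (K * e) * L by ring.
 by apply: lerD; apply: ler_pM => //; [exact: fK|exact: gL|exact: fL|exact: gK].
Qed.

Lemma niceZ c g : nice g -> nice (fun x => c * g x).
Proof. by move=> h; apply: niceM => //; exact: nice_cst. Qed.

Lemma niceB f g : nice f -> nice g -> nice (fun x => f x - g x).
Proof.
move=> hf hg; have := niceD hf (niceZ (-1) hg).
by under eq_fun do rewrite mulN1r.
Qed.

Lemma niceX g k : nice g -> nice (fun x => g x ^+ k).
Proof.
move=> h; elim: k => [|k IH]; first by under eq_fun do rewrite expr0; exact: nice_cst.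
by under eq_fun do rewrite exprS; exact: niceM.
Qed.

Lemma nice_sum (I : Type) (s : seq I) (f : I -> n.-tuple R -> R) :
 (forall i, nice (f i)) -> nice (fun x => \sum_(i <- s) f i x).
Proof.
move=> h; elim: s => [|i s IH].
 by under eq_fun do rewrite big_nil; exact: nice_cst.
by under eq_fun do rewrite big_cons; exact: niceD.
Qed.

Lemma nice_uniform (I : finType) (f : I -> n.-tuple R -> R) : (forall i, nice (f i)) ->
 exists K, 0 <= K /\ forall i, simplex_lip (f i) K.
Proof.
move=> h; have /choice[K hK] : forall i, exists K, simplex_lip (f i) K.
 by move=> i; have [_ [K hK]] := h i; exists K.
have K0 i : 0 <= K i by have [] := hK i.
exists (\sum_i K i); split; first exact: sumr_ge0.
move=> i; apply: (simplex_lipW _ (hK i)).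
by rewrite (bigD1 i)//= lerDl sumr_ge0.
Qed.

Lemma simplex_lip_sqdist g K x y : simplex_lip g K -> simplex x -> simplex y ->
 (g x - g y) ^+ 2 <= K ^+ 2 * sqdist x y.
Proof.
move=> [K0 _ gL] sx sy.
have d0 : 0 <= sqdist x y by apply: sumr_ge0 => k _; exact: sqr_ge0.
have := gL x y (Num.sqrt (sqdist x y)) sx sy.
rewrite -[X in K ^+ 2 * X](sqr_sqrtr d0) -exprMn -[(g x - g y) ^+ 2]real_normK ?num_real// => h.
rewrite lerXn2r ?nnegrE ?mulr_ge0 ?sqrtr_ge0 ?h// => k.
rewrite -sqrtr_sqr ler_wsqrtr// /sqdist (bigD1 k)//= lerDl.
by apply: sumr_ge0 => j _; exact: sqr_ge0.
Qed.

End simplex_lipschitz.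

Section softmax_perturbation.
Variables (R : realType) (m : nat).
Implicit Types (y : m.-tuple R) (dl al : 'I_m.+1 -> R).

(** The constant [c] takes care of the normalisation of the last log-coordinate to 0: neither the
    softmax nor F sees a shift common to all coordinates. *)
Definition shifted y y' dl c := forall i, logcoord y' i = logcoord y i + dl i + c.

Definition sm y (i : 'I_m.+1) : R := tnth (softmax y) i.

Lemma sm_ge0 y i : 0 <= sm y i. Proof. exact/ltW/softmax_gt0. Qed.

Lemma sm_sum1 y : \sum_i sm y i = 1. Proof. exact: softmax_sum1. Qed.

Lemma simplex_softmax y : simplex (softmax y).
Proof. by have [] := int_simplex_softmax y. Qed.

Lemma exp_norm_shifted y y' dl c : shifted y y' dl c ->
 exp_norm y' = expR c * exp_norm y * tilt_norm (sm y) dl 1.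
Proof.
move=> h; rewrite [LHS]exp_normE mulr_sumr; apply: eq_bigr => j _.
rewrite h !expRD /sm tnth_softmax mul1r.
by field; rewrite gt_eqF// exp_norm_gt0.
Qed.

Lemma softmax_shifted y y' dl c i : shifted y y' dl c -> sm y' i = tilt (sm y) dl 1 i.
Proof.
move=> h; have Z0 := tilt_norm_gt0 dl (sm_ge0 y) (sm_sum1 y) 1.
rewrite {1}/sm tnth_softmax (exp_norm_shifted h) h !expRD /tilt /sm tnth_softmax mul1r.
field; rewrite !gt_eqF ?expR_gt0 ?exp_norm_gt0//.
Qed.

(** This is the product of the x_i^al_i, since ln x_i = y_i - ln (sum of the exp y_k). *)
Definition simplex_density al y : R :=
 expR (\sum_i al i * logcoord y i - (\sum_i al i) * ln (exp_norm y)).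

Lemma simplex_density_shifted al y y' dl c : shifted y y' dl c ->
 simplex_density al y' =
 simplex_density al y * tilt_ratio (sm y) dl al (\sum_i al i) 1.
Proof.
move=> h; have Z0 := tilt_norm_gt0 dl (sm_ge0 y) (sm_sum1 y) 1.
rewrite /simplex_density /tilt_ratio -expRD (exp_norm_shifted h); congr expR.
rewrite !lnM ?posrE ?mulr_gt0 ?expR_gt0 ?exp_norm_gt0// expRK.
rewrite (eq_bigr (fun i => al i * logcoord y i + al i * dl i + al i * c)) => [|i _]; last first.
 by rewrite h; ring.
by rewrite !big_split /= -mulr_suml; ring.
Qed.

Lemma simplex_density_gt0 al y : 0 < simplex_density al y.
Proof. exact: expR_gt0. Qed.

Lemma measurable_simplex_density al : borel (simplex_density al).
Proof.
apply: measurableT_comp => //; apply: measurable_funB.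
 apply: measurable_fun_bigsum => i; apply: measurable_funM => //.
 exact: measurable_logcoord.
apply: measurable_funM => //.
apply: measurableT_comp; first exact: measurable_ln.
exact: measurable_exp_norm.
Qed.

Lemma softmax_lip y y' dl c D : shifted y y' dl c -> (forall i, `|dl i| <= D) ->
 forall i, `|tnth (softmax y') i - tnth (softmax y) i| <= 2 * D.
Proof.
move=> h hD i; rewrite -/(sm y' i) (softmax_shifted i h).
exact: (tilt_expand1 (sm_ge0 y) (sm_sum1 y) hD).
Qed.

Lemma nice_softmax_lip (g : m.+1.-tuple R -> R) K y y' dl c D : simplex_lip g K ->
 shifted y y' dl c -> (forall i, `|dl i| <= D) ->
 `|g (softmax y') - g (softmax y)| <= K * (2 * D).
Proof.
move=> [_ _ gL] h hD; apply: gL; [exact: simplex_softmax|exact: simplex_softmax|].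
exact: softmax_lip h hD.
Qed.

(* The last log-coordinate is identically 0. *)
Definition extend (dl : 'I_m -> R) (i : 'I_m.+1) : R := nth 0 [tuple dl j | j < m] i.

Lemma extend_max (dl : 'I_m -> R) : extend dl ord_max = 0.
Proof. by rewrite /extend nth_default// size_tuple. Qed.

Lemma extend_widen (dl : 'I_m -> R) j : extend dl (widen_ord (leqnSn m) j) = dl j.
Proof. by rewrite /extend /= (nth_map j) ?size_enum_ord// nth_ord_enum. Qed.

Lemma extend_shifted y y' : shifted y y' (extend (fun j => tnth y' j - tnth y j)) 0.
Proof.
apply: ord_max_ind => [j|]; rewrite ?logcoord_widen ?extend_widen ?logcoord_max ?extend_max.
 by rewrite addr0 addrC subrK.
by rewrite !addr0.
Qed.

Lemma extend_le (dl : 'I_m -> R) D : 0 <= D -> (forall j, `|dl j| <= D) ->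
 forall i, `|extend dl i| <= D.
Proof.
by move=> D0 h; apply: ord_max_ind => [j|]; rewrite ?extend_widen ?extend_max ?normr0.
Qed.

End softmax_perturbation.

Section approximate_equality.
Variable R : realType.
Implicit Types a b c : \bar R.

(* Equality up to a factor between exp(-ep) and exp(ep): unlike an additive
   error, it makes sense for infinite integrals. *)
Definition apx (ep : R) a b : Prop :=
 (a <= (expR ep)%:E * b)%E /\ (b <= (expR ep)%:E * a)%E.

Lemma apx_sym ep a b : apx ep a b -> apx ep b a. Proof. by case. Qed.

Lemma apx_refl a : apx 0 a a. Proof. by rewrite /apx expR0 mul1e. Qed.

Lemma apx_trans e1 e2 a b c : apx e1 a b -> apx e2 b c -> apx (e1 + e2) a c.
Proof.
have h (x y z : \bar R) (e e' : R) : (x <= (expR e)%:E * y)%E -> (y <= (expR e')%:E * z)%E ->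
  (x <= (expR (e + e'))%:E * z)%E.
 move=> xy yz; apply: (le_trans xy); rewrite expRD EFinM -muleA.
 by apply: lee_wpmul2l yz; rewrite lee_fin expR_ge0.
move=> [ab ba] [bc cb]; split; first exact: h ab bc.
by rewrite addrC; exact: h cb ba.
Qed.

Lemma apxW e1 e2 a b : e1 <= e2 -> (0 <= a)%E -> (0 <= b)%E -> apx e1 a b -> apx e2 a b.
Proof.
move=> e12 a0 b0 [ab ba]; split; [apply: (le_trans ab)|apply: (le_trans ba)];
 by apply: lee_wpmul2r => //; rewrite lee_fin ler_expR.
Qed.

Lemma apx_real (dl x y : R) : 0 <= y -> 0 <= dl -> dl <= 2^-1 -> `|x - y| <= dl * y ->
 apx (2 * dl) x%:E y%:E.
Proof.
move=> y0 d0 d1; rewrite ler_norml => /andP[h1 h2].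
have h3 := expR_ge1Dx (2 * dl); rewrite /apx -!EFinM !lee_fin; split.
 apply: (@le_trans _ _ ((1 + dl) * y)); first by lra.
 by rewrite ler_wpM2r//; lra.
have x0 : (1 - dl) * y <= x by lra.
have x00 : 0 <= x by apply: le_trans x0; rewrite mulr_ge0// subr_ge0; lra.
apply: (@le_trans _ _ ((1 + 2 * dl) * x)); last by rewrite ler_wpM2r.
apply: (@le_trans _ _ ((1 + 2 * dl) * ((1 - dl) * y))); last by rewrite ler_wpM2l//; lra.
rewrite mulrA ler_peMl//; nra.
Qed.

Lemma apxM e (x y : R) c : (0 <= c)%E -> apx e x%:E y%:E -> apx e (x%:E * c) (y%:E * c).
Proof.
by move=> c0 [xy yx]; split; rewrite muleA; apply: lee_wpmul2r.
Qed.

Section integral.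
Context d (T : measurableType d) (mu : {measure set T -> \bar R}).

Lemma apx_integral e (f g : T -> \bar R) : (forall x, (0 <= f x)%E) -> (forall x, (0 <= g x)%E) ->
 borel f -> borel g ->
 (forall x, apx e (f x) (g x)) -> apx e (\int[mu]_x f x)%E (\int[mu]_x g x)%E.
Proof.
have h (f1 g1 : T -> \bar R) : (forall x, (0 <= f1 x)%E) -> (forall x, (0 <= g1 x)%E) ->
 borel f1 -> borel g1 ->
 (forall x, f1 x <= (expR e)%:E * g1 x)%E -> (\int[mu]_x f1 x <= (expR e)%:E * \int[mu]_x g1 x)%E.
 move=> f0 g0 mf mg fg; rewrite -ge0_integralZl//.
 apply: ge0_le_integral => //; exact: measurable_funeM.
by move=> f0 g0 mf mg fg; split; apply: h => // x; case: (fg x).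
Qed.

End integral.

(** The first-order terms of the three factors cancel up to order h, so that the product is 1 +
    O(h^2). *)
Lemma prod3_bound (h e dd k r2 K C2 C3 : R) : 0 <= h -> h <= 1 -> 0 <= K -> 0 <= C2 ->
 `|e| <= K -> `|dd| <= K -> `|k| <= K -> `|r2| <= C2 * h ^+ 2 -> `|e + dd + k| <= C3 * h ->
 `|(1 + h * e + r2) * (1 + h * dd) * (1 + h * k) - 1| <=
  (C3 + 3 * K ^+ 2 + K ^+ 3 + C2 * (1 + K) ^+ 2) * h ^+ 2.
Proof.
move=> h0 h1 K0 C20 eK dK kK r2C sC.
have -> : (1 + h * e + r2) * (1 + h * dd) * (1 + h * k) - 1 =
 h * (e + dd + k) + (h ^+ 2 * (e * dd) + h ^+ 2 * (e * k) + h ^+ 2 * (dd * k)) + h ^+ 3 * (e * dd * k) +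
 r2 * ((1 + h * dd) * (1 + h * k)) by ring.
have nM (a b A B : R) : `|a| <= A -> `|b| <= B -> `|a * b| <= A * B.
 by move=> ha hb; rewrite normrM ler_pM.
have h20 : 0 <= h ^+ 2 by exact: sqr_ge0.
have hn k' : `|h ^+ k'| <= h ^+ k' by rewrite ger0_norm// exprn_ge0.
have b1 : `|h * (e + dd + k)| <= h * (C3 * h) by apply: nM => //; rewrite ger0_norm.
have b2 := nM _ _ _ _ (hn 2%N) (nM _ _ _ _ eK dK).
have b3 := nM _ _ _ _ (hn 2%N) (nM _ _ _ _ eK kK).
have b4 := nM _ _ _ _ (hn 2%N) (nM _ _ _ _ dK kK).
have h32 : `|h ^+ 3| <= h ^+ 2 by rewrite ger0_norm ?exprn_ge0// exprS ler_piMl.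
have b5 := nM _ _ _ _ h32 (nM _ _ _ _ (nM _ _ _ _ eK dK) kK).
have b6 (z : R) : `|z| <= K -> `|1 + h * z| <= 1 + K.
 move=> zK; apply: (le_trans (ler_normD _ _)); rewrite normr1 lerD2l.
 by rewrite normrM ger0_norm//; apply: (le_trans _ zK); rewrite ler_piMl.
have b7 := nM _ _ _ _ r2C (nM _ _ _ _ (b6 _ dK) (b6 _ kK)).
have t (a b A B : R) : `|a| <= A -> `|b| <= B -> `|a + b| <= A + B.
 by move=> ha hb; apply: (le_trans (ler_normD _ _)); exact: lerD.
apply: (le_trans (t _ _ _ _ (t _ _ _ _ (t _ _ _ _ b1 (t _ _ _ _ (t _ _ _ _ b2 b3) b4)) b5) b7)).
rewrite le_eqVlt; apply/orP; left; apply/eqP; ring.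
Qed.

End approximate_equality.

(** * The drift half of a splitting step and its adjoint *)

Section drift_shears.
Variables (R : realType) (m : nat) (At : 'M[R]_m.+1) (al : 'I_m.+1 -> R).
Implicit Types (y : m.-tuple R) (x : m.+1.-tuple R) (j : 'I_m).
Notation leb := (lebesgue_tuple R m).
Notation wi := (widen_ord (leqnSn m)).

Let g := \sum_i al i.

Definition payoff (i : 'I_m.+1) x : R := \sum_j At i j * tnth x j.
(** With the modified payoff matrix this is the drift of ln (x_j / x_n): the Ito correction of the
    logarithm is the subtraction of half the squared noise intensity in each row, as the x_i sum to
    1. *)
Definition rel_payoff j x : R := payoff (wi j) x - payoff ord_max x.
(** The derivative of [rel_payoff j] along its own log-coordinate. *)
Definition rel_payoff' j x : R :=
 tnth x (wi j) * ((At (wi j) (wi j) - At ord_max (wi j)) - rel_payoff j x).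
(* [- F^-1 d/dy_j (F r_j)] with [r_j := rel_payoff j]. *)
Definition shear_kappa j x : R :=
 - rel_payoff' j x - rel_payoff j x * (al (wi j) - g * tnth x (wi j)).

Definition shear h y j : m.-tuple R := tuple_update y j (tnth y j + h * rel_payoff j (softmax y)).
(** The coordinates are updated one after the other, each with the values already updated. The
    result differs from the Euler step of the drift by O(h^2), but every stage changes one
    coordinate only. *)
Definition sweep h y (s : seq 'I_m) : m.-tuple R := foldl (shear h) y s.

Lemma nice_payoff i : nice (payoff i).
Proof. by apply: nice_sum => j; apply: niceZ; exact: nice_coord. Qed.

Lemma nice_rel_payoff j : nice (rel_payoff j).
Proof. by apply: niceB; exact: nice_payoff. Qed.

Lemma nice_rel_payoff' j : nice (rel_payoff' j).
Proof.
apply: niceM; first exact: nice_coord.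
by apply: niceB; [exact: nice_cst|exact: nice_rel_payoff].
Qed.

Lemma nice_shear_kappa j : nice (shear_kappa j).
Proof.
apply: niceB; first by have := niceZ (-1) (nice_rel_payoff' j); under eq_fun do rewrite mulN1r.
apply: niceM; first exact: nice_rel_payoff.
by apply: niceB; [exact: nice_cst|apply: niceZ; exact: nice_coord].
Qed.

Lemma measurable_nice_softmax (f : m.+1.-tuple R -> R) : nice f ->
 borel (fun y => f (softmax y)).
Proof. by move=> [mf _]; exact: measurableT_comp mf (@measurable_softmax R m). Qed.

Lemma measurable_shear h j : borel (fun y => shear h y j).
Proof.
apply: measurable_tuple_update => //; apply: measurable_funD; first exact: measurable_tnth.
by apply: measurable_funM => //; exact: measurable_nice_softmax (nice_rel_payoff j).
Qed.

Lemma measurable_sweep h s : borel (fun y => sweep h y s).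
Proof.
elim: s => [|j s IH] //=; exact: measurableT_comp IH (measurable_shear h j).
Qed.

Definition unit_dir j (r : R) (i : 'I_m.+1) : R := if i == wi j then r else 0.

Lemma update_shifted y j (r : R) : shifted y (tuple_update y j (tnth y j + r)) (unit_dir j r) 0.
Proof.
apply: ord_max_ind => [k|]; rewrite /unit_dir ?logcoord_widen ?logcoord_max addr0.
 have -> : (wi k == wi j) = (k == j) by rewrite -!val_eqE.
 by rewrite tnth_tuple_update; case: eqP => [->|_]; rewrite ?addr0.
by rewrite -val_eqE /= gtn_eqF ?ltn_ord// addr0.
Qed.

Lemma shear_shifted h y j : shifted y (shear h y j) (unit_dir j (h * rel_payoff j (softmax y))) 0.
Proof. exact: update_shifted. Qed.

Lemma unit_dir_le j (r D : R) : `|r| <= D -> forall i, `|unit_dir j r i| <= D.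
Proof. by move=> rD i; rewrite /unit_dir; case: ifP => // _; rewrite normr0 (le_trans _ rD). Qed.

Lemma unit_dir_sum j (r : R) (f : 'I_m.+1 -> R) : \sum_i f i * unit_dir j r i = f (wi j) * r.
Proof.
rewrite (bigD1 (wi j))//= big1 => [|i /negbTE ij]; last by rewrite /unit_dir ij mulr0.
by rewrite addr0 /unit_dir eqxx.
Qed.

Section bounds.
Variable K : R.
Hypothesis K0 : 0 <= K.
Hypothesis bK : forall j, simplex_lip (rel_payoff j) K.
Hypothesis dK : forall j, simplex_lip (rel_payoff' j) K.
Hypothesis kK : forall j, simplex_lip (shear_kappa j) K.

Let sx y := simplex_softmax y.

Lemma shear_step_le h y j : 0 <= h -> `|h * rel_payoff j (softmax y)| <= h * K.
Proof.
by move=> h0; rewrite normrM ger0_norm// ler_wpM2l//; have [_ b _] := bK j; exact: b.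
Qed.

Lemma shear_nice_le (f : m.+1.-tuple R -> R) L h y j : 0 <= h -> simplex_lip f L ->
 `|f (softmax (shear h y j)) - f (softmax y)| <= L * (2 * (h * K)).
Proof.
move=> h0 fL; apply: (nice_softmax_lip fL (shear_shifted h y j)).
by apply: unit_dir_le; exact: shear_step_le.
Qed.

(** Each earlier shear moves the point by at most h K and thereby the drift of a later one by 2 K^2
    h; multiplied by the step this is of second order. As [s] has no repetition, coordinate j is
    updated at most once. *)
Lemma sweep_displacement h s y j : 0 <= h -> uniq s ->
 `|tnth (sweep h y s) j - tnth y j - h * rel_payoff j (softmax y) * (j \in s)%:R| <=
  (2 * K ^+ 2) * (size s)%:R * h ^+ 2.
Proof.
move=> h0; elim: s y => [|i s IH] y /=.
 by move=> _; rewrite mulr0 subr0 subrr normr0 mulr0 mul0r.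
move=> /andP[iNs us]; have := IH (shear h y i) us.
set y1 := shear h y i; set z := sweep h y1 s => hz.
have e1 : tnth y1 j = tnth y j + (if j == i then h * rel_payoff j (softmax y) else 0).
 by rewrite /y1 tnth_tuple_update; case: eqP => [->|_]; rewrite ?addr0.
have hb : `|rel_payoff j (softmax y1) - rel_payoff j (softmax y)| <= K * (2 * (h * K)).
 exact: shear_nice_le.
have -> : tnth z j - tnth y j - h * rel_payoff j (softmax y) * (j \in i :: s)%:R =
  (tnth z j - tnth y1 j - h * rel_payoff j (softmax y1) * (j \in s)%:R) +
  h * (rel_payoff j (softmax y1) - rel_payoff j (softmax y)) * (j \in s)%:R.
 by rewrite e1 in_cons; case: eqP => [->|_] /=; rewrite ?(negbTE iNs) /= ?mulr1 ?mulr0 ?addr0; ring.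
apply: (le_trans (ler_normD _ _)).
have -> : 2 * K ^+ 2 * (size s).+1%:R * h ^+ 2 =
  2 * K ^+ 2 * (size s)%:R * h ^+ 2 + h * (K * (2 * (h * K))) by rewrite -natr1; ring.
apply: lerD => //; rewrite !normrM (ger0_norm h0).
apply: (@le_trans _ _ (h * (K * (2 * (h * K))) * 1)); last by rewrite mulr1.
apply: ler_pM => //; rewrite ?mulr_ge0//; first by rewrite ler_wpM2l.
by case: (j \in s); rewrite ?normr1 ?normr0.
Qed.

End bounds.

(** Moving one log-coordinate is exponential tilting in the direction of a unit vector, for which
    the first moment is the tilted weight itself. *)
Lemma is_derive_softmax_coord y j (r : R) i :
 is_derive r 1 (fun r : R => tnth (softmax (tuple_update y j r)) i)
  (tnth (softmax (tuple_update y j r)) i * ((i == wi j)%:R - tnth (softmax (tuple_update y j r)) (wi j))).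
Proof.
pose y0 := tuple_update y j 0; pose dl := unit_dir j 1.
have E (s : R) k : tnth (softmax (tuple_update y j s)) k = tilt (sm y0) dl s k.
 have h := @update_shifted y0 j s.
 rewrite tnth_tuple_update eqxx add0r tuple_updateK in h.
 rewrite -/(sm _ k) (softmax_shifted k h) /tilt /tilt_norm.
 have e (k' : 'I_m.+1) : 1 * unit_dir j s k' = s * dl k'.
  by rewrite /dl /unit_dir mul1r; case: ifP; rewrite ?mulr1 ?mulr0.
 by rewrite e; congr (_ / _); apply: eq_bigr => k' _; rewrite e.
rewrite (_ : (fun r : R => _) = (fun s => tilt (sm y0) dl s i)); last by apply/funext => s; rewrite E.
have := @is_derive_tilt _ _ (sm y0) dl (sm_ge0 y0) (sm_sum1 y0) r i.
rewrite !E.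
have -> : dl i = (i == wi j)%:R by rewrite /dl /unit_dir; case: eqP.
suff -> : tilt_moment (sm y0) dl 1 r = tilt (sm y0) dl r (wi j) by [].
rewrite /tilt_moment; under eq_bigr do rewrite expr1.
by rewrite unit_dir_sum mulr1.
Qed.

Lemma continuous_softmax_coord y j i :
 continuous (fun r : R => tnth (softmax (tuple_update y j r)) i).
Proof.
move=> r; apply: differentiable_continuous; apply/derivable1_diffP.
exact: (@ex_derive _ _ _ _ _ _ _ (is_derive_softmax_coord y j r i)).
Qed.

Lemma is_derive_payoff y j (r : R) i :
 is_derive r 1 (fun r : R => payoff i (softmax (tuple_update y j r)))
  (tnth (softmax (tuple_update y j r)) (wi j) *
   (At i (wi j) - payoff i (softmax (tuple_update y j r)))).
Proof.
rewrite (_ : (fun r : R => _) = \sum_(k < m.+1)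
  (fun r : R => At i k * tnth (softmax (tuple_update y j r)) k)); last first.
 by apply/funext => s; rewrite fct_sumE.
set x := softmax (tuple_update y j r).
have df (k : 'I_m.+1) : is_derive r 1 (fun r : R => At i k * tnth (softmax (tuple_update y j r)) k)
  (At i k * (tnth x k * ((k == wi j)%:R - tnth x (wi j)))).
 have -> : (fun r : R => At i k * tnth (softmax (tuple_update y j r)) k) =
  (fun r : R => At i k *: (fun r : R => tnth (softmax (tuple_update y j r)) k) r) by [].
 have h := is_derive_softmax_coord y j r k.
 by apply: is_derive_eq.
apply: is_derive_eq.
transitivity (\sum_(k < m.+1) (At i k * tnth x k * (k == wi j)%:R - At i k * tnth x k * tnth x (wi j))).
 by apply: eq_bigr => k _; ring.
rewrite sumrB -mulr_suml (bigD1 (wi j))//= eqxx big1 => [|k /negbTE ->]; last by rewrite mulr0.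
by rewrite /= mulr1 addr0 /payoff; ring.
Qed.

Lemma is_derive_rel_payoff y j (r : R) k :
 is_derive r 1 (fun r : R => rel_payoff k (softmax (tuple_update y j r)))
  (tnth (softmax (tuple_update y j r)) (wi j) *
   (At (wi k) (wi j) - At ord_max (wi j) - rel_payoff k (softmax (tuple_update y j r)))).
Proof.
have h1 := is_derive_payoff y j r (wi k); have h2 := is_derive_payoff y j r ord_max.
by apply: (@is_derive_eq _ _ _ _ _ _ _ _ (is_deriveB h1 h2)); rewrite /rel_payoff; ring.
Qed.

Lemma continuous_rel_payoff y j k :
 continuous (fun r : R => rel_payoff k (softmax (tuple_update y j r))).
Proof.
move=> r; apply: differentiable_continuous; apply/derivable1_diffP.
exact: (@ex_derive _ _ _ _ _ _ _ (is_derive_rel_payoff y j r k)).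
Qed.

Let theta h j y : R := tnth y j + h * rel_payoff j (softmax y).
Let jac h j y : R := 1 + h * rel_payoff' j (softmax y).

Let is_derive_theta h y j (r : R) :
 is_derive r 1 (fun r => theta h j (tuple_update y j r)) (jac h j (tuple_update y j r)).
Proof.
have d1 := is_derive_rel_payoff y j r j.
rewrite (_ : (fun r : R => _) =
  (fun r : R => r + h *: (fun r : R => rel_payoff j (softmax (tuple_update y j r))) r)); last first.
 by apply/funext => s; rewrite /theta tnth_tuple_update eqxx.
by apply: is_derive_eq; rewrite /jac /rel_payoff' /GRing.scale/=.
Qed.

Let continuous_jac h y j : continuous (fun r : R => jac h j (tuple_update y j r)).
Proof.
move=> r; apply: cvgD; first exact: cvg_cst.
apply: cvgM; first exact: cvg_cst.
apply: cvgM; first exact: continuous_softmax_coord.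
by apply: cvgB; [exact: cvg_cst|exact: continuous_rel_payoff].
Qed.

(** The map stays within h K of the identity, so it takes every value by the intermediate value
    theorem. *)
Let range_theta h y j : 0 <= h -> range (fun r : R => theta h j (tuple_update y j r)) = [set: R].
Proof.
move=> h0; have [_ [K [K0 bK _]]] := nice_rel_payoff j.
set f := fun r => _; have fK r : `|f r - r| <= h * K.
 rewrite /f /theta tnth_tuple_update eqxx addrC addKr normrM ger0_norm//.
 by rewrite ler_wpM2l//; apply: bK; exact: simplex_softmax.
have cf : continuous f.
 move=> r; apply: differentiable_continuous; apply/derivable1_diffP.
 exact: (@ex_derive _ _ _ _ _ _ _ (is_derive_theta h y j r)).
apply/seteqP; split => // z _.
have hK : 0 <= h * K by exact: mulr_ge0.
have ab : z - h * K <= z + h * K by lra.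
have [] := @IVT R f (z - h * K) (z + h * K) z ab.
- by apply: continuous_subspaceT.
- have := fK (z - h * K); have := fK (z + h * K); rewrite !ler_norml => /andP[h1 h2] /andP[h3 h4].
 by rewrite ge_min le_max; apply/andP; split; apply/orP; [left|right]; lra.
by move=> c _ fc; exists c.
Qed.

Section adjoint.
Variable K : R.
Hypothesis K0 : 0 <= K.
Hypothesis bK : forall j, simplex_lip (rel_payoff j) K.
Hypothesis dK : forall j, simplex_lip (rel_payoff' j) K.
Hypothesis kK : forall j, simplex_lip (shear_kappa j) K.

Notation F := (simplex_density al).

Let c := \sum_i `|al i| + `|g|.
Let c0 : 0 <= c. Proof. by rewrite addr_ge0// sumr_ge0. Qed.
Let C2 := (c ^+ 2 + 2 * c) * K ^+ 2 * expR (c * K).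
Let CS := 2 * K ^+ 2 + 3 * (2 * K) ^+ 2 + (2 * K) ^+ 3 + C2 * (1 + 2 * K) ^+ 2.

Let C20 : 0 <= C2.
Proof. by rewrite !mulr_ge0 ?expR_ge0 ?sqr_ge0// addr_ge0 ?sqr_ge0// mulr_ge0. Qed.

Let CS0 : 0 <= CS.
Proof.
have K2 : 0 <= 2 * K by exact: mulr_ge0.
have e1 := exprn_ge0 3 K2; have e2 := sqr_ge0 (2 * K); have e3 := sqr_ge0 K.
have e4 : 0 <= C2 * (1 + 2 * K) ^+ 2 by rewrite mulr_ge0 ?sqr_ge0.
by rewrite /CS; lra.
Qed.

(** F changes by the factor 1 + h e + O(h^2) with [e] the slope of ln F along the drift, the
    Jacobian is 1 + h [rel_payoff'], and [shear_kappa] is minus the sum of the two slopes. Its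
    evaluation at the image point rather than at [y] costs O(h^2) more. *)
Lemma shear_density h y j : 0 <= h -> h <= 1 ->
 `|F (shear h y j) * (1 + h * shear_kappa j (softmax (shear h y j))) *
  (1 + h * rel_payoff' j (softmax y)) - F y| <= CS * h ^+ 2 * F y.
Proof.
move=> h0 h1; set y1 := shear h y j; set x := softmax y.
have F0 := simplex_density_gt0 al y.
have hs := shear_shifted h y j; rewrite -/y1 -/x in hs.
set t := h * rel_payoff j x in hs.
have tD : forall i, `|unit_dir j t i| <= h * K.
 by apply: unit_dir_le; exact: (shear_step_le bK).
pose e := rel_payoff j x * (al (wi j) - g * tnth x (wi j)).
have hr := @tilt_ratio_expand2 _ _ (sm y) (unit_dir j t) (h * K) (sm_ge0 y) (sm_sum1 y) tD al g c (lexx _).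
rewrite unit_dir_sum tilt_moment0 in hr; last exact: sm_sum1.
rewrite (eq_bigr (fun i => sm y i * unit_dir j t i)) in hr; last by move=> i _; rewrite expr1.
rewrite unit_dir_sum -/(sm y) in hr.
set r1 := tilt_ratio _ _ _ _ _ in hr.
have FE : F y1 = F y * r1 by exact: (simplex_density_shifted al hs).
have -> : F y1 * (1 + h * shear_kappa j (softmax y1)) * (1 + h * rel_payoff' j x) - F y =
  F y * ((1 + h * e + (r1 - 1 - h * e)) * (1 + h * rel_payoff' j x) *
   (1 + h * shear_kappa j (softmax y1)) - 1) by rewrite FE; ring.
rewrite normrM (gtr0_norm F0) mulrC ler_wpM2r ?(ltW F0)//.
have [_ dK' _] := dK j; have [_ kK' _] := kK j.
have kE : shear_kappa j x = - rel_payoff' j x - e by [].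
have d1 := dK' _ (simplex_softmax y); have k1 := kK' _ (simplex_softmax y).
have k2 := kK' _ (simplex_softmax y1); rewrite -/x in d1 k1.
apply: prod3_bound => //.
- by rewrite mulr_ge0.
- have -> : e = - rel_payoff' j x - shear_kappa j x by rewrite kE; ring.
 by apply: (le_trans (ler_normB _ _)); rewrite normrN mulr_natl mulr2n; exact: lerD.
- by apply: (le_trans d1); rewrite ler_peMl// ler1n.
- by apply: (le_trans k2); rewrite ler_peMl// ler1n.
- have -> : r1 - 1 - h * e = r1 - 1 - (al (wi j) * t - g * (sm y (wi j) * t)).
  by rewrite /e /t /sm -/x; ring.
 apply: (le_trans hr); rewrite /C2 exprMn.
 have h2 : expR (c * (h * K)) <= expR (c * K).
  by rewrite ler_expR ler_wpM2l// ler_piMl.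
 have -> : (c ^+ 2 + 2 * c) * (h ^+ 2 * K ^+ 2) * expR (c * (h * K)) =
  (c ^+ 2 + 2 * c) * K ^+ 2 * h ^+ 2 * expR (c * (h * K)) by ring.
 have -> : (c ^+ 2 + 2 * c) * K ^+ 2 * expR (c * K) * h ^+ 2 =
  (c ^+ 2 + 2 * c) * K ^+ 2 * h ^+ 2 * expR (c * K) by ring.
 by rewrite ler_wpM2l// !mulr_ge0 ?sqr_ge0// addr_ge0 ?sqr_ge0// mulr_ge0.
- have -> : e + rel_payoff' j x + shear_kappa j (softmax y1) =
  shear_kappa j (softmax y1) - shear_kappa j x by rewrite kE; ring.
 have := shear_nice_le bK y j h0 (kK j); rewrite -/y1 -/x.
 by move=> hh; apply: (le_trans hh); rewrite le_eqVlt; apply/orP; left; apply/eqP; ring.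
Qed.

Let mF := measurable_simplex_density al.

(** The shear is substituted in the integral on the right; the weight and the Jacobian then
    recombine to F by [shear_density]. *)
Lemma shear_adjoint h j (psi : m.-tuple R -> \bar R) : 0 <= h -> h <= 1 -> h * K <= 2^-1 ->
 CS * h ^+ 2 <= 2^-1 -> (forall y, (0 <= psi y)%E) -> borel psi ->
 apx (2 * (CS * h ^+ 2))
  (\int[leb]_y ((F y)%:E * psi (shear h y j)))%E
  (\int[leb]_y ((F y * (1 + h * shear_kappa j (softmax y)))%:E * psi y))%E.
Proof.
move=> h0 h1 hK hC p0 mp.
have hn (f : m.+1.-tuple R -> R) y : simplex_lip f K -> `|h * f (softmax y)| <= 2^-1.
 move=> [_ fK _]; apply: le_trans hK; rewrite normrM ger0_norm// ler_wpM2l//.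
 by apply: fK; exact: simplex_softmax.
have k0 y : 0 <= 1 + h * shear_kappa j (softmax y).
 by have := hn _ y (kK j); rewrite ler_norml => /andP[]; lra.
have j0 y : 0 < jac h j y.
 by have := hn _ y (dK j); rewrite /jac ler_norml => /andP[]; lra.
have mk : borel (fun y => F y * (1 + h * shear_kappa j (softmax y))).
 apply: measurable_funM => //; apply: measurable_funD => //; apply: measurable_funM => //.
 exact: measurable_nice_softmax (nice_shear_kappa j).
have mj : borel (jac h j).
 apply: measurable_funD => //; apply: measurable_funM => //.
 exact: measurable_nice_softmax (nice_rel_payoff' j).
have mt : borel (theta h j).
 apply: measurable_funD; first exact: measurable_tnth.
 by apply: measurable_funM => //; exact: measurable_nice_softmax (nice_rel_payoff j).
have mH : borel
  (fun y => (F y * (1 + h * shear_kappa j (softmax y)))%:E * psi y)%E.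
 by apply: emeasurable_funM => //; exact/measurable_EFinP.
rewrite [X in apx _ _ X](shear_substitution (i := j) (theta := theta h j) (J := jac h j))//; last 2 first.
- by move=> y; exact: range_theta.
- by move=> y; rewrite mule_ge0// lee_fin mulr_ge0// ltW// simplex_density_gt0.
apply: apx_integral => //.
- by move=> y; rewrite mule_ge0// lee_fin ltW// simplex_density_gt0.
- move=> y; rewrite mule_ge0// ?lee_fin ?(ltW (j0 _))// mule_ge0//.
 by rewrite lee_fin mulr_ge0// ltW// simplex_density_gt0.
- apply: emeasurable_funM; first exact/measurable_EFinP.
 exact: measurableT_comp mp (measurable_shear h j).
- apply: emeasurable_funM; last exact/measurable_EFinP.
 exact: measurableT_comp mH (measurable_shear h j).
move=> y; rewrite muleAC -EFinM; apply: apxM => //; apply: apx_sym.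
apply: apx_real => //; first by rewrite ltW// simplex_density_gt0.
 by rewrite mulr_ge0 ?sqr_ge0.
by have := shear_density y j h0 h1; rewrite /shear /jac /theta.
Qed.

Lemma sweep_nice_le (f : m.+1.-tuple R -> R) L h y s : 0 <= h -> simplex_lip f L ->
 `|f (softmax (sweep h y s)) - f (softmax y)| <= (size s)%:R * (L * (2 * (h * K))).
Proof.
move=> h0 fL; elim: s y => [|i s IH] y /=; first by rewrite subrr normr0 mul0r.
have -> : f (softmax (sweep h (shear h y i) s)) - f (softmax y) =
 (f (softmax (sweep h (shear h y i) s)) - f (softmax (shear h y i))) +
 (f (softmax (shear h y i)) - f (softmax y)) by ring.
apply: (le_trans (ler_normD _ _)); rewrite -natr1 mulrDl mul1r.
by apply: lerD; [exact: IH|exact: (shear_nice_le bK)].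
Qed.

(** The first shear is transposed with the rest of the sweep absorbed in the test function. The
    factor 1 + h kappa_i that appears is then evaluated after the remaining shears, at relative cost
    O(h^2), so that it belongs to the test function of the induction hypothesis. Finally the product
    of two factors 1 + O(h) is replaced by 1 plus the sum. *)
Lemma sweep_adjoint s : exists C h1, [/\ 0 <= C, 0 < h1, h1 <= 1 &
 forall h (psi : m.-tuple R -> \bar R), 0 <= h -> h <= h1 ->
 (forall y, (0 <= psi y)%E) -> borel psi ->
 apx (C * h ^+ 2)
  (\int[leb]_y ((F y)%:E * psi (sweep h y s)))%E
  (\int[leb]_y ((F y * (1 + h * \sum_(j <- s) shear_kappa j (softmax y)))%:E * psi y))%E].
Proof.
elim: s => [|i s [C [h1 [C0 h10 h11 IH]]]].
 exists 0, 1; split => // h psi h0 _ p0 mp; rewrite mul0r.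
 rewrite [X in apx _ _ X](_ : _ = \int[leb]_y ((F y)%:E * psi y))%E; first exact: apx_refl.
 by apply: eq_integral => y _; rewrite big_nil mulr0 addr0 mulr1.
pose S := (size s)%:R : R; have S0 : 0 <= S by rewrite ler0n.
pose c2 := 2 * (S * (K * (2 * K))); have c20 : 0 <= c2 by rewrite !mulr_ge0.
pose c4 := 2 * (K * (S * K)); have c40 : 0 <= c4 by rewrite !mulr_ge0.
(* [q] dominates every constant of the step, so that the single condition h q <= 1/2 provides all
   smallness and positivity requirements. *)
pose q := 1 + K + CS + c2 + c4 + (S + 1) * K.
have SK0 : 0 <= (S + 1) * K by rewrite mulr_ge0// addr_ge0.
have q0 : 0 < q by rewrite /q; have := CS0; have := K0; lra.
have [qK qCS qc2 qc4 qSK] : [/\ K <= q, CS <= q, c2 <= q, c4 <= q & (S + 1) * K <= q].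
 by have := CS0; have := K0; split; rewrite /q; lra.
pose h2 := Num.min h1 (2 * q)^-1.
have h20 : 0 < h2 by rewrite lt_min h10 invr_gt0 mulr_gt0.
exists (2 * CS + 2 * c2 + C + 2 * c4), h2; split => //.
- by have := CS0; lra.
- by rewrite ge_min h11.
move=> h psi h0 hh2 p0 mp.
have hh1 : h <= h1 by apply: (le_trans hh2); rewrite ge_min lexx.
have hq : h * q <= 2^-1.
 have : h <= (2 * q)^-1 by apply: (le_trans hh2); rewrite ge_min lexx orbT.
 by move=> h3; rewrite -ler_pdivlMr//; apply: (le_trans h3); rewrite invfM.
have hle1 : h <= 1 by exact: le_trans hh1 h11.
have small (a : R) : 0 <= a -> a <= q -> h * a <= 2^-1.
 by move=> a0 aq; apply: le_trans hq; rewrite ler_wpM2l.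
have small2 (a : R) : 0 <= a -> a <= q -> a * h ^+ 2 <= 2^-1.
 move=> a0 aq; apply: le_trans (small a a0 aq); rewrite expr2 mulrA [h * a]mulrC.
 by rewrite ler_piMr// mulr_ge0.
have kle j y : `|shear_kappa j (softmax y)| <= K.
 by have [_ h' _] := kK j; apply: h'; exact: simplex_softmax.
have sle y : `|\sum_(j <- s) shear_kappa j (softmax y)| <= S * K.
 apply: (le_trans (ler_norm_sum _ _ _)).
 apply: (le_trans (ler_sum _ (fun j _ => kle j y))).
 by rewrite big_const_seq count_predT iter_addr_0 /S mulr_natl.
have F0 y : 0 <= F y by rewrite ltW// simplex_density_gt0.
have k0 y : 2^-1 <= 1 + h * shear_kappa i (softmax y).
 have : `|h * shear_kappa i (softmax y)| <= 2^-1.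
  rewrite normrM ger0_norm//; apply: (@le_trans _ _ (h * K)); first by rewrite ler_wpM2l.
  by exact: small.
 by rewrite ler_norml => /andP[]; lra.
have s0 y : 2^-1 <= 1 + h * \sum_(j <- i :: s) shear_kappa j (softmax y).
 have : `|h * \sum_(j <- i :: s) shear_kappa j (softmax y)| <= 2^-1.
  rewrite normrM ger0_norm// big_cons; apply: (@le_trans _ _ (h * ((S + 1) * K))).
   rewrite ler_wpM2l// (le_trans (ler_normD _ _))// mulrDl mul1r addrC lerD//.
  by exact: small.
 by rewrite ler_norml => /andP[]; lra.
have s0' y : 2^-1 <= 1 + h * \sum_(j <- s) shear_kappa j (softmax y).
 have : `|h * \sum_(j <- s) shear_kappa j (softmax y)| <= 2^-1.
  rewrite normrM ger0_norm//; apply: (@le_trans _ _ (h * ((S + 1) * K))).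
   rewrite ler_wpM2l// (le_trans (sle y))// mulrDl mul1r lerDl//.
  by exact: small.
 by rewrite ler_norml => /andP[]; lra.
have mk j : borel (fun y => shear_kappa j (softmax y)).
 exact: measurable_nice_softmax (nice_shear_kappa j).
have mk1 : borel (fun y => 1 + h * shear_kappa i (softmax y)).
 by apply: measurable_funD => //; exact: measurable_funM.
have mks (t : seq 'I_m) : borel
  (fun y => 1 + h * \sum_(j <- t) shear_kappa j (softmax y)).
 apply: measurable_funD => //; apply: measurable_funM => //.
 exact: measurable_sum.
have msw := measurable_sweep h s.
have mpsw : borel (fun y => psi (sweep h y s)).
 exact: measurableT_comp mp msw.
have -> : (2 * CS + 2 * c2 + C + 2 * c4) * h ^+ 2 =
 2 * (CS * h ^+ 2) + (2 * (c2 * h ^+ 2) + (C * h ^+ 2 + 2 * (c4 * h ^+ 2))) by ring.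
apply: (apx_trans (b := (\int[leb]_y ((F y * (1 + h * shear_kappa i (softmax y)))%:E * psi (sweep h y s)))%E)).
 apply: (@shear_adjoint h i (fun y => psi (sweep h y s))) => //.
  by exact: small.
 by exact: small2.
apply: (apx_trans (b := (\int[leb]_y ((F y)%:E *
  ((1 + h * shear_kappa i (softmax (sweep h y s)))%:E * psi (sweep h y s))))%E)).
 apply: apx_integral.
 - by move=> y; rewrite mule_ge0// lee_fin mulr_ge0//; have := k0 y; lra.
 - by move=> y; rewrite mule_ge0 ?lee_fin// mule_ge0// lee_fin; have := k0 (sweep h y s); lra.
 - apply: emeasurable_funM => //; apply/measurable_EFinP; exact: measurable_funM.
 - apply: emeasurable_funM; first exact/measurable_EFinP.
  apply: emeasurable_funM => //; apply/measurable_EFinP; exact: measurableT_comp mk1 msw.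
 move=> y; rewrite muleA -EFinM; apply: apxM => //.
 apply: apx_real.
 - by rewrite mulr_ge0//; have := k0 (sweep h y s); lra.
 - by rewrite mulr_ge0// sqr_ge0.
 - by exact: small2.
 rewrite -mulrBr normrM (ger0_norm (F0 y)) mulrCA ler_wpM2l//.
 apply: (@le_trans _ _ (c2 * h ^+ 2 * 2^-1)).
  have -> : 1 + h * shear_kappa i (softmax y) - (1 + h * shear_kappa i (softmax (sweep h y s))) =
   - (h * (shear_kappa i (softmax (sweep h y s)) - shear_kappa i (softmax y))) by ring.
  rewrite normrN normrM ger0_norm//.
  have := sweep_nice_le y s h0 (kK i) => hh.
  apply: (le_trans (ler_wpM2l h0 hh)); rewrite le_eqVlt; apply/orP; left; apply/eqP.
  by rewrite /c2 /S; field.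
 by rewrite ler_wpM2l ?mulr_ge0 ?sqr_ge0.
apply: (apx_trans (b := (\int[leb]_y ((F y * (1 + h * \sum_(j <- s) shear_kappa j (softmax y)))%:E *
  ((1 + h * shear_kappa i (softmax y))%:E * psi y)))%E)).
 apply: (IH h (fun y => ((1 + h * shear_kappa i (softmax y))%:E * psi y)%E)) => //.
  by move=> y; rewrite mule_ge0// lee_fin; have := k0 y; lra.
 by apply: emeasurable_funM => //; exact/measurable_EFinP.
apply: apx_integral.
- move=> y; rewrite mule_ge0// ?lee_fin ?mulr_ge0//; first by have := s0' y; lra.
 by rewrite mule_ge0// lee_fin; have := k0 y; lra.
- by move=> y; rewrite mule_ge0// lee_fin mulr_ge0//; have := s0 y; lra.
- apply: emeasurable_funM; first by apply/measurable_EFinP; exact: measurable_funM.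
 by apply: emeasurable_funM => //; exact/measurable_EFinP.
- by apply: emeasurable_funM => //; apply/measurable_EFinP; exact: measurable_funM.
move=> y; rewrite muleA -EFinM; apply: apxM => //.
apply: apx_real.
- by rewrite mulr_ge0//; have := s0 y; lra.
- by rewrite mulr_ge0// sqr_ge0.
- by exact: small2.
rewrite -[F y * _ * (1 + h * shear_kappa i _)]mulrA -mulrBr normrM (ger0_norm (F0 y)) mulrCA ler_wpM2l//.
apply: (@le_trans _ _ (c4 * h ^+ 2 * 2^-1)); last by rewrite ler_wpM2l ?mulr_ge0 ?sqr_ge0.
rewrite big_cons; set a := shear_kappa i _; set b := \sum_(j <- s) _.
have -> : (1 + h * b) * (1 + h * a) - (1 + h * (a + b)) = h ^+ 2 * (a * b) by ring.
rewrite normrM (ger0_norm (sqr_ge0 h)).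
have -> : c4 * h ^+ 2 * 2^-1 = h ^+ 2 * (K * (S * K)) by rewrite /c4; field.
rewrite ler_wpM2l ?sqr_ge0// normrM; apply: ler_pM => //; [exact: kle|exact: sle].
Qed.

End adjoint.

End drift_shears.

Section translation.
Variables (R : realType) (m : nat) (t : m.-tuple R).
Notation leb := (lebesgue_tuple R m).

Definition translate (s : seq 'I_m) (y : m.-tuple R) : m.-tuple R :=
 [tuple if j \in s then tnth y j + tnth t j else tnth y j | j < m].

Let measurable_translate s : borel (translate s).
Proof.
apply: measurable_fun_tuple => j; case: (j \in s); last exact: measurable_tnth.
by apply: measurable_funD => //; exact: measurable_tnth.
Qed.

(** A translation is a product of shears with Jacobian 1, one for each index in [s]. *)
Lemma integral_translate s (H : m.-tuple R -> \bar R) : uniq s ->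
 (forall y, (0 <= H y)%E) -> borel H ->
 (\int[leb]_y H y = \int[leb]_y H (translate s y))%E.
Proof.
move=> + H0 mH; elim: s => [_|i s IH /= /andP[iNs us]].
 by apply: eq_integral => y _; congr H; apply: eq_from_tnth => j; rewrite tnth_mktuple.
have dth y (r : R) : is_derive r 1 (fun r => tnth (tuple_update y i r) i + tnth t i) 1.
 rewrite (_ : (fun r => _) = (fun r : R => r + tnth t i)); last first.
  by apply/funext => a; rewrite tnth_tuple_update eqxx.
 by apply: is_derive_eq; rewrite addr0.
rewrite (IH us) (shear_substitution (i := i) (theta := fun y => tnth y i + tnth t i) (J := fun=> 1))//.
- apply: eq_integral => y _; rewrite mule1; congr H; apply: eq_from_tnth => j.
 rewrite !tnth_mktuple in_cons; case: eqP => [->|_] //=.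
 by rewrite (negbTE iNs).
- by apply: measurable_funD => //; exact: measurable_tnth.
- by move=> y r; exact: cvg_cst.
- move=> y; apply/seteqP; split => // z _; exists (z - tnth t i) => //.
 by rewrite tnth_tuple_update eqxx subrK.
- exact: measurableT_comp mH (measurable_translate s).
Qed.

End translation.

Section increment_moments.
Context d (T : measurableType d) (R : realType) (P : probability T R).
Variables (n : nat) (W : 'I_n -> R -> T -> R).
Hypothesis hW : standard_brownian_motion P W.

(** A common bound B for h^(1/2) and for all increments of the step, so that h <= B^2 and every
    error term can be counted in powers of B. *)
Definition step_size (u v : R) (w : T) : R :=
 Num.sqrt (v - u) + \sum_(i < n) `|winc W i u v w|.

Lemma measurable_step_size u v : 0 <= u -> 0 <= v -> borel (step_size u v).
Proof.
move=> u0 v0; apply: measurable_funD => //; apply: measurable_fun_bigsum => i.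
by apply: measurableT_comp => //; exact: (measurable_winc hW).
Qed.

Lemma step_size_ge0 u v w : 0 <= step_size u v w.
Proof. by rewrite addr_ge0 ?sqrtr_ge0// sumr_ge0. Qed.

Lemma step_size_ge_sqrt u v w : Num.sqrt (v - u) <= step_size u v w.
Proof. by rewrite lerDl sumr_ge0. Qed.

Lemma step_size_ge_winc i u v w : `|winc W i u v w| <= step_size u v w.
Proof.
rewrite /step_size (bigD1 i)//= addrCA lerDl addr_ge0 ?sqrtr_ge0//.
by rewrite sumr_ge0.
Qed.

Definition step_moment_const (k : nat) (c : R) : R :=
 n.+1%:R ^+ k * (expR (c * n.+1%:R) + n%:R * gaussian_const k (c * n.+1%:R)).

Lemma step_moment_const_ge0 k c : 0 <= step_moment_const k c.
Proof.
rewrite /step_moment_const /gaussian_const; apply: mulr_ge0; first exact: exprn_ge0.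
apply: addr_ge0; first exact: expR_ge0.
apply: mulr_ge0; first exact: ler0n.
apply: mulr_ge0; first exact: ler0n.
by apply: mulr_ge0; [exact: ler0n|exact: expR_ge0].
Qed.

(** [step_size] is at most n + 1 times its largest term. The function is increasing, so its value is
    bounded by the sum of its values at n + 1 times each term, and the Gaussian bounds apply to
    each. *)
Lemma step_moment k (c : R) u v : 0 <= c -> 0 <= u -> u < v -> v - u <= 1 ->
 L1 P (fun w => step_size u v w ^+ k * expR (c * step_size u v w)) /\
 mean P (fun w => step_size u v w ^+ k * expR (c * step_size u v w)) <=
  step_moment_const k c * Num.sqrt (v - u) ^+ k.
Proof.
move=> c0 u0 uv h1; have v0 : 0 <= v by rewrite (le_trans u0)// ltW.
set s := Num.sqrt (v - u).
have s0 : 0 < s by rewrite sqrtr_gt0 subr_gt0.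
have s1 : s <= 1 by rewrite -sqrtr1 ler_wsqrtr.
pose q : R := n.+1%:R; have q0 : 0 < q by rewrite ltr0n.
pose f (x : R) := (q * x) ^+ k * expR (c * (q * x)).
have f0 x : 0 <= x -> 0 <= f x by move=> x0; rewrite mulr_ge0 ?expR_ge0// exprn_ge0// mulr_ge0// ltW.
have fE x : f x = q ^+ k * (x ^+ k * expR ((c * q) * x)).
 by rewrite /f exprMn -!mulrA.
have gm i : L1 P (fun w => `|winc W i u v w| ^+ k * expR (c * q * `|winc W i u v w|)) /\
  mean P (fun w => `|winc W i u v w| ^+ k * expR (c * q * `|winc W i u v w|)) <=
   gaussian_const k (c * q) * s ^+ k.
 apply: gaussian_abs_moment => //; first exact: (measurable_winc hW).
  by move=> B mB; exact: (bm_gaussian hW).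
 by rewrite mulr_ge0// ltW.
have gi i : L1 P (fun w => f `|winc W i u v w|).
 by under eq_fun do rewrite fE; apply: L1Z; case: (gm i).
have iS : L1 P (fun w => f s + \sum_(i < n) f `|winc W i u v w|).
 by apply: L1D; [exact: L1_cst|exact: L1_sum].
have ms := measurable_step_size u0 v0.
have mf : borel (fun w => step_size u v w ^+ k * expR (c * step_size u v w)).
 apply: measurable_funM; first exact: measurable_funX.
 by apply: measurableT_comp => //; exact: measurable_funM.
have le w : step_size u v w ^+ k * expR (c * step_size u v w) <=
  f s + \sum_(i < n) f `|winc W i u v w|.
 have mono (x y : R) : 0 <= x -> x <= q * y -> x ^+ k * expR (c * x) <= f y.
  move=> x0 xy; have qy : 0 <= q * y by exact: le_trans xy.
  by rewrite /f ler_pM ?expR_ge0 ?exprn_ge0 ?lerXn2r// ler_expR ler_wpM2l.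
 have sge : 0 <= \sum_(i < n) f `|winc W i u v w| by apply: sumr_ge0 => i _; exact: f0.
 have [[i hi]|/forallNP H] := pselect (exists i, s < `|winc W i u v w|).
  pose i0 := [arg max_(j > i) `|winc W j u v w|]%O.
  have hmax j : `|winc W j u v w| <= `|winc W i0 u v w|.
   by rewrite /i0; case: Order.TotalTheory.arg_maxP => // j0 _; apply.
  apply: (@le_trans _ _ (f `|winc W i0 u v w|)).
   apply: mono; first exact: step_size_ge0.
   rewrite /step_size -/s /q -natr1 mulrDl mul1r addrC lerD//.
    rewrite mulr_natl -[X in _ *+ X]card_ord -sumr_const.
    by apply: ler_sum => j _.
   by apply: (le_trans (ltW hi)).
  rewrite (bigD1 i0)//= addrCA lerDl addr_ge0 ?f0 ?(ltW s0)//.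
  by apply: sumr_ge0 => j _; exact: f0.
 apply: (@le_trans _ _ (f s)); last by rewrite lerDl.
 apply: mono; first exact: step_size_ge0.
 rewrite /step_size -/s /q -natr1 mulrDl mul1r addrC lerD//.
 rewrite mulr_natl -[X in _ *+ X]card_ord -sumr_const.
 by apply: ler_sum => j _; rewrite leNgt; apply/negP; exact: H.
have if' := L1_le mf (fun w => eq_ind_r (fun x => x <= _) (le w)
 (ger0_norm (mulr_ge0 (exprn_ge0 k (step_size_ge0 u v w)) (expR_ge0 _)))) iS.
split => //; apply: (le_trans (le_mean if' iS le)).
rewrite meanD ?mean_cst; [|exact: L1_cst|exact: L1_sum].
rewrite mean_sum//.
have b1 : f s <= q ^+ k * expR (c * q) * s ^+ k.
 rewrite fE -[leRHS]mulrA; apply: ler_wpM2l; first by rewrite exprn_ge0// ltW.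
 rewrite [leLHS]mulrC; apply: ler_wpM2r; first by rewrite exprn_ge0// ltW.
 by rewrite ler_expR ler_piMr// mulr_ge0// ltW.
have b2 : \sum_(i < n) mean P (fun w => f `|winc W i u v w|) <=
  n%:R * (q ^+ k * gaussian_const k (c * q) * s ^+ k).
 rewrite mulr_natl -[X in _ *+ X]card_ord -sumr_const.
 apply: ler_sum => i _; under eq_fun do rewrite fE.
 rewrite meanZ ?(gm i).1// -[leRHS]mulrA; apply: ler_wpM2l; last exact: (gm i).2.
 by rewrite exprn_ge0// ltW.
apply: (le_trans (lerD b1 b2)); rewrite /step_moment_const -/q le_eqVlt.
by apply/orP; left; apply/eqP; ring.
Qed.

Section quadratic.
Variables (u v : R).
Hypotheses (u0 : 0 <= u) (uv : u <= v).

Lemma winc_linear_mean (a : 'I_n -> R) :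
 L2 P (fun w => \sum_i a i * winc W i u v w) /\
 mean P (fun w => \sum_i a i * winc W i u v w) = 0.
Proof.
have h i := winc_mean hW i u0 uv.
have s i : L2 P (winc W i u v) by case: (h i).
split; first by apply: L2_sum => i; exact: L2Z.
rewrite mean_sum => [|i]; last by apply: L1Z; exact: sq_L1.
apply: big1 => i _; rewrite meanZ; last exact: sq_L1.
by case: (h i) => _ -> _; rewrite mulr0.
Qed.

Lemma winc_square_mean (a : 'I_n -> R) :
 L1 P (fun w => (\sum_i a i * winc W i u v w) ^+ 2) /\
 mean P (fun w => (\sum_i a i * winc W i u v w) ^+ 2) = (v - u) * \sum_i a i ^+ 2.
Proof.
split; first by case: (winc_linear_mean a).1.
have h i := winc_mean hW i u0 uv.
have s i : L2 P (winc W i u v) by case: (h i).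
have E w : (\sum_i a i * winc W i u v w) ^+ 2 =
  \sum_i \sum_j (a i * a j) * (winc W i u v w * winc W j u v w).
 by rewrite expr2 big_distrlr /=; apply: eq_bigr => i _; apply: eq_bigr => j _; ring.
under eq_fun do rewrite E.
have ij i j : L1 P (fun w => (a i * a j) * (winc W i u v w * winc W j u v w)).
 by apply: L1Z; exact: L1M.
rewrite mean_sum => [|i]; last exact: L1_sum.
rewrite mulr_sumr; apply: eq_bigr => i _; rewrite mean_sum//.
rewrite (bigD1 i)//= big1 => [|j ji].
 by rewrite meanZ ?winc_cross// ?eqxx; [rewrite /=; ring|exact: L1M].
by rewrite meanZ ?winc_cross// 1?eq_sym ?(negbTE ji) ?mulr0//; exact: L1M.
Qed.

Lemma winc_diag_mean (b : 'I_n -> R) :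
 L1 P (fun w => \sum_i b i * winc W i u v w ^+ 2) /\
 mean P (fun w => \sum_i b i * winc W i u v w ^+ 2) = (v - u) * \sum_i b i.
Proof.
have h i := winc_mean hW i u0 uv.
have s i : L2 P (winc W i u v) by case: (h i).
have iz i : L1 P (fun w => b i * winc W i u v w ^+ 2).
 by apply: L1Z; case: (s i).
split; first exact: L1_sum.
rewrite mean_sum// mulr_sumr; apply: eq_bigr => i _.
by rewrite meanZ ?(s i).2//; case: (h i) => _ _ ->; rewrite mulrC.
Qed.

End quadratic.
End increment_moments.

(** * The noise half of a splitting step, and the adjoint of a whole step *)

Section noise_step.
Variables (R : realType) (m : nat) (At : 'M[R]_m.+1) (al sg : 'I_m.+1 -> R).
Notation leb := (lebesgue_tuple R m).
Notation wi := (widen_ord (leqnSn m)).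
Notation F := (simplex_density al).

Let g := \sum_i al i.

Definition noise (a : R) (y : m.-tuple R) (v : m.+1.-tuple R) : m.-tuple R :=
 [tuple tnth y j + a * (sg (wi j) * tnth v (wi j) - sg ord_max * tnth v ord_max) | j < m].

Definition drift_kappa (x : m.+1.-tuple R) : R := \sum_(j < m) shear_kappa At al j x.

(* Half the sum of the second derivatives of F along the n noise directions,
   divided by F. *)
Definition noise_kappa (x : m.+1.-tuple R) : R :=
 (\sum_i ((al i - g * tnth x i) * sg i) ^+ 2 -
  g * (\sum_i tnth x i * sg i ^+ 2 - \sum_i (tnth x i * sg i) ^+ 2)) / 2.

Lemma nice_drift_kappa : nice drift_kappa.
Proof. by apply: nice_sum => j; exact: nice_shear_kappa. Qed.

Lemma nice_noise_kappa : nice noise_kappa.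
Proof.
have nc (k : 'I_m.+1) : nice (fun x : m.+1.-tuple R => tnth x k) := nice_coord _ k.
have np (f h : m.+1.-tuple R -> R) : nice f -> nice h -> nice (fun x => f x - h x) := @niceB _ _ f h.
have n1 : nice (fun x : m.+1.-tuple R => \sum_i ((al i - g * tnth x i) * sg i) ^+ 2).
 apply: nice_sum => i; apply: niceX; apply: niceM; last exact: nice_cst.
 by apply: (np); [exact: nice_cst|apply: niceZ; exact: nc].
have n2 : nice (fun x : m.+1.-tuple R => \sum_i tnth x i * sg i ^+ 2).
 by apply: nice_sum => i; apply: niceM; [exact: nc|exact: nice_cst].
have n3 : nice (fun x : m.+1.-tuple R => \sum_i (tnth x i * sg i) ^+ 2).
 by apply: nice_sum => i; apply: niceX; apply: niceM; [exact: nc|exact: nice_cst].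
apply: niceM; last exact: nice_cst.
by apply: (np) => //; apply: niceZ; exact: np.
Qed.

Lemma noise_shifted a y v : shifted y (noise a y v) (fun i => a * (sg i * tnth v i))
 (- (a * (sg ord_max * tnth v ord_max))).
Proof.
apply: ord_max_ind => [k|]; rewrite ?logcoord_widen ?logcoord_max.
 by rewrite tnth_mktuple; ring.
by rewrite add0r subrr.
Qed.

Lemma noiseK a y v : noise a (noise (- a) y v) v = y.
Proof. by apply: eq_from_tnth => j; rewrite !tnth_mktuple; ring. Qed.

Let S := \sum_i `|sg i|.
Let S0 : 0 <= S. Proof. exact: sumr_ge0. Qed.
Let c := \sum_i `|al i| + `|g|.
Let c0 : 0 <= c. Proof. by rewrite addr_ge0// sumr_ge0. Qed.
Let c30 : 0 <= c ^+ 3 + 6 * c ^+ 2 + 6 * c.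
Proof. by apply: addr_ge0; [apply: addr_ge0|]; rewrite ?exprn_ge0// mulr_ge0// exprn_ge0. Qed.
Let c20 : 0 <= c ^+ 2 + 2 * c.
Proof. by apply: addr_ge0; rewrite ?exprn_ge0// mulr_ge0. Qed.

Lemma noise_dir_le a (v : m.+1.-tuple R) B : `|a| <= 1 -> (forall i, `|tnth v i| <= B) ->
 forall i, `|a * (sg i * tnth v i)| <= S * B.
Proof.
move=> a1 vB i; have B0 : 0 <= B := le_trans (normr_ge0 _) (vB i).
rewrite normrM; apply: (@le_trans _ _ (1 * (S * B))); last by rewrite mul1r.
rewrite ler_pM// normrM ler_pM// /S (bigD1 i)//= lerDl.
exact: sumr_ge0.
Qed.

(** With [noise_quadratic] below, the first-order and twice the second-order term of F(y - v) /
    F(y), where -v stands for the translation by noise of factor -1. *)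
Definition noise_linear (y : m.-tuple R) (v : m.+1.-tuple R) : R :=
 \sum_i (- ((al i - g * sm y i) * sg i)) * tnth v i.

Definition noise_quadratic (y : m.-tuple R) (v : m.+1.-tuple R) : R :=
 noise_linear y v ^+ 2 -
 g * (\sum_i (sm y i * sg i ^+ 2) * tnth v i ^+ 2 - (\sum_i (sm y i * sg i) * tnth v i) ^+ 2).

Section expansion.
Variable K : R.
Hypothesis hK : simplex_lip drift_kappa K.

Definition noise_const : R := (c ^+ 3 + 6 * c ^+ 2 + 6 * c) * S ^+ 3 + 2 * K * S + c * S * K +
 (c ^+ 2 + 2 * c) * S ^+ 2 * K.
(** The additional 1 absorbs one power of B through B <= exp(B), because the expansion also produces
    terms of order B^4. *)
Definition noise_rate : R := c * S + 1.

Lemma noise_const_ge0 : 0 <= noise_const.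
Proof.
have [K0 _ _] := hK.
by rewrite /noise_const; repeat apply: addr_ge0; repeat (apply: mulr_ge0 => //); exact: exprn_ge0.
Qed.

Lemma noise_density y v B h : 0 <= h -> 0 <= B -> h <= B ^+ 2 -> (forall i, `|tnth v i| <= B) ->
 `|F (noise (-1) y v) * (1 + h * drift_kappa (softmax (noise (-1) y v))) -
  F y * (1 + h * drift_kappa (softmax y) + noise_linear y v + noise_quadratic y v / 2)| <=
 F y * (noise_const * (B ^+ 3 * expR (noise_rate * B))).
Proof.
move=> h0 B0 hB vB; have [K0 fK _] := hK.
set y1 := noise (-1) y v; pose dl i := -1 * (sg i * tnth v i).
have hs : shifted y y1 dl (- (-1 * (sg ord_max * tnth v ord_max))) := noise_shifted (-1) y v.
have n1 : `|-1 : R| <= 1 by rewrite normrN normr1.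
have D := noise_dir_le n1 vB; rewrite -/dl in D.
set d := S * B in D; have d0 : 0 <= d by rewrite mulr_ge0.
have x3 := @tilt_ratio_expand3 _ _ (sm y) dl d (sm_ge0 y) (sm_sum1 y) D al g c (lexx _).
have x2 := @tilt_ratio_expand2 _ _ (sm y) dl d (sm_ge0 y) (sm_sum1 y) D al g c (lexx _).
have i01 : 0 <= (1 : R) <= 1 by rewrite lexx ler01.
have x1 := @tilt_ratio_le _ _ (sm y) dl d (sm_ge0 y) (sm_sum1 y) D al g c (lexx _) 1 i01.
have x0 := tilt_ratio_gt0 (sm y) dl al g 1.
set r := tilt_ratio _ _ _ _ _ in x0 x1 x2 x3.
have FE : F y1 = F y * r by exact: (simplex_density_shifted al hs).
rewrite !tilt_moment0 in x2 x3; try exact: sm_sum1.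
have m1 : \sum_i sm y i * dl i ^+ 1 = - \sum_i (sm y i * sg i) * tnth v i.
 by rewrite -sumrN; apply: eq_bigr => i _; rewrite /dl expr1; ring.
have m2 : \sum_i sm y i * dl i ^+ 2 = \sum_i (sm y i * sg i ^+ 2) * tnth v i ^+ 2.
 by apply: eq_bigr => i _; rewrite /dl; ring.
have lE : \sum_i al i * dl i - g * \sum_i sm y i * dl i ^+ 1 = noise_linear y v.
 rewrite /noise_linear mulr_sumr -sumrB; apply: eq_bigr => i _; rewrite /dl expr1; ring.
rewrite lE in x2 x3; rewrite m1 m2 sqrrN -/(noise_quadratic y v) in x3.
have lD : `|noise_linear y v| <= c * d.
 rewrite -lE m1; have -> : c * d = (\sum_i `|al i|) * d + `|g| * d by rewrite /c mulrDl.
 apply: (le_trans (ler_normB _ _)); apply: lerD.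
  apply: (le_trans (ler_norm_sum _ _ _)); rewrite mulr_suml.
  by apply: ler_sum => i _; rewrite normrM ler_wpM2l ?D.
 rewrite normrM ler_wpM2l// -m1.
 apply: (le_trans (ler_norm_sum _ _ _)).
 rewrite -[leRHS]mul1r -(sm_sum1 y) mulr_suml; apply: ler_sum => i _.
 by rewrite expr1 normrM (ger0_norm (sm_ge0 _ _)) ler_wpM2l ?sm_ge0 ?D.
have kD : `|drift_kappa (softmax y1) - drift_kappa (softmax y)| <= K * (2 * d).
 exact: (nice_softmax_lip hK hs D).
have kK := fK _ (simplex_softmax y).
have F0 := simplex_density_gt0 al y.
set a := drift_kappa (softmax y) in kD kK *; set a1 := drift_kappa (softmax y1) in kD *.
set L := noise_linear y v in x2 x3 lD *; set Q := noise_quadratic y v in x3 *.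
have -> : F y1 * (1 + h * a1) - F y * (1 + h * a + L + Q / 2) =
  F y * ((r - 1 - L - Q / 2) + h * (r * (a1 - a) + (r - 1) * a)) by rewrite FE; field.
rewrite normrM (gtr0_norm F0) ler_wpM2l ?(ltW F0)//.
set E := expR (noise_rate * B).
have E1 : 1 <= E by rewrite -expR0 ler_expR mulr_ge0// addr_ge0// mulr_ge0.
have Ec : expR (c * d) <= E.
 by rewrite /E ler_expR /noise_rate [(c * S + 1) * B]mulrDl mul1r /d mulrA lerDl.
have EB : B * expR (c * d) <= E.
 rewrite /E /noise_rate [(c * S + 1) * B]mulrDl mul1r expRD mulrC /d mulrA ler_wpM2l ?expR_ge0//.
 by apply: le_trans (expR_ge1Dx B); rewrite lerDr.
have B3 : 0 <= B ^+ 3 by exact: exprn_ge0.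
have BE (z w : R) : 0 <= z -> w <= E -> z * B ^+ 3 * w <= z * (B ^+ 3 * E).
 by move=> z0 wE; rewrite -mulrA ler_wpM2l// ler_wpM2l.
have nM (p q p' q' : R) : `|p| <= p' -> `|q| <= q' -> `|p * q| <= p' * q'.
 by move=> hp hq; rewrite normrM ler_pM.
have t1 : `|r - 1 - L - Q / 2| <= (c ^+ 3 + 6 * c ^+ 2 + 6 * c) * S ^+ 3 * (B ^+ 3 * E).
 apply: (le_trans x3); rewrite /d exprMn.
 have -> : (c ^+ 3 + 6 * c ^+ 2 + 6 * c) * (S ^+ 3 * B ^+ 3) * expR (c * (S * B)) =
  (c ^+ 3 + 6 * c ^+ 2 + 6 * c) * S ^+ 3 * B ^+ 3 * expR (c * (S * B)) by ring.
 by apply: BE => //; rewrite mulr_ge0 ?exprn_ge0.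
have rn : `|r| <= expR (c * d) by rewrite gtr0_norm.
have t2 : `|h * (r * (a1 - a))| <= 2 * K * S * (B ^+ 3 * E).
 have hh : `|h| <= B ^+ 2 by rewrite ger0_norm.
 apply: (le_trans (nM _ _ _ _ hh (nM _ _ _ _ rn kD))); rewrite /d.
 have -> : B ^+ 2 * (expR (c * (S * B)) * (K * (2 * (S * B)))) =
  2 * K * S * B ^+ 3 * expR (c * (S * B)) by ring.
 by apply: BE => //; rewrite !mulr_ge0.
have t3 : `|h * ((r - 1) * a)| <= c * S * K * (B ^+ 3 * E) + (c ^+ 2 + 2 * c) * S ^+ 2 * K * (B ^+ 3 * E).
 have hh : `|h| <= B ^+ 2 by rewrite ger0_norm.
 have r1 : `|r - 1| <= c * d + (c ^+ 2 + 2 * c) * d ^+ 2 * expR (c * d).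
  have -> : r - 1 = L + (r - 1 - L) by ring.
  by apply: (le_trans (ler_normD _ _)); exact: lerD.
 apply: (le_trans (nM _ _ _ _ hh (nM _ _ _ _ r1 kK))); rewrite /d.
 have -> : B ^+ 2 * ((c * (S * B) + (c ^+ 2 + 2 * c) * (S * B) ^+ 2 * expR (c * (S * B))) * K) =
  c * S * K * B ^+ 3 * 1 + (c ^+ 2 + 2 * c) * S ^+ 2 * K * B ^+ 3 * (B * expR (c * (S * B))) by ring.
 by apply: lerD; apply: BE; rewrite ?mulr_ge0 ?exprn_ge0.
rewrite mulrDr; apply: (le_trans (ler_normD _ _)).
apply: (le_trans (lerD t1 (le_trans (ler_normD _ _) (lerD t2 t3)))).
by rewrite /noise_const le_eqVlt; apply/orP; left; apply/eqP; ring.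
Qed.

End expansion.

Section adjoint.
Context d (T : measurableType d) (P : probability T R).
Variables (W : 'I_m.+1 -> R -> T -> R).
Hypothesis hW : standard_brownian_motion P W.

Let mF := measurable_simplex_density (m := m) al.
Let F0 y : 0 <= F y. Proof. by rewrite ltW// simplex_density_gt0. Qed.

Lemma measurable_noise a d' (E : measurableType d') (y : E -> m.-tuple R) (v : E -> m.+1.-tuple R) :
 borel y -> borel v ->
 borel (fun x => noise a (y x) (v x)).
Proof.
move=> my mv; apply: measurable_fun_tuple => j.
apply: measurable_funD; first exact: measurable_fun_tnth.
apply: measurable_funM => //; apply: measurable_funB.
 by apply: measurable_funM => //; exact: measurable_fun_tnth.
by apply: measurable_funM => //; exact: measurable_fun_tnth.
Qed.

(** For each event the noise is a translation, which preserves Lebesgue measure and whose inverse is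
    the noise of factor -1; two applications of Tonelli bring the mean from the test function to the
    weight. *)
Lemma noise_transpose (V : T -> m.+1.-tuple R) (f : m.-tuple R -> R) (psi : m.-tuple R -> \bar R) :
 borel V -> borel f -> (forall y, 0 <= f y) ->
 (forall y, (0 <= psi y)%E) -> borel psi ->
 (\int[leb]_y ((f y)%:E * \int[P]_w psi (noise 1 y (V w))) =
  \int[leb]_y ((\int[P]_w (f (noise (-1) y (V w)))%:E) * psi y))%E.
Proof.
move=> mV mf f0 p0 mp.
have mN a : borel (fun p => noise a p.1 (V p.2)).
 apply: measurable_noise; first exact: measurable_fst.
 by apply: measurableT_comp => //; exact: measurable_snd.
have mNy a (w : T) : borel (fun y => noise a y (V w)).
 exact: measurable_noise.
have mNw a (y : m.-tuple R) : borel (fun w => noise a y (V w)).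
 exact: measurable_noise.
pose G1 (p : m.-tuple R * T) : \bar R := ((f p.1)%:E * psi (noise 1 p.1 (V p.2)))%E.
pose G2 (p : m.-tuple R * T) : \bar R := ((f (noise (-1) p.1 (V p.2)))%:E * psi p.1)%E.
have mG1 : borel G1.
 apply: emeasurable_funM; last exact: measurableT_comp mp (mN 1).
 by apply/measurable_EFinP; apply: measurableT_comp => //; exact: measurable_fst.
have mG2 : borel G2.
 apply: emeasurable_funM; last by apply: measurableT_comp => //; exact: measurable_fst.
 by apply/measurable_EFinP; exact: measurableT_comp mf (mN (-1)).
have G10 p : (0 <= G1 p)%E by rewrite mule_ge0// lee_fin.
have G20 p : (0 <= G2 p)%E by rewrite mule_ge0// lee_fin.
transitivity (\int[leb]_y \int[P]_w G1 (y, w))%E.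
 apply: eq_integral => y _; rewrite -ge0_integralZl//; last by rewrite lee_fin.
 exact: measurableT_comp mp (mNw 1 y).
rewrite (fubini_tonelli _ mG1 G10).
transitivity (\int[P]_w \int[leb]_y G2 (y, w))%E; last first.
 rewrite -(fubini_tonelli _ mG2 G20); apply: eq_integral => y _.
 rewrite -ge0_integralZr//.
 - by apply/measurable_EFinP; exact: measurableT_comp mf (mNw (-1) y).
 - by move=> w _; rewrite lee_fin.
apply: eq_integral => w _.
pose t : m.-tuple R := [tuple - (sg (wi j) * tnth (V w) (wi j) - sg ord_max * tnth (V w) ord_max) | j < m].
have tE y : translate t (enum 'I_m) y = noise (-1) y (V w).
 by apply: eq_from_tnth => j; rewrite !tnth_mktuple mem_enum mulN1r.
rewrite [LHS](@integral_translate _ _ t (enum 'I_m)); last first.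
- apply: emeasurable_funM; first exact/measurable_EFinP.
 exact: measurableT_comp mp (mNy 1 w).
- by move=> y; exact: G10.
- exact: enum_uniq.
apply: eq_integral => y _; rewrite tE /G1 /G2 /=.
by have := noiseK 1 y (V w) => ->.
Qed.

Lemma noise_mean y u v (h := v - u) : 0 <= u -> u < v ->
 let L w := noise_linear y (increment W u v w) in
 let Q w := noise_quadratic y (increment W u v w) in
 [/\ L1 P L, L1 P Q, mean P L = 0 &
   mean P (fun w => Q w / 2) = h * noise_kappa (softmax y)].
Proof.
move=> u0 uv L Q; have uv' := ltW uv.
have VE w i : tnth (increment W u v w) i = winc W i u v w by rewrite tnth_mktuple.
pose a (i : 'I_m.+1) := - ((al i - g * sm y i) * sg i).
pose q (i : 'I_m.+1) := sm y i * sg i ^+ 2.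
pose e (i : 'I_m.+1) := sm y i * sg i.
have LE : L = fun w => \sum_i a i * winc W i u v w.
 by apply/funext => w; apply: eq_bigr => i _; rewrite VE.
have [sL mL] := winc_linear_mean hW u0 uv' a.
have [iL2 mL2] := winc_square_mean hW u0 uv' a.
have [iq mq] := winc_diag_mean hW u0 uv' q.
have [ie me] := winc_square_mean hW u0 uv' e.
have QE : Q = fun w => (\sum_i a i * winc W i u v w) ^+ 2 -
  g * (\sum_i q i * winc W i u v w ^+ 2 - (\sum_i e i * winc W i u v w) ^+ 2).
 apply/funext => w; rewrite /Q /noise_quadratic -/(L w) LE; congr (_ - _ * (_ - _ ^+ 2)).
  by apply: eq_bigr => i _; rewrite VE.
 by apply: eq_bigr => i _; rewrite VE.
have iD := L1B iq ie.
have iQ : L1 P Q by rewrite QE; apply: L1B => //; exact: L1Z.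
split => //; first by rewrite LE; exact: sq_L1.
 by rewrite LE.
rewrite (_ : (fun w => Q w / 2) = fun w => 2^-1 * Q w); last by apply/funext => w; rewrite mulrC.
rewrite meanZ// QE meanB//; last exact: L1Z.
rewrite meanZ// meanB// mL2 mq me -/h /noise_kappa.
have -> : \sum_i a i ^+ 2 = \sum_i ((al i - g * tnth (softmax y) i) * sg i) ^+ 2.
 by apply: eq_bigr => i _; rewrite /a sqrrN.
by rewrite /q /e /sm; field.
Qed.

Definition replicator_kappa (x : m.+1.-tuple R) : R := drift_kappa x + noise_kappa x.

Lemma nice_replicator_kappa : nice replicator_kappa.
Proof. by apply: niceD; [exact: nice_drift_kappa|exact: nice_noise_kappa]. Qed.

(** The weight carries the factor 1 + h [drift_kappa] already: the sweep, which acts first in a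
    step, is transposed first, and the noise then acts on what it leaves. After averaging, the
    linear term disappears and the quadratic one yields [noise_kappa]; the third-order remainder is
    O(h^(3/2)). *)
Lemma noise_density_mean : exists C, 0 <= C /\ forall y u v, 0 <= u -> u < v -> v - u <= 1 ->
 let h := v - u in
 let A w := F (noise (-1) y (increment W u v w)) *
   (1 + h * drift_kappa (softmax (noise (-1) y (increment W u v w)))) in
 L1 P A /\
 `|mean P A - F y * (1 + h * replicator_kappa (softmax y))| <= C * Num.sqrt h ^+ 3 * F y.
Proof.
have [_ [K hK]] := nice_drift_kappa; have [K0 _ _] := hK.
pose M := step_moment_const (R := R) m.+1 3 noise_rate.
have nr0 : 0 <= noise_rate by rewrite /noise_rate addr_ge0// mulr_ge0.
have M0 : 0 <= M by exact: step_moment_const_ge0.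
exists (noise_const K * M); split; first by rewrite mulr_ge0// noise_const_ge0.
move=> y u v u0 uv h1 h A.
have v0 : 0 <= v by rewrite (le_trans u0)// ltW.
have h0 : 0 < h by rewrite subr_gt0.
have [iL iQ mL mQ] := noise_mean y u0 uv.
have [iB mB] := step_moment hW 3 nr0 u0 uv h1; rewrite -/M in mB.
set B := step_size W u v in iB mB.
pose main w := F y * (1 + h * drift_kappa (softmax y) + noise_linear y (increment W u v w) +
 noise_quadratic y (increment W u v w) / 2).
have iQ2 : L1 P (fun w => noise_quadratic y (increment W u v w) / 2).
 by have := L1Z 2^-1 iQ; under eq_fun do rewrite mulrC.
have i1 : L1 P (fun w => 1 + h * drift_kappa (softmax y) + noise_linear y (increment W u v w)).
 by apply: L1D => //; exact: L1_cst.
have im : L1 P main by apply: L1Z; exact: L1D.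
have mmain : mean P main = F y * (1 + h * replicator_kappa (softmax y)).
 rewrite /main meanZ; last exact: L1D.
 rewrite meanD// meanD//; last exact: L1_cst.
 by rewrite mean_cst mL mQ /replicator_kappa -/h; ring.
have mV : borel (increment W u v) by exact: (measurable_increment hW).
have mNy : borel (fun w => noise (-1) y (increment W u v w)).
 exact: measurable_noise.
have mA : borel A.
 apply: measurable_funM; first exact: measurableT_comp mF mNy.
 apply: measurable_funD => //; apply: measurable_funM => //.
 exact: measurableT_comp (measurable_nice_softmax nice_drift_kappa) mNy.
have le w : `|A w - main w| <= F y * (noise_const K * (B w ^+ 3 * expR (noise_rate * B w))).
 apply: noise_density => //; first exact: ltW.
 - exact: step_size_ge0.
 - have := step_size_ge_sqrt W u v w; rewrite -/h -/B => hB.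
  by rewrite -{1}(sqr_sqrtr (ltW h0)) lerXn2r ?nnegrE ?sqrtr_ge0// step_size_ge0.
 - by move=> i; rewrite tnth_mktuple; exact: step_size_ge_winc.
have iR : L1 P (fun w => F y * (noise_const K * (B w ^+ 3 * expR (noise_rate * B w)))).
 by apply: L1Z; exact: L1Z.
have iAm : L1 P (fun w => A w - main w).
 by apply: (L1_le _ le iR); apply: measurable_funB => //; exact: measurable_L1 im.
have iA : L1 P A.
 by have := L1D iAm im; under eq_fun do rewrite subrK.
split => //; rewrite -mmain -meanB//.
apply: (le_trans (norm_mean_le iAm iR le)).
rewrite !meanZ//; last exact: L1Z.
rewrite [leLHS]mulrC; apply: ler_wpM2r => //.
by rewrite -[leRHS]mulrA; apply: ler_wpM2l => //; exact: noise_const_ge0.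
Qed.

Definition scheme_step (h : R) (y : m.-tuple R) (v : m.+1.-tuple R) : m.-tuple R :=
 noise 1 (sweep At h y (enum 'I_m)) v.

Lemma measurable_scheme_step h d' (E : measurableType d') (y : E -> m.-tuple R) (v : E -> m.+1.-tuple R) :
 borel y -> borel v ->
 borel (fun x => scheme_step h (y x) (v x)).
Proof.
move=> my mv; apply: measurable_noise => //.
exact: measurableT_comp (measurable_sweep At h (enum 'I_m)) my.
Qed.

(** The sweep is transposed against the noise-averaged test function [psi'], at a relative error
    O(h^2), and the noise is then moved to the weight, at a relative error O(h^(3/2)). *)
Lemma step_adjoint : exists C h1, [/\ 0 <= C, 0 < h1, h1 <= 1 &
 forall u v (psi : m.-tuple R -> \bar R), 0 <= u -> u < v -> v - u <= h1 ->
 (forall y, (0 <= psi y)%E) -> borel psi ->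
 (forall y, 0 <= 1 + (v - u) * replicator_kappa (softmax y)) /\
 apx (C * Num.sqrt (v - u) ^+ 3)
  (\int[leb]_y ((F y)%:E * \int[P]_w psi (scheme_step (v - u) y (increment W u v w))))%E
  (\int[leb]_y ((F y * (1 + (v - u) * replicator_kappa (softmax y)))%:E * psi y))%E].
Proof.
have [Kb [Kb0 hb]] := nice_uniform (nice_rel_payoff At).
have [Kd [Kd0 hd]] := nice_uniform (nice_rel_payoff' At).
have [Kk [Kk0 hk]] := nice_uniform (nice_shear_kappa At al).
pose K3 := Kb + Kd + Kk.
have K30 : 0 <= K3 by rewrite !addr_ge0.
have lb j : simplex_lip (rel_payoff At j) K3 by apply: simplex_lipW (hb j); rewrite /K3; lra.
have ld j : simplex_lip (rel_payoff' At j) K3 by apply: simplex_lipW (hd j); rewrite /K3; lra.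
have lk j : simplex_lip (shear_kappa At al j) K3 by apply: simplex_lipW (hk j); rewrite /K3; lra.
have [C1 [h1 [C10 h10 h11 sweepA]]] := sweep_adjoint K30 lb ld lk (enum 'I_m).
have [C2 [C20 dens]] := noise_density_mean.
have [_ [Kr [Kr0 hr _]]] := nice_replicator_kappa.
have [_ [Kf [Kf0 hf _]]] := nice_drift_kappa.
pose q := 1 + Kr + Kf + 2 * C2; have q0 : 0 < q by rewrite /q; lra.
pose h2 := Num.min h1 ((2 * q)^-1 ^+ 2).
have q2 : (2 * q)^-1 <= 2^-1 by rewrite lef_pV2 ?posrE ?mulr_gt0// /q; lra.
have q20 : 0 < (2 * q)^-1 by rewrite invr_gt0 mulr_gt0.
exists (C1 + 4 * C2), h2; split.
- by lra.
- by rewrite lt_min h10 exprn_gt0.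
- by rewrite ge_min h11.
move=> u v psi u0 uv hh p0 mp; set h := v - u in hh *.
have h0 : 0 < h by rewrite subr_gt0.
have hh1 : h <= h1 by apply: (le_trans hh); rewrite ge_min lexx.
have hle : h <= 1 by exact: le_trans hh1 h11.
set s := Num.sqrt h; have s0 : 0 <= s by exact: sqrtr_ge0.
have sE : s ^+ 2 = h by rewrite sqr_sqrtr// ltW.
have sq : s <= (2 * q)^-1.
 rewrite -(ler_pXn2r (n := 2))// ?nnegrE// ?(ltW q20)// sE.
 by apply: (le_trans hh); rewrite ge_min lexx orbT.
have s1 : s <= 1 by lra.
have hs : h <= s by rewrite -sE expr2 ler_piMl.
have smalls (a : R) : 0 <= a -> a <= q -> a * s <= 2^-1.
 move=> a0 aq; apply: (@le_trans _ _ (q * (2 * q)^-1)); first by rewrite ler_pM.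
 by rewrite invfM mulrCA divff ?mulr1// gt_eqF.
have small (a : R) : 0 <= a -> a <= q -> h * a <= 2^-1.
 move=> a0 aq; apply: le_trans (smalls a a0 aq); by rewrite mulrC ler_wpM2l.
have [qr qf qc] : [/\ Kr <= q, Kf <= q & 2 * C2 <= q] by split; rewrite /q; lra.
have nn (f : m.+1.-tuple R -> R) k y : 0 <= k -> k <= q -> (forall x, simplex x -> `|f x| <= k) ->
  2^-1 <= 1 + h * f (softmax y).
 move=> k0 kq fk; have : `|h * f (softmax y)| <= 2^-1.
  apply: le_trans (small k k0 kq); rewrite normrM gtr0_norm// ler_wpM2l ?(ltW h0)//.
  by apply: fk; exact: simplex_softmax.
 by rewrite ler_norml => /andP[]; lra.
have nr y : 2^-1 <= 1 + h * replicator_kappa (softmax y) by exact: nn hr.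
have nf y : 2^-1 <= 1 + h * drift_kappa (softmax y) by exact: nn hf.
split; first by move=> y; have := nr y; lra.
have v0 : 0 <= v by rewrite (le_trans u0)// ltW.
have mV : borel (increment W u v) by exact: (measurable_increment hW).
pose psi' (y : m.-tuple R) : \bar R := (\int[P]_w psi (noise 1 y (increment W u v w)))%E.
have psi'0 y : (0 <= psi' y)%E by apply: integral_ge0.
have mG : borel (fun p => psi (noise 1 p.1 (increment W u v p.2))).
 apply: measurableT_comp mp _; apply: measurable_noise; first exact: measurable_fst.
 by apply: measurableT_comp => //; exact: measurable_snd.
have mpsi' : borel psi'.
 exact: (measurable_fun_fubini_tonelli_F _ mG (fun p => p0 _)).
have a1 := sweepA h psi' (ltW h0) hh1 psi'0 mpsi'.
have mk (f : m.+1.-tuple R -> R) : nice f ->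
  borel (fun y => F y * (1 + h * f (softmax y))).
 move=> nf'; apply: measurable_funM => //; apply: measurable_funD => //.
 by apply: measurable_funM => //; exact: measurable_nice_softmax.
have Fk0 y : 0 <= F y * (1 + h * drift_kappa (softmax y)).
 by rewrite mulr_ge0//; have := nf y; lra.
have E1 : (\int[leb]_y ((F y * (1 + h * \sum_(j <- enum 'I_m) shear_kappa At al j (softmax y)))%:E * psi' y) =
  \int[leb]_y ((\int[P]_w (F (noise (-1) y (increment W u v w)) *
   (1 + h * drift_kappa (softmax (noise (-1) y (increment W u v w)))))%:E) * psi y))%E.
 rewrite -(noise_transpose (f := fun y => F y * (1 + h * drift_kappa (softmax y))) mV)//; last first.
  exact: mk nice_drift_kappa.
 by apply: eq_integral => y _; rewrite /drift_kappa big_enum.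
rewrite E1 in a1.
have hs3 : C1 * h ^+ 2 <= C1 * s ^+ 3.
 have -> : h ^+ 2 = s * s ^+ 3 by rewrite -[in LHS]sE; ring.
 apply: ler_wpM2l => //; apply: ler_piMl => //; exact: exprn_ge0.
have I0 (f : m.-tuple R -> \bar R) : (forall y, (0 <= f y)%E) ->
  (0 <= \int[leb]_y (f y * psi y))%E.
 by move=> f0; apply: integral_ge0 => y _; exact: mule_ge0.
rewrite mulrDl; apply: apx_trans (apxW hs3 _ _ a1) _.
- by apply: integral_ge0 => y _; rewrite mule_ge0// lee_fin.
- by apply: I0 => y; apply: integral_ge0 => w _; rewrite lee_fin.
have -> : 4 * C2 * s ^+ 3 = 2 * (2 * C2 * s ^+ 3) by ring.
have mA : borel
  (fun y => \int[P]_w (F (noise (-1) y (increment W u v w)) *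
   (1 + h * drift_kappa (softmax (noise (-1) y (increment W u v w)))))%:E)%E.
 apply: (@measurable_fun_fubini_tonelli_F _ _ _ _ _ P (fun p : m.-tuple R * T =>
  (F (noise (-1) p.1 (increment W u v p.2)) *
   (1 + h * drift_kappa (softmax (noise (-1) p.1 (increment W u v p.2)))))%:E)).
  apply/measurable_EFinP; apply: measurableT_comp (mk _ nice_drift_kappa) _.
  apply: measurable_noise; first exact: measurable_fst.
  by apply: measurableT_comp => //; exact: measurable_snd.
 by move=> p; rewrite lee_fin.
apply: apx_integral.
- by move=> y; rewrite mule_ge0//; apply: integral_ge0 => w _; rewrite lee_fin.
- by move=> y; rewrite mule_ge0// lee_fin mulr_ge0//; have := nr y; lra.
- exact: emeasurable_funM.
- apply: emeasurable_funM => //; apply/measurable_EFinP; exact: mk nice_replicator_kappa.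
move=> y; have [iA mAb] := dens y u v u0 uv hle.
rewrite (meanE iA); apply: apxM => //; apply: apx_real.
- by rewrite mulr_ge0//; have := nr y; lra.
- by rewrite mulr_ge0 ?exprn_ge0// mulr_ge0.
- apply: le_trans (smalls (2 * C2) _ qc); last by rewrite mulr_ge0.
 by rewrite ler_wpM2l ?mulr_ge0// exprS ler_piMr// expr_le1.
apply: (le_trans mAb); rewrite -/h -/s.
have -> : 2 * C2 * s ^+ 3 * (F y * (1 + h * replicator_kappa (softmax y))) =
 C2 * s ^+ 3 * F y * (2 * (1 + h * replicator_kappa (softmax y))) by ring.
rewrite ler_peMr//; first by rewrite mulr_ge0// mulr_ge0// exprn_ge0.
by have := nr y; lra.
Qed.

End adjoint.
End noise_step.

(** * Strong error of one step *)

Section weighted_quadratic.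
Variables (R : realType) (n : nat) (p : 'I_n -> R).
Hypotheses (p0 : forall i, 0 <= p i) (p1 : \sum_i p i = 1).
Implicit Types a d : 'I_n -> R.

Definition wmean a : R := \sum_k p k * a k.
(** Twice the second-order coefficient, relative to p_i, in the expansion of the i-th tilted
    weight. *)
Definition wvar i a : R := (a i - wmean a) ^+ 2 - (wmean (fun k => a k ^+ 2) - wmean a ^+ 2).

Lemma wmean_le a A : (forall k, `|a k| <= A) -> `|wmean a| <= A.
Proof.
move=> aA; apply: (le_trans (ler_norm_sum _ _ _)).
rewrite -[leRHS]mul1r -p1 mulr_suml; apply: ler_sum => k _.
by rewrite normrM (ger0_norm (p0 k)) ler_wpM2l.
Qed.

Lemma wmeanD a d : wmean (fun k => a k + d k) = wmean a + wmean d.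
Proof. by rewrite /wmean -big_split; apply: eq_bigr => k _; rewrite mulrDr. Qed.

Lemma wmeanZ c a : wmean (fun k => c * a k) = c * wmean a.
Proof. by rewrite /wmean mulr_sumr; apply: eq_bigr => k _; rewrite mulrCA. Qed.

Lemma wvar_perturb i a d A D : (forall k, `|a k| <= A) -> (forall k, `|d k| <= D) ->
 `|wvar i (fun k => a k + d k) - wvar i a| <= 6 * (D * (2 * A + D)).
Proof.
move=> aA dD.
have E : wvar i (fun k => a k + d k) - wvar i a =
 (d i - wmean d) * (2 * (a i - wmean a) + (d i - wmean d)) -
  wmean (fun k => d k * (2 * a k + d k)) + wmean d * (2 * wmean a + wmean d).
 rewrite /wvar wmeanD.
 have -> : wmean (fun k => (a k + d k) ^+ 2) =
  wmean (fun k => a k ^+ 2) + wmean (fun k => d k * (2 * a k + d k)).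
  by rewrite -wmeanD; congr wmean; apply/funext => k; ring.
 ring.
have nM (x y X Y : R) : `|x| <= X -> `|y| <= Y -> `|x * y| <= X * Y.
 by move=> hx hy; rewrite normrM ler_pM.
have t (x y X Y : R) : `|x| <= X -> `|y| <= Y -> `|x + y| <= X + Y.
 by move=> hx hy; apply: (le_trans (ler_normD _ _)); exact: lerD.
have tB (x y X Y : R) : `|x| <= X -> `|y| <= Y -> `|x - y| <= X + Y.
 by move=> hx hy; apply: (le_trans (ler_normB _ _)); exact: lerD.
have n2 : `|2 : R| <= 2 by rewrite ger0_norm.
have h1 := nM _ _ _ _ (tB _ _ _ _ (dD i) (wmean_le dD))
 (t _ _ _ _ (nM _ _ _ _ n2 (tB _ _ _ _ (aA i) (wmean_le aA))) (tB _ _ _ _ (dD i) (wmean_le dD))).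
have h2 : `|wmean (fun k => d k * (2 * a k + d k))| <= D * (2 * A + D).
 by apply: wmean_le => k; apply: (nM) => //; apply: (t) => //; exact: (nM).
have h3 := nM _ _ _ _ (wmean_le dD) (t _ _ _ _ (nM _ _ _ _ n2 (wmean_le aA)) (wmean_le dD)).
rewrite E; apply: (le_trans (t _ _ _ _ (tB _ _ _ _ h1 h2) h3)).
by rewrite le_eqVlt; apply/orP; left; apply/eqP; ring.
Qed.

End weighted_quadratic.

(** * Expansion of one scheme step on the simplex *)

Section scheme_expansion.
Variables (R : realType) (m : nat) (At : 'M[R]_m.+1) (sg : 'I_m.+1 -> R).
Implicit Types (x : m.+1.-tuple R) (y : m.-tuple R) (v : m.+1.-tuple R).
Notation wi := (widen_ord (leqnSn m)).

Definition rel_noise (i j : 'I_m.+1) x : R := ((i == j)%:R - tnth x j) * sg j.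

Definition scheme_diffusion (i j : 'I_m.+1) x : R := tnth x i * rel_noise i j x.

(** The coefficients of the second-order term of the i-th softmax coordinate in the noise, half of
    p_i times [wvar], written as a bilinear form in [v]. *)
Definition scheme_quadratic (i j k : 'I_m.+1) x : R :=
 tnth x i / 2 * (rel_noise i j x * rel_noise i k x -
  ((j == k)%:R * (tnth x j * sg j ^+ 2) - (tnth x j * sg j) * (tnth x k * sg k))).

(** The last sum is the Ito correction: the mean of the quadratic term, whose matrix of second
    moments is h times the identity. *)
Definition scheme_drift (i : 'I_m.+1) x : R :=
 tnth x i * (payoff At i x - \sum_k tnth x k * payoff At k x) + \sum_j scheme_quadratic i j j x.

Lemma nice_rel_noise i j : nice (rel_noise i j).
Proof.
apply: niceM; last exact: nice_cst.
by apply: niceB; [exact: nice_cst|exact: nice_coord].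
Qed.

Lemma nice_scheme_diffusion i j : nice (scheme_diffusion i j).
Proof. by apply: niceM; [exact: nice_coord|exact: nice_rel_noise]. Qed.

Lemma nice_scheme_quadratic i j k : nice (scheme_quadratic i j k).
Proof.
apply: niceM; first by apply: niceM; [exact: nice_coord|exact: nice_cst].
apply: niceB; first by apply: niceM; exact: nice_rel_noise.
have nc l : nice (fun x : m.+1.-tuple R => tnth x l * sg l).
 by apply: niceM; [exact: nice_coord|exact: nice_cst].
apply: niceB; last exact: niceM.
by apply: niceM; [exact: nice_cst|apply: niceM; [exact: nice_coord|exact: nice_cst]].
Qed.

Lemma nice_scheme_drift i : nice (scheme_drift i).
Proof.
apply: niceD; last by apply: nice_sum => j; exact: nice_scheme_quadratic.
apply: niceM; first exact: nice_coord.
apply: niceB; first exact: nice_payoff.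
by apply: nice_sum => k; apply: niceM; [exact: nice_coord|exact: nice_payoff].
Qed.

Lemma scheme_diffusionE i x v :
 \sum_j scheme_diffusion i j x * tnth v j =
 tnth x i * (sg i * tnth v i - wmean (tnth x) (fun k => sg k * tnth v k)).
Proof.
have -> : sg i * tnth v i = \sum_j (i == j)%:R * (sg j * tnth v j).
 by rewrite (bigD1 i)//= eqxx mul1r big1 ?addr0// => j /negbTE ji; rewrite eq_sym ji mul0r.
rewrite /wmean -sumrB mulr_sumr; apply: eq_bigr => j _.
by rewrite /scheme_diffusion /rel_noise; ring.
Qed.

Lemma scheme_quadraticE i x v :
 \sum_j \sum_k scheme_quadratic i j k x * (tnth v j * tnth v k) =
 tnth x i * wvar (tnth x) i (fun k => sg k * tnth v k) / 2.
Proof.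
rewrite /wvar; set a := fun k => sg k * tnth v k.
have e1 : a i - wmean (tnth x) a = \sum_j rel_noise i j x * tnth v j.
 have -> : a i = \sum_j (i == j)%:R * a j.
  by rewrite (bigD1 i)//= eqxx mul1r big1 ?addr0// => j /negbTE ji; rewrite eq_sym ji mul0r.
 rewrite /wmean -sumrB; apply: eq_bigr => j _.
 by rewrite /rel_noise /a; ring.
have sq (f : 'I_m.+1 -> R) : (\sum_j f j) ^+ 2 = \sum_j \sum_k f j * f k.
 by rewrite expr2 big_distrlr.
have e2 : wmean (tnth x) (fun k => a k ^+ 2) =
  \sum_j \sum_k (j == k)%:R * (tnth x j * sg j ^+ 2) * (tnth v j * tnth v k).
 apply: eq_bigr => j _; rewrite (bigD1 j)//= eqxx big1 => [|k /negbTE kj].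
  by rewrite /a /=; ring.
 by rewrite eq_sym kj !mul0r.
rewrite e1 e2 sq /wmean sq.
have -> : tnth x i * (\sum_j \sum_k rel_noise i j x * tnth v j * (rel_noise i k x * tnth v k) -
  (\sum_j \sum_k (j == k)%:R * (tnth x j * sg j ^+ 2) * (tnth v j * tnth v k) -
  \sum_j \sum_k tnth x j * a j * (tnth x k * a k))) / 2 =
 (tnth x i / 2) * (\sum_j \sum_k rel_noise i j x * tnth v j * (rel_noise i k x * tnth v k) -
  (\sum_j \sum_k (j == k)%:R * (tnth x j * sg j ^+ 2) * (tnth v j * tnth v k) -
  \sum_j \sum_k tnth x j * a j * (tnth x k * a k))) by ring.
rewrite -!sumrB mulr_sumr; apply: eq_bigr => j _; rewrite -!sumrB mulr_sumr.
by apply: eq_bigr => k _; rewrite /scheme_quadratic /a; ring.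
Qed.

Let S := \sum_i `|sg i|.

(** A step shifts the log-coordinates by the noise plus h times the payoffs, up to O(h^2). In the
    third-order expansion of the tilt, the quadratic term is replaced by its value at the noise
    alone, at cost O(h B), and is centred by moving its mean into the drift. Since h <= B^2, all
    errors are O(B^3). *)
Lemma scheme_expand : exists C, 0 <= C /\ forall h y v B, 0 <= h -> h <= 1 -> 0 <= B -> h <= B ^+ 2 ->
 (forall i, `|tnth v i| <= B) -> let x := softmax y in forall i,
 `|tnth (softmax (scheme_step At sg h y v)) i - tnth x i - h * scheme_drift i x -
   \sum_j scheme_diffusion i j x * tnth v j -
   \sum_j \sum_k scheme_quadratic i j k x * (tnth v j * tnth v k - h * (j == k)%:R)| <= C * B ^+ 3.
Proof.
have [Kb [Kb0 hb]] := nice_uniform (nice_rel_payoff At).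
have [Kd [Kd0 hd]] := nice_uniform (nice_rel_payoff' At).
have [Ku [Ku0 hu]] := nice_uniform (nice_payoff At).
have S0 : 0 <= S by exact: sumr_ge0.
pose c2 := 2 * Kb ^+ 2 * m%:R; have c20 : 0 <= c2 by rewrite !mulr_ge0 ?sqr_ge0.
pose c1 := Ku + c2; have c10 : 0 <= c1 by rewrite addr_ge0.
pose L := S + c1; have L0 : 0 <= L by rewrite addr_ge0.
exists (26 * L ^+ 3 + 3 * (c1 * (2 * S + c1)) + 2 * c2); split.
 by rewrite !addr_ge0 ?mulr_ge0 ?exprn_ge0// addr_ge0// mulr_ge0.
move=> h y v B h0 h1 B0 hB2 vB x i.
have hB : h <= B.
 rewrite -(ler_pXn2r (n := 2))// ?nnegrE//; apply: le_trans hB2.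
 by rewrite expr2 ler_piMl.
have hB3 : h ^+ 2 <= B ^+ 3 by rewrite expr2 exprS mulrC ler_pM.
have hBB : h * B <= B ^+ 3 by rewrite exprSr ler_wpM2r.
pose p := sm y; have pE k : tnth x k = p k by [].
have p0 := sm_ge0 y; have p1 := sm_sum1 y.
set z := sweep At h y (enum 'I_m).
pose dl j := tnth z j - tnth y j.
pose a k := sg k * tnth v k.
pose U k := payoff At k x.
(* Adding the payoff of the last coordinate to all shifts is invisible to the softmax and makes
   every shift, including the last, close to h times its own payoff plus the noise. *)
pose dd k := extend dl k + h * U ord_max + a k.
have hs : shifted y (scheme_step At sg h y v) dd (- (sg ord_max * tnth v ord_max) - h * U ord_max).
 move=> k; have := noise_shifted sg 1 z v k; rewrite /scheme_step -/z => ->.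
 by rewrite (extend_shifted y z k) /dd /dl /a; ring.
pose ep k := extend dl k + h * U ord_max - h * U k.
have epB k : `|ep k| <= c2 * h ^+ 2.
 move: k; apply: ord_max_ind => [j|]; rewrite /ep ?extend_max ?extend_widen; last first.
  by rewrite add0r subrr normr0 mulr_ge0// sqr_ge0.
 have := sweep_displacement hb y j h0 (enum_uniq 'I_m).
 rewrite mem_enum mulr1 size_enum_ord -/z -/(dl j).
 by have -> : dl j - h * rel_payoff At j (softmax y) =
  dl j + h * U ord_max - h * U (wi j) by rewrite /rel_payoff /U /x; ring.
pose et k := h * U k + ep k.
have ddE : dd = fun k => a k + et k by apply/funext => k; rewrite /dd /et /ep; ring.
have etB k : `|et k| <= c1 * h.
 rewrite /et; apply: (le_trans (ler_normD _ _)); rewrite /c1 mulrDl; apply: lerD.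
  rewrite normrM ger0_norm// mulrC ler_wpM2r//.
  by have [_ b _] := hu k; apply: b; exact: simplex_softmax.
 by apply: (le_trans (epB k)); rewrite ler_wpM2l// expr2 ler_piMl.
have aB k : `|a k| <= S * B.
 rewrite normrM ler_pM// /S (bigD1 k)//= lerDl.
 exact: sumr_ge0.
have ddB k : `|dd k| <= L * B.
 rewrite ddE; apply: (le_trans (ler_normD _ _)); rewrite /L mulrDl; apply: lerD => //.
 by apply: (le_trans (etB k)); rewrite ler_wpM2l.
have e3 := tilt_expand3 p0 p1 ddB i.
rewrite -(softmax_shifted i hs) !tilt_moment0// in e3.
have M1 : \sum_k p k * dd k ^+ 1 = wmean p dd by apply: eq_bigr => k _; rewrite expr1.
rewrite -/p M1 -/(wmean p (fun k => dd k ^+ 2)) -/(wvar p i dd) in e3.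
have vp := wvar_perturb p0 p1 i aB etB; rewrite -ddE in vp.
set x' := tnth (softmax (scheme_step At sg h y v)) i; rewrite -/(sm _ i) -/x' in e3.
have e3' : `|x' - p i - p i * (dd i - wmean p dd) - p i * wvar p i dd / 2| <= 26 * (L * B) ^+ 3.
 exact: e3.
have Q1 : \sum_j \sum_k scheme_quadratic i j k x * (tnth v j * tnth v k - h * (j == k)%:R) =
  p i * wvar p i a / 2 - h * \sum_j scheme_quadratic i j j x.
 have := scheme_quadraticE i x v; rewrite -/a -/p => <-.
 rewrite mulr_sumr -sumrB; apply: eq_bigr => j _.
 have -> : h * scheme_quadratic i j j x = \sum_k scheme_quadratic i j k x * (h * (j == k)%:R).
  rewrite (bigD1 j)//= eqxx big1 => [|k /negbTE kj]; first by rewrite /=; ring.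
  by rewrite eq_sym kj !mulr0.
 by rewrite -sumrB; apply: eq_bigr => k _; ring.
have D1 : \sum_j scheme_diffusion i j x * tnth v j = p i * (a i - wmean p a).
 exact: scheme_diffusionE.
rewrite Q1 D1 /scheme_drift pE.
have -> : \sum_k tnth x k * payoff At k x = wmean p U by [].
have mdd : wmean p dd = wmean p a + (h * wmean p U + wmean p ep).
 by rewrite ddE wmeanD wmeanD wmeanZ.
have -> : x' - p i - h * (p i * (payoff At i x - wmean p U) + \sum_j scheme_quadratic i j j x) -
  p i * (a i - wmean p a) - (p i * wvar p i a / 2 - h * \sum_j scheme_quadratic i j j x) =
 (x' - p i - p i * (dd i - wmean p dd) - p i * wvar p i dd / 2) +
 p i * (ep i - wmean p ep) + p i * ((wvar p i dd - wvar p i a) / 2).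
 by rewrite mdd ddE /et -/(U i); field.
have pi1 : `|p i| <= 1.
 by rewrite ger0_norm// -p1 (bigD1 i)//= lerDl; apply: sumr_ge0.
have nM (r s r' s' : R) : `|r| <= r' -> `|s| <= s' -> `|r * s| <= r' * s'.
 by move=> hx hy; rewrite normrM ler_pM.
have t1 : `|p i * (ep i - wmean p ep)| <= 1 * (c2 * h ^+ 2 + c2 * h ^+ 2).
 apply: nM => //; apply: (le_trans (ler_normB _ _)); apply: lerD => //.
 exact: wmean_le.
have n2 : `|2^-1 : R| <= 2^-1 by rewrite ger0_norm.
have t2 := nM _ _ _ _ pi1 (nM _ _ _ _ vp n2).
apply: (le_trans (ler_normD _ _)).
apply: (le_trans (lerD (le_trans (ler_normD _ _) (lerD e3' t1)) t2)).
have a2 : c2 * h ^+ 2 <= c2 * B ^+ 3 by rewrite ler_wpM2l.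
have a3 : c1 * h * (2 * (S * B) + c1 * h) <= c1 * (2 * S + c1) * B ^+ 3.
 have b1 : 2 * (S * B) + c1 * h <= (2 * S + c1) * B.
  by rewrite [leRHS]mulrDl mulrA lerD2l ler_wpM2l.
 apply: (le_trans (ler_wpM2l (mulr_ge0 c10 h0) b1)).
 have -> : c1 * h * ((2 * S + c1) * B) = c1 * (2 * S + c1) * (h * B) by ring.
 by rewrite ler_wpM2l// mulr_ge0// addr_ge0// mulr_ge0.
have -> : (26 * L ^+ 3 + 3 * (c1 * (2 * S + c1)) + 2 * c2) * B ^+ 3 =
 26 * L ^+ 3 * B ^+ 3 + 3 * (c1 * (2 * S + c1) * B ^+ 3) + 2 * (c2 * B ^+ 3) by ring.
have -> : 26 * (L * B) ^+ 3 + 1 * (c2 * h ^+ 2 + c2 * h ^+ 2) +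
  1 * (6 * (c1 * h * (2 * (S * B) + c1 * h)) / 2) =
 26 * L ^+ 3 * B ^+ 3 + 3 * (c1 * h * (2 * (S * B) + c1 * h)) + 2 * (c2 * h ^+ 2) by field.
by apply: lerD; [rewrite lerD2l ler_wpM2l|rewrite ler_wpM2l].
Qed.

End scheme_expansion.

Section replicator_coefficients.
Variables (R : realType) (m : nat) (A : 'M[R]_m.+1) (sigma : 'rV[R]_m.+1).
Implicit Types x : m.+1.-tuple R.

Let sg (i : 'I_m.+1) : R := sigma 0 i.
Let At := modified_payoff A sigma.

Let fit i x : R := payoff A i x - sg i ^+ 2 * tnth x i.

Lemma replicator_driftE i x : replicator_drift A sigma x i ord0 =
 tnth x i * (fit i x - \sum_k tnth x k * fit k x).
Proof.
rewrite /replicator_drift -mulmxA mxE.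
have B k : ((A - diag_mx (\row_i (sigma 0 i ^+ 2))) *m col_of_tuple x) k ord0 = fit k x.
 rewrite mulmxBl mxE mul_diag_mx !mxE /fit /payoff /sg; congr (_ - _).
 by apply: eq_bigr => j _; rewrite !mxE.
transitivity (\sum_k (tnth x i *+ (i == k) - tnth x i * tnth x k) * fit k x).
 apply: eq_bigr => k _; rewrite B; congr (_ * _).
 rewrite /replicator_mx !mxE; congr (_ *+ _ - _).
 by rewrite big_ord_recl big_ord0 addr0 !mxE.
under eq_bigr do rewrite mulrBl.
rewrite sumrB (bigD1 i)//= eqxx big1 => [|k /negbTE ki]; last by rewrite eq_sym ki mul0r.
rewrite addr0 mulr1n [RHS]mulrBr mulr_sumr; congr (_ - _); apply: eq_bigr => k _.
by rewrite mulrA.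
Qed.

Lemma replicator_diffusionE i j x : replicator_diffusion sigma x i j = scheme_diffusion sg i j x.
Proof.
rewrite /replicator_diffusion mul_mx_diag !mxE big_ord_recl big_ord0 addr0 !mxE.
rewrite /scheme_diffusion /rel_noise -/(sg j); case: eqVneq => [->|_]; rewrite ?mulr1n ?mulr0n; ring.
Qed.

(** Ito's formula for the softmax reduced to algebra: the correction contained in [scheme_drift] and
    the half squared intensities subtracted in the modified payoff combine to the term with the full
    squared intensities in the drift of the equation. The identity needs the coordinates to sum to
    1. *)
Lemma scheme_driftE i x : simplex x ->
 replicator_drift A sigma x i ord0 = scheme_drift At sg i x.
Proof.
move=> [_ x1]; rewrite replicator_driftE /scheme_drift.
have pE k : payoff At k x = payoff A k x - sg k ^+ 2 / 2.
 have -> : sg k ^+ 2 / 2 = \sum_j sg k ^+ 2 / 2 * tnth x j by rewrite -mulr_sumr x1 mulr1.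
 rewrite /payoff /At -sumrB; apply: eq_bigr => j _.
 by rewrite !mxE /sg; ring.
set s1 := \sum_k tnth x k * sg k ^+ 2; set s2 := \sum_k tnth x k ^+ 2 * sg k ^+ 2.
set q := \sum_k tnth x k * payoff A k x.
have f1 : \sum_k tnth x k * fit k x = q - s2.
 by rewrite /q /s2 -sumrB; apply: eq_bigr => k _; rewrite /fit; ring.
have f2 : \sum_k tnth x k * payoff At k x = q - s1 / 2.
 rewrite /q /s1 mulr_suml -sumrB; apply: eq_bigr => k _; rewrite pE; ring.
have f3 : \sum_j scheme_quadratic sg i j j x =
  tnth x i / 2 * (sg i ^+ 2 * (1 - 2 * tnth x i) + s2 - (s1 - s2)).
 rewrite -mulr_sumr; congr (_ * _).
 have -> : sg i ^+ 2 * (1 - 2 * tnth x i) =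
   \sum_j (i == j)%:R * (sg j ^+ 2 * (1 - 2 * tnth x j)).
  by rewrite (bigD1 i)//= eqxx mul1r big1 ?addr0// => j /negbTE ji; rewrite eq_sym ji mul0r.
 rewrite /s1 /s2 -sumrB -big_split -sumrB /=; apply: eq_bigr => j _.
 by rewrite eqxx /rel_noise; case: (i == j); rewrite /=; ring.
by rewrite f1 f2 f3 pE /fit; field.
Qed.

Lemma nice_replicator_drift i : nice (fun x => replicator_drift A sigma x i ord0).
Proof.
have nf k : nice (fit k).
 apply: niceB; first exact: nice_payoff.
 by apply: niceZ; exact: nice_coord.
under eq_fun do rewrite replicator_driftE.
apply: niceM; first exact: nice_coord.
apply: niceB => //; apply: nice_sum => k; apply: niceM => //; exact: nice_coord.
Qed.

Lemma nice_replicator_diffusion i j : nice (fun x => replicator_diffusion sigma x i j).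
Proof. by under eq_fun do rewrite replicator_diffusionE; exact: nice_scheme_diffusion. Qed.

Definition coefficient_bound (K : R) : Prop :=
 [/\ 0 <= K, forall k x, @simplex R m.+1 x -> `|replicator_drift A sigma x k ord0| <= K,
   forall k j x, @simplex R m.+1 x -> `|replicator_diffusion sigma x k j| <= K,
   forall k x y, @simplex R m.+1 x -> @simplex R m.+1 y ->
    (replicator_drift A sigma x k ord0 - replicator_drift A sigma y k ord0) ^+ 2 <= K * sqdist x y &
   forall k j x y, @simplex R m.+1 x -> @simplex R m.+1 y ->
    (replicator_diffusion sigma x k j - replicator_diffusion sigma y k j) ^+ 2 <= K * sqdist x y].

Lemma coefficient_bound_exists : exists K, coefficient_bound K.
Proof.
have [K1 [K10 h1]] := nice_uniform nice_replicator_drift.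
have [K2 [K20 h2]] := nice_uniform (fun k : 'I_m.+1 * 'I_m.+1 => nice_replicator_diffusion k.1 k.2).
have q1 := sqr_ge0 K1; have q2 := sqr_ge0 K2.
have d0 x y : 0 <= sqdist x y by apply: sumr_ge0 => k _; exact: sqr_ge0.
exists (K1 + K2 + K1 ^+ 2 + K2 ^+ 2); split.
- by rewrite !addr_ge0.
- by move=> k x sx; have [_ h _] := h1 k; apply: (le_trans (h x sx)); rewrite -!addrA lerDl !addr_ge0.
- move=> k j x sx; have [_ h _] := h2 (k, j); apply: (le_trans (h x sx)).
 by rewrite [K1 + K2]addrC -!addrA lerDl !addr_ge0.
- move=> k x y sx sy; apply: (le_trans (simplex_lip_sqdist (h1 k) sx sy)).
 by rewrite ler_wpM2r// -addrA addrC -addrA lerDl !addr_ge0.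
- move=> k j x y sx sy; apply: (le_trans (simplex_lip_sqdist (h2 (k, j)) sx sy)).
 by rewrite ler_wpM2r// lerDr !addr_ge0.
Qed.

End replicator_coefficients.

Section error_recursion.
Context d (T : measurableType d) (R : realType) (P : probability T R).

(** The product of [e] and [M] has mean 0, while [e r] is split by Young's inequality with weight
    [h]; this costs h times the old error and [ta / h]. Errors with [mu] of order h^2 and [ta] of
    order h^3 thus add only O(h^2) per step. *)
Lemma mean_error_step (e M r : T -> R) (h al mu ta : R) : 0 < h -> h <= 1 ->
 L2 P e -> L2 P M -> L2 P r ->
 mean P (fun w => e w * M w) = 0 -> mean P (fun w => e w ^+ 2) <= al ->
 mean P (fun w => M w ^+ 2) <= mu -> mean P (fun w => r w ^+ 2) <= ta ->
 mean P (fun w => (e w + M w + r w) ^+ 2) <= (1 + h) * al + 2 * mu + 3 * ta / h.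
Proof.
move=> h0 h1 ie iM ir eM ea Mm rt.
have ie2 := ie.2; have iM2 := iM.2; have ir2 := ir.2.
have ieM := L1M ie iM.
have h1' : 0 < 1 + h by lra.
have i1 : L1 P (fun w => (1 + h) * e w ^+ 2 + 2 * M w ^+ 2 + 3 / h * r w ^+ 2 + 2 * (e w * M w)).
 by do 3 (apply: L1D; last exact: L1Z); exact: L1Z.
have hV : 1 <= h^-1 by rewrite invf_ge1.
apply: (le_trans (le_mean (L2D (L2D ie iM) ir).2 i1 _)).
 move=> w.
 have q1 := sqr_ge0 (h * e w - r w); have q2 := sqr_ge0 (M w - r w).
 have q3 : 0 <= h^-1 * (h * e w - r w) ^+ 2 by rewrite mulr_ge0// invr_ge0 ltW.
 have q4 : h^-1 * (h * e w - r w) ^+ 2 = h * e w ^+ 2 - 2 * (e w * r w) + h^-1 * r w ^+ 2.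
  by field; rewrite gt_eqF.
 have q5 : 0 <= (h^-1 - 1) * r w ^+ 2 by rewrite mulr_ge0 ?sqr_ge0// subr_ge0.
 rewrite -subr_ge0.
 have -> : (1 + h) * e w ^+ 2 + 2 * M w ^+ 2 + 3 / h * r w ^+ 2 + 2 * (e w * M w) -
   (e w + M w + r w) ^+ 2 = (h * e w ^+ 2 - 2 * (e w * r w) + h^-1 * r w ^+ 2) +
   (M w - r w) ^+ 2 + 2 * ((h^-1 - 1) * r w ^+ 2) by ring.
 by rewrite -q4 !addr_ge0// mulr_ge0.
rewrite !meanD ?meanZ//; try by repeat (apply: L1D); exact: L1Z.
rewrite eM mulr0 addr0; apply: lerD.
 by apply: lerD; apply: ler_wpM2l => //; exact: ltW.
by rewrite [leRHS]mulrAC ler_wpM2l// divr_ge0// ltW.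
Qed.

End error_recursion.

Section sq_mean.
Context d (T : measurableType d) (R : realType) (P : probability T R).

Lemma sq_mean_le (f : T -> R) : L2 P f -> mean P f ^+ 2 <= mean P (fun w => f w ^+ 2).
Proof.
move=> sf; set c := mean P f; have fi := sq_L1 sf.
have : 0 <= mean P (fun w => f w ^+ 2 + (- (2 * c) * f w + c ^+ 2)).
 apply: mean_ge0 => w; have -> : f w ^+ 2 + (- (2 * c) * f w + c ^+ 2) = (f w - c) ^+ 2 by ring.
 exact: sqr_ge0.
have i1 : L1 P (fun w => - (2 * c) * f w) by exact: L1Z.
have i2 : L1 P (fun=> c ^+ 2) by exact: L1_cst.
rewrite (meanD sf.2 (L1D i1 i2)) (meanD i1 i2) meanZ// mean_cst -/c => h; rewrite -subr_ge0; apply: le_trans h _.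
by rewrite le_eqVlt; apply/orP; left; apply/eqP; ring.
Qed.

End sq_mean.

Section strong_scheme.
Context d (T : measurableType d) (R : realType) (P : probability T R).
Variables (m : nat) (A : 'M[R]_m.+1) (sigma : 'rV[R]_m.+1) (W : 'I_m.+1 -> R -> T -> R).
Hypothesis hW : standard_brownian_motion P W.

Let sg (i : 'I_m.+1) : R := sigma 0 i.
Let At := modified_payoff A sigma.
Notation b := (replicator_drift A sigma).
Notation C := (replicator_diffusion sigma).

Definition scheme_error (x : m.+1.-tuple R) (y : m.-tuple R) (i : 'I_m.+1) : R :=
 tnth x i - tnth (softmax y) i.

Definition mean_sq_error (X : T -> m.+1.-tuple R) (Y : T -> m.-tuple R) : R :=
 \sum_i mean P (fun w => scheme_error (X w) (Y w) i ^+ 2).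

Lemma past_scheme_step u v (Y : T -> m.-tuple R) : 0 <= u -> u < v -> past P W u Y ->
 past P W v (fun w => scheme_step At sg (v - u) (Y w) (increment W u v w)).
Proof.
move=> u0 uv pY; apply/pastE; apply: measurable_scheme_step.
 by apply/pastE; exact: past_le (ltW uv) pY.
apply/pastE; apply: past_tuple => i.
have -> : (fun w => tnth (increment W u v w) i) = winc W i u v.
 by apply/funext => w; rewrite tnth_mktuple.
by apply: past_winc => //; exact: ltW.
Qed.

Lemma mean_scheme_quadratic (qc : T -> R) (z : T -> R) (L M : R) i j u v : 0 <= u -> u < v ->
 past P W u qc -> past P W u z -> (forall w, `|qc w| <= L) -> (forall w, `|z w| <= M) ->
 mean P (fun w => z w * (qc w * (winc W i u v w * winc W j u v w - (v - u) * (i == j)%:R))) = 0.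
Proof.
move=> u0 uv pq pz qL zM.
have [iw _ _] := winc_mean hW i u0 (ltW uv); have [jw _ _] := winc_mean hW j u0 (ltW uv).
pose g (x : m.+1.-tuple R) : R := tnth x i * tnth x j - (v - u) * (i == j)%:R.
have mg : borel g.
 by apply: measurable_funB => //; apply: measurable_funM; exact: measurable_tnth.
have gE : g \o increment W u v = fun w => winc W i u v w * winc W j u v w - (v - u) * (i == j)%:R.
 by apply/funext => w; rewrite /g /= !tnth_mktuple.
have ig : L1 P (g \o increment W u v).
 by rewrite gE; apply: L1B; [exact: L1M|exact: L1_cst].
have pzq : past P W u (fun w => z w * qc w) by exact: pastM.
have izq : L1 P (fun w => z w * qc w).
 apply: sq_L1; apply: (L2_bounded P (M := M * L)).
  exact: past_measurable hW _ _ _ _ pzq.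
 by move=> w; rewrite normrM ler_pM.
have [_ e] := increment_mean hW u0 uv pzq izq mg ig.
have -> : (fun w => z w * (qc w * (winc W i u v w * winc W j u v w - (v - u) * (i == j)%:R))) =
  (fun w => z w * qc w * g (increment W u v w)).
 by apply/funext => w; rewrite -mulrA; congr (_ * (_ * _)); rewrite -[RHS]/((g \o increment W u v) w) gE.
rewrite e gE meanB; [|exact: L1M|exact: L1_cst].
by rewrite (winc_cross hW _ _ u0 (ltW uv)) mean_cst subrr mulr0.
Qed.

(** The first estimate is the recursion of the strong error. The second bounds the change of the
    mean error: for a start without error it is O(h^(3/2)), half an order better than the strong
    error of one step, because the part orthogonal to the past drops out. *)
Lemma scheme_error_step : exists c, 0 <= c /\
 forall x0 (X : R -> T -> m.+1.-tuple R) u v (Y : T -> m.-tuple R),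
 strong_solution P W b C x0 X -> 0 <= u -> u < v -> v - u <= 1 -> past P W u Y ->
 let Y' w := scheme_step At sg (v - u) (Y w) (increment W u v w) in
 mean_sq_error (X v) Y' <= (1 + c * (v - u)) * mean_sq_error (X u) Y + c * (v - u) ^+ 2 /\
 forall i, (mean P (fun w => scheme_error (X v w) (Y' w) i) -
       mean P (fun w => scheme_error (X u w) (Y w) i)) ^+ 2 <=
  c * (v - u) ^+ 2 * (mean_sq_error (X u) Y + (v - u)).
Proof.
have [K hK] := coefficient_bound_exists A sigma.
have [K0 bK CK bL CL] := hK.
have [C1 [C10 expand]] := scheme_expand At sg.
have [Kq [Kq0 hq]] := nice_uniform (fun k : 'I_m.+1 * 'I_m.+1 * 'I_m.+1 =>
 nice_scheme_quadratic sg k.1.1 k.1.2 k.2).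
pose n : R := m.+1%:R; have n0 : 0 <= n by exact: ler0n.
pose sc := step_const m.+1 K; have sc0 : 0 <= sc by exact: step_const_ge0.
pose C2 := n * (n * (Kq * 2)); have C20 : 0 <= C2 by rewrite !mulr_ge0.
pose M4 := step_moment_const (R := R) m.+1 4 0; have M40 : 0 <= M4 by exact: step_moment_const_ge0.
pose M6 := step_moment_const (R := R) m.+1 6 0; have M60 : 0 <= M6 by exact: step_moment_const_ge0.
pose ca := 1 + n * (4 * n ^+ 2 * K + 6 * K).
pose cb := n * (8 * (sc + C2 ^+ 2 * M4) + 12 * (sc + C1 ^+ 2 * M6)).
have ca0 : 0 <= ca by rewrite addr_ge0// mulr_ge0// addr_ge0// !mulr_ge0// exprn_ge0.
have cb0 : 0 <= cb.
 by rewrite mulr_ge0// addr_ge0// mulr_ge0// addr_ge0// mulr_ge0// exprn_ge0.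
pose cr := 2 * K + 4 * (sc + C1 ^+ 2 * M6).
have cr0 : 0 <= cr by apply: addr_ge0; apply: mulr_ge0 => //; rewrite addr_ge0// mulr_ge0// exprn_ge0.
exists (ca + cb + cr); split; first by rewrite addr_ge0// addr_ge0.
move=> x0 X u v Y hX u0 uv h1 pY; set h := v - u in h1 *.
have h0 : 0 < h by rewrite subr_gt0.
have mb k : borel (fun x => b x k ord0) := (nice_replicator_drift A sigma k).1.
have mC k j : borel (fun x => C x k j) := (nice_replicator_diffusion sigma k j).1.
have [D [r hDr]] := solution_step hW mb mC K0 bK CK bL CL hX u0 uv h1.
have simX s w : 0 <= s -> simplex (X s w) := @sol_state _ _ _ _ _ _ _ _ _ _ hX s w.
have simY (w : T) : simplex (softmax (Y w)) := simplex_softmax (Y w).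
have pX : past P W u (X u) by exact: solution_past hX u u0.
have pf (f : m.+1.-tuple R -> R) : nice f -> past P W u (fun w => f (X u w)).
 by move=> [mf _]; exact: past_comp mf pX.
have pg (f : m.+1.-tuple R -> R) : nice f -> past P W u (fun w => f (softmax (Y w))).
 by move=> nf; exact: past_comp (measurable_nice_softmax nf) pY.
pose xh w := softmax (Y w); pose V := increment W u v; pose B := step_size W u v.
have VE w i : tnth (V w) i = winc W i u v w by rewrite tnth_mktuple.
set Y' := fun w => scheme_step At sg h (Y w) (V w).
have pY' : past P W v Y' by exact: past_scheme_step.
set Phi := mean_sq_error (X u) Y.
pose e i w := scheme_error (X u w) (Y w) i.
have pe i : past P W u (e i).
 by apply: pastB; [exact: pf (nice_coord R i)|exact: pg (nice_coord R i)].
have coord1 (x : m.+1.-tuple R) i : simplex x -> `|tnth x i| <= 1.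
 by move=> [hx _]; have /andP[x0' x1] := hx i; rewrite ger0_norm.
have e2 i w : `|e i w| <= 2.
 apply: (le_trans (ler_normB _ _)); have -> : (2 : R) = 1 + 1 by [].
 by apply: lerD; apply: coord1 => //; exact: simX.
have me i := past_measurable hW (pe i).
have se i : L2 P (e i) := L2_bounded P (me i) (e2 i).
have Phi0 : 0 <= Phi by apply: sumr_ge0 => j _; apply: mean_ge0 => w; exact: sqr_ge0.
have isq : L1 P (fun w => sqdist (X u w) (xh w)).
 by apply: L1_sum => i; exact: (se i).2.
have msq : mean P (fun w => sqdist (X u w) (xh w)) = Phi.
 by rewrite /sqdist mean_sum// => i; exact: (se i).2.
have lipsq (f : m.+1.-tuple R -> R) : nice f ->
  (forall x y, simplex x -> simplex y -> (f x - f y) ^+ 2 <= K * sqdist x y) ->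
  let Df w := f (X u w) - f (xh w) in
  [/\ past P W u Df, exists L, forall w, `|Df w| <= L, L2 P Df &
    mean P (fun w => Df w ^+ 2) <= K * Phi].
 move=> nf fL Df; have pD : past P W u Df by apply: pastB; [exact: pf|exact: pg].
 have [_ [L [L0 fb _]]] := nf.
 have Db w : `|Df w| <= L + L.
  by apply: (le_trans (ler_normB _ _)); apply: lerD; apply: fb; [exact: simX|exact: simY].
 have sD := L2_bounded P (past_measurable hW pD) Db.
 split => //; first by exists (L + L).
 rewrite -msq -meanZ//; apply: le_mean; [exact: sD.2|exact: L1Z|].
 by move=> w; apply: fL; [exact: simX|exact: simY].
have ib k := step_moment hW k (lexx 0) u0 uv h1.
have B0 w : 0 <= B w by exact: step_size_ge0.
have hB2 w : h <= B w ^+ 2.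
 have hB := step_size_ge_sqrt W u v w.
 by rewrite -(sqr_sqrtr (ltW h0)) lerXn2r ?nnegrE ?sqrtr_ge0//.
have Bmom k : L1 P (fun w => B w ^+ k) /\
  mean P (fun w => B w ^+ k) <= step_moment_const m.+1 k 0 * Num.sqrt h ^+ k.
 by have := ib k; under eq_fun do rewrite mul0r expR0 mulr1.
have domB (f : T -> R) (c : R) k : 0 <= c -> borel f -> (forall w, `|f w| <= c * B w ^+ k) ->
  L2 P f /\
  mean P (fun w => f w ^+ 2) <= c ^+ 2 * (step_moment_const m.+1 (k * 2) 0 * Num.sqrt h ^+ (k * 2)).
 move=> c0 mf fB; have [i2 b2] := Bmom (k * 2)%N.
 have le w : f w ^+ 2 <= c ^+ 2 * B w ^+ (k * 2).
  rewrite exprM -exprMn -real_normK ?num_real//.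
  by rewrite lerXn2r ?nnegrE// mulr_ge0// exprn_ge0.
 have iz : L1 P (fun w => c ^+ 2 * B w ^+ (k * 2)) by exact: L1Z.
 have if2 : L1 P (fun w => f w ^+ 2).
  apply: (L1_le _ _ iz); first exact: measurable_funX.
  by move=> w; rewrite ger0_norm ?sqr_ge0.
 split => //; apply: (le_trans (le_mean if2 iz le)).
 by rewrite meanZ// ler_wpM2l// sqr_ge0.
have sW j : L2 P (winc W j u v) by have [] := winc_mean hW j u0 (ltW uv).
pose q i w := \sum_j \sum_k scheme_quadratic sg i j k (xh w) *
  (winc W j u v w * winc W k u v w - h * (j == k)%:R).
have mqj i j k : borel (fun w => scheme_quadratic sg i j k (xh w) *
  (winc W j u v w * winc W k u v w - h * (j == k)%:R)).
 apply: measurable_funM; first exact: past_measurable hW _ _ _ _ (pg _ (nice_scheme_quadratic sg i j k)).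
 by apply: measurable_funB => //; apply: measurable_funM; [exact: (sW j).1|exact: (sW k).1].
have mq i : borel (q i).
 by apply: measurable_fun_bigsum => j; apply: measurable_fun_bigsum => k.
have qcb i j k w : `|scheme_quadratic sg i j k (xh w)| <= Kq.
 by have [_ h' _] := hq (i, j, k); exact: (h' _ (simY w)).
have wB j w : `|winc W j u v w| <= B w by exact: step_size_ge_winc.
have qjB i j k w : `|scheme_quadratic sg i j k (xh w) *
  (winc W j u v w * winc W k u v w - h * (j == k)%:R)| <= Kq * 2 * B w ^+ 2.
 rewrite normrM -mulrA ler_pM// mulr_natl mulr2n; apply: (le_trans (ler_normB _ _)); apply: lerD.
  by rewrite normrM expr2 ler_pM.
 rewrite normrM gtr0_norm//; apply: le_trans (hB2 w).
 by case: (j == k); rewrite ?normr1 ?normr0 ?mulr1// mulr0 ltW.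
have sumc (f : 'I_m.+1 -> R) (c : R) : (forall j, `|f j| <= c) -> `|\sum_j f j| <= n * c.
 move=> fc; apply: (le_trans (ler_norm_sum _ _ _)).
 rewrite /n mulr_natl -[X in _ *+ X]card_ord -sumr_const; exact: ler_sum.
have qB i w : `|q i w| <= C2 * B w ^+ 2.
 rewrite /C2 -!mulrA; apply: (sumc) => j; apply: (sumc) => k.
 by rewrite mulrA; exact: qjB.
have [sq eq] : (forall i, L2 P (q i)) /\
  forall i, mean P (fun w => q i w ^+ 2) <= C2 ^+ 2 * (M4 * h ^+ 2).
 have hh i := domB (q i) C2 2%N C20 (mq i) (qB i).
 split => i; first exact: (hh i).1.
 by have := (hh i).2; rewrite -/M4 (exprM _ 2 2) sqr_sqrtr ?(ltW h0).
pose rr i w := tnth (softmax (Y' w)) i - tnth (xh w) i - h * scheme_drift At sg i (xh w) -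
 \sum_j scheme_diffusion sg i j (xh w) * winc W j u v w - q i w.
have rrB i w : `|rr i w| <= C1 * B w ^+ 3.
 have vB j : `|tnth (V w) j| <= B w by rewrite VE.
 have := expand h (Y w) (V w) (B w) (ltW h0) h1 (B0 w) (hB2 w) vB i.
 rewrite /rr /q -/(xh w) -/(Y' w).
 by under eq_bigr do rewrite VE; under [X in _ - X]eq_bigr do under eq_bigr do rewrite !VE.
have mrr i : borel (rr i).
 apply: measurable_funB => //; apply: measurable_funB; last first.
  apply: measurable_fun_bigsum => j; apply: measurable_funM; last exact: (sW j).1.
  exact: past_measurable hW _ _ _ _ (pg _ (nice_scheme_diffusion sg i j)).
 apply: measurable_funB; last first.
  apply: measurable_funM => //.
  exact: past_measurable hW _ _ _ _ (pg _ (nice_scheme_drift At sg i)).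
 apply: measurable_funB; last exact: past_measurable hW _ _ _ _ (pg _ (nice_coord R i)).
 exact: past_measurable hW _ _ _ _ (past_comp (measurable_nice_softmax (nice_coord R i)) pY').
have [srr err] : (forall i, L2 P (rr i)) /\
  forall i, mean P (fun w => rr i w ^+ 2) <= C1 ^+ 2 * (M6 * h ^+ 3).
 have hh i := domB (rr i) C1 3%N C10 (mrr i) (rrB i).
 split => i; first exact: (hh i).1.
 by have := (hh i).2; rewrite -/M6 (exprM _ 2 3) sqr_sqrtr ?(ltW h0).
pose dC i j w := C (X u w) i j - C (xh w) i j.
have hdC i j := lipsq (fun x => C x i j) (nice_replicator_diffusion sigma i j) (fun x y => CL i j x y).
pose db i w := b (X u w) i ord0 - b (xh w) i ord0.
have hdb i := lipsq (fun x => b x i ord0) (nice_replicator_drift A sigma i) (fun x y => bL i x y).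
pose G i w := \sum_j dC i j w * winc W j u v w.
have sGj i j : L2 P (fun w => dC i j w * winc W j u v w).
 have [p [L hL] _ _] := hdC i j.
 exact: (L2_mull (past_measurable hW p) hL (sW j)).
have sG i : L2 P (G i) by exact: L2_sum.
have eG i : mean P (fun w => G i w ^+ 2) <= n ^+ 2 * (h * (K * Phi)).
 apply: mean_sq_sum_le => // j; under eq_fun do rewrite exprMn.
 have [p _ s2 m2] := hdC i j.
 have p2 : past P W u (fun w => dC i j w ^+ 2) by exact: pastM.
 have [_ _ _ ->] := past_winc_mean hW j u0 (ltW uv) p2 s2.2.
 by rewrite mulrC ler_wpM2l// ltW.
(* [M] collects the terms with mean 0 against the past: the difference of the diffusion terms, the
   stochastic remainder of the solution and the centred quadratic term of the scheme. [ro] collects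
   the rest, which is smaller by a factor h^(1/2) in mean square norm. *)
pose M i w := G i w + (D i w - q i w).
pose ro i w := h * db i w + (r i w - rr i w).
have sD i : L2 P (D i) by case: (hDr i) => -[].
have sr i : L2 P (r i) by case: (hDr i) => -[].
have sdb i : L2 P (db i) by case: (hdb i).
have sDq i := L2B (sD i) (sq i).
have srr' i := L2B (sr i) (srr i).
have sM i : L2 P (M i) by exact: L2D.
have sro i : L2 P (ro i).
 by apply: L2D => //; exact: L2Z.
have sqN (f : T -> R) : mean P (fun w => (- f w) ^+ 2) = mean P (fun w => f w ^+ 2).
 by congr mean; apply/funext => w; rewrite sqrrN.
have eMi i : mean P (fun w => M i w ^+ 2) <= 2 * (n ^+ 2 * (h * (K * Phi))) +
  4 * ((sc + C2 ^+ 2 * M4) * h ^+ 2).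
 apply: (le_trans (mean_sqD_le (sG i) (sDq i))); apply: lerD; first by rewrite ler_wpM2l.
 have := mean_sqD_le (sD i) (L2N (sq i)); rewrite sqN => hh.
 have -> : 4 * ((sc + C2 ^+ 2 * M4) * h ^+ 2) =
  2 * (2 * (sc * h ^+ 2) + 2 * (C2 ^+ 2 * (M4 * h ^+ 2))) by ring.
 rewrite ler_wpM2l//; apply: (le_trans hh); apply: lerD; rewrite ler_wpM2l//.
 by case: (hDr i).
have ero i : mean P (fun w => ro i w ^+ 2) <= 2 * (h ^+ 2 * (K * Phi)) +
  4 * ((sc + C1 ^+ 2 * M6) * h ^+ 3).
 apply: (le_trans (mean_sqD_le (L2Z h (sdb i)) (srr' i))); apply: lerD.
  rewrite ler_wpM2l// mean_sqZ// ler_wpM2l ?sqr_ge0//.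
  by case: (hdb i).
 have := mean_sqD_le (sr i) (L2N (srr i)); rewrite sqN => hh.
 have -> : 4 * ((sc + C1 ^+ 2 * M6) * h ^+ 3) =
  2 * (2 * (sc * h ^+ 3) + 2 * (C1 ^+ 2 * (M6 * h ^+ 3))) by ring.
 rewrite ler_wpM2l//; apply: (le_trans hh); apply: lerD; rewrite ler_wpM2l//.
 by case: (hDr i).
have eM0 i (z : T -> R) : past P W u z -> (forall w, `|z w| <= 2) -> mean P (fun w => z w * M i w) = 0.
 move=> pz z2; have sz := L2_bounded P (past_measurable hW pz) z2.
 have i1 : L1 P (fun w => z w * G i w) by exact: L1M.
 have i2 : L1 P (fun w => z w * D i w) by exact: L1M.
 have i3 : L1 P (fun w => z w * q i w) by exact: L1M.
 have -> : (fun w => z w * M i w) = (fun w => z w * G i w + (z w * D i w - z w * q i w)).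
  by apply/funext => w; rewrite /M; ring.
 rewrite meanD ?meanB//; last exact: L1B.
 have [_ _ _ _ hz] := hDr i; rewrite (hz z 2 pz z2) sub0r.
 have -> : mean P (fun w => z w * G i w) = 0.
  under eq_fun do rewrite /G mulr_sumr.
  rewrite mean_sum => [|j]; last exact: L1M.
  apply: big1 => j _; under eq_fun do rewrite mulrA.
  have [p [L hL] s2 _] := hdC i j.
  have iz : L1 P (fun w => z w * dC i j w) by exact: L1M.
  by have [] := past_winc_mean hW j u0 (ltW uv) (pastM pz p) iz.
 rewrite add0r; apply/eqP; rewrite oppr_eq0; apply/eqP.
 have iq j k : L1 P (fun w => z w * (scheme_quadratic sg i j k (xh w) *
   (winc W j u v w * winc W k u v w - h * (j == k)%:R))).
  apply: L1M => //.
  by have [] := domB _ (Kq * 2) 2%N (mulr_ge0 Kq0 (ler0n _ _)) (mqj i j k) (qjB i j k).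
 under eq_fun do rewrite /q mulr_sumr; under eq_fun do under eq_bigr do rewrite mulr_sumr.
 rewrite mean_sum => [|j]; last exact: L1_sum.
 apply: big1 => j _; rewrite mean_sum//; apply: big1 => k _.
 exact: (mean_scheme_quadratic j k u0 uv (pg _ (nice_scheme_quadratic sg i j k)) pz (qcb i j k) z2).
have split_error i w : scheme_error (X v w) (Y' w) i = e i w + M i w + ro i w.
 have [_ hx _ _ _] := hDr i.
 have xE : tnth (softmax (Y' w)) i = tnth (xh w) i + h * scheme_drift At sg i (xh w) +
  \sum_j scheme_diffusion sg i j (xh w) * winc W j u v w + q i w + rr i w by rewrite /rr; ring.
 rewrite /scheme_error hx xE /e /scheme_error /M /ro /db /G.
 rewrite -(scheme_driftE _ _ _ (simY w)) -/(xh w).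
 have -> : \sum_j dC i j w * winc W j u v w = \sum_j C (X u w) i j * winc W j u v w -
   \sum_j scheme_diffusion sg i j (xh w) * winc W j u v w.
  rewrite -sumrB; apply: eq_bigr => j _; rewrite /dC mulrBl.
  by rewrite [C (xh w) i j]replicator_diffusionE.
 by rewrite -/h; ring.
have step i : mean P (fun w => scheme_error (X v w) (Y' w) i ^+ 2) <=
  (1 + h) * mean P (fun w => e i w ^+ 2) + 2 * (2 * (n ^+ 2 * (h * (K * Phi))) +
  4 * ((sc + C2 ^+ 2 * M4) * h ^+ 2)) + 3 * (2 * (h ^+ 2 * (K * Phi)) +
  4 * ((sc + C1 ^+ 2 * M6) * h ^+ 3)) / h.
 under eq_fun do rewrite split_error.
 exact: (mean_error_step h0 h1 (se i) (sM i) (sro i) (eM0 i _ (pe i) (e2 i)) (lexx _) (eMi i) (ero i)).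
split; last first.
 move=> i; under eq_fun do rewrite split_error.
 have ie := sq_L1 (se i); have iM := sq_L1 (sM i).
 rewrite (meanD (L1D ie iM) (sq_L1 (sro i))) (meanD ie iM).
 have M0 : mean P (M i) = 0.
  have h1' (w : T) : `|1 : R| <= 2 by rewrite normr1 ler1n.
  have pc : past P W u (fun _ : T => 1 : R) by exact: past_cst.
  by have := eM0 i (fun=> 1) pc h1'; under eq_fun do rewrite mul1r.
 rewrite M0 addr0 addrC addKr; apply: (le_trans (sq_mean_le (sro i))).
 apply: (le_trans (ero i)); rewrite -/Phi -/h.
 apply: (@le_trans _ _ (cr * h ^+ 2 * (Phi + h))); last first.
  apply: ler_wpM2r; first by rewrite addr_ge0// ltW.
  by apply: ler_wpM2r; rewrite ?sqr_ge0// lerDr addr_ge0.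
 have t1 : 0 <= 4 * (sc + C1 ^+ 2 * M6) * h ^+ 2 * Phi.
  by rewrite mulr_ge0// mulr_ge0 ?sqr_ge0// mulr_ge0// addr_ge0// mulr_ge0// sqr_ge0.
 have t2 : 0 <= 2 * K * h ^+ 3 by apply: mulr_ge0; [exact: mulr_ge0|apply/exprn_ge0/ltW].
 rewrite -subr_ge0; apply: (le_trans (addr_ge0 t1 t2)).
 by rewrite le_eqVlt; apply/orP; left; apply/eqP; rewrite /cr; ring.
have cD : ca + cb <= ca + cb + cr by rewrite lerDl.
apply: (@le_trans _ _ ((1 + (ca + cb) * h) * Phi + (ca + cb) * h ^+ 2)); last first.
 apply: lerD; last by apply: ler_wpM2r; rewrite ?sqr_ge0.
 by apply: ler_wpM2r => //; rewrite lerD2l ler_wpM2r// ltW.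
rewrite {1}/mean_sq_error; apply: (le_trans (ler_sum _ (fun i _ => step i))).
rewrite !big_split /= -mulr_sumr -/(mean_sq_error (X u) Y) -/Phi.
have sumn (c : R) : \sum_(i < m.+1) c = n * c by rewrite sumr_const card_ord mulr_natl.
rewrite !sumn.
have -> : (1 + h) * Phi + n * (2 * (2 * (n ^+ 2 * (h * (K * Phi))) + 4 * ((sc + C2 ^+ 2 * M4) * h ^+ 2))) +
  n * (3 * (2 * (h ^+ 2 * (K * Phi)) + 4 * ((sc + C1 ^+ 2 * M6) * h ^+ 3)) / h) =
 (1 + ca * h) * Phi + cb * h ^+ 2 by rewrite /ca /cb; field; rewrite gt_eqF.
apply: lerD; first by rewrite ler_wpM2r// lerD2l ler_wpM2r ?(ltW h0)// lerDl.
by rewrite ler_wpM2r ?sqr_ge0// lerDr.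
Qed.

End strong_scheme.

(** * Test functions *)

Section summable_mean.
Context d (T : measurableType d) (R : realType) (P : probability T R).

(** The series of the [f k] has a finite mean, hence converges almost everywhere, and its terms tend
    to 0. *)
Lemma ae_cvg0_summable (f : nat -> T -> R) (a : nat -> R) (C : R) :
 (forall k, borel (f k)) -> (forall k w, 0 <= f k w) ->
 (forall k, (\int[P]_w (f k w)%:E <= (a k)%:E)%E) ->
 (forall n, \sum_(0 <= k < n) a k <= C) -> {ae P, forall w, f k w @[k --> \oo] --> 0}.
Proof.
move=> mf f0 fa aC; pose S w := (\sum_(0 <= k <oo) (f k w)%:E)%E.
have mS : borel S.
 by apply: ge0_emeasurable_sum => [k w _ _|k _]; [rewrite lee_fin|apply/measurable_EFinP].
have iS : (\int[P]_w S w <= C%:E)%E.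
 rewrite integral_nneseries//; [|by move=> k; apply/measurable_EFinP|by move=> k w _; rewrite lee_fin].
 apply: lime_le; first by apply: is_cvg_nneseries => k _ _; apply: integral_ge0 => w _; rewrite lee_fin.
 apply: nearW => n; apply: (@le_trans _ _ (\sum_(0 <= k < n) (a k)%:E)%E); first exact: lee_sum.
 by rewrite sumEFin lee_fin.
have S0 w : (0 <= S w)%E by apply: nneseries_ge0 => k _ _; rewrite lee_fin.
have SI : P.-integrable [set: T] S.
 apply/integrableP; split => //; under eq_integral do rewrite gee0_abs//.
 by rewrite (le_lt_trans iS)// ltry.
apply: filterS (integrable_ae measurableT SI) => w /(_ I) Sfin.
apply: cvg_series_cvg_0; apply: nondecreasing_is_cvgn.
 by apply: nondecreasing_series => k _ _.
exists (fine (S w)) => _ [n _ <-]; rewrite -lee_fin fineK// /series/= -sumEFin.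
by apply: nneseries_lim_ge => k _ _; rewrite lee_fin.
Qed.

Lemma mean_cvg_bounded (f : nat -> T -> R) (g : T -> R) (M : R) :
 (forall k, borel (f k)) -> borel g ->
 (forall k w, `|f k w| <= M) -> {ae P, forall w, f k w @[k --> \oo] --> g w} ->
 (\int[P]_w (f k w)%:E)%E @[k --> \oo] --> (\int[P]_w (g w)%:E)%E.
Proof.
move=> mf mg fM fg.
have [] := @dominated_convergence _ _ _ P _ measurableT (fun k w => (f k w)%:E) (fun w => (g w)%:E) (cst M%:E).
- by move=> k; apply/measurable_EFinP.
- exact/measurable_EFinP.
- by apply: filterS fg => w fgw _; apply: cvg_EFin; [exact: nearW|exact: fgw].
- exact: (L1_cst P M).
- by apply: aeW => w k _; rewrite /= lee_fin.
by [].
Qed.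

End summable_mean.

Section test_functions.
Variables (R : realType) (n : nat).
Implicit Types (f : n.-tuple R -> R) (x : n.-tuple R).

(** A test function vanishes as soon as one coordinate is small, that is, outside a compact set of
    log-coordinates; this makes it integrable against F dy even when F dy is infinite. *)
Definition test_function f :=
 [/\ nice f, forall x, 0 <= f x &
   exists2 ep : R, 0 < ep & forall x i, tnth x i <= ep -> f x = 0].

Definition orthant (a : 'I_n -> R) : set (n.-tuple R) := [set x | forall i, a i < tnth x i].

Lemma measurable_orthant a : measurable (orthant a).
Proof.
rewrite (_ : orthant a = \bigcap_(i in [set: 'I_n]) ((fun x => tnth x i) @^-1` `]a i, +oo[%classic)).
 apply: fin_bigcap_measurable => // i _.
 by rewrite -[X in measurable X]setTI; exact: measurable_tnth.
apply/seteqP; split => x h i; first by move=> _; rewrite /= in_itv/= andbT; exact: h.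
by have := h i I; rewrite /= in_itv/= andbT.
Qed.

Lemma measurable_orthants :
 @measurable _ (n.-tuple R) = <<s [set S | exists a, S = orthant a] >>.
Proof.
set G := [set S | _]; apply/seteqP; split; last first.
 by apply: smallest_sub; [exact: sigma_algebra_measurable|move=> _ [a ->]; exact: measurable_orthant].
apply: smallest_sub; first exact: smallest_sigma_algebra.
move=> S; rewrite -bigcup_seq => -[i _ [B mB <-]].
suff mi : measurable_fun [set: g_sigma_algebraType G] (fun x : n.-tuple R => tnth x i).
 by have := mi measurableT B mB.
apply: (measurability _ (RGenOInfty.measurableE R)) => _ [_ [a ->] <-]; rewrite setTI.
rewrite (_ : _ @^-1` _ = \bigcup_k (orthant (fun j => if j == i then a else - k%:R))).
 by apply: bigcup_measurable => k _; apply: sub_sigma_algebra; exists (fun j => if j == i then a else - k%:R).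
apply/seteqP; split => x /=; last first.
 by move=> [k _ /(_ i)]; rewrite eqxx in_itv/= andbT.
rewrite in_itv/= andbT => ax; exists (Num.truncn (\sum_j `|tnth x j|)).+1 => // j.
case: eqP => [->//|_]; rewrite ltrNl; apply: (@le_lt_trans _ _ (\sum_j `|tnth x j|)).
 apply: (@le_trans _ _ `|tnth x j|); first by rewrite -normrN ler_norm.
 by rewrite (bigD1 j)//= lerDl sumr_ge0.
by apply: truncnS_gt.
Qed.

Definition ramp (k a u : R) : R := Num.min 1 (k * Num.max 0 (u - a)).

Lemma ramp_ge0 k a u : 0 <= k -> 0 <= ramp k a u.
Proof. by move=> k0; rewrite le_min ler01 mulr_ge0// le_max lexx. Qed.

Lemma ramp_le1 k a u : ramp k a u <= 1.
Proof. by rewrite ge_min lexx. Qed.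

Lemma ramp_lip k a u v : 0 <= k -> `|ramp k a u - ramp k a v| <= k * `|u - v|.
Proof.
move=> k0; wlog uv : u v / v <= u => [hw|].
 by have [/hw//|/ltW /hw h] := leP v u; rewrite distrC (distrC u).
have mx : Num.max 0 (v - a) <= Num.max 0 (u - a).
 by rewrite ge_max !le_max lexx/= lerD2r uv orbT.
have d : Num.max 0 (u - a) - Num.max 0 (v - a) <= u - v.
 rewrite lerBlDr ge_max; apply/andP; split.
  by rewrite addr_ge0 ?subr_ge0// le_max lexx.
 have -> : u - a = u - v + (v - a) by ring.
 by rewrite lerD2l le_max lexx orbT.
have kd : k * Num.max 0 (v - a) <= k * Num.max 0 (u - a) by exact: ler_wpM2l.
have rm : ramp k a v <= ramp k a u by rewrite /ramp le_min !ge_min lexx/= kd orbT.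
rewrite !ger0_norm ?subr_ge0// lerBlDr /ramp [leRHS]addrC -lerBlDr.
rewrite le_min lerBlDr ge_min; apply/andP; split.
 by rewrite lerDl mulr_ge0// subr_ge0.
rewrite lerBlDr ge_min; apply/orP; right.
have := ler_wpM2l k0 d; rewrite mulrBr lerBlDr => h; apply: (le_trans h).
by rewrite addrC.
Qed.

Lemma nice_ramp k a i : 0 <= k -> nice (fun x => ramp k a (tnth x i)).
Proof.
move=> k0; split.
 apply: measurable_minr => //; apply: measurable_funM => //; apply: measurable_maxr => //.
 by apply: measurable_funB => //; exact: measurable_tnth.
exists (1 + k); split; first by rewrite addr_ge0.
 by move=> x _; rewrite ger0_norm ?ramp_ge0// (le_trans (ramp_le1 _ _ _))// lerDl.
move=> x y e _ _ h; apply: (le_trans (ramp_lip _ _ _ k0)).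
have e0 : 0 <= e := le_trans (normr_ge0 _) (h i).
apply: (@le_trans _ _ (k * e)); first exact: ler_wpM2l.
by rewrite ler_wpM2r// lerDr.
Qed.

Lemma nice_prod (I : Type) (s : seq I) (f : I -> n.-tuple R -> R) :
 (forall i, nice (f i)) -> nice (fun x => \prod_(i <- s) f i x).
Proof.
move=> h; elim: s => [|i s IH].
 by under eq_fun do rewrite big_nil; exact: nice_cst.
by under eq_fun do rewrite big_cons; exact: niceM.
Qed.

Definition ramps k (a : 'I_n -> R) x : R := \prod_(i < n) ramp k (a i) (tnth x i).

Lemma test_ramps k a : (0 < n)%N -> 0 <= k -> (forall i, 0 < a i) -> test_function (ramps k a).
Proof.
move=> n0 k0 a0; split.
- by apply: nice_prod => i; exact: nice_ramp.
- by move=> x; apply: prodr_ge0 => i _; exact: ramp_ge0.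
pose j : 'I_n := Ordinal n0; pose i0 := [arg min_(i < j) a i]%O.
exists (a i0) => // x i xi; rewrite /ramps (bigD1 i)//= /ramp.
have ai : a i0 <= a i by rewrite /i0; case: Order.TotalTheory.arg_minP => // i' _; apply.
have -> : Num.max 0 (tnth x i - a i) = 0.
 by apply/max_idPl; rewrite subr_le0 (le_trans xi).
by rewrite mulr0 (min_idPr ler01) mul0r.
Qed.

Lemma ramps_cvg a x : (ramps k%:R a x)%:E @[k --> \oo] --> (\1_(orthant a) x)%:E.
Proof.
apply: cvg_EFin; first exact: nearW.
have [xa|xa] := pselect (orthant a x).
 rewrite indicE mem_set// /=.
 have : \forall k \near \oo, forall i, 1 <= k%:R * (tnth x i - a i).
  apply: filter_forall => i; have d0 : 0 < tnth x i - a i by rewrite subr_gt0; exact: xa.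
  exists (Num.truncn (tnth x i - a i)^-1).+1 => // k /= hk.
  rewrite -ler_pdivrMr// div1r; apply: (le_trans (ltW (truncnS_gt _))).
  by rewrite ler_nat.
 move=> h; apply: cvg_near_cst; apply: filterS h => k h.
 rewrite /= /ramps big1// => i _; rewrite /ramp (max_idPr _) ?subr_ge0 ?(ltW (xa i))//.
 by apply/min_idPl; exact: h.
rewrite indicE memNset// /=; apply: cvg_near_cst; apply: nearW => k /=.
move/existsNP : xa => [i /negP]; rewrite -leNgt => xi.
rewrite /ramps (bigD1 i)//= /ramp (max_idPl _) ?subr_le0//.
by rewrite mulr0 (min_idPr ler01) mul0r.
Qed.

Lemma ramps_nd a x k l : (k <= l)%N -> ramps k%:R a x <= ramps l%:R a x.
Proof.
move=> kl; apply: ler_prod => i _; rewrite ramp_ge0//= /ramp le_min !ge_min lexx/=.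
by apply/orP; right; rewrite ler_wpM2r ?ler_nat// le_max lexx.
Qed.

Section uniqueness.
Hypothesis n0 : (0 < n)%N.
Variables mu1 mu2 : {measure set (n.-tuple R) -> \bar R}.
Hypothesis test_eq : forall f, test_function f ->
 (\int[mu1]_x (f x)%:E = \int[mu2]_x (f x)%:E)%E.
Hypothesis test_fin : forall f, test_function f -> (\int[mu1]_x (f x)%:E < +oo)%E.

Let eq_orthant a : (forall i, 0 < a i) -> mu1 (orthant a) = mu2 (orthant a).
Proof.
move=> a0; have mo := measurable_orthant a.
have H (mu : {measure set (n.-tuple R) -> \bar R}) :
  (\int[mu]_x (ramps k%:R a x)%:E)%E @[k --> \oo] --> mu (orthant a).
 have -> : mu (orthant a) = (\int[mu]_x limn (fun k => (ramps k%:R a x)%:E))%E.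
  rewrite -[X in mu X]setIT -integral_indic//; apply: eq_integral => x _.
  by apply/esym/cvg_lim => //; exact: ramps_cvg.
 apply: cvg_monotone_convergence => //.
 - move=> k; apply/measurable_EFinP.
  by have [[]] := test_ramps n0 (ler0n R k) a0.
 - by move=> k x _; rewrite lee_fin; have [] := test_ramps n0 (ler0n R k) a0.
 - by move=> x _ k l kl; rewrite lee_fin; exact: ramps_nd.
have := H mu2; under eq_fun do rewrite -(test_eq (test_ramps n0 (ler0n R _) a0)).
by move=> h2; rewrite -(cvg_lim _ (H mu1))// (cvg_lim _ h2).
Qed.

Let fin_orthant a : (forall i, 0 < a i) -> (mu1 (orthant a) < +oo)%E.
Proof.
move=> a0; have mo := measurable_orthant a.
pose j : 'I_n := Ordinal n0; pose i0 := [arg min_(i < j) a i]%O.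
have ai i : a i0 <= a i by rewrite /i0; case: Order.TotalTheory.arg_minP => // i' _; apply.
pose b i := a i / 2; have b0 i : 0 < b i by rewrite divr_gt0.
pose k := (a i0)^-1 * 2; have k0 : 0 <= k by rewrite mulr_ge0// invr_ge0 ltW.
have tk := test_ramps n0 k0 b0; apply: le_lt_trans (test_fin tk).
rewrite -[X in mu1 X]setIT -integral_indic//; apply: ge0_le_integral => //.
- by apply/measurable_EFinP; exact: measurable_indic.
- by apply/measurable_EFinP; case: tk => -[].
move=> x _; rewrite lee_fin indicE; have [xa|xa] := boolP (x \in orthant a); last by case: tk.
rewrite /ramps big1// => i _; rewrite /ramp; apply/min_idPl.
have xi : a i < tnth x i by move: xa; rewrite inE; apply.
apply: (@le_trans _ _ (k * (a i / 2))).
 by rewrite /k mulrACA divff// mulr1 mulrC ler_pdivlMr// mul1r.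
rewrite ler_wpM2l// le_max; apply/orP; right; rewrite /b; lra.
Qed.

(** Products of ramps increase to indicators of orthants with positive corners, so the measures
    agree there. On the orthant [O k] both are finite and the orthants form a generating system
    closed under intersection; letting k grow exhausts the open positive orthant. *)
Lemma test_measure_unique B : measurable B -> B `<=` orthant (fun=> 0) -> mu1 B = mu2 B.
Proof.
move=> mB B0; pose O k : set (n.-tuple R) := orthant (fun=> k.+1%:R^-1).
have mO k : measurable (O k) := measurable_orthant _.
have eqO k : mu1 (B `&` O k) = mu2 (B `&` O k).
 apply: (@measure_unique _ R _ [set S | exists a, S = orthant a] (fun j => orthant (fun=> - j%:R))
  measurable_orthants _ _ _ (mrestr mu1 (mO k)) (mrestr mu2 (mO k))) => //.
 - move=> _ _ [a ->] [b ->]; exists (fun i => Num.max (a i) (b i)).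
  apply/seteqP; split => x /=; first by move=> [ha hb] i; rewrite gt_max ha hb.
  by move=> h; split => i; have := h i; rewrite gt_max => /andP[].
 - by move=> j; exists (fun=> - j%:R).
 - apply/seteqP; split => // x _; exists (Num.truncn (\sum_j `|tnth x j|)).+1 => // j.
  rewrite ltrNl; apply: (@le_lt_trans _ _ (\sum_j `|tnth x j|)); last exact: truncnS_gt.
  apply: (@le_trans _ _ `|tnth x j|); first by rewrite -normrN ler_norm.
  by rewrite (bigD1 j)//= lerDl sumr_ge0.
 - move=> _ [a ->]; rewrite /= /mrestr (_ : _ `&` _ = orthant (fun i => Num.max (a i) k.+1%:R^-1)).
   by apply: eq_orthant => i; rewrite lt_max invr_gt0 ltr0n orbT.
  apply/seteqP; split => x /=; first by move=> [ha hb] i; rewrite gt_max ha; exact: hb.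
  by move=> h; split => i; have := h i; rewrite gt_max => /andP[].
 - move=> j; rewrite /= /mrestr; apply: le_lt_trans (fin_orthant (a := fun=> k.+1%:R^-1) _).
   apply: le_measure; [rewrite inE|rewrite inE; exact: mO|exact: subIsetr].
   by apply: measurableI => //; exact: measurable_orthant.
  by move=> i; rewrite invr_gt0.
have cup : \bigcup_k (B `&` O k) = B.
 apply/seteqP; split => x; first by move=> [k _ []].
 move=> Bx; pose j : 'I_n := Ordinal n0; pose i0 := [arg min_(i < j) tnth x i]%O.
 have xi i : tnth x i0 <= tnth x i.
  by rewrite /i0; case: Order.TotalTheory.arg_minP => // i' _; apply.
 exists (Num.truncn (tnth x i0)^-1) => //; split => // i; apply: lt_le_trans (xi i).
 have x0 : 0 < tnth x i0 by exact: (B0 _ Bx).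
 by rewrite -[ltRHS]invrK ltf_pV2 ?posrE ?invr_gt0 ?ltr0n// truncnS_gt.
have H (mu : {measure set (n.-tuple R) -> \bar R}) : mu (B `&` O k) @[k --> \oo] --> mu B.
 rewrite -[in X in _ --> X]cup; apply: nondecreasing_cvg_mu.
 - by move=> k; exact: measurableI.
 - by rewrite cup.
 - move=> k l kl; apply/subsetPset; apply: setIS => x h i.
  by apply: le_lt_trans (h i); rewrite lef_pV2 ?posrE ?ltr0n// ler_nat ltnS.
have := H mu2; under eq_fun do rewrite -eqO.
by move=> h2; rewrite -(cvg_lim _ (H mu1))// (cvg_lim _ h2).
Qed.

End uniqueness.
End test_functions.

(** * Growth of F and decay of test functions in log-coordinates *)

Section density_growth.
Variables (R : realType) (m : nat).
Notation leb := (lebesgue_tuple R m).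

Lemma logcoord_norm (y : m.-tuple R) i : `|logcoord y i| <= \sum_j `|tnth y j|.
Proof.
elim/ord_max_ind: i => [j|]; last by rewrite logcoord_max normr0 sumr_ge0.
by rewrite logcoord_widen (bigD1 j)//= lerDl sumr_ge0.
Qed.

Lemma exp_normr_bound (y : m.-tuple R) : 0 <= ln (exp_norm y) <= ln m.+1%:R + \sum_j `|tnth y j|.
Proof.
have e1 : 1 <= exp_norm y by rewrite /exp_norm lerDl sumr_ge0// => j _; exact: expR_ge0.
apply/andP; split; first by rewrite ln_ge0.
rewrite -[\sum_j _]expRK -lnM ?posrE ?expR_gt0// ler_ln ?posrE ?exp_norm_gt0 ?mulr_gt0 ?expR_gt0//.
rewrite exp_normE mulr_natl -[X in _ *+ X]card_ord -sumr_const; apply: ler_sum => i _.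
by rewrite ler_expR (le_trans (ler_norm _))// logcoord_norm.
Qed.

(** ln F grows at most linearly, with slope at most S + |g| in the sum of the |y_j|; one more unit
    of rate leaves the integrable weight of rate 1. *)
Lemma simplex_density_weight (al : 'I_m.+1 -> R) : exists l K, [/\ 0 <= l, 0 <= K &
 forall y, simplex_density al y * exp_weight l y <= K * exp_weight 1 y].
Proof.
pose S := \sum_i `|al i|; pose g := \sum_i al i.
have S0 : 0 <= S by exact: sumr_ge0.
exists (S + `|g| + 1), (expR (`|g| * ln m.+1%:R)); split; rewrite ?expR_ge0//.
 by rewrite !addr_ge0.
move=> y; rewrite /simplex_density /exp_weight -!expRD ler_expR -/g.
set N := \sum_j `|tnth y j|; have /andP[l0 l1] := exp_normr_bound y.
have h1 : \sum_i al i * logcoord y i <= S * N.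
 rewrite /S mulr_suml; apply: ler_sum => i _; apply: (le_trans (ler_norm _)).
 by rewrite normrM ler_wpM2l// logcoord_norm.
have h2 : - (g * ln (exp_norm y)) <= `|g| * (ln m.+1%:R + N).
 apply: (le_trans (ler_norm _)); rewrite normrN normrM (ger0_norm l0).
 by rewrite ler_wpM2l.
have h3 := lerD h1 h2; rewrite -subr_ge0 in h3; rewrite -subr_ge0.
by apply: (le_trans h3); rewrite le_eqVlt; apply/orP; left; apply/eqP; ring.
Qed.

(** Where a test function does not vanish, all x_i exceed some ep, hence every |y_j| is at most -ln
    ep, and the exponential weight is bounded below there. *)
Lemma test_exp_weight (f : m.+1.-tuple R -> R) l : test_function f -> 0 <= l ->
 exists C, 0 <= C /\ forall z, f (softmax z) <= C * exp_weight l z.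
Proof.
move=> [[_ [K [K0 fK _]]] f0 [ep ep0 fep]] l0; pose L := - ln ep.
exists (K * expR (l * (m%:R * L))); split; first by rewrite mulr_ge0 ?expR_ge0.
move=> z; have [/existsP[i xi]|] := boolP [exists i, tnth (softmax z) i <= ep].
 by rewrite (fep _ i)// mulr_ge0 ?mulr_ge0 ?expR_ge0.
rewrite negb_exists => /forallP xep; have {}xep i : ep < tnth (softmax z) i by rewrite ltNge.
have x1 i : tnth (softmax z) i <= 1 by have [h _] := simplex_softmax z; have /andP[] := h i.
have zL j : `|tnth z j| <= L.
 have zE : tnth z j = ln (tnth (softmax z) (widen_ord (leqnSn m) j)) - ln (tnth (softmax z) ord_max).
  rewrite !tnth_softmax logcoord_max logcoord_widen expR0 -ln_div ?posrE ?divr_gt0 ?expR_gt0 ?exp_norm_gt0//.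
  by rewrite div1r invrK divfK ?expRK// gt_eqF// exp_norm_gt0.
 have b i : ln ep <= ln (tnth (softmax z) i) <= 0.
  rewrite ler_ln ?posrE ?softmax_gt0// (ltW (xep i)) /=.
  by rewrite ln_le0.
 have /andP[a1 a2] := b (widen_ord (leqnSn m) j); have /andP[b1 b2] := b ord_max.
 by rewrite zE /L ler_norml; apply/andP; split; lra.
have fz : f (softmax z) <= K by apply: le_trans (ler_norm _) _; apply: fK; exact: simplex_softmax.
apply: (le_trans fz); rewrite -mulrA -expRD -[leLHS]mulr1 ler_wpM2l// -[leLHS]expR0 ler_expR.
rewrite subr_ge0 ler_wpM2l// mulr_natl -[X in _ *+ X]card_ord -sumr_const.
exact: ler_sum.
Qed.

Lemma apx_eq (a b : \bar R) : (0 <= a)%E -> (0 <= b)%E -> a \is a fin_num ->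
 (forall dl, 0 < dl -> apx dl a b) -> a = b.
Proof.
have h (x y : R) : 0 <= y -> (forall dl, 0 < dl -> x <= expR dl * y) -> x <= y.
 move=> y0 xy; apply/ler_addgt0Pr => ep ep0.
 have q0 : 0 < ep / (y + 1) by rewrite divr_gt0// ltr_wpDl.
 have := xy (ln (1 + ep / (y + 1))) _; rewrite ln_gt0 ?ltrDl// => /(_ isT) hx.
 apply: (le_trans hx); rewrite lnK ?posrE ?addr_gt0// mulrDl mul1r lerD2l.
 by rewrite mulrAC -mulrA ler_piMr ?(ltW ep0)// ler_pdivrMr ?mul1r ?lerDl// ltr_wpDl.
case: a => [x| |]//; case: b => [y| |]//; rewrite ?lee_fin.
 move=> x0 y0 _ xy; congr EFin; apply/le_anti/andP; split; apply: h => // dl dl0;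
  by have [] := xy dl dl0; rewrite -!EFinM !lee_fin.
by move=> x0 _ _ /(_ 1 ltr01)[_]; rewrite -EFinM leye_eq.
Qed.

End density_growth.

Section dirichlet.
Variables (R : realType) (m : nat) (alpha : 'cV[R]_m.+1).
Let al (i : 'I_m.+1) : R := alpha i 0.

Definition log_chart (x : m.+1.-tuple R) : m.-tuple R :=
 [tuple ln (tnth x (widen_ord (leqnSn m) j)) - ln (tnth x ord_max) | j < m].

Lemma measurable_log_chart : borel log_chart.
Proof.
apply: measurable_fun_tuple => j; apply: measurable_funB.
 by apply: measurableT_comp => //; exact: measurable_tnth.
by apply: measurableT_comp => //; exact: measurable_tnth.
Qed.

Lemma log_chartK x : int_simplex x -> softmax (log_chart x) = x.
Proof.
move=> /int_simplexP[x0 x1]; have lc i : expR (logcoord (log_chart x) i) = tnth x i / tnth x ord_max.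
 elim/ord_max_ind: i => [j|]; last by rewrite logcoord_max expR0 divff// gt_eqF.
 by rewrite logcoord_widen tnth_mktuple expRB !lnK ?posrE.
apply: eq_from_tnth => i; rewrite tnth_softmax lc exp_normE.
under eq_bigr do rewrite lc.
by rewrite -mulr_suml x1 div1r invrK divfK// gt_eqF.
Qed.

Lemma measurable_dirichlet : borel (dirichlet_density alpha).
Proof.
apply: measurable_fun_bigprod => i.
exact: measurableT_comp (measurable_powR _) (measurable_tnth i).
Qed.

Lemma dirichlet_ge0 x : 0 <= dirichlet_density alpha x.
Proof. by apply: prodr_ge0 => i _; exact: powR_ge0. Qed.

Lemma dirichlet_softmax (y : m.-tuple R) :
 dirichlet_density alpha (softmax y) * \prod_i tnth (softmax y) i = simplex_density al y.
Proof.
rewrite /dirichlet_density -big_split/= /simplex_density mulr_suml -sumrB expR_sum.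
apply: eq_bigr => i _; have s0 := softmax_gt0 y i.
rewrite /powR gt_eqF// -{2}[tnth _ _]lnK// -expRD; congr expR.
have -> : ln (tnth (softmax y) i) = logcoord y i - ln (exp_norm y).
 by rewrite tnth_softmax ln_div ?posrE ?expR_gt0 ?exp_norm_gt0// expRK.
by rewrite /al; ring.
Qed.

End dirichlet.

(** * Functions with a first-order expansion on the simplex *)

Section linearizable.
Variables (R : realType) (n : nat).
Implicit Types f : n.-tuple R -> R.

(* One gradient, at [x], serves for both [x1] and [x2]: the remainder is
   [K * (r * e)] although [x1] and [x2] are at distance [r] from [x]. *)
Definition linearized f (g : 'I_n -> n.-tuple R -> R) (K : R) : Prop :=
 [/\ simplex_lip f K, forall i x, @simplex R n x -> `|g i x| <= K &
  forall x x1 x2 r e, @simplex R n x -> @simplex R n x1 -> @simplex R n x2 ->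
  (forall i, `|tnth x1 i - tnth x i| <= r) -> (forall i, `|tnth x2 i - tnth x i| <= r) ->
  (forall i, `|tnth x1 i - tnth x2 i| <= e) -> 0 <= r -> 0 <= e ->
  `|f x1 - f x2 - \sum_i g i x * (tnth x1 i - tnth x2 i)| <= K * (r * e)].

Definition smooth f := borel f /\ exists g K, linearized f g K.

Lemma smooth_nice f : smooth f -> nice f.
Proof. by move=> [mf [g [K [hf _ _]]]]; split => //; exists K. Qed.

Lemma smooth_cst c : smooth (fun=> c).
Proof.
have [mf [K hK]] := nice_cst n c; split => //; exists (fun _ _ => 0), K; have [K0 _ _] := hK.
split => //; first by move=> i x _; rewrite normr0.
move=> x x1 x2 r e _ _ _ _ _ _ r0 e0; rewrite subrr big1 ?subrr ?normr0 ?mulr_ge0// => i _.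
by rewrite mul0r.
Qed.

Lemma smooth_coord k : smooth (fun x => tnth x k).
Proof.
have [mf [K hK]] := nice_coord R k; split => //; have [K0 _ _] := hK.
exists (fun i _ => (i == k)%:R), (K + 1); split.
- by apply: simplex_lipW hK; rewrite lerDl.
- by move=> i x _; case: eqP => _; rewrite ?normr1 ?normr0 ?lerDr ?addr_ge0.
move=> x x1 x2 r e _ _ _ _ _ _ r0 e0; rewrite (bigD1 k)//= eqxx mul1r big1 => [|i /negbTE ->].
 by rewrite addr0 subrr normr0 mulr_ge0 ?mulr_ge0 ?addr_ge0.
by rewrite mul0r.
Qed.

Lemma smoothM f h : smooth f -> smooth h -> smooth (fun x => f x * h x).
Proof.
move=> [mf [gf [K [lf bf tf]]]] [mh [gh [L [lh bh th]]]].
have [mfh [N lN]] := niceM (smooth_nice (conj mf (ex_intro _ gf (ex_intro _ K (And3 lf bf tf)))))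
 (smooth_nice (conj mh (ex_intro _ gh (ex_intro _ L (And3 lh bh th))))).
have [K0 fK fl] := lf; have [L0 hL hl] := lh; have [N0 _ _] := lN.
have KL : 0 <= K * L by rewrite mulr_ge0.
split => //; exists (fun i x => f x * gh i x + h x * gf i x), (N + 4 * (K * L)); split.
- by apply: simplex_lipW lN; rewrite lerDl mulr_ge0.
- move=> i x sx; apply: (le_trans (ler_normD _ _)); rewrite !normrM.
 have h1 : `|f x| * `|gh i x| <= K * L by apply: ler_pM; rewrite ?fK ?bh.
 have h2 : `|h x| * `|gf i x| <= K * L by rewrite mulrC; apply: ler_pM; rewrite ?hL ?bf.
 by lra.
move=> x x1 x2 r e sx s1 s2 r1 r2 e12 r0 e0.
have -> : f x1 * h x1 - f x2 * h x2 -
  \sum_i (f x * gh i x + h x * gf i x) * (tnth x1 i - tnth x2 i) =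
 f x * (h x1 - h x2 - \sum_i gh i x * (tnth x1 i - tnth x2 i)) +
 h x * (f x1 - f x2 - \sum_i gf i x * (tnth x1 i - tnth x2 i)) +
 (f x1 - f x) * (h x1 - h x2) + (h x2 - h x) * (f x1 - f x2).
 have -> : \sum_i (f x * gh i x + h x * gf i x) * (tnth x1 i - tnth x2 i) =
   f x * (\sum_i gh i x * (tnth x1 i - tnth x2 i)) + h x * (\sum_i gf i x * (tnth x1 i - tnth x2 i)).
  by rewrite !mulr_sumr -big_split; apply: eq_bigr => i _ /=; ring.
 by ring.
have re : 0 <= r * e by rewrite mulr_ge0.
have b1 : `|f x * (h x1 - h x2 - \sum_i gh i x * (tnth x1 i - tnth x2 i))| <= K * (L * (r * e)).
 by rewrite normrM; apply: ler_pM => //; [exact: fK|exact: th].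
have b2 : `|h x * (f x1 - f x2 - \sum_i gf i x * (tnth x1 i - tnth x2 i))| <= L * (K * (r * e)).
 by rewrite normrM; apply: ler_pM => //; [exact: hL|exact: tf].
have b3 : `|(f x1 - f x) * (h x1 - h x2)| <= (K * r) * (L * e).
 by rewrite normrM; apply: ler_pM => //; [exact: fl|exact: hl].
have b4 : `|(h x2 - h x) * (f x1 - f x2)| <= (L * r) * (K * e).
 by rewrite normrM; apply: ler_pM => //; [exact: hl|exact: fl].
apply: (le_trans (ler_normD _ _)); apply: (le_trans (lerD (ler_normD _ _) b4)).
apply: (le_trans (lerD (lerD (ler_normD _ _) b3) (lexx _))).
apply: (le_trans (lerD (lerD (lerD b1 b2) (lexx _)) (lexx _))).
have Nre : 0 <= N * (r * e) by rewrite mulr_ge0.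
rewrite -subr_ge0; apply: (le_trans Nre).
by rewrite le_eqVlt; apply/orP; left; apply/eqP; ring.
Qed.

Lemma smoothD f h : smooth f -> smooth h -> smooth (fun x => f x + h x).
Proof.
move=> [mf [gf [K [lf bf tf]]]] [mh [gh [L [lh bh th]]]].
have [mfh [N lN]] := niceD (conj mf (ex_intro _ K lf) : nice f) (conj mh (ex_intro _ L lh) : nice h).
have [K0 _ _] := lf; have [L0 _ _] := lh; have [N0 _ _] := lN.
split => //; exists (fun i x => gf i x + gh i x), (N + K + L); split.
- by apply: simplex_lipW lN; rewrite -addrA lerDl addr_ge0.
- move=> i x sx; apply: (le_trans (ler_normD _ _)).
 have := bf i x sx; have := bh i x sx; lra.
move=> x x1 x2 r e sx s1 s2 r1 r2 e12 r0 e0.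
have -> : f x1 + h x1 - (f x2 + h x2) - \sum_i (gf i x + gh i x) * (tnth x1 i - tnth x2 i) =
 (f x1 - f x2 - \sum_i gf i x * (tnth x1 i - tnth x2 i)) +
 (h x1 - h x2 - \sum_i gh i x * (tnth x1 i - tnth x2 i)).
 under eq_bigr do rewrite mulrDl.
 by rewrite big_split/=; ring.
apply: (le_trans (ler_normD _ _)).
apply: (le_trans (lerD (tf x x1 x2 r e sx s1 s2 r1 r2 e12 r0 e0) (th x x1 x2 r e sx s1 s2 r1 r2 e12 r0 e0))).
by rewrite -mulrDl ler_wpM2r ?mulr_ge0// -addrA lerDr.
Qed.

Lemma smoothB f h : smooth f -> smooth h -> smooth (fun x => f x - h x).
Proof.
move=> sf sh; have := smoothD sf (smoothM (smooth_cst (-1)) sh).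
by under eq_fun do rewrite mulN1r.
Qed.

Lemma smooth_sum (I : Type) (s : seq I) (f : I -> n.-tuple R -> R) :
 (forall i, smooth (f i)) -> smooth (fun x => \sum_(i <- s) f i x).
Proof.
move=> h; elim: s => [|i s IH].
 by under eq_fun do rewrite big_nil; exact: smooth_cst.
by under eq_fun do rewrite big_cons; exact: smoothD.
Qed.

Lemma smooth_prod (I : Type) (s : seq I) (f : I -> n.-tuple R -> R) :
 (forall i, smooth (f i)) -> smooth (fun x => \prod_(i <- s) f i x).
Proof.
move=> h; elim: s => [|i s IH].
 by under eq_fun do rewrite big_nil; exact: smooth_cst.
by under eq_fun do rewrite big_cons; exact: smoothM.
Qed.

Lemma smooth_sq f : smooth f -> smooth (fun x => f x ^+ 2).
Proof. by move=> h; under eq_fun do rewrite expr2; exact: smoothM. Qed.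

(** The square makes the cut-off differentiable with a Lipschitz derivative, which is all that
    [linearized] demands. *)
Definition bump (ep u : R) : R := Num.max 0 (u - ep) ^+ 2.

(** The bump is convex, so its increment between two points lies between the increments of its
    tangents at the two points. The slopes are then compared with the slope at [x], the derivative
    being Lipschitz with constant 2. *)
Lemma smooth_bump ep k : 0 <= ep -> smooth (fun x => bump ep (tnth x k)).
Proof.
move=> ep0; pose p u := Num.max 0 (u - ep).
have p0 u : 0 <= p u by rewrite le_max lexx.
have pge u : u - ep <= p u by rewrite le_max lexx orbT.
have plip u v : p u - p v <= `|u - v|.
 rewrite lerBlDr ge_max; apply/andP; split; first by rewrite addr_ge0.
 have := ler_norm (u - v); have := pge v; lra.
have pabs u v : `|p u - p v| <= `|u - v|.
 by rewrite ler_norml plip lerNl opprB distrC plip.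
have pn : nice (fun x : n.-tuple R => p (tnth x k)).
 split.
  apply: measurable_maxr => //; apply: measurable_funB => //; exact: measurable_tnth.
 exists 1; split => //.
  move=> x [h _]; have /andP[_ x1] := h k; rewrite ger0_norm// ge_max ler01/=; lra.
 by move=> x y e _ _ xy; rewrite mul1r; apply: (le_trans (pabs _ _)).
have [mf [K lK]] := niceX 2 pn; have [K0 _ _] := lK; have [_ [L [L0 pL _]]] := pn.
have convex u v : 2 * p v * (u - v) <= p u ^+ 2 - p v ^+ 2.
 rewrite -subr_ge0; have [v0|v0] := leP (v - ep) 0.
  have -> : p v = 0 by apply/max_idPl.
  by rewrite mulr0 mul0r expr0n subr0 subr0 sqr_ge0.
 have pv : p v = v - ep by apply/max_idPr/ltW.
 have -> : p u ^+ 2 - p v ^+ 2 - 2 * p v * (u - v) = (p u - p v) ^+ 2 + 2 * p v * (p u - (u - ep)).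
  by rewrite pv; ring.
 by rewrite addr_ge0 ?sqr_ge0// mulr_ge0 ?mulr_ge0// subr_ge0.
split => //; exists (fun i x => (i == k)%:R * (2 * p (tnth x k))), (K + 2 * L + 2); split.
- by apply: simplex_lipW lK; rewrite -addrA lerDl addr_ge0// mulr_ge0.
- move=> i x sx; case: (i == k); rewrite ?mul0r ?normr0 ?mul1r; last by rewrite !addr_ge0// mulr_ge0.
 apply: (@le_trans _ _ (2 * L)); first by rewrite normrM ger0_norm// ler_wpM2l// pL.
 have -> : K + 2 * L + 2 = 2 * L + (K + 2) by ring.
 by rewrite lerDl addr_ge0.
move=> x x1 x2 r e sx s1 s2 r1 r2 e12 r0 e0.
rewrite (bigD1 k)//= eqxx mul1r big1 => [|i /negbTE ->]; last by rewrite !mul0r.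
rewrite addr0 /bump -!/(p _); set u := tnth x k; set a := tnth x1 k; set b := tnth x2 k.
have ra := r1 k; have rb := r2 k; have eab := e12 k.
have re : 0 <= r * e by rewrite mulr_ge0.
have cross v : `|v - u| <= r -> `|2 * (p v - p u) * (a - b)| <= 2 * (r * e).
 move=> vr; rewrite normrM normrM ger0_norm// -mulrA; apply: ler_wpM2l => //.
 by apply: ler_pM => //; exact: le_trans (pabs _ _) vr.
have := cross a ra; have := cross b rb; rewrite !ler_norml => /andP[cb1 cb2] /andP[ca1 ca2].
have v1 := convex a b; have v2 := convex b a.
have KL : 0 <= (K + 2 * L) * (r * e) by rewrite mulr_ge0// addr_ge0// mulr_ge0.
have -> : (K + 2 * L + 2) * (r * e) = (K + 2 * L) * (r * e) + 2 * (r * e) by ring.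
set Q := (K + 2 * L) * (r * e) in KL *.
have eb : 2 * (p b - p u) * (a - b) = 2 * p b * (a - b) - 2 * p u * (a - b) by ring.
have ea : 2 * (p a - p u) * (a - b) = - (2 * p a * (b - a)) - 2 * p u * (a - b) by ring.
rewrite eb in cb1 cb2; rewrite ea in ca1 ca2; apply/andP; split; lra.
Qed.

End linearizable.

Section smooth_kappa.
Variables (R : realType) (m : nat) (At : 'M[R]_m.+1) (al sg : 'I_m.+1 -> R).

Lemma smooth_replicator_kappa : smooth (replicator_kappa At al sg).
Proof.
pose sc (k : 'I_m.+1) := @smooth_coord R _ k; pose cst (c : R) := smooth_cst m.+1 c.
have sp i : smooth (payoff At i) by apply: smooth_sum => j; exact: smoothM.
have sr j : smooth (rel_payoff At j) by exact: smoothB.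
have sr' j : smooth (rel_payoff' At j) by apply: smoothM => //; exact: smoothB.
have ss j : smooth (shear_kappa At al j).
 apply: smoothB; first by have := smoothB (cst 0) (sr' j); under eq_fun do rewrite sub0r.
 by apply: smoothM => //; apply: smoothB => //; exact: smoothM.
apply: smoothD; first exact: smooth_sum.
apply: smoothM => //; apply: smoothB.
 by apply: smooth_sum => i; apply: smooth_sq; apply: smoothM => //; apply: smoothB => //; exact: smoothM.
apply: smoothM => //; apply: smoothB; apply: smooth_sum => i; first exact: smoothM.
by apply: smooth_sq; exact: smoothM.
Qed.

End smooth_kappa.

Section real_estimates.
Variable R : realType.

(** The interpolation between a uniform bound u^4 and a tail bound v^4: it keeps most of the
    smallness of [u] and one factor of decay. *)
Lemma min_pow4 (u v : R) : 0 <= u -> 0 <= v -> Num.min (u ^+ 4) (v ^+ 4) <= u ^+ 3 * v.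
Proof.
move=> u0 v0; have [uv|vu] := leP u v; rewrite ge_min; apply/orP; [left|right].
 by rewrite exprSr ler_wpM2l// exprn_ge0.
by rewrite exprSr ler_wpM2r// lerXn2r ?nnegrE// ltW.
Qed.

Lemma exp_sandwich (dl i j M : R) : 0 <= dl -> dl <= 2^-1 -> 0 <= i -> i <= M ->
 i <= expR dl * j -> j <= expR dl * i -> `|j - i| <= 4 * dl * M.
Proof.
move=> dl0 dl2 i0 iM ap1 ap2; have E0 := expR_ge0 dl.
have eE : expR dl <= 1 + 2 * dl.
 have e1 := expR_ge1Dx (- dl); have e2 : expR dl * expR (- dl) = 1 by rewrite -expRD subrr expR0.
 have e3 : expR dl * (1 - dl) <= 1 by rewrite -[leRHS]e2 ler_wpM2l.
 have e4 : 1 <= (1 - dl) * (1 + 2 * dl).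
  have -> : (1 - dl) * (1 + 2 * dl) = 1 + dl * (1 - 2 * dl) by ring.
  by rewrite lerDl mulr_ge0// subr_ge0; lra.
 have d1 : 0 < 1 - dl by lra.
 by rewrite -(ler_pM2l d1) [leLHS]mulrC; exact: le_trans e3 e4.
have j0 : 0 <= j by rewrite -(pmulr_rge0 _ (expR_gt0 dl)); exact: le_trans i0 ap1.
have ij : i <= (1 + 2 * dl) * j by apply: (le_trans ap1); rewrite ler_wpM2r.
have ji : j <= (1 + 2 * dl) * i by apply: (le_trans ap2); rewrite ler_wpM2r.
have j2 : j <= 2 * i by apply: (le_trans ji); rewrite ler_wpM2r//; lra.
have M2 : 0 <= 2 * dl by rewrite mulr_ge0.
have u z : z <= 2 * M -> 2 * dl * z <= 4 * dl * M.
 have -> : 4 * dl * M = 2 * dl * (2 * M) by ring.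
 by move=> h; exact: ler_wpM2l.
have u1 : 2 * dl * i <= 4 * dl * M by apply: u; lra.
have u2 : 2 * dl * j <= 4 * dl * M by apply: u; lra.
by rewrite ler_norml; apply/andP; split; lra.
Qed.

End real_estimates.

(** * Invariance and the vanishing of kappa *)

Section solution.
Context d (T : measurableType d) (R : realType) (P : probability T R).
Variables (m : nat) (A : 'M[R]_m.+1) (sigma : 'rV[R]_m.+1) (W : 'I_m.+1 -> R -> T -> R).
Hypothesis hW : standard_brownian_motion P W.
Variable X : m.+1.-tuple R -> R -> T -> m.+1.-tuple R.
Hypothesis hX : stochastic_replicator A sigma P W X.
Notation leb := (lebesgue_tuple R m).
Notation wi := (widen_ord (leqnSn m)).
Let sg (i : 'I_m.+1) : R := sigma 0 i.
Let At := modified_payoff A sigma.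

Lemma solution_simplex y t w : 0 <= t -> simplex (X (softmax y) t w).
Proof. by move=> t0; apply: (sol_state (hX (int_simplex_softmax y))). Qed.

Lemma measurable_solution_softmax y t : 0 <= t -> borel (X (softmax y) t).
Proof. exact: (measurable_solution hW (hX (int_simplex_softmax y))). Qed.

Lemma L1_nice (phi : m.+1.-tuple R -> R) (z : T -> m.+1.-tuple R) : nice phi ->
 borel z -> (forall w, simplex (z w)) -> L1 P (fun w => phi (z w)).
Proof.
move=> [mphi [K [_ phiK _]]] mz sz; apply: (L1_le _ _ (L1_cst P K)).
 exact: measurableT_comp mphi mz.
by move=> w; exact: phiK.
Qed.

Fixpoint scheme_path (h : R) (k : nat) (y : m.-tuple R) (w : T) : m.-tuple R :=
 if k is k'.+1 then
  scheme_step At sg h (scheme_path h k' y w) (increment W (k'%:R * h) (k'.+1%:R * h) w)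
 else y.

Let grid_diff (h : R) (k : nat) : k.+1%:R * h - k%:R * h = h.
Proof. by rewrite -mulrBl -natrB// subSnn mul1r. Qed.

Let grid_lt (h : R) (k : nat) : 0 < h -> k%:R * h < k.+1%:R * h.
Proof. by move=> h0; rewrite ltr_pM2r// ltr_nat. Qed.

Let grid_ge0 (h : R) (k : nat) : 0 < h -> 0 <= k%:R * h.
Proof. by move=> h0; rewrite mulr_ge0// ltW. Qed.

Lemma past_scheme_path h k y : 0 < h -> past P W (k%:R * h) (scheme_path h k y).
Proof.
move=> h0; elim: k => [|k IH]; first by apply/pastE; exact: measurable_cst.
have := past_scheme_step A sigma (grid_ge0 k h0) (grid_lt k h0) IH.
by rewrite grid_diff.
Qed.

Lemma measurable_scheme_path2 h k : 0 < h ->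
 borel (fun p => scheme_path h k p.1 p.2).
Proof.
move=> h0; elim: k => [|k IH]; first exact: measurable_fst.
apply: measurable_scheme_step => //.
apply: measurableT_comp; last exact: measurable_snd.
by apply: (measurable_increment hW); exact: grid_ge0.
Qed.

Lemma measurable_scheme_path h k y : 0 < h -> borel (scheme_path h k y).
Proof.
move=> h0; have : past P W (k%:R * h) (scheme_path h k y) by exact: past_scheme_path.
exact: past_measurable.
Qed.

(** A discrete Gronwall argument on the recursion of [scheme_error_step]. The initial error vanishes
    only in mean, as the solution starts at its point almost surely. *)
Lemma path_error : exists c, 0 <= c /\ forall h k y, 0 < h -> h <= 1 ->
 mean_sq_error P (X (softmax y) (k%:R * h)) (scheme_path h k y) <=
  c * h * (k%:R * h) * expR (c * (k%:R * h)).
Proof.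
have [c [c0 step]] := scheme_error_step A sigma hW.
exists c; split => // h k y h0 h1; have ch0 : 0 <= c * h by rewrite mulr_ge0// ltW.
have sx := hX (int_simplex_softmax y).
have main : mean_sq_error P (X (softmax y) (k%:R * h)) (scheme_path h k y) <=
  c * h ^+ 2 * k%:R * (1 + c * h) ^+ k.
 elim: k => [|k IH].
  rewrite mul0r mulr0 mul0r /mean_sq_error big1// => i _.
  have sol := sol_start sx.
  suff -> : mean P (fun w => (scheme_error (X (softmax y) 0 w) y i) ^+ 2) = mean P (fun=> 0) by exact: mean_cst.
  apply: eq_mean_ae => //.
   apply: measurable_funX; apply: measurable_funB => //.
   by apply: measurableT_comp (measurable_tnth i) (measurable_solution hW sx (lexx 0)).
  by apply: filterS sol => w ->; rewrite /scheme_error subrr expr0n.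
 have dl1 : k.+1%:R * h - k%:R * h <= 1 by rewrite grid_diff.
 have pk : past P W (k%:R * h) (scheme_path h k y) by exact: past_scheme_path.
 have [hs _] := step _ _ _ _ _ sx (grid_ge0 k h0) (grid_lt k h0) dl1 pk.
 rewrite grid_diff in hs.
 apply: (le_trans hs).
 apply: (@le_trans _ _ ((1 + c * h) * (c * h ^+ 2 * k%:R * (1 + c * h) ^+ k) + c * h ^+ 2)).
  by rewrite lerD2r ler_wpM2l// addr_ge0.
 have e1 : 1 <= (1 + c * h) ^+ k.+1 by rewrite exprn_ege1// lerDl.
 have e2 : c * h ^+ 2 * 1 <= c * h ^+ 2 * (1 + c * h) ^+ k.+1.
  by rewrite ler_wpM2l// mulr_ge0// sqr_ge0.
 rewrite mulr1 in e2; rewrite -subr_ge0.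
 have -> : c * h ^+ 2 * k.+1%:R * (1 + c * h) ^+ k.+1 -
   ((1 + c * h) * (c * h ^+ 2 * k%:R * (1 + c * h) ^+ k) + c * h ^+ 2) =
   c * h ^+ 2 * (1 + c * h) ^+ k.+1 - c * h ^+ 2 by rewrite [(1 + c * h) ^+ k.+1]exprS -natr1; ring.
 by rewrite subr_ge0.
apply: (le_trans main).
have -> : c * h ^+ 2 * k%:R = c * h * (k%:R * h) by ring.
apply: ler_wpM2l; first by rewrite mulr_ge0// grid_ge0.
have -> : c * (k%:R * h) = (c * h) * k%:R by ring.
rewrite [c * h * _]mulrC expRM_natl.
by rewrite lerXn2r ?nnegrE ?expR_ge0 ?addr_ge0//; exact: expR_ge1Dx.
Qed.

(** In log-coordinates the noise is additive and telescopes to a combination of the Brownian values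
    at the final time, so only the drift, which is bounded, accumulates. The bound depends on the
    elapsed time but not on the number of steps. *)
Lemma path_displacement : exists c, 0 <= c /\ forall h k y w j, 0 < h -> h <= 1 ->
 `|tnth (scheme_path h k y w) j - tnth y j| <= c * (k%:R * h) +
  `|sg (wi j)| * `|winc W (wi j) 0 (k%:R * h) w| + `|sg ord_max| * `|winc W ord_max 0 (k%:R * h) w|.
Proof.
have [K [K0 hb]] := nice_uniform (nice_rel_payoff At).
pose c := K + 2 * K ^+ 2 * m%:R.
have c0 : 0 <= c by rewrite addr_ge0// !mulr_ge0// sqr_ge0.
exists c; split => // h k y w j h0 h1.
have main : `|tnth (scheme_path h k y w) j - tnth y j -
  (sg (wi j) * winc W (wi j) 0 (k%:R * h) w - sg ord_max * winc W ord_max 0 (k%:R * h) w)| <= c * (k%:R * h).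
 elim: k => [|k IH].
  by rewrite mul0r /winc !subrr !mulr0 subrr subr0 normr0.
 set z := scheme_path h k y w in IH.
 have sw := sweep_displacement hb z j (ltW h0) (enum_uniq 'I_m).
 rewrite mem_enum mulr1 size_enum_ord in sw.
 have rb : `|h * rel_payoff At j (softmax z)| <= h * K.
  rewrite normrM gtr0_norm// ler_wpM2l ?(ltW h0)//.
  by have [_ b _] := hb j; apply: b; exact: simplex_softmax.
 have sw2 : `|tnth (sweep At h z (enum 'I_m)) j - tnth z j| <= c * h.
  have -> : tnth (sweep At h z (enum 'I_m)) j - tnth z j =
   (tnth (sweep At h z (enum 'I_m)) j - tnth z j - h * rel_payoff At j (softmax z)) +
   h * rel_payoff At j (softmax z) by ring.
  apply: (le_trans (ler_normD _ _)); rewrite /c mulrDl [leRHS]addrC; apply: lerD; last by rewrite [leRHS]mulrC.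
  apply: (le_trans sw); apply: ler_wpM2l; first by rewrite !mulr_ge0// sqr_ge0.
  by rewrite expr2 ler_piMl// ltW.
 rewrite /= -/z tnth_mktuple !tnth_mktuple.
 set a := tnth (sweep At h z (enum 'I_m)) j in sw2 *.
 have -> : a + 1 * (sg (wi j) * (W (wi j) (k.+1%:R * h) w - W (wi j) (k%:R * h) w) -
    sg ord_max * (W ord_max (k.+1%:R * h) w - W ord_max (k%:R * h) w)) - tnth y j -
   (sg (wi j) * winc W (wi j) 0 (k.+1%:R * h) w - sg ord_max * winc W ord_max 0 (k.+1%:R * h) w) =
   (a - tnth z j) + (tnth z j - tnth y j -
   (sg (wi j) * winc W (wi j) 0 (k%:R * h) w - sg ord_max * winc W ord_max 0 (k%:R * h) w)).
  by rewrite /winc; ring.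
 apply: (le_trans (ler_normD _ _)).
 have -> : c * (k.+1%:R * h) = c * h + c * (k%:R * h) by rewrite -natr1; ring.
 exact: lerD.
rewrite -!normrM -addrA.
set p := sg (wi j) * _ in main *; set q := sg ord_max * _ in main *.
have -> : tnth (scheme_path h k y w) j - tnth y j =
 (tnth (scheme_path h k y w) j - tnth y j - (p - q)) + (p - q) by ring.
apply: (le_trans (ler_normD _ _)); apply: lerD => //.
exact: ler_normB.
Qed.

(** The Markov property of the scheme: the next increment is independent of the path so far. *)
Lemma path_transition h k y (psi : m.-tuple R -> \bar R) : 0 < h ->
 (forall z, (0 <= psi z)%E) -> borel psi ->
 (\int[P]_w psi (scheme_path h k.+1 y w) =
  \int[P]_w \int[P]_w' psi (scheme_step At sg h (scheme_path h k y w)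
   (increment W (k%:R * h) (k.+1%:R * h) w')))%E.
Proof.
move=> h0 p0 mp.
have mI : borel (increment W (k%:R * h) (k.+1%:R * h)).
 by apply: (measurable_increment hW); exact: grid_ge0.
apply: (@independent_tonelli _ _ _ P _ _ _ _ (scheme_path h k y) _ (measurable_scheme_path k y h0) mI _
 (fun z => psi (scheme_step At sg h z.1 z.2))) => //.
- move=> B C mB mC; apply: (increment_independent hW) => //.
 + exact: grid_ge0.
 + exact: grid_lt.
 + exact: past_scheme_path.
- apply: measurableT_comp mp _.
 by apply: measurable_scheme_step; [exact: measurable_fst|exact: measurable_snd].
Qed.

Section adjoint.
Variable al : 'I_m.+1 -> R.
Notation F := (simplex_density al).
Hypothesis kappa0 : forall y : m.-tuple R, replicator_kappa At al sg (softmax y) = 0.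

(** With kappa = 0 the adjoint of one step returns the weight F itself, so the steps can be
    transposed one by one and their relative errors add up. *)
Lemma path_adjoint : exists C h1, [/\ 0 <= C, 0 < h1, h1 <= 1 &
 forall h k (psi : m.-tuple R -> \bar R), 0 < h -> h <= h1 ->
 (forall z, (0 <= psi z)%E) -> borel psi ->
 apx (k%:R * (C * Num.sqrt h ^+ 3))
  (\int[leb]_y ((F y)%:E * \int[P]_w psi (scheme_path h k y w)))%E
  (\int[leb]_y ((F y)%:E * psi y))%E].
Proof.
have [C [h1 [C0 h10 h11 adj]]] := step_adjoint At al sg hW.
exists C, h1; split => // h k psi h0 hh1.
elim: k psi => [|k IH] psi p0 mp.
 rewrite mul0r; rewrite [X in apx _ X _](_ : _ = \int[leb]_y ((F y)%:E * psi y))%E; first exact: apx_refl.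
 apply: eq_integral => y _; congr (_ * _)%E => /=.
 rewrite integral_cst// [X in (_ * X)%E](_ : _ = 1%E) ?mule1//; exact: probability_setT.
pose psi' z : \bar R := (\int[P]_w psi (scheme_step At sg h z (increment W (k%:R * h) (k.+1%:R * h) w)))%E.
have p'0 z : (0 <= psi' z)%E by apply: integral_ge0.
have mI : borel (increment W (k%:R * h) (k.+1%:R * h)).
 by apply: (measurable_increment hW); exact: grid_ge0.
have mp' : borel psi'.
 apply: (@measurable_fun_fubini_tonelli_F _ _ _ _ _ P (fun p : m.-tuple R * T =>
  psi (scheme_step At sg h p.1 (increment W (k%:R * h) (k.+1%:R * h) p.2)))) => //.
 apply: measurableT_comp mp _; apply: measurable_scheme_step; first exact: measurable_fst.
 by apply: measurableT_comp => //; exact: measurable_snd.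
have E1 : (\int[leb]_y ((F y)%:E * \int[P]_w psi (scheme_path h k.+1 y w)) =
  \int[leb]_y ((F y)%:E * \int[P]_w psi' (scheme_path h k y w)))%E.
 by apply: eq_integral => y _; congr (_ * _)%E; rewrite path_transition.
have E2 : (\int[leb]_y ((F y * (1 + (k.+1%:R * h - k%:R * h) * replicator_kappa At al sg (softmax y)))%:E * psi y) =
  \int[leb]_y ((F y)%:E * psi y))%E.
 by apply: eq_integral => y _; rewrite kappa0 mulr0 addr0 mulr1.
have le1 : k.+1%:R * h - k%:R * h <= h1 by rewrite grid_diff.
have [_ a2] := adj (k%:R * h) (k.+1%:R * h) psi (grid_ge0 k h0) (grid_lt k h0) le1 p0 mp.
rewrite E2 grid_diff in a2.
rewrite E1 -natr1 mulrDl mul1r; exact: apx_trans (IH psi' p'0 mp') a2.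
Qed.

End adjoint.

Lemma exp_sum_moment (c t : R) : 0 <= c -> 0 < t ->
 L1 P (fun w => expR (c * \sum_i `|winc W i 0 t w|)) /\
 mean P (fun w => expR (c * \sum_i `|winc W i 0 t w|)) <=
  m.+1%:R * (2 * expR ((c * m.+1%:R) ^+ 2 * t / 2)).
Proof.
move=> c0 t0; pose n : R := m.+1%:R; have n0 : 0 <= n by exact: ler0n.
have gi i : L1 P (fun w => expR (c * n * `|winc W i 0 t w|)) /\
  mean P (fun w => expR (c * n * `|winc W i 0 t w|)) <= 2 * expR ((c * n) ^+ 2 * t / 2).
 have s0 : 0 < Num.sqrt (t - 0) by rewrite subr0 sqrtr_gt0.
 have := gaussian_exp_abs (measurable_winc hW i (lexx 0) (ltW t0)) s0
  (fun B mB => bm_gaussian hW i (lexx 0) t0 mB) (c * n).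
 by rewrite sqr_sqrtr subr0// ltW.
have iS : L1 P (fun w => \sum_i expR (c * n * `|winc W i 0 t w|)).
 by apply: L1_sum => i; case: (gi i).
have ms : borel (fun w => expR (c * \sum_i `|winc W i 0 t w|)).
 apply: measurableT_comp => //; apply: measurable_funM => //.
 apply: measurable_fun_bigsum => i; apply: measurableT_comp => //.
 exact: (measurable_winc hW i (lexx 0) (ltW t0)).
have le w : expR (c * \sum_i `|winc W i 0 t w|) <= \sum_i expR (c * n * `|winc W i 0 t w|).
 pose i0 := [arg max_(j > (ord0 : 'I_m.+1)) `|winc W j 0 t w|]%O.
 have hmax j : `|winc W j 0 t w| <= `|winc W i0 0 t w|.
  by rewrite /i0; case: Order.TotalTheory.arg_maxP => // j0 _; apply.
 rewrite [leRHS](bigD1 i0)//=; apply: ler_wpDr; first by apply: sumr_ge0 => j _; exact: expR_ge0.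
 rewrite ler_expR -mulrA ler_wpM2l// /n mulr_natl -[X in _ *+ X]card_ord -sumr_const.
 exact: ler_sum.
have iE : L1 P (fun w => expR (c * \sum_i `|winc W i 0 t w|)).
 by apply: (L1_le ms _ iS) => w; rewrite ger0_norm ?expR_ge0.
split => //; apply: (le_trans (le_mean iE iS le)).
rewrite mean_sum => [|i]; last by case: (gi i).
rewrite mulr_natl -[X in _ *+ X]card_ord -sumr_const; apply: ler_sum => i _.
by case: (gi i).
Qed.

(** By [path_displacement] the weight at the end is at most the weight at the start times the
    exponential of a multiple of the displacement, whose mean is bounded uniformly in the start and
    in the number of steps up to time [t1]. *)
Lemma path_tail (l t1 : R) : 0 <= l -> 0 <= t1 -> exists C, 0 <= C /\
 forall h k y, 0 < h -> h <= 1 -> (0 < k)%N -> k%:R * h <= t1 ->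
 (\int[P]_w (exp_weight l (scheme_path h k y w))%:E <= (C * exp_weight l y)%:E)%E.
Proof.
move=> l0 t10; have [c [c0 hd]] := path_displacement.
pose S := \sum_i `|sg i|; have S0 : 0 <= S by exact: sumr_ge0.
have sgS i : `|sg i| <= S by rewrite /S (bigD1 i)//= lerDl sumr_ge0.
pose M : R := m%:R; have M0 : 0 <= M by exact: ler0n.
pose q := l * (M * (2 * S)); have q0 : 0 <= q by rewrite !mulr_ge0.
exists (expR (l * (M * (c * t1))) * (m.+1%:R * (2 * expR ((q * m.+1%:R) ^+ 2 * t1 / 2)))).
split; first by rewrite mulr_ge0 ?expR_ge0// mulr_ge0// mulr_ge0// expR_ge0.
move=> h k y h0 h1 k0 kt; set t := k%:R * h in kt.
have t0 : 0 < t by rewrite mulr_gt0// ltr0n.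
have [iE mE] := exp_sum_moment q0 t0.
set N := fun w => \sum_i `|winc W i 0 t w|.
have le w : exp_weight l (scheme_path h k y w) <=
  exp_weight l y * expR (l * (M * (c * t1))) * expR (q * N w).
 rewrite /exp_weight -!expRD ler_expR.
 have b j : `|tnth y j| - (c * t1 + 2 * S * N w) <= `|tnth (scheme_path h k y w) j|.
  have dj := hd h k y w j h0 h1; rewrite -/t in dj.
  have wN i : `|winc W i 0 t w| <= N w by rewrite /N (bigD1 i)//= lerDl sumr_ge0.
  have d2 : `|tnth (scheme_path h k y w) j - tnth y j| <= c * t1 + 2 * S * N w.
   apply: (le_trans dj); rewrite -addrA; apply: lerD; first by rewrite ler_wpM2l.
   by rewrite -mulrA mulr_natl mulr2n; apply: lerD; apply: ler_pM.
  rewrite lerBlDr; apply: le_trans (_ : _ <= `|tnth (scheme_path h k y w) j| +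
   `|tnth (scheme_path h k y w) j - tnth y j|) _; last by rewrite lerD2l.
  have {1}-> : tnth y j = tnth (scheme_path h k y w) j - (tnth (scheme_path h k y w) j - tnth y j) by ring.
  exact: ler_normB.
 have := @ler_sum _ _ (index_enum 'I_m) xpredT _ _ (fun j _ => b j); rewrite sumrB sumr_const card_ord -[_ *+ m]mulr_natl -/M => hs.
 have hs' := ler_wpM2l l0 hs.
 rewrite -subr_ge0; rewrite -subr_ge0 in hs'; apply: le_trans hs' _.
 by rewrite le_eqVlt; apply/orP; left; apply/eqP; rewrite /q; ring.
have iR : L1 P (fun w => exp_weight l y * expR (l * (M * (c * t1))) * expR (q * N w)).
 exact: L1Z.
have mW : borel (fun w => exp_weight l (scheme_path h k y w)).
 exact: measurableT_comp (@measurable_exp_weight R m l) (measurable_scheme_path k y h0).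
apply: (@le_trans _ _ (\int[P]_w (exp_weight l y * expR (l * (M * (c * t1))) * expR (q * N w))%:E)%E).
 apply: ge0_le_integral => //.
 - by move=> w _; rewrite lee_fin expR_ge0.
 - exact/measurable_EFinP.
 - by apply/measurable_EFinP; exact: measurable_L1 iR.
 - by move=> w _; rewrite lee_fin.
rewrite (meanE iR) lee_fin meanZ//.
have -> : exp_weight l y * expR (l * (M * (c * t1))) * mean P (fun w => expR (q * N w)) =
 expR (l * (M * (c * t1))) * mean P (fun w => expR (q * N w)) * exp_weight l y by ring.
rewrite ler_wpM2r ?expR_ge0// ler_wpM2l ?expR_ge0//; apply: (le_trans mE).
by rewrite ler_wpM2l// ler_wpM2l// ler_expR ler_wpM2r// ler_wpM2l// sqr_ge0.
Qed.

(** * Convergence of the scheme along dyadic grids *)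

Section grid.
Variables (t : R) (t0 : 0 < t).

(** The second factor exceeds [t], so that the step is at most 2^-k, in particular at most 1, for
    every k. *)
Definition grid_size (k : nat) : nat := 2 ^ k * (Num.truncn t).+1.
Definition grid_step (k : nat) : R := t / (grid_size k)%:R.

Lemma grid_size_gt0 k : (0 < grid_size k)%N.
Proof. by rewrite muln_gt0 expn_gt0. Qed.

Let gsR k : 0 < (grid_size k)%:R :> R. Proof. by rewrite ltr0n grid_size_gt0. Qed.

Lemma grid_step_gt0 k : 0 < grid_step k. Proof. exact: divr_gt0. Qed.

Lemma grid_stepK k : (grid_size k)%:R * grid_step k = t.
Proof. by rewrite /grid_step mulrC divfK// gt_eqF. Qed.

Lemma grid_step_le k : grid_step k <= (2 ^+ k)^-1.
Proof.
rewrite /grid_step ler_pdivrMr// /grid_size natrM natrX mulrA mulVf ?expf_neq0// mul1r.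
by apply/ltW/truncnS_gt.
Qed.

Lemma grid_step_le1 k : grid_step k <= 1.
Proof. by apply: (le_trans (grid_step_le k)); rewrite invf_le1 ?exprn_gt0// exprn_ege1// ler1n. Qed.

Definition grid_path k (y : m.-tuple R) (w : T) := scheme_path (grid_step k) (grid_size k) y w.

Lemma measurable_grid_path k y : borel (grid_path k y).
Proof. exact: (measurable_scheme_path _ _ (grid_step_gt0 k)). Qed.

Lemma measurable_grid_path2 k : borel (fun p => grid_path k p.1 p.2).
Proof. exact: (measurable_scheme_path2 _ (grid_step_gt0 k)). Qed.

(** The mean square errors are bounded by a multiple of 2^-k. Their sum is finite, which improves
    convergence in mean square to almost sure convergence. *)
Lemma grid_path_cvg y : {ae P, forall w i,
 tnth (softmax (grid_path k y w)) i @[k --> \oo] --> tnth (X (softmax y) t w) i}.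
Proof.
have [c [c0 hc]] := path_error.
have mX : borel (X (softmax y) t).
 exact: (measurable_solution_softmax y (ltW t0)).
pose e k i w := scheme_error (X (softmax y) t w) (grid_path k y w) i.
have mc k i : borel (fun w => tnth (softmax (grid_path k y w)) i).
 apply: measurable_fun_tnth; apply: measurableT_comp (measurable_grid_path k y).
 exact: measurable_softmax.
have me k i : borel (fun w => e k i w ^+ 2).
 by apply: measurable_funX; apply: measurable_funB => //; exact: measurable_fun_tnth.
have simc (x : m.+1.-tuple R) i : simplex x -> 0 <= tnth x i <= 1 by case.
have sX w : simplex (X (softmax y) t w) := @sol_state _ _ _ _ _ _ _ _ _ _ (hX (int_simplex_softmax y)) t w (ltW t0).
have e1 k i w : `|e k i w| <= 1.
 have /andP[a1 a2] := simc _ i (sX w); have /andP[b1 b2] := simc _ i (simplex_softmax (grid_path k y w)).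
 by rewrite /e /scheme_error ler_norml; apply/andP; split; lra.
have ie k i : L1 P (fun w => e k i w ^+ 2).
 apply: (L1_le (me k i) _ (L1_cst P 1)) => w.
 by rewrite normrX exprn_ile1.
pose D := c * t * expR (c * t); have D0 : 0 <= D by rewrite mulr_ge0 ?expR_ge0// mulr_ge0// ltW.
have S k : (\int[P]_w (\sum_i e k i w ^+ 2)%:E <= (D * (2 ^+ k)^-1)%:E)%E.
 rewrite (meanE (L1_sum _ (ie k))) lee_fin mean_sum//.
 have := hc (grid_step k) (grid_size k) y (grid_step_gt0 k) (grid_step_le1 k).
 rewrite grid_stepK => h; apply: (le_trans h).
 have -> : c * grid_step k * t * expR (c * t) = D * grid_step k by rewrite /D; ring.
 by rewrite ler_wpM2l// grid_step_le.
have geo n : \sum_(0 <= k < n) D * (2 ^+ k)^-1 <= 2 * D.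
 suff -> : \sum_(0 <= k < n) D * (2 ^+ k)^-1 = 2 * D - 2 * D * (2 ^+ n)^-1.
  by rewrite lerBlDr lerDl; apply: divr_ge0; [exact: mulr_ge0|exact: exprn_ge0].
 elim: n => [|n IH]; first by rewrite big_geq// expr0 invr1 mulr1 subrr.
 by rewrite big_nat_recr//= IH exprS invfM; field; rewrite expf_neq0.
have := ae_cvg0_summable (f := fun k w => \sum_i e k i w ^+ 2) _ _ S geo.
have ms k : borel (fun w => \sum_i e k i w ^+ 2) by exact: measurable_fun_bigsum.
have s0 k w : 0 <= \sum_i e k i w ^+ 2 by apply: sumr_ge0 => i _; exact: sqr_ge0.
move=> /(_ ms s0); apply: filterS => w /cvgr0Pnorm_lt cw i.
apply/cvgrPdist_lt => ep ep0.
have := cw (ep ^+ 2) (exprn_gt0 2 ep0); apply: filterS => k hk.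
rewrite -/(scheme_error _ _ i) -/(e k i w).
rewrite -(@ltr_pXn2r _ 2)// ?nnegrE ?(ltW ep0)// real_normK ?num_real//.
apply: le_lt_trans hk; rewrite ger0_norm// (bigD1 i)//= lerDl.
by apply: sumr_ge0 => j _; exact: sqr_ge0.
Qed.

(** The solution is given for each starting point separately, without any joint measurability. The
    upper limit of the scheme is measurable in the pair and almost surely equals the solution for
    each start; it replaces the solution wherever integrals over starts and events are exchanged. *)
Definition solution_limit (p : m.-tuple R * T) : m.+1.-tuple R :=
 [tuple fine (limn_esup (fun k => (tnth (softmax (grid_path k p.1 p.2)) i)%:E)) | i < m.+1].

Lemma measurable_solution_limit : borel solution_limit.
Proof.
apply: measurable_fun_tuple => i; apply: measurableT_comp => //.
apply: measurable_fun_limn_esup => k; apply/measurable_EFinP; apply: measurable_fun_tnth.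
by apply: measurableT_comp (measurable_grid_path2 k); exact: measurable_softmax.
Qed.

Lemma solution_limitE y : {ae P, forall w, solution_limit (y, w) = X (softmax y) t w}.
Proof.
apply: filterS (grid_path_cvg y) => w cw; apply: eq_from_tnth => i.
have ce : (tnth (softmax (grid_path k y w)) i)%:E @[k --> \oo] --> (tnth (X (softmax y) t w) i)%:E.
 by apply: cvg_EFin (cw i); exact: nearW.
rewrite tnth_mktuple /= is_cvg_limn_esupE; last by apply/cvg_ex; eexists; exact: ce.
by rewrite (cvg_lim _ ce).
Qed.

Lemma nice_grid_cvg (phi : m.+1.-tuple R -> R) y : nice phi ->
 (\int[P]_w (phi (softmax (grid_path k y w)))%:E)%E @[k --> \oo] -->
 (\int[P]_w (phi (X (softmax y) t w))%:E)%E.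
Proof.
move=> np; have [mp [K [K0 bK lK]]] := np.
have sx := hX (int_simplex_softmax y).
apply: (@mean_cvg_bounded _ _ _ P _ _ K).
- by move=> k; exact: measurableT_comp (measurable_nice_softmax np) (measurable_grid_path k y).
- exact: measurableT_comp mp (measurable_solution hW sx (ltW t0)).
- by move=> k w; apply: bK; exact: simplex_softmax.
apply: filterS (grid_path_cvg y) => w cw; apply/cvgrPdist_le => ep ep0.
pose de := ep / (K + 1); have de0 : 0 < de by rewrite divr_gt0// ltr_wpDl.
have : \forall k \near \oo, forall i, `|tnth (X (softmax y) t w) i - tnth (softmax (grid_path k y w)) i| <= de.
 apply: filter_forall => i; have /cvgrPdist_le := cw i; exact.
apply: filterS => k hk.
apply: (le_trans (lK _ _ de _ (simplex_softmax _) hk)).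
 exact: (@sol_state _ _ _ _ _ _ _ _ _ _ sx t w (ltW t0)).
by rewrite /de mulrCA ler_piMr ?(ltW ep0)// ler_pdivrMr ?mul1r ?lerDl// ltr_wpDl.
Qed.

End grid.

Lemma test_tail (phi : m.+1.-tuple R -> R) (l t1 : R) : test_function phi -> 0 <= l -> 0 <= t1 ->
 exists C, [/\ 0 <= C,
  forall h k y, 0 < h -> h <= 1 -> (0 < k)%N -> k%:R * h <= t1 ->
   (\int[P]_w (phi (softmax (scheme_path h k y w)))%:E <= (C * exp_weight l y)%:E)%E &
  forall t y, 0 < t -> t <= t1 ->
   (\int[P]_w (phi (X (softmax y) t w))%:E <= (C * exp_weight l y)%:E)%E].
Proof.
move=> tp l0 t10; have [C1 [C10 h1]] := test_exp_weight tp l0.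
have [C2 [C20 h2]] := path_tail l0 t10.
have [np p0 _] := tp.
have tail h k y : 0 < h -> h <= 1 -> (0 < k)%N -> k%:R * h <= t1 ->
  (\int[P]_w (phi (softmax (scheme_path h k y w)))%:E <= (C1 * C2 * exp_weight l y)%:E)%E.
 move=> h0 hh k0 kt; have mp := measurable_scheme_path k y h0.
 apply: (@le_trans _ _ (\int[P]_w (C1%:E * (exp_weight l (scheme_path h k y w))%:E))%E).
  apply: ge0_le_integral => //.
  - by move=> w _; rewrite lee_fin.
  - by apply/measurable_EFinP; exact: measurableT_comp (measurable_nice_softmax np) mp.
  - apply/measurable_EFinP; apply: measurable_funM => //.
   exact: measurableT_comp (measurable_exp_weight _) mp.
  - by move=> w _; rewrite lee_fin.
 rewrite ge0_integralZl//; last by move=> w _; rewrite lee_fin expR_ge0.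
  by rewrite -mulrA EFinM; apply: lee_wpmul2l; rewrite ?lee_fin//; exact: h2.
 by apply/measurable_EFinP; exact: measurableT_comp (measurable_exp_weight _) mp.
exists (C1 * C2); split => //; first exact: mulr_ge0.
move=> t y t0 tt1; apply: cvge_to_le (nice_grid_cvg t0 np) _.
apply: nearW => k; apply: tail; [exact: grid_step_gt0|exact: grid_step_le1|exact: grid_size_gt0|].
by rewrite grid_stepK.
Qed.

Lemma transition_integral t y (psi : m.+1.-tuple R -> \bar R) : 0 < t ->
 (forall x, (0 <= psi x)%E) -> borel psi ->
 (\int[P]_w psi (X (softmax y) t w) = \int[P]_w psi (solution_limit t (y, w)))%E.
Proof.
move=> t0 p0 mp; apply: ae_eq_integral => //.
- exact: measurableT_comp mp (measurable_solution_softmax y (ltW t0)).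
- apply: measurableT_comp mp _; apply: measurableT_comp; first exact: (measurable_solution_limit t0).
 exact: measurable_pair1.
- by apply: filterS (solution_limitE t0 y) => w -> _.
Qed.

Lemma measurable_transition_integral t (psi : m.+1.-tuple R -> \bar R) : 0 < t ->
 (forall x, (0 <= psi x)%E) -> borel psi ->
 borel (fun y => \int[P]_w psi (X (softmax y) t w))%E.
Proof.
move=> t0 p0 mp; under eq_fun do rewrite (transition_integral _ t0 p0 mp).
apply: (@measurable_fun_fubini_tonelli_F _ _ _ _ _ P (fun p => psi (solution_limit t p))) => //.
by apply: measurableT_comp mp _; exact: (measurable_solution_limit t0).
Qed.

(** After one step, [phi] is linearised at the common starting point. The gradient there is
    deterministic and meets only the mean error, which is O(h^(3/2)); the remainder is a product of
    a displacement of order h^(1/2) and a strong error of order h. *)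
Lemma one_step_mean (phi : m.+1.-tuple R -> R) : smooth phi -> exists C, 0 <= C /\
 forall h y, 0 < h -> h <= 1 ->
 `|mean P (fun w => phi (X (softmax y) h w)) - mean P (fun w => phi (softmax (scheme_path h 1 y w)))| <=
  C * Num.sqrt h ^+ 3.
Proof.
move=> sp; have np := smooth_nice sp; have [mphi [g [L [lphi gb lin]]]] := sp; have [L0 phiL _] := lphi.
have [K hK] := coefficient_bound_exists A sigma; have [K0 bK CK bL CL] := hK.
have mb k : borel (fun x => replicator_drift A sigma x k ord0) := (nice_replicator_drift A sigma k).1.
have mC k j : borel (fun x => replicator_diffusion sigma x k j) := (nice_replicator_diffusion sigma k j).1.
have [c [c0 step]] := scheme_error_step A sigma hW.
pose n : R := m.+1%:R; have n0 : 0 <= n by exact: ler0n.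
pose C1 := n * increment_const m.+1 K; have C10 : 0 <= C1 by rewrite mulr_ge0// increment_const_ge0.
exists (L * (2 * C1 + 3 * c) + n * (L * (c + 1))); split.
 by apply: addr_ge0; apply: mulr_ge0 => //; [apply: addr_ge0; exact: mulr_ge0|apply: mulr_ge0 => //; exact: addr_ge0].
move=> h y h0 h1; set x := softmax y; have sx := hX (int_simplex_softmax y); have simx := simplex_softmax y.
pose s := Num.sqrt h; have s0 : 0 < s by rewrite sqrtr_gt0.
have s1 : s <= 1 by rewrite -sqrtr1 ler_sqrt.
have hs : h = s ^+ 2 by rewrite sqr_sqrtr// ltW.
have pE w : scheme_path h 1 y w = scheme_step At sg (h - 0) y (increment W 0 h w).
 by rewrite /= mul0r mul1r subr0.
have py : past P W 0 (fun _ : T => y) by apply/pastE; exact: measurable_cst.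
have h10 : h - 0 <= 1 by rewrite subr0.
have start := sol_start sx.
have mX t : 0 <= t -> borel (X x t) by move=> t0; exact: (measurable_solution hW sx t0).
have E0 i : mean P (fun w => scheme_error (X x 0 w) y i) = 0 /\
  mean P (fun w => scheme_error (X x 0 w) y i ^+ 2) = 0.
 have me : borel (fun w => scheme_error (X x 0 w) y i).
  by apply: measurable_funB => //; apply: measurable_fun_tnth; exact: mX.
 rewrite -[RHS](mean_cst P 0); split; [|rewrite -[RHS](mean_cst P 0)]; apply: eq_mean_ae => //.
 - by apply: filterS start => w ->; rewrite /scheme_error subrr.
 - exact: measurable_funX.
 - by apply: filterS start => w ->; rewrite /scheme_error subrr expr0n.
have [] := step x (X x) 0 h (fun=> y) sx (lexx 0) h0 h10 py.
have -> : mean_sq_error P (X x 0) (fun=> y) = 0 by rewrite /mean_sq_error big1// => i _; case: (E0 i).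
rewrite subr0 mulr0 !add0r => mse me.
have {}mse : mean_sq_error P (X x h) (scheme_path h 1 y) <= c * h ^+ 2.
 apply: le_trans mse; rewrite le_eqVlt; apply/orP; left; apply/eqP; congr (mean_sq_error P _ _).
 by apply/funext => w; rewrite pE subr0.
have {}me i : `|mean P (fun w => scheme_error (X x h w) (scheme_path h 1 y w) i)| <= (c + 1) * s ^+ 3.
 rewrite -(@ler_pXn2r _ 2)// ?nnegrE ?mulr_ge0 ?addr_ge0 ?exprn_ge0 ?(ltW s0)// real_normK ?num_real//.
 have := me i; have [-> _] := E0 i; rewrite subr0; under eq_fun do rewrite -[h in scheme_step _ _ h]subr0 -pE.
 move=> hh; apply: (le_trans hh); rewrite hs.
 have -> : c * (s ^+ 2) ^+ 2 * s ^+ 2 = c * (s ^+ 3) ^+ 2 by ring.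
 rewrite [leRHS]exprMn; apply: ler_wpM2r; first exact: sqr_ge0.
 have -> : (c + 1) ^+ 2 = c + (c ^+ 2 + c + 1) by ring.
 by rewrite lerDl !addr_ge0// sqr_ge0.
pose S w := softmax (scheme_path h 1 y w); pose e i w := scheme_error (X x h w) (scheme_path h 1 y w) i.
have mp : borel (scheme_path h 1 y) := measurable_scheme_path 1 y h0.
have mS : borel S by exact: measurableT_comp (@measurable_softmax R m) mp.
have simX w : simplex (X x h w) := @sol_state _ _ _ _ _ _ _ _ _ _ sx h w (ltW h0).
have simS w : simplex (S w) by exact: simplex_softmax.
have coord1 (z z' : m.+1.-tuple R) i : simplex z -> simplex z' -> `|tnth z i - tnth z' i| <= 1.
 move=> [hz _] [hz' _]; have /andP[a1 a2] := hz i; have /andP[b1 b2] := hz' i.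
 by rewrite ler_norml; apply/andP; split; lra.
have sq (z z' : T -> m.+1.-tuple R) i : borel z -> borel z' ->
  (forall w, simplex (z w)) -> (forall w, simplex (z' w)) -> L2 P (fun w => tnth (z w) i - tnth (z' w) i).
 move=> mz mz' sz sz'; apply: (L2_bounded P (M := 1)); last by move=> w; exact: coord1.
 by apply: measurable_funB; exact: measurable_fun_tnth.
pose Z w := sqdist (X x h w) x; pose E w := sqdist (X x h w) (S w).
have iZ : L1 P Z.
 by apply: L1_sum => i; have [] := sq (X x h) (fun=> x) i (mX h (ltW h0)) (measurable_cst _) simX (fun=> simx).
have se i : L2 P (e i) := sq (X x h) S i (mX h (ltW h0)) mS simX simS.
have iE : L1 P E by apply: L1_sum => i; exact: (se i).2.
have mZ : mean P Z <= C1 * h.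
 have [_] := mean_sqdist hW mb mC K0 bK CK sx (lexx 0) (ltW h0) h10.
 rewrite subr0; apply: le_trans; rewrite le_eqVlt; apply/orP; left; apply/eqP; apply: eq_mean_ae.
 - exact: (measurable_L1 iZ).
 - apply: measurable_fun_bigsum => k; apply: measurable_funX.
  by apply: measurable_funB; apply: measurable_fun_tnth; apply: mX => //; exact: ltW.
 - by apply: filterS start => w ->.
have mE : mean P E <= c * h ^+ 2.
 rewrite /E /sqdist mean_sum => [|i]; last exact: (se i).2.
 exact: mse.
have d0 (z z' : m.+1.-tuple R) : 0 <= sqdist z z' by apply: sumr_ge0 => i _; exact: sqr_ge0.
have dk (z z' : m.+1.-tuple R) i q : sqdist z z' <= q -> `|tnth z i - tnth z' i| <= Num.sqrt q.
 move=> zq; rewrite -sqrtr_sqr ler_sqrt ?(le_trans (d0 z z'))//; apply: le_trans zq.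
 by rewrite /sqdist (bigD1 i)//= lerDl sumr_ge0// => j _; exact: sqr_ge0.
pose rest w := phi (X x h w) - phi (S w) - \sum_i g i x * e i w.
pose Zr w := 2 * Z w + 2 * E w.
have Zr0 w : 0 <= Zr w by rewrite addr_ge0// mulr_ge0// d0.
(* The product of displacement and error is split with the weights [s] and 1 / [s], where s =
   h^(1/2): as [Z] has mean O(h) and [E] mean O(h^2), both terms are of order s^3. *)
have restB w : `|rest w| <= L * (s * Zr w + E w / s).
 have dS : sqdist (S w) x <= Zr w.
  rewrite /Zr /Z /E /sqdist !mulr_sumr -big_split/=; apply: ler_sum => i _.
  set b' := tnth (S w) i; set a := tnth x i; set b := tnth (X x h w) i.
  rewrite -subr_ge0; have -> : 2 * (b - a) ^+ 2 + 2 * (b - b') ^+ 2 - (b' - a) ^+ 2 = (2 * b - a - b') ^+ 2 by ring.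
  exact: sqr_ge0.
 have dX : sqdist (X x h w) x <= Zr w.
  rewrite /Zr -[leLHS]mul1r; apply: ler_wpDr; first by rewrite mulr_ge0// d0.
  by rewrite ler_wpM2r ?d0// ler1n.
 have := lin x (X x h w) (S w) (Num.sqrt (Zr w)) (Num.sqrt (E w)) simx (simX w) (simS w)
  (fun i => dk _ _ i _ dX) (fun i => dk _ _ i _ dS) (fun i => dk _ _ i _ (lexx _)) (sqrtr_ge0 _) (sqrtr_ge0 _).
 move=> hl; apply: (le_trans hl); apply: ler_wpM2l => //.
 set p := Num.sqrt (Zr w); set q := Num.sqrt (E w).
 have p0 : 0 <= p by exact: sqrtr_ge0.
 have q0 : 0 <= q by exact: sqrtr_ge0.
 have -> : Zr w = p ^+ 2 by rewrite sqr_sqrtr.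
 have -> : E w = q ^+ 2 by rewrite sqr_sqrtr// d0.
 have pq : 0 <= p * q by rewrite mulr_ge0.
 have -> : s * p ^+ 2 + q ^+ 2 / s = (s * p - q) ^+ 2 / s + p * q + p * q by field; rewrite gt_eqF.
 by rewrite lerDr addr_ge0// divr_ge0 ?sqr_ge0// ltW.
have iX := L1_nice np (mX h (ltW h0)) simX; have iS := L1_nice np mS simS.
have ie i : L1 P (fun w => g i x * e i w) by apply: L1Z; exact: sq_L1.
have isum : L1 P (fun w => \sum_i g i x * e i w) by exact: L1_sum.
have idom : L1 P (fun w => L * (s * Zr w + s^-1 * E w)).
 apply: L1Z; apply: L1D; last exact: L1Z.
 by apply: L1Z; apply: L1D; exact: L1Z.
have -> : mean P (fun w => phi (X x h w)) - mean P (fun w => phi (softmax (scheme_path h 1 y w))) =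
  mean P rest + \sum_i g i x * mean P (e i).
 rewrite (meanB (L1B iX iS) isum) (meanB iX iS) mean_sum//.
 under [X in _ - X + _]eq_bigr do rewrite (meanZ _ (sq_L1 (se _))).
 by rewrite subrK.
apply: (le_trans (ler_normD _ _)); rewrite mulrDl; apply: lerD.
 have b1 : `|mean P rest| <= mean P (fun w => L * (s * Zr w + s^-1 * E w)).
  apply: norm_mean_le => // [|w]; last by rewrite [s^-1 * _]mulrC; exact: restB.
  by apply: L1B => //; exact: L1B.
 apply: (le_trans b1).
 have iZr : L1 P Zr by apply: L1D; exact: L1Z.
 have -> : mean P (fun w => L * (s * Zr w + s^-1 * E w)) =
   L * (s * (2 * mean P Z + 2 * mean P E) + s^-1 * mean P E).
  rewrite meanZ ?meanD ?meanZ ?meanD ?meanZ//; try exact: L1Z.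
  by apply: L1D; exact: L1Z.
 rewrite -mulrA; apply: ler_wpM2l => //.
 apply: (@le_trans _ _ (s * (2 * (C1 * h) + 2 * (c * h ^+ 2)) + s^-1 * (c * h ^+ 2))).
  apply: lerD; last by rewrite ler_wpM2l// invr_ge0 ltW.
  by apply: ler_wpM2l; rewrite ?(ltW s0)//; apply: lerD; exact: ler_wpM2l.
 have -> : s * (2 * (C1 * h) + 2 * (c * h ^+ 2)) + s^-1 * (c * h ^+ 2) =
  (2 * C1 + 3 * c) * s ^+ 3 - 2 * c * s ^+ 3 * (1 - s ^+ 2) by rewrite hs; field; rewrite gt_eqF.
 rewrite gerBl mulr_ge0// ?mulr_ge0 ?exprn_ge0 ?(ltW s0)//.
 by rewrite subr_ge0 exprn_ile1// ltW.
apply: (le_trans (ler_norm_sum _ _ _)).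
have -> : n * (L * (c + 1)) * s ^+ 3 = \sum_(i < m.+1) L * ((c + 1) * s ^+ 3).
 by rewrite sumr_const card_ord -[RHS]mulr_natl; rewrite /n; ring.
apply: ler_sum => i _; rewrite normrM; apply: ler_pM => //; first exact: gb.
exact: me.
Qed.

(** * From test functions to invariance of the measure *)

Section density.
Variable alpha : 'cV[R]_m.+1.
Let al (i : 'I_m.+1) : R := alpha i 0.
Let F : m.-tuple R -> R := simplex_density al.
Let kappa := replicator_kappa At al sg.

Let F0 y : 0 <= F y. Proof. exact/ltW/simplex_density_gt0. Qed.
Let mF : borel F. Proof. exact: measurable_simplex_density. Qed.

Lemma measurable_density_transition (phi : m.+1.-tuple R -> R) t : test_function phi -> 0 < t ->
 borel (fun y => (F y)%:E * \int[P]_w (phi (X (softmax y) t w))%:E)%E.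
Proof.
move=> [[mp _] p0 _] t0; apply: emeasurable_funM; first exact/measurable_EFinP.
apply: (@measurable_transition_integral t (EFin \o phi)) => //.
exact/measurable_EFinP.
Qed.

Lemma measurable_density_scheme (phi : m.+1.-tuple R -> R) h k : test_function phi -> 0 < h ->
 borel (fun y => (F y)%:E * \int[P]_w (phi (softmax (scheme_path h k y w)))%:E)%E.
Proof.
move=> [np p0 _] h0; apply: emeasurable_funM; first exact/measurable_EFinP.
apply: (@measurable_fun_fubini_tonelli_F _ _ _ _ _ P
 (fun p => (phi (softmax (scheme_path h k p.1 p.2)))%:E)) => [|p]; last by rewrite lee_fin.
apply/measurable_EFinP; apply: measurableT_comp (measurable_nice_softmax np) _.
exact: measurable_scheme_path2.
Qed.

(** By the tail bound with a rate adapted to F, the integrands are dominated by a multiple of the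
    integrable exponential weight, uniformly in the grid. *)
Lemma density_transition_limit (phi : m.+1.-tuple R -> R) t : test_function phi -> 0 < t ->
 (\int[leb]_y ((F y)%:E * \int[P]_w (phi (X (softmax y) t w))%:E) < +oo)%E /\
 (\int[leb]_y ((F y)%:E * \int[P]_w (phi (softmax (grid_path t k y w)))%:E))%E @[k --> \oo] -->
 (\int[leb]_y ((F y)%:E * \int[P]_w (phi (X (softmax y) t w))%:E))%E.
Proof.
move=> tp t0; have [l [K [l0 K0 FK]]] := simplex_density_weight al.
have [C [C0 h1 h2]] := test_tail tp l0 (ltW t0).
have [np p0 _] := tp.
have i0 (f : T -> m.+1.-tuple R) : (0 <= \int[P]_w (phi (f w))%:E)%E.
 by apply: integral_ge0 => w _; rewrite lee_fin.
have dom y (I : \bar R) : (0 <= I)%E -> (I <= (C * exp_weight l y)%:E)%E ->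
  (`|(F y)%:E * I| <= (C * K * exp_weight 1 y)%:E)%E.
 move=> I0 IC; rewrite gee0_abs; last by rewrite mule_ge0// lee_fin.
 apply: (@le_trans _ _ ((F y)%:E * (C * exp_weight l y)%:E)%E).
  by apply: lee_wpmul2l => //; rewrite lee_fin.
 by rewrite -EFinM lee_fin mulrCA -mulrA ler_wpM2l.
have mX := measurable_density_transition tp t0.
have [||||] := @dominated_convergence _ _ _ leb _ measurableT
 (fun k y => (F y)%:E * \int[P]_w (phi (softmax (grid_path t k y w)))%:E)%E
 (fun y => (F y)%:E * \int[P]_w (phi (X (softmax y) t w))%:E)%E
 (fun y => (C * K * exp_weight 1 y)%:E) _ mX.
- by move=> k; exact: measurable_density_scheme tp (grid_step_gt0 t0 k).
- apply: aeW => y _; apply: cvgeZl => //; exact: (nice_grid_cvg t0 np).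
- apply/integrableP; split.
  by apply/measurable_EFinP; apply: measurable_funM => //; exact: measurable_exp_weight.
 under eq_integral do rewrite gee0_abs ?lee_fin ?mulr_ge0 ?expR_ge0// EFinM.
 have CK : (0 <= (C * K)%:E)%E by rewrite lee_fin mulr_ge0.
 rewrite ge0_integralZl//; first by rewrite lte_mul_pinfty//; exact: integral_exp_weight.
  by apply/measurable_EFinP; exact: measurable_exp_weight.
 by move=> y _; rewrite lee_fin expR_ge0.
- apply: aeW => y k _; apply: dom => //; apply: h1; [exact: grid_step_gt0|exact: grid_step_le1|exact: grid_size_gt0|].
 by rewrite grid_stepK.
move=> /integrableP[_ If] _ lim; split => //; apply: le_lt_trans If.
apply: ge0_le_integral => //.
- by move=> y _; rewrite mule_ge0// lee_fin.
- exact: measurableT_comp.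
- by move=> y _; exact: lee_abs.
Qed.

(** On the k-th grid the relative errors add up to t C times the square root of the step, which
    tends to 0; [q] is chosen to make this less than a given [dl]. Finiteness of the limit integral
    turns arbitrarily small relative error into equality. *)
Lemma density_test_invariant (phi : m.+1.-tuple R -> R) t : test_function phi -> 0 < t ->
 (forall y : m.-tuple R, replicator_kappa At al sg (softmax y) = 0) ->
 (\int[leb]_y ((F y)%:E * \int[P]_w (phi (X (softmax y) t w))%:E) =
  \int[leb]_y ((F y)%:E * (phi (softmax y))%:E))%E.
Proof.
move=> tp t0 kappa0; have [np p0 _] := tp.
have [fin lim] := density_transition_limit tp t0.
have [C [h1 [C0 h10 h11 adj]]] := path_adjoint kappa0.
set a := (\int[leb]_y _)%E in fin lim *; set b := (\int[leb]_y _)%E.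
have a0 : (0 <= a)%E.
 by apply: integral_ge0 => y _; rewrite mule_ge0 ?lee_fin//; apply: integral_ge0 => w _; rewrite lee_fin.
have b0 : (0 <= b)%E by apply: integral_ge0 => y _; rewrite mule_ge0 ?lee_fin.
apply: apx_eq => //; first by rewrite ge0_fin_numE.
move=> dl dl0; pose q := Num.min h1 ((dl / (t * C + 1)) ^+ 2).
have tC : 0 < t * C + 1 by rewrite ltr_wpDl// mulr_ge0// ltW.
have q0 : 0 < q by rewrite lt_min h10 exprn_gt0// divr_gt0.
have [k0 _ hk0] : \forall k \near \oo, grid_step t k <= q.
 exists (Num.truncn q^-1).+1 => // k /= hk; apply: (le_trans (grid_step_le t k)).
 rewrite -[leRHS]invrK lef_pV2 ?posrE ?invr_gt0 ?exprn_gt0//.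
 apply: (le_trans (ltW (truncnS_gt _))); apply: (@le_trans _ _ k%:R); first by rewrite ler_nat.
 by rewrite -natrX ler_nat ltnW// ltn_expl.
have akb k : (k0 <= k)%N -> apx dl (\int[leb]_y ((F y)%:E * \int[P]_w (phi (softmax (grid_path t k y w)))%:E))%E b.
 move=> /hk0 /=; rewrite le_min => /andP[gh1 gq]; have g0 := grid_step_gt0 t0 k.
 have mp : borel (fun z => (phi (softmax z))%:E).
  by apply/measurable_EFinP; exact: measurable_nice_softmax.
 have := adj (grid_step t k) (grid_size t k) _ g0 gh1 (fun z => _ : (0 <= (phi (softmax z))%:E)%E) mp.
 move=> /(_ (fun z => ltac:(by rewrite lee_fin))); apply: apxW.
 - set s := Num.sqrt _; have s0 : 0 <= s by exact: sqrtr_ge0.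
  have sq : s <= dl / (t * C + 1).
   by rewrite -(ler_pXn2r (n := 2))// ?nnegrE ?divr_ge0 ?(ltW dl0) ?(ltW tC)// sqr_sqrtr// ltW.
  have -> : (grid_size t k)%:R * (C * s ^+ 3) = (grid_size t k)%:R * (s ^+ 2) * C * s by ring.
  rewrite sqr_sqrtr ?(ltW g0)// grid_stepK; apply: (@le_trans _ _ ((t * C + 1) * s)).
   by rewrite ler_wpM2r// lerDl.
  by rewrite mulrC -ler_pdivlMr.
 - by apply: integral_ge0 => y _; rewrite mule_ge0 ?lee_fin//; apply: integral_ge0 => w _; rewrite lee_fin.
 - by [].
have near_k (Q : nat -> Prop) : (forall k, (k0 <= k)%N -> Q k) -> \forall k \near \oo, Q k by exists k0.
split.
 by apply: cvge_to_le lim _; apply: near_k => k /akb[].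
apply: cvge_to_ge (cvgeZl (y := (expR dl)%:E) _ lim) _ => //.
by apply: near_k => k /akb[].
Qed.

Let F20 (p : m.-tuple R * T) : 0 <= F p.1. Proof. by []. Qed.
Let mF2 : measurable_fun [set: m.-tuple R * T] (fun p => F p.1).
Proof. by apply: measurableT_comp mF _; exact: measurable_fst. Qed.

Definition start_law : set (m.+1.-tuple R) -> \bar R :=
 pushforward (weighted leb F0 mF) (@softmax R m).

HB.instance Definition _ := Measure.copy start_law
 (measure_function_pushforward__canonical__measure_function_Measure
   (weighted leb F0 mF) (@measurable_softmax R m)).

Lemma integral_start_law (psi : m.+1.-tuple R -> \bar R) : (forall x, (0 <= psi x)%E) ->
 borel psi ->
 (\int[start_law]_x psi x = \int[leb]_y ((F y)%:E * psi (softmax y)))%E.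
Proof.
move=> p0 mp; rewrite ge0_integral_pushforward//; last exact: measurable_softmax.
rewrite preimage_setT integral_weighted; last 2 first.
- by move=> y; exact: p0.
- exact: measurableT_comp mp (@measurable_softmax R m).
by apply: eq_integral => y _; rewrite muleC.
Qed.

Section law.
Variables (t : R) (t0 : 0 < t).

(** The law at time [t] started from F dy. It is an image measure of a product, hence built from
    [solution_limit], which is jointly measurable. *)
Definition flow_law : set (m.+1.-tuple R) -> \bar R :=
 pushforward (weighted (leb \x P)%E F20 mF2) (solution_limit t).

HB.instance Definition _ := Measure.copy flow_law
 (measure_function_pushforward__canonical__measure_function_Measure
   (weighted (leb \x P)%E F20 mF2) (measurable_solution_limit t0)).

Lemma integral_flow_law (psi : m.+1.-tuple R -> \bar R) : (forall x, (0 <= psi x)%E) ->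
 borel psi ->
 (\int[flow_law]_x psi x =
  \int[leb]_y ((F y)%:E * \int[P]_w psi (X (softmax y) t w)))%E.
Proof.
move=> p0 mp; have ms := measurable_solution_limit t0.
have mps : borel (fun p => psi (solution_limit t p)).
 exact: measurableT_comp mp ms.
rewrite ge0_integral_pushforward// preimage_setT integral_weighted//; last by move=> p; exact: p0.
rewrite fubini_tonelli1//; last 2 first.
- by apply: emeasurable_funM => //; exact/measurable_EFinP.
- by move=> p; rewrite mule_ge0//= ?p0// lee_fin.
apply: eq_integral => y _; rewrite /fubini_F/= (transition_integral)//.
rewrite -ge0_integralZl ?lee_fin//; first by apply: eq_integral => w _; rewrite muleC.
by apply: measurableT_comp mps _; exact: measurable_pair1.
Qed.

Lemma indic_integral (mu : {measure set (m.+1.-tuple R) -> \bar R}) B : measurable B ->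
 mu B = (\int[mu]_x (\1_B x)%:E)%E.
Proof. by move=> mB; rewrite integral_indic// setIT. Qed.

Lemma transition_indic y s B : 0 <= s -> measurable B ->
 P (X (softmax y) s @^-1` B) = (\int[P]_w (\1_B (X (softmax y) s w))%:E)%E.
Proof.
move=> s0 mB; have mX := measurable_solution_softmax y s0.
have mXB : measurable (X (softmax y) s @^-1` B) by rewrite -[X in measurable X]setTI; exact: mX.
by rewrite -[X in P X]setIT -integral_indic.
Qed.

Lemma start_lawE B : measurable B ->
 start_law B = (\int[leb]_y ((F y)%:E * (\1_B (softmax y))%:E))%E.
Proof.
move=> mB; rewrite indic_integral// integral_start_law//.
by apply/measurable_EFinP; exact: measurable_indic.
Qed.

Lemma flow_lawE B : measurable B ->
 flow_law B = (\int[leb]_y ((F y)%:E * P (X (softmax y) t @^-1` B)))%E.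
Proof.
move=> mB; rewrite indic_integral// integral_flow_law//; last by apply/measurable_EFinP; exact: measurable_indic.
by apply: eq_integral => y _; rewrite transition_indic// ltW.
Qed.

Lemma flow_law_test :
 (forall B, measurable B -> B `<=` @int_simplex R m.+1 -> start_law B = flow_law B) ->
 forall phi : m.+1.-tuple R -> R, test_function phi ->
 (\int[leb]_y ((F y)%:E * (phi (softmax y))%:E) =
  \int[leb]_y ((F y)%:E * \int[P]_w (phi (X (softmax y) t w))%:E))%E.
Proof.
move=> eqB phi [[mp _] p0 [ep ep0 hep]]; pose D := @int_simplex R m.+1.
have mD : measurable D by exact: measurable_int_simplex.
(* The two laws are compared only on subsets of the interior, while the solution is only known to
   stay in the closed simplex. On the simplex [phi] vanishes off the interior, so the indicator
   changes nothing there. *)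
pose psi x := (phi x * \1_D x)%:E.
have psi0 x : (0 <= psi x)%E by rewrite lee_fin mulr_ge0.
have mpsi : borel psi.
 by apply/measurable_EFinP; apply: measurable_funM => //; exact: measurable_indic.
have psiE x : simplex x -> psi x = (phi x)%:E.
 move=> sx; rewrite /psi indicE; have [|xD] := boolP (x \in D); first by rewrite mulr1.
 rewrite mulr0; congr EFin; apply/esym; apply: contrapT => px; case/negP: xD; rewrite inE; split => // i.
 by rewrite ltNge; apply/negP => xi; apply: px; apply: (hep _ i); exact: le_trans (ltW ep0).
have -> : (\int[leb]_y ((F y)%:E * (phi (softmax y))%:E) = \int[start_law]_x psi x)%E.
 rewrite integral_start_law//; apply: eq_integral => y _.
 by rewrite psiE//; exact: simplex_softmax.
have -> : (\int[leb]_y ((F y)%:E * \int[P]_w (phi (X (softmax y) t w))%:E) = \int[flow_law]_x psi x)%E.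
 rewrite integral_flow_law//; apply: eq_integral => y _; congr (_ * _)%E; apply: eq_integral => w _.
 rewrite psiE//; exact: (solution_simplex y w (ltW t0)).
have E (mu : {measure set (m.+1.-tuple R) -> \bar R}) : (\int[mu]_x psi x = \int[mu]_(x in D) psi x)%E.
 rewrite [RHS]integral_mkcond; apply: eq_integral => x _; rewrite /patch; case: ifPn => // xD.
 by rewrite /psi indicE (negbTE xD) mulr0.
rewrite !E; apply: eq_measure_integral => B mB BD; exact: eqB.
Qed.

Lemma test_flow_law :
 (forall phi : m.+1.-tuple R -> R, test_function phi ->
 (\int[leb]_y ((F y)%:E * \int[P]_w (phi (X (softmax y) t w))%:E) =
  \int[leb]_y ((F y)%:E * (phi (softmax y))%:E))%E) ->
 forall B, measurable B -> B `<=` @int_simplex R m.+1 -> start_law B = flow_law B.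
Proof.
move=> ht B mB BD.
have side phi : @test_function R m.+1 phi -> (forall x, (0 <= (phi x)%:E)%E) /\
  borel (fun x => (phi x)%:E).
 by move=> [[mp _] p0 _]; split; [move=> x; rewrite lee_fin|exact/measurable_EFinP].
apply: (test_measure_unique (ltn0Sn m)) => //.
- move=> phi tp; have [p0 mp] := side phi tp.
 by rewrite integral_start_law// integral_flow_law// ht.
- move=> phi tp; have [p0 mp] := side phi tp.
 rewrite integral_start_law// -ht//.
 by have [] := density_transition_limit tp t0.
- by move=> x /BD/int_simplexP[x0 _].
Qed.

End law.

Section invariance.
Let f := dirichlet_density alpha.
Let D := @int_simplex R m.+1.

Let mp t B : 0 <= t -> measurable B ->
 borel (fun y => P (X (softmax y) t @^-1` B)) /\
 (t = 0 -> forall y, P (X (softmax y) t @^-1` B) = (\1_B (softmax y))%:E).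
Proof.
move=> t0 mB; have mi : borel (fun x => (\1_B x)%:E : \bar R).
 by apply/measurable_EFinP; exact: measurable_indic.
have PE y := transition_indic y t0 mB.
have P0 : t = 0 -> forall y, P (X (softmax y) t @^-1` B) = (\1_B (softmax y))%:E.
 move=> t00 y; rewrite PE; transitivity (\int[P]_w (cst (\1_B (softmax y))%:E w))%E.
  apply: ae_eq_integral => //.
   exact: measurableT_comp mi (measurable_solution_softmax y t0).
  by have := sol_start (hX (int_simplex_softmax y)); apply: filterS => w; rewrite t00 => -> _.
 rewrite integral_cst// [X in (_ * X)%E](_ : _ = 1%E) ?mule1//; exact: probability_setT.
split => //; move: t0; rewrite le_eqVlt => /orP[/eqP t00|t0].
 have -> : (fun y => P (X (softmax y) t @^-1` B)) = (fun y => (\1_B (softmax y))%:E).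
  by apply/funext => y; exact: P0.
 exact: measurableT_comp mi (@measurable_softmax R m).
under eq_fun do rewrite PE.
by apply: (measurable_transition_integral t0) mi => x; rewrite lee_fin.
Qed.

(** The Jacobian of the chart turns the Dirichlet density into F, so both sides of the invariance
    equation become integrals against F dy. *)
Lemma invariant_densityE : invariant_density (transition_probability P X) f <->
 forall t B, 0 <= t -> measurable B -> B `<=` D ->
  (\int[leb]_y ((F y)%:E * (\1_B (softmax y))%:E) =
  \int[leb]_y ((F y)%:E * P (X (softmax y) t @^-1` B)))%E.
Proof.
have f0 := dirichlet_ge0 alpha; have mf := measurable_dirichlet alpha.
have fF y (e : \bar R) : ((f (softmax y))%:E * e * (\prod_(i < m.+1) tnth (softmax y) i)%:E = (F y)%:E * e)%E.
 by rewrite muleAC -EFinM dirichlet_softmax.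
have E1 B : measurable B -> B `<=` D ->
  (\int[@simplex_lebesgue R m.+1]_(x in B) (f x)%:E = \int[leb]_y ((F y)%:E * (\1_B (softmax y))%:E))%E.
 move=> mB BD; transitivity (\int[@simplex_lebesgue R m.+1]_(x in D) ((f x)%:E * (\1_B x)%:E))%E.
  rewrite -(setIidr BD) integral_mkcondr; apply: eq_integral => x _; rewrite /patch indicE.
  by rewrite setIidr//; case: (x \in B); rewrite ?mule1 ?mule0.
 rewrite integral_int_simplex.
 - by apply: eq_integral => y _; exact: fF.
 - by move=> x _; rewrite mule_ge0// lee_fin.
 - by apply: measurable_funTS; apply: emeasurable_funM; apply/measurable_EFinP => //; exact: measurable_indic.
have E2 t B : 0 <= t -> measurable B ->
  (\int[@simplex_lebesgue R m.+1]_(x in D) (transition_probability P X t x B * (f x)%:E) =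
   \int[leb]_y ((F y)%:E * P (X (softmax y) t @^-1` B)))%E.
 move=> t0 mB; rewrite integral_int_simplex.
 - by apply: eq_integral => y _; rewrite [X in (X * _)%E]muleC fF.
 - by move=> x _; rewrite mule_ge0 ?lee_fin.
 - apply: emeasurable_funM; last by apply: measurable_funTS; exact/measurable_EFinP.
  have [my _] := mp t0 mB.
  (* Measurability of the transition probability in its starting point is available in
     log-coordinates only and is carried back by [log_chart]. *)
  apply: (eq_measurable_fun (fun x => P (X (softmax (log_chart x)) t @^-1` B))).
   by move=> x /set_mem Dx; rewrite /transition_probability log_chartK.
  by apply: measurable_funTS; exact: measurableT_comp my (@measurable_log_chart R m).
split=> [[_ _ h] t B t0 mB BD|h]; first by rewrite -E1// -E2//; exact: h.
split => //; first exact: measurable_funTS.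
by move=> t B t0 mB BD; rewrite E1// E2//; exact: h.
Qed.

Lemma kappa0_invariant :
 (forall x, D x -> replicator_kappa At al sg x = 0) ->
 invariant_density (transition_probability P X) f.
Proof.
move=> kappa0; apply/invariant_densityE => t B; rewrite le_eqVlt => /orP[/eqP <-|t0] mB BD.
 have [_ h] := mp (lexx 0) mB.
 by apply: eq_integral => y _; rewrite h.
have := test_flow_law t0 _ mB BD.
rewrite start_lawE// (flow_lawE)//; apply => phi tp.
apply: (density_test_invariant) => // y; apply: kappa0; exact: int_simplex_softmax.
Qed.

Lemma invariant_test t (phi : m.+1.-tuple R -> R) :
 invariant_density (transition_probability P X) f -> 0 < t -> test_function phi ->
 (\int[leb]_y ((F y)%:E * (phi (softmax y))%:E) =
  \int[leb]_y ((F y)%:E * \int[P]_w (phi (X (softmax y) t w))%:E))%E.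
Proof.
move=> /invariant_densityE h t0 tp; apply: (flow_law_test t0) => // B mB BD.
by rewrite start_lawE// (flow_lawE)//; apply: h => //; exact: ltW.
Qed.

End invariance.

(** * Vanishing of kappa for an invariant density *)

Section necessity.
Hypothesis invariant : invariant_density (transition_probability P X) (dirichlet_density alpha).

Let nk : nice kappa. Proof. exact: nice_replicator_kappa. Qed.

Section moment.
Variables (phi : m.+1.-tuple R -> R) (K : R).
Hypotheses (tp : test_function phi) (sp : smooth phi) (K0 : 0 <= K).
Hypothesis kK : forall x, @simplex R m.+1 x -> `|kappa x| <= K.

Let a := (\int[leb]_y (F y * phi (softmax y))%:E)%E.
(* Adding [K] makes the integrand nonnegative: [b = K a] below says that
   F kappa phi integrates to 0. *)
Let b := (\int[leb]_y (F y * ((kappa (softmax y) + K) * phi (softmax y)))%:E)%E.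

Let p0 x : 0 <= phi x. Proof. by case: tp. Qed.
Let k0 y : 0 <= kappa (softmax y) + K.
Proof. by have := kK (simplex_softmax y); rewrite ler_norml => /andP[h _]; rewrite -lerBlDr sub0r. Qed.
Let mphi : borel (fun y => phi (softmax y)).
Proof. by apply: measurable_nice_softmax; case: tp. Qed.
Let mk : borel (fun y => kappa (softmax y)).
Proof. exact: measurable_nice_softmax. Qed.

Lemma density_moment_fin : (a < +oo)%E.
Proof.
have := (density_transition_limit tp ltr01).1.
by rewrite -(invariant_test invariant ltr01 tp).
Qed.

Let a0 : (0 <= a)%E. Proof. by apply: integral_ge0 => y _; rewrite lee_fin mulr_ge0. Qed.
Let b0 : (0 <= b)%E. Proof. by apply: integral_ge0 => y _; rewrite lee_fin !mulr_ge0. Qed.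

Let b_fin : (b < +oo)%E.
Proof.
apply: (@le_lt_trans _ _ ((2 * K)%:E * a)%E); last first.
 by rewrite lte_mul_pinfty ?density_moment_fin// lee_fin mulr_ge0.
rewrite -ge0_integralZl ?lee_fin ?mulr_ge0//; last 2 first.
- by apply/measurable_EFinP; exact: measurable_funM.
- by move=> y _; rewrite lee_fin mulr_ge0.
apply: ge0_le_integral => //.
- by move=> y _; rewrite lee_fin !mulr_ge0.
- apply/measurable_EFinP; apply: measurable_funM => //; apply: measurable_funM => //.
 exact: measurable_funD.
- apply: emeasurable_funM => //; apply/measurable_EFinP; exact: measurable_funM.
move=> y _; rewrite -EFinM lee_fin [leRHS]mulrCA; apply: ler_wpM2l => //; apply: ler_wpM2r => //.
by have := kK (simplex_softmax y); rewrite ler_norml => /andP[_ h]; lra.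
Qed.

Let J (h : R) := (\int[leb]_y ((F y * (1 + h * kappa (softmax y)))%:E * (phi (softmax y))%:E))%E.

Let JE h : 0 <= h -> (forall y, 0 <= 1 + h * kappa (softmax y)) ->
 J h = (fine a + h * (fine b - K * fine a))%:E.
Proof.
move=> h0 hp; have J0 : (0 <= J h)%E.
 by apply: integral_ge0 => y _; rewrite mule_ge0 ?lee_fin ?mulr_ge0.
have aE : a = (fine a)%:E by rewrite fineK// ge0_fin_numE// density_moment_fin.
have bE : b = (fine b)%:E by rewrite fineK// ge0_fin_numE.
have E : (J h + (h * K)%:E * a = a + h%:E * b)%E.
 have mFphi : borel (fun y => (F y * phi (softmax y))%:E).
  by apply/measurable_EFinP; exact: measurable_funM.
 have mFk : borel (fun y => (F y * ((kappa (softmax y) + K) * phi (softmax y)))%:E).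
  apply/measurable_EFinP; apply: measurable_funM => //; apply: measurable_funM => //.
  exact: measurable_funD.
 rewrite -!ge0_integralZl ?lee_fin ?mulr_ge0//; last 2 first.
 - by move=> y _; rewrite lee_fin !mulr_ge0.
 - by move=> y _; rewrite lee_fin mulr_ge0.
 rewrite -!ge0_integralD//.
 - by apply: eq_integral => y _; rewrite -!EFinM -!EFinD; congr EFin; ring.
 - by move=> y _; rewrite lee_fin mulr_ge0.
 - by move=> y _; rewrite -EFinM lee_fin !mulr_ge0.
 - exact: emeasurable_funM.
 - by move=> y _; rewrite mule_ge0 ?lee_fin ?mulr_ge0.
 - apply: emeasurable_funM; apply/measurable_EFinP => //; apply: measurable_funM => //.
  by apply: measurable_funD => //; exact: measurable_funM.
 - by move=> y _; rewrite -EFinM lee_fin !mulr_ge0.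
 - exact: emeasurable_funM.
move: E J0; rewrite aE bE -!EFinM -EFinD; case: (J h) => [j| |]//= [E] _.
by congr EFin; lra.
Qed.

(** The integral [I] of one scheme step of length h is located twice: invariance puts it within
    [D1 * q ^+ 3] of [a], and the adjoint puts it within a factor exp(C q^4) of [J h] = a + h (b - K
    a). With h = ta^8 and q = ta^3 both errors are at most of order h ta, so division by h and ta ->
    0 give the identity. *)
Lemma kappa_moment : (b = K%:E * a)%E.
Proof.
have [np _ _] := tp; pose fa := fine a; have aE : a = fa%:E by rewrite fineK// ge0_fin_numE// density_moment_fin.
pose fb := fine b; have bE : b = fb%:E by rewrite fineK// ge0_fin_numE.
have [l [Kd [l0 Kd0 FK]]] := simplex_density_weight al.
pose N := fine (\int[leb]_y (exp_weight 1 y)%:E)%E.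
have NE : (\int[leb]_y (exp_weight 1 y)%:E = N%:E)%E.
 rewrite /N fineK// ge0_fin_numE ?integral_exp_weight//.
 by apply: integral_ge0 => y _; rewrite lee_fin expR_ge0.
have N0 : 0 <= N by apply: fine_ge0; apply: integral_ge0 => y _; rewrite lee_fin expR_ge0.
(* The rate is four times the one that tames F, because the interpolation [min_pow4] retains only
   one of four factors of decay. *)
have [Ct [Ct0 t1 t2]] := test_tail tp (mulr_ge0 (ler0n R 4) l0) ler01.
have [Co [Co0 os]] := one_step_mean sp.
have [C [h1 [C0 h10 h11 adj]]] := step_adjoint At al sg hW.
pose D := Ct + Co; have D0 : 0 <= D by exact: addr_ge0.
pose D1 := D * (Kd * N); have D10 : 0 <= D1 by rewrite !mulr_ge0.
pose M := fa + D1; have M0 : 0 <= M by rewrite addr_ge0// /fa fine_ge0.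
pose D2 := D1 + 4 * C * M; have D20 : 0 <= D2 by rewrite addr_ge0// !mulr_ge0.
(* The error of one step is at most D q^4, and by the tail bounds at most D w^4
   with w = exp_weight l y, hence at most D q^3 w, which is integrable against F.
   With h = ta^8, the total q^3 = ta^9 is negligible with respect to h. *)
have main ta : 0 < ta -> ta <= 1 -> ta <= h1 -> ta <= (2 * (C + 1))^-1 ->
  `|fb - K * fa| <= D2 * ta.
 move=> ta0 ta1 tah taC; pose h := ta ^+ 8; pose q := ta ^+ 3.
 have h0 : 0 < h by rewrite exprn_gt0.
 have hta : h <= ta by rewrite /h exprS ler_piMr ?(ltW ta0)// exprn_ile1// ltW.
 have h1' : h <= 1 := le_trans hta ta1.
 have q0 : 0 <= q by rewrite exprn_ge0// ltW.
 have q1 : q <= 1 by rewrite exprn_ile1// ltW.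
 have s3 : Num.sqrt h ^+ 3 = q ^+ 4.
  have -> : h = (ta ^+ 4) ^+ 2 by rewrite /h -exprM.
  by rewrite sqrtr_sqr ger0_norm ?exprn_ge0 ?(ltW ta0)// /q -!exprM.
 pose EX y := mean P (fun w => phi (X (softmax y) h w)).
 pose ES y := mean P (fun w => phi (softmax (scheme_path h 1 y w))).
 have rX y : L1 P (fun w => phi (X (softmax y) h w)).
  apply: (L1_nice np (measurable_solution_softmax y (ltW h0))) => w.
  exact: (solution_simplex y w (ltW h0)).
 have rS y : L1 P (fun w => phi (softmax (scheme_path h 1 y w))).
  apply: (L1_nice np) => [|w]; last exact: simplex_softmax.
  exact: measurableT_comp (@measurable_softmax R m) (measurable_scheme_path 1 y h0).
 have near y : `|EX y - ES y| <= D * q ^+ 3 * exp_weight l y.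
  have w0 : 0 <= exp_weight l y by exact: expR_ge0.
  have w4 : exp_weight (4 * l) y = exp_weight l y ^+ 4.
   by rewrite /exp_weight -expRM_natl; congr expR; ring.
  have bX : EX y <= Ct * exp_weight l y ^+ 4.
   by rewrite -w4 -lee_fin -(meanE (rX y)); exact: t2.
  have bS : ES y <= Ct * exp_weight l y ^+ 4.
   by rewrite -w4 -lee_fin -(meanE (rS y)); apply: t1; rewrite ?mul1r.
  have eX : 0 <= EX y by exact: mean_ge0.
  have eS : 0 <= ES y by exact: mean_ge0.
  have n1 : `|EX y - ES y| <= D * exp_weight l y ^+ 4.
   have Dw : Ct * exp_weight l y ^+ 4 <= D * exp_weight l y ^+ 4.
    by rewrite ler_wpM2r ?exprn_ge0// lerDl.
   by rewrite ler_norml; apply/andP; split; lra.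
  have n2 : `|EX y - ES y| <= D * q ^+ 4.
   have CoD : Co <= D by rewrite /D lerDr.
   by apply: (le_trans (os h y h0 h1')); rewrite s3; apply: ler_wpM2r CoD; exact: exprn_ge0.
  rewrite -[leRHS]mulrA; apply: le_trans (ler_wpM2l D0 (min_pow4 q0 w0)).
  have [_|_] := leP (q ^+ 4) (exp_weight l y ^+ 4); [exact: n2|exact: n1].
 pose I := (\int[leb]_y ((F y)%:E * \int[P]_w (phi (softmax (scheme_path h 1 y w)))%:E))%E.
 have mES := measurable_density_scheme 1 tp h0.
 have mEX := measurable_density_transition tp h0.
 have mw : measurable_fun [set: m.-tuple R] (fun y => (D * q ^+ 3 * (Kd * exp_weight 1 y))%:E).
  by apply/measurable_EFinP; do 2 apply: measurable_funM => //; exact: measurable_exp_weight.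
 have intw : (\int[leb]_y (D * q ^+ 3 * (Kd * exp_weight 1 y))%:E = (D1 * q ^+ 3)%:E)%E.
  under eq_integral do rewrite mulrA EFinM.
  have ck : (0 <= (D * q ^+ 3 * Kd)%:E)%E by rewrite lee_fin mulr_ge0// mulr_ge0// exprn_ge0.
  rewrite ge0_integralZl//; last 2 first.
  - by apply/measurable_EFinP; exact: measurable_exp_weight.
  - by move=> z _; rewrite lee_fin expR_ge0.
  by rewrite NE -EFinM; congr EFin; rewrite /D1; ring.
 have aX : a = (\int[leb]_y ((F y)%:E * \int[P]_w (phi (X (softmax y) h w))%:E))%E.
  by rewrite -(invariant_test invariant h0 tp).
 have cmp (U V : m.-tuple R -> R) (iU iV : m.-tuple R -> \bar R) : (forall y, iU y = (U y)%:E) -> (forall y, iV y = (V y)%:E) ->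
   (forall y, 0 <= U y) -> (forall y, 0 <= V y) ->
   measurable_fun [set: m.-tuple R] (fun y => (F y)%:E * iU y)%E ->
   measurable_fun [set: m.-tuple R] (fun y => (F y)%:E * iV y)%E ->
   (forall y, `|U y - V y| <= D * q ^+ 3 * exp_weight l y) ->
   (\int[leb]_y ((F y)%:E * iU y) <= \int[leb]_y ((F y)%:E * iV y) + (D1 * q ^+ 3)%:E)%E.
  move=> UE VE U0 V0 mU mV UV; rewrite -intw -ge0_integralD//; last 2 first.
  - by move=> y _; rewrite VE -EFinM lee_fin mulr_ge0.
  - move=> y _; rewrite lee_fin; apply: mulr_ge0; first by rewrite mulr_ge0// exprn_ge0.
   by rewrite mulr_ge0// expR_ge0.
  apply: ge0_le_integral => //.
  - by move=> y _; rewrite UE -EFinM lee_fin mulr_ge0.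
  - exact: emeasurable_funD.
  move=> z _; rewrite UE VE -!EFinM -EFinD lee_fin -lerBlDl -mulrBr.
  apply: (@le_trans _ _ (F z * (D * q ^+ 3 * exp_weight l z))).
   by rewrite ler_wpM2l// (le_trans (ler_norm _)).
  have -> : F z * (D * q ^+ 3 * exp_weight l z) = D * q ^+ 3 * (F z * exp_weight l z) by ring.
  by rewrite ler_wpM2l// mulr_ge0// exprn_ge0.
 have eX0 y : 0 <= EX y by exact: mean_ge0.
 have eS0 y : 0 <= ES y by exact: mean_ge0.
 have c1 : (a <= I + (D1 * q ^+ 3)%:E)%E.
  rewrite aX; apply: (cmp EX ES) => // y; [exact: meanE|exact: meanE].
 have c2 : (I <= a + (D1 * q ^+ 3)%:E)%E.
  rewrite aX; apply: (cmp ES EX) => // y; [exact: meanE|exact: meanE|by rewrite distrC].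
 have hh1 : h - 0 <= h1 by rewrite subr0 (le_trans hta).
 have mps : measurable_fun [set: m.-tuple R] (fun z => (phi (softmax z))%:E) by exact/measurable_EFinP.
 have [pos ap] := adj 0 h (fun z => (phi (softmax z))%:E) (lexx 0) h0 hh1 (fun z => ltac:(by rewrite lee_fin)) mps.
 move: ap; rewrite subr0 s3 in pos *.
 have -> : (\int[leb]_y ((F y)%:E * \int[P]_w (phi (softmax (scheme_step At sg h y (increment W 0 h w))))%:E) = I)%E.
  apply: eq_integral => y _; congr (_ * _)%E; apply: eq_integral => w _.
  by rewrite /= mul0r mul1r.
 rewrite -/(J h) (JE (ltW h0) pos) -/fa -/fb => -[].
 have I0 : (0 <= I)%E.
  by apply: integral_ge0 => y _; rewrite mule_ge0 ?lee_fin//; apply: integral_ge0 => w _; rewrite lee_fin.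
 move: c1 c2 I0; rewrite aE; case: I => [i| |]//; rewrite -!EFinM -!EFinD !lee_fin => c1 c2 i0 ap1 ap2.
 set j := fa + _ in ap1 ap2.
 pose dl := C * q ^+ 4; have dl0 : 0 <= dl by rewrite mulr_ge0// exprn_ge0.
 have dl2 : dl <= 2^-1.
  apply: (@le_trans _ _ ((C + 1) * ta)).
   apply: ler_pM => //; [exact: exprn_ge0|by rewrite lerDl|].
   by rewrite /q -exprM exprS ler_piMr ?(ltW ta0)// exprn_ile1// ltW.
  have C10 : 0 < C + 1 by rewrite ltr_wpDl.
  rewrite mulrC -ler_pdivlMr//; apply: (le_trans taC).
  by rewrite invfM.
 have iM : i <= M by apply: (le_trans c2); rewrite lerD2l ler_piMr// exprn_ile1.
 have r1 := exp_sandwich dl0 dl2 i0 iM ap1 ap2.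
 have r2 : `|i - fa| <= D1 * q ^+ 3.
  by rewrite ler_norml; apply/andP; split; lra.
 have ja : j - fa = h * (fb - K * fa) by rewrite /j; ring.
 have r3 : h * `|fb - K * fa| <= h * (D2 * ta).
  rewrite -{1}(gtr0_norm h0) -normrM -ja.
  have -> : j - fa = (j - i) + (i - fa) by ring.
  apply: (le_trans (ler_normD _ _)); apply: (le_trans (lerD r1 r2)).
  have q3 : h * ta = q ^+ 3 by rewrite /h /q -exprSr -exprM.
  have -> : h * (D2 * ta) = D1 * q ^+ 3 + 4 * C * M * q ^+ 3 by rewrite -q3 /D2; ring.
  rewrite addrC lerD2l; have -> : 4 * dl * M = 4 * C * M * q ^+ 3 * q by rewrite /dl; ring.
  have Q0 : 0 <= 4 * C * M * q ^+ 3.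
   by apply: mulr_ge0; [apply: mulr_ge0 => //; exact: mulr_ge0|exact: exprn_ge0].
  by apply: ler_piMr; [exact: Q0|exact: q1].
 by rewrite -(ler_pM2l h0).
suff E : fb = K * fa by rewrite bE aE -EFinM E.
apply/eqP; rewrite -subr_eq0 -normr_le0; apply/ler_addgt0Pr => ep ep0; rewrite add0r.
pose ta := Num.min (Num.min 1 h1) (Num.min (2 * (C + 1))^-1 (ep / (D2 + 1))).
have D3 : 0 < D2 + 1 by rewrite ltr_wpDl.
have ta0 : 0 < ta by rewrite !lt_min ltr01 h10 divr_gt0// invr_gt0 mulr_gt0// ltr_wpDl.
have taD : ta <= ep / (D2 + 1) by rewrite !ge_min lexx !orbT.
apply: (le_trans (main ta ta0 _ _ _)); rewrite ?ge_min ?lexx ?orbT//.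
apply: (@le_trans _ _ ((D2 + 1) * ta)); first by rewrite ler_wpM2r ?(ltW ta0)// lerDl.
by rewrite mulrC -ler_pdivlMr.
Qed.

End moment.

(* The test functions (kappa + 1)^2 chi and (kappa - 1)^2 chi differ by
   4 kappa chi, so that F kappa^2 chi integrates to 0. *)
Lemma kappa_ae0 (ep : R) : 0 < ep ->
 {ae leb, forall y, (forall i, ep < tnth (softmax y) i) -> kappa (softmax y) = 0}.
Proof.
move=> ep0; pose chi (x : m.+1.-tuple R) := \prod_i bump ep (tnth x i).
have chi0 x : 0 <= chi x by apply: prodr_ge0 => i _; exact: sqr_ge0.
have schi : smooth chi by apply: smooth_prod => i; apply: smooth_bump; exact: ltW.
have sk : smooth kappa by exact: smooth_replicator_kappa.
have [_ [K [K0 kK _]]] := nk.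
pose phi c x := (kappa x + c) ^+ 2 * chi x.
have sp c : smooth (phi c) by apply: smoothM => //; apply: smooth_sq; apply: smoothD => //; exact: smooth_cst.
have p0 c x : 0 <= phi c x by rewrite mulr_ge0// sqr_ge0.
have tp c : test_function (phi c).
 split => //; first exact: smooth_nice.
 exists ep => // x i xi; rewrite /phi /chi (bigD1 i)//= /bump (max_idPl _) ?subr_le0//.
 by rewrite expr0n mul0r mulr0.
have k0 y : 0 <= kappa (softmax y) + K.
 by have := kK _ (simplex_softmax y); rewrite ler_norml => /andP[h _]; rewrite -lerBlDr sub0r.
have Fgt0 y : 0 < F y by exact: simplex_density_gt0.
have mk : borel (fun y => kappa (softmax y)) by exact: measurable_nice_softmax.
have mphi c : borel (fun y => phi c (softmax y)).
 by apply: measurable_nice_softmax; exact: smooth_nice.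
pose a c := (\int[leb]_y (F y * phi c (softmax y))%:E)%E.
pose b c := (\int[leb]_y (F y * ((kappa (softmax y) + K) * phi c (softmax y)))%:E)%E.
have ba c : b c = (K%:E * a c)%E := kappa_moment (tp c) (sp c) K0 kK.
have afin c : (a c < +oo)%E := density_moment_fin (tp c).
have mFp c : borel (fun y => (F y * phi c (softmax y))%:E).
 by apply/measurable_EFinP; exact: measurable_funM.
have mFkp c : borel (fun y => (F y * ((kappa (softmax y) + K) * phi c (softmax y)))%:E).
 apply/measurable_EFinP; apply: measurable_funM => //; apply: measurable_funM => //.
 exact: measurable_funD.
have Fp0 c y : (0 <= (F y * phi c (softmax y))%:E)%E by rewrite lee_fin mulr_ge0.
have Fkp0 c y : (0 <= (F y * ((kappa (softmax y) + K) * phi c (softmax y)))%:E)%E.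
 by rewrite lee_fin; apply: mulr_ge0 => //; exact: mulr_ge0.
have comb c c' : (\int[leb]_y ((F y * ((kappa (softmax y) + K) * phi c (softmax y)))%:E +
  K%:E * (F y * phi c' (softmax y))%:E) = K%:E * a c + K%:E * a c')%E.
 rewrite ge0_integralD//; last 2 first.
 - by move=> y _; rewrite mule_ge0.
 - exact: emeasurable_funM.
 by rewrite -/(b c) ba ge0_integralZl.
pose D y := F y * (4 * kappa (softmax y) ^+ 2 * chi (softmax y)).
have D0 y : 0 <= D y by rewrite mulr_ge0// mulr_ge0// mulr_ge0// sqr_ge0.
have mD : borel (fun y => (D y)%:E).
 have nD : nice (fun x => 4 * kappa x ^+ 2 * chi x).
  by apply: niceM; [apply: niceZ; exact: niceX|exact: smooth_nice].
 by apply/measurable_EFinP; apply: measurable_funM => //; exact: (measurable_nice_softmax nD).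
have E : (K%:E * a 1%R + K%:E * a (- 1)%R = K%:E * a (- 1)%R + K%:E * a 1%R + \int[leb]_y (D y)%:E)%E.
 rewrite -[LHS]comb -[in RHS]comb -ge0_integralD//; last 3 first.
 - by move=> y _; rewrite adde_ge0// mule_ge0.
 - by apply: emeasurable_funD => //; exact: emeasurable_funM.
 - by move=> y _; rewrite lee_fin.
 apply: eq_integral => y _; rewrite -!EFinM -!EFinD; congr EFin; rewrite /D /phi; ring.
have Dz : (\int[leb]_y (D y)%:E = 0)%E.
 have aE c : a c = (fine (a c))%:E.
  by rewrite fineK// ge0_fin_numE//; apply: integral_ge0.
 have I0 : (0 <= \int[leb]_y (D y)%:E)%E by apply: integral_ge0 => y _; rewrite lee_fin.
 move: E I0; rewrite (aE 1) (aE (- 1)) -!EFinM -!EFinD.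
 case: (\int[leb]_y _)%E => [z| |]//= [E] _; congr EFin.
 by move: E; set u := K * _; set v := K * _ => E; lra.
have /(ae_eq_integral_abs leb measurableT mD) : (\int[leb]_y `|(D y)%:E| = 0)%E.
 by rewrite -[RHS]Dz; apply: eq_integral => y _; rewrite gee0_abs ?lee_fin.
apply: filterS => y /(_ I) [Dy] ey; have chi1 : 0 < chi (softmax y).
 by apply: prodr_gt0 => i _; rewrite /bump exprn_gt0// lt_max subr_gt0 ey orbT.
apply: contrapT => /eqP ky; have : 0 < D y.
 rewrite mulr_gt0// mulr_gt0// mulr_gt0// lt_neqAle sqr_ge0 andbT eq_sym.
 by rewrite sqrf_eq0.
by rewrite Dy ltxx.
Qed.

(** If kappa were not 0 at [x], the Lipschitz property would keep it nonzero on a box of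
    log-coordinates around the point, away from the boundary of the simplex. The box has positive
    measure, which contradicts vanishing almost everywhere. *)
Lemma invariant_kappa0 x : int_simplex x -> kappa x = 0.
Proof.
move=> ix; apply: contrapT => /eqP kx; have [x0 _] := (int_simplexP x).1 ix.
pose y0 := log_chart x; have xE : softmax y0 = x by exact: log_chartK.
pose i0 := [arg min_(i < (ord0 : 'I_m.+1)) tnth x i]%O.
have xi i : tnth x i0 <= tnth x i.
 by rewrite /i0; case: Order.TotalTheory.arg_minP => // i' _; apply.
have [_ [K hK]] := nice_replicator_kappa At al sg; have [K0 _ _] := hK.
pose ep := tnth x i0 / 2; have ep0 : 0 < ep by rewrite divr_gt0.
have k0 : 0 < `|kappa x| by rewrite normr_gt0.
pose dl := Num.min (ep / 4) (`|kappa x| / (2 * K + 1) / 2).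
have K1 : 0 < 2 * K + 1 by rewrite ltr_wpDl// mulr_ge0.
have dl0 : 0 < dl by rewrite lt_min !divr_gt0.
pose B (j : 'I_m) : set R := `]tnth y0 j - dl, tnth y0 j + dl[%classic.
have near y : (forall j, B j (tnth y j)) ->
  (forall i, ep < tnth (softmax y) i) /\ kappa (softmax y) != 0.
 move=> yB; have ydl j : `|tnth y j - tnth y0 j| <= dl.
  by have := yB j; rewrite /B /= in_itv/= => /andP[b1 b2]; rewrite ler_norml; apply/andP; split; lra.
 have sh := extend_shifted y0 y; have edl := extend_le (ltW dl0) ydl.
 split.
  move=> i; have := softmax_lip sh edl i; rewrite xE ler_norml => /andP[b1 _].
  have d1 : dl <= ep / 4 by rewrite ge_min lexx.
  by have := xi i; have e2 : tnth x i0 = 2 * ep by [rewrite /ep; field]; lra.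
 apply/eqP => ky; have := nice_softmax_lip hK sh edl; rewrite xE -/kappa ky sub0r normrN => h.
 have d2 : dl <= `|kappa x| / (2 * K + 1) / 2 by rewrite ge_min lexx orbT.
 have : (2 * K + 1) * dl <= `|kappa x| / 2.
  by rewrite mulrC -ler_pdivlMr// mulrAC.
 by move: h; have -> : K * (2 * dl) = (2 * K + 1) * dl - dl by [ring]; lra.
have mB j : measurable (B j) by exact: measurable_itv.
have [N [mN N0 subN]] := kappa_ae0 ep0.
have BN : [set y : m.-tuple R | forall j, B j (tnth y j)] `<=` N.
 by move=> y /near[h1 /eqP h2]; apply: subN => /= /(_ h1).
have mbox : measurable [set y : m.-tuple R | forall j, B j (tnth y j)].
 rewrite (_ : mkset _ = \bigcap_(j in [set: 'I_m]) ((fun y => tnth y j) @^-1` B j)).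
  apply: fin_bigcap_measurable => // j _.
  by rewrite -[X in measurable X]setTI; exact: measurable_tnth.
 by apply/seteqP; split => y /= h j; [move=> _|]; exact: h.
have := @le_measure _ _ _ leb _ _ (mem_set mbox) (mem_set mN) BN.
rewrite /= N0 lebesgue_tuple_box//.
under eq_bigr do rewrite lebesgue_measure_itv/= lte_fin ltrBlDr -addrA ltrDl addr_gt0// -EFinB opprB addrC addrA subrK.
by rewrite prodEFin lee_fin leNgt prodr_gt0// => j _; rewrite addr_gt0.
Qed.

End necessity.
End density.
End solution.

(** * Conditions (a) and (b) *)

Section quadratic_form.
Variables (R : realType) (n : nat).

Let form (N : 'I_n -> 'I_n -> R) (z w : 'I_n -> R) : R := \sum_i \sum_j N i j * (z i * w j).

Let formDl N z z' w : form N (fun i => z i + z' i) w = form N z w + form N z' w.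
Proof.
rewrite -big_split/=; apply: eq_bigr => i _; rewrite -big_split/=; apply: eq_bigr => j _; ring.
Qed.

Let formDr N z w w' : form N z (fun i => w i + w' i) = form N z w + form N z w'.
Proof.
rewrite -big_split/=; apply: eq_bigr => i _; rewrite -big_split/=; apply: eq_bigr => j _; ring.
Qed.

Let form_delta N i0 j0 : form N (fun i => (i == i0)%:R) (fun j => (j == j0)%:R) = N i0 j0.
Proof.
rewrite /form (bigD1 i0)//= (bigD1 j0)//= !eqxx !mulr1 !big1 ?addr0//.
 by move=> i /negbTE ->; rewrite big1// => j _; rewrite mul0r mulr0.
by move=> j /negbTE ->; rewrite !mulr0.
Qed.

(** As the x_i sum to 1, the polynomial is the bilinear form with matrix [N] at the pair (x, x). By
    homogeneity this vanishes at every vector with positive entries, and only the symmetric part of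
    [N] matters. *)
Lemma quadratic_simplex0 (M : 'I_n -> 'I_n -> R) (v : 'I_n -> R) (c : R) : (0 < n)%N ->
 (forall x, @int_simplex R n x ->
  \sum_i \sum_j M i j * (tnth x i * tnth x j) + \sum_i v i * tnth x i + c = 0) <->
 (forall i j, M i j + M j i + (v i + v j) + 2 * c = 0).
Proof.
move=> n0; pose N i j := M i j + v i + c.
have E (x : n.-tuple R) : \sum_i tnth x i = 1 ->
  \sum_i \sum_j M i j * (tnth x i * tnth x j) + \sum_i v i * tnth x i + c =
  form N (tnth x) (tnth x).
 move=> x1; have -> : \sum_i v i * tnth x i = \sum_i \sum_j v i * (tnth x i * tnth x j).
  by apply: eq_bigr => i _; rewrite -!mulr_sumr x1 mulr1.
 have -> : c = \sum_i \sum_j c * (tnth x i * tnth x j).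
  under eq_bigr do rewrite -!mulr_sumr x1 mulr1.
  by rewrite -mulr_sumr x1 mulr1.
 rewrite -!big_split/=; apply: eq_bigr => i _; rewrite -!big_split/=.
 by apply: eq_bigr => j _; rewrite /N; ring.
split=> [h i0 j0|h x /int_simplexP[_ x1]]; last first.
 rewrite E//; have : form N (tnth x) (tnth x) + form N (tnth x) (tnth x) = 0.
  rewrite {2}/form exchange_big/= -big_split/=; apply: big1 => i _; rewrite -big_split/=.
  apply: big1 => j _; have := h i j; rewrite /N => hij.
  have -> : (M i j + v i + c) * (tnth x i * tnth x j) + (M j i + v j + c) * (tnth x j * tnth x i) =
   (M i j + M j i + (v i + v j) + 2 * c) * (tnth x i * tnth x j) by ring.
  by rewrite hij mul0r.
 by set q := form _ _ _ => hq; lra.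
have H (z : 'I_n -> R) : (forall i, 0 < z i) -> form N z z = 0.
 move=> z0; pose s := \sum_i z i; have s0 : 0 < s.
  by rewrite /s (bigD1 (Ordinal n0))//= ltr_pwDl// sumr_ge0// => i _; exact: ltW.
 pose x : n.-tuple R := [tuple z i / s | i < n].
 have x1 : \sum_i tnth x i = 1.
  by under eq_bigr do rewrite tnth_mktuple; rewrite -mulr_suml divff// gt_eqF.
 have ix : int_simplex x by apply/int_simplexP; split => // i; rewrite tnth_mktuple divr_gt0.
 have := h x ix; rewrite E// => hx.
 have -> : form N z z = s ^+ 2 * form N (tnth x) (tnth x).
  rewrite mulr_sumr; apply: eq_bigr => i _; rewrite mulr_sumr; apply: eq_bigr => j _.
  by rewrite !tnth_mktuple; field; rewrite gt_eqF.
 by rewrite hx mulr0.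
(* The second difference of the quadratic form at the vector of ones, in the directions of two unit
   vectors, isolates the symmetric coefficient; all four points have positive entries. *)
pose one (_ : 'I_n) : R := 1; pose d k (i : 'I_n) : R := (i == k)%:R.
have h1 := H one (fun=> ltr01).
have h2 k : form N (fun i => one i + d k i) (fun i => one i + d k i) = 0.
 by apply: H => i; rewrite ltr_pwDl.
have h3 : form N (fun i => one i + d i0 i + d j0 i) (fun i => one i + d i0 i + d j0 i) = 0.
 by apply: H => i; rewrite ltr_pwDl// ltr_pwDl.
have := h2 i0; have := h2 j0; move: h3.
rewrite !formDl !formDr (form_delta N i0 i0) (form_delta N j0 j0) (form_delta N i0 j0) (form_delta N j0 i0) h1 /N.
lra.
Qed.

End quadratic_form.

Section kappa_algebra.
Variables (R : realType) (m : nat) (B : 'M[R]_m.+1) (al sg : 'I_m.+1 -> R).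
Let g := \sum_i al i.

Definition kappa_mx i j : R := (1 + g) * (B i j + (i == j)%:R * (g * sg i ^+ 2 / 2)).
Definition kappa_vec k : R := - (B k k + \sum_i al i * B i k + g * sg k ^+ 2 * (al k + 2^-1)).
Definition kappa_cst : R := 2^-1 * \sum_i sg i ^+ 2 * al i ^+ 2.

Lemma replicator_kappaE x : \sum_i tnth x i = 1 ->
 replicator_kappa B al sg x =
 \sum_i \sum_j kappa_mx i j * (tnth x i * tnth x j) + \sum_i kappa_vec i * tnth x i + kappa_cst.
Proof.
move=> x1; pose p i := payoff B i x; pose q := p ord_max.
have split_sum (u : 'I_m.+1 -> R) (s t : R) :
  \sum_i (- (tnth x i * (B i i - B ord_max i - (u i - s))) - (u i - s) * (al i - t * tnth x i)) =
  (1 + t) * (\sum_i tnth x i * u i) - \sum_i tnth x i * B i i - \sum_i u i * al i +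
  \sum_i B ord_max i * tnth x i - (1 + t) * s * (\sum_i tnth x i) + s * \sum_i al i.
 by rewrite !mulr_sumr -!sumrN -!big_split/=; apply: eq_bigr => i _; ring.
have dE : drift_kappa B al x =
  (1 + g) * (\sum_i tnth x i * p i) - \sum_i tnth x i * B i i - \sum_i p i * al i.
 (* The sum over the n - 1 log-coordinates extends to all n indices, as the term of the last index
    vanishes. This removes the special role of the last coordinate. *)
 have -> : drift_kappa B al x = \sum_i
   (- (tnth x i * (B i i - B ord_max i - (p i - q))) - (p i - q) * (al i - g * tnth x i)).
  rewrite /drift_kappa [RHS]big_ord_recr/= -/q !subrr mulr0 mul0r oppr0 !addr0.
  by apply: eq_bigr => j _.
 rewrite split_sum x1 (_ : \sum_i B ord_max i * tnth x i = q)// -/g.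
 by set u := \sum_i _; set v := \sum_i _; set w := \sum_i _; ring.
have nE : noise_kappa al sg x = kappa_cst - \sum_i g * al i * sg i ^+ 2 * tnth x i +
  \sum_i (g ^+ 2 / 2 + g / 2) * sg i ^+ 2 * tnth x i ^+ 2 - \sum_i g / 2 * sg i ^+ 2 * tnth x i.
 rewrite /noise_kappa /kappa_cst -/g.
 have -> : g * (\sum_i tnth x i * sg i ^+ 2 - \sum_i (tnth x i * sg i) ^+ 2) =
   \sum_i g * (tnth x i * sg i ^+ 2 - (tnth x i * sg i) ^+ 2).
  by rewrite -sumrB mulr_sumr.
 by rewrite -sumrB mulr_suml mulr_sumr -!sumrN -!big_split/=; apply: eq_bigr => i _; field.
rewrite /replicator_kappa dE nE.
have mE : \sum_i \sum_j kappa_mx i j * (tnth x i * tnth x j) =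
  \sum_i (1 + g) * (tnth x i * p i) + \sum_i (g ^+ 2 / 2 + g / 2) * sg i ^+ 2 * tnth x i ^+ 2.
 rewrite -big_split/=; apply: eq_bigr => i _.
 have -> : \sum_j kappa_mx i j * (tnth x i * tnth x j) =
   \sum_j (1 + g) * (tnth x i * (B i j * tnth x j)) +
   \sum_j (i == j)%:R * ((1 + g) * (g * sg i ^+ 2 / 2) * tnth x i * tnth x j).
  by rewrite -big_split/=; apply: eq_bigr => j _; rewrite /kappa_mx; ring.
 rewrite -!mulr_sumr; congr (_ + _); rewrite (bigD1 i)//= eqxx mul1r big1 ?addr0; first by field.
 by move=> j; rewrite eq_sym => /negbTE ->; rewrite mul0r.
have vE : \sum_i kappa_vec i * tnth x i = - \sum_i tnth x i * B i i - \sum_i p i * al i -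
  \sum_i g * al i * sg i ^+ 2 * tnth x i - \sum_i g / 2 * sg i ^+ 2 * tnth x i.
 have -> : \sum_i p i * al i = \sum_i (\sum_k al k * B k i) * tnth x i.
  under eq_bigr do rewrite mulrC mulr_sumr; under [RHS]eq_bigr do rewrite mulr_suml.
  by rewrite exchange_big/=; apply: eq_bigr => i _; apply: eq_bigr => j _; ring.
 by rewrite -!sumrN -!big_split/=; apply: eq_bigr => i _; rewrite /kappa_vec; field.
by rewrite mE vE -mulr_sumr; ring.
Qed.

(** For g = -1 the quadratic part is 0 and the diagonal equations are condition (b). Otherwise the
    combination of the equations for (i, j), (i, i) and (j, j) that eliminates the linear part gives
    the pairwise condition after division by 1 + g; under it, the diagonal equations say that every
    (B al)_k equals the number [e] introduced below. *)
Lemma kappa_conditions :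
 (forall i j, kappa_mx i j + kappa_mx j i + (kappa_vec i + kappa_vec j) + 2 * kappa_cst = 0) <->
 ([/\ g != -1,
    forall i j, i != j ->
     B i j + B j i - B i i - B j j = g / 2 * (sg i ^+ 2 + sg j ^+ 2),
    forall i j, \sum_k B i k * al k = \sum_k B j k * al k &
    g = 0 -> forall k : 'I_m.+1, k = 0%N :> nat ->
     \sum_j B k j * al j = \sum_i B i i * al i - kappa_cst]
  \/
  (g = -1 /\ forall k, sg k ^+ 2 / 2 + kappa_cst + al k * sg k ^+ 2 - B k k - \sum_i al i * B i k = 0)).
Proof.
pose sB k := \sum_j B k j * al j.
pose e := \sum_i al i * B i i + g / 2 * (\sum_i al i * sg i ^+ 2) - kappa_cst.
have [gm|gm] := eqVneq g (- 1).
 have mx0 i j : kappa_mx i j = 0 by rewrite /kappa_mx gm subrr mul0r.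
 split=> [h|[[/eqP]//|[_ h]] i j].
  right; split => // k; have := h k k; rewrite !mx0 /kappa_vec gm; lra.
 have := h i; have := h j; rewrite !mx0 /kappa_vec gm; lra.
have g1 : 1 + g != 0 by rewrite addrC -[1]opprK subr_eq0.
have diagE k : (forall i j, B i j + B j i = B i i + B j j + g / 2 * (sg i ^+ 2 + sg j ^+ 2) - (i == j)%:R * (g * sg i ^+ 2)) ->
  kappa_mx k k + kappa_vec k + kappa_cst = sB k - e.
 move=> hs; rewrite /kappa_mx eqxx mul1r /kappa_vec.
 have -> : \sum_i al i * B i k = \sum_i al i * B i i + B k k * (\sum_i al i) +
   g / 2 * (\sum_i al i * sg i ^+ 2) + g / 2 * sg k ^+ 2 * (\sum_i al i) - g * sg k ^+ 2 * al k - sB k.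
  have -> : g * sg k ^+ 2 * al k = \sum_i (i == k)%:R * (g * sg i ^+ 2 * al i).
   rewrite (bigD1 k)//= eqxx mul1r big1 ?addr0// => i /negbTE ->; exact: mul0r.
  rewrite /sB !mulr_sumr -!sumrN -!big_split/=; apply: eq_bigr => i _.
  have -> : B i k = B i i + B k k + g / 2 * (sg i ^+ 2 + sg k ^+ 2) - (i == k)%:R * (g * sg i ^+ 2) - B k i.
   by rewrite -hs addrK.
  ring.
 by rewrite -/g /e; field.
have sym : (forall i j, i != j -> B i j + B j i - B i i - B j j = g / 2 * (sg i ^+ 2 + sg j ^+ 2)) ->
  forall i j, B i j + B j i = B i i + B j j + g / 2 * (sg i ^+ 2 + sg j ^+ 2) - (i == j)%:R * (g * sg i ^+ 2).
 move=> h i j; case: eqVneq => [->|ij]; first by rewrite mul1r; field.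
 by rewrite mul0r subr0 -(h _ _ ij); ring.
have offE i j : i != j -> kappa_mx i j + kappa_mx j i - kappa_mx i i - kappa_mx j j =
  (1 + g) * (B i j + B j i - B i i - B j j - g / 2 * (sg i ^+ 2 + sg j ^+ 2)).
 move=> ij; have ji : (j == i) = false by rewrite eq_sym (negbTE ij).
 by rewrite /kappa_mx !eqxx ji (negbTE ij) !mul0r !mul1r; field.
split=> [h|[[_ hs hc h0]|[/eqP]]]; last by rewrite (negbTE gm).
 have hd i : kappa_mx i i + kappa_vec i + kappa_cst = 0.
  by have := h i i; set u := kappa_mx i i; set v := kappa_vec i; lra.
 have hs i j : i != j -> B i j + B j i - B i i - B j j = g / 2 * (sg i ^+ 2 + sg j ^+ 2).
  move=> ij; apply/eqP; rewrite -subr_eq0; apply/eqP; apply: (mulfI g1); rewrite mulr0 -offE//.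
  have := h i j; have := hd i; have := hd j.
  by set u := kappa_mx i i; set v := kappa_mx j j; set w := kappa_mx i j; set z := kappa_mx j i; lra.
 have sBe k : sB k = e.
  by apply/eqP; rewrite -subr_eq0 -(diagE k (sym hs)) hd.
 left; split => // [i j|g0 k _]; first by rewrite -!/(sB _) !sBe.
 rewrite -/(sB k) sBe /e g0 !mul0r addr0; congr (_ - _).
 by apply: eq_bigr => i _; rewrite mulrC.
have hs' := sym hs.
have sBe k : sB k = e.
 have [g0|g0] := eqVneq g 0.
  have -> : sB k = sB ord0 by exact: hc.
  rewrite /sB (h0 g0 ord0 (erefl _)) /e g0 !mul0r addr0; congr (_ - _).
  by apply: eq_bigr => i _; rewrite mulrC.
 (* For nonzero g, equality of all (B al)_k already fixes their common value: the sum of al_i (B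
    al)_i is g times that value, and symmetrising the double sum by the pairwise condition gives g
    times [e]. For g = 0 this identity is void, which explains the separate requirement in that
    case. *)
 have E1 : \sum_i al i * sB i = g * sB k.
  by rewrite /g mulr_suml; apply: eq_bigr => i _; congr (_ * _); exact: hc.
 have E2 : \sum_i al i * sB i + \sum_i al i * sB i = g * e + g * e.
  have -> : \sum_i al i * sB i = \sum_i \sum_j al i * al j * B i j.
   by apply: eq_bigr => i _; rewrite mulr_sumr; apply: eq_bigr => j _; ring.
  rewrite {2}exchange_big/= -big_split/=.
  have -> : \sum_i (\sum_j al i * al j * B i j + \sum_j al j * al i * B j i) =
    \sum_i \sum_j al i * al j * (B i i + B j j + g / 2 * (sg i ^+ 2 + sg j ^+ 2) - (i == j)%:R * (g * sg i ^+ 2)).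
   apply: eq_bigr => i _; rewrite -big_split/=; apply: eq_bigr => j _.
   by rewrite -hs'; ring.
  have -> : \sum_i \sum_j al i * al j * (B i i + B j j + g / 2 * (sg i ^+ 2 + sg j ^+ 2) - (i == j)%:R * (g * sg i ^+ 2)) =
   \sum_i (al i * (B i i + g / 2 * sg i ^+ 2) * g + al i * (\sum_j al j * (B j j + g / 2 * sg j ^+ 2)) - g * (sg i ^+ 2 * al i ^+ 2)).
   apply: eq_bigr => i _.
   have -> : g * (sg i ^+ 2 * al i ^+ 2) = \sum_j (i == j)%:R * (al i * al j * (g * sg i ^+ 2)).
    rewrite (bigD1 i)//= eqxx mul1r big1 ?addr0; first by ring.
    by move=> j; rewrite eq_sym => /negbTE ->; exact: mul0r.
   rewrite [X in _ * X + _](_ : g = \sum_j al j)// !mulr_sumr -sumrN -!big_split/=.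
   by apply: eq_bigr => j _; ring.
  have split3 (u w z : 'I_m.+1 -> R) (p q r : R) :
    \sum_i (u i * p + w i * q - r * z i) = (\sum_i u i) * p + (\sum_i w i) * q - r * \sum_i z i.
   by rewrite !mulr_suml mulr_sumr -sumrN -!big_split.
  rewrite split3.
  rewrite -/g; have -> : \sum_i al i * (B i i + g / 2 * sg i ^+ 2) = \sum_i al i * B i i + g / 2 * (\sum_i al i * sg i ^+ 2).
   by rewrite mulr_sumr -big_split/=; apply: eq_bigr => i _; ring.
  by rewrite /e /kappa_cst; field.
 apply: (mulfI g0); move: E2; rewrite E1; set u := g * _; set v := g * _; lra.
have hd k : kappa_mx k k + kappa_vec k + kappa_cst = 0 by rewrite (diagE k hs') sBe subrr.
move=> i j; have hi := hd i; have hj := hd j; have [<-|ij] := eqVneq i j.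
 by move: hi; set u := kappa_mx i i; set v := kappa_vec i; lra.
have := offE i j ij; rewrite (hs _ _ ij) subrr mulr0.
by move: hi hj; set u := kappa_mx i i; set v := kappa_mx j j; set w := kappa_mx i j; set z := kappa_mx j i; lra.
Qed.

End kappa_algebra.

Theorem theorem3p6 (R : realType) (n : nat) (hn : (2 <= n)%N)
    (A : 'M[R]_n) (sigma : 'rV[R]_n) (hsigma : forall i, 0 < sigma 0 i)
    (d : measure_display) (T : measurableType d) (P : probability T R)
    (W : 'I_n -> R -> T -> R) (hW : standard_brownian_motion P W)
    (X : n.-tuple R -> R -> T -> n.-tuple R)
    (hX : stochastic_replicator A sigma P W X)
    (alpha : 'cV[R]_n) :
  let gamma := \sum_(i < n) alpha i 0 in
  let At := modified_payoff A sigma in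
  invariant_density (transition_probability P X) (dirichlet_density alpha) <->
  ([/\ gamma != -1,
       forall i j, i != j ->
         A i j + A j i - A i i - A j j =
         gamma / 2 * (sigma 0 i ^+ 2 + sigma 0 j ^+ 2),
       forall i j, (At *m alpha) i 0 = (At *m alpha) j 0 &
       gamma = 0 -> forall k : 'I_n, k = 0%N :> nat ->
         (At *m alpha) k 0 =
         \sum_(i < n) At i i * alpha i 0
         - 2^-1 * \sum_(i < n) sigma 0 i ^+ 2 * alpha i 0 ^+ 2]
   \/
   (gamma = -1 /\
    forall k,
      sigma 0 k ^+ 2 / 2 + 2^-1 * \sum_(i < n) sigma 0 i ^+ 2 * alpha i 0 ^+ 2
      + alpha k 0 * sigma 0 k ^+ 2 - At k k
      - \sum_(i < n) alpha i 0 * At i k = 0)).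
Proof.
case: n hn A sigma hsigma W hW X hX alpha => [//|m] hn A sigma hsigma W hW X hX alpha gamma At.
pose al (i : 'I_m.+1) : R := alpha i 0; pose sg (i : 'I_m.+1) : R := sigma 0 i.
have kappaP : invariant_density (transition_probability P X) (dirichlet_density alpha) <->
    forall x, @int_simplex R m.+1 x -> replicator_kappa At al sg x = 0.
  split=> [inv x ix|k0]; first exact: (invariant_kappa0 hW hX inv ix).
  exact: (kappa0_invariant hW hX k0).
have quadP := quadratic_simplex0 (kappa_mx At al sg) (kappa_vec At al sg) (kappa_cst al sg) (ltn0Sn m).
have condP := kappa_conditions At al sg.
have AtE i j : A i j + A j i - A i i - A j j = At i j + At j i - At i i - At j j.
  by rewrite !mxE; ring.
have mulE i : (At *m alpha) i 0 = \sum_k At i k * al k by rewrite mxE.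
apply: (iff_trans kappaP); apply: (iff_trans (B := forall x, @int_simplex R m.+1 x ->
    \sum_i \sum_j kappa_mx At al sg i j * (tnth x i * tnth x j) +
    \sum_i kappa_vec At al sg i * tnth x i + kappa_cst al sg = 0)).
  by split=> h x ix; have [_ x1] := (int_simplexP x).1 ix; have := h x ix; rewrite replicator_kappaE.
apply: (iff_trans quadP); apply: (iff_trans condP).
split=> -[[g1 hs hc h0]|hb]; [left|right; exact: hb|left|right; exact: hb]; split => //.
- by move=> i j ij; rewrite AtE hs.
- by move=> i j; rewrite !mulE.
- by move=> g0 k k0; rewrite mulE h0.
- by move=> i j ij; rewrite -AtE hs.
- by move=> i j; rewrite -!mulE.
- by move=> g0 k k0; rewrite -mulE h0.
Qed.
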